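(* A finitely generated group $H$ belongs to $PSPACE$ if and only if $H$ is (isomorphic to) a subgroup of a finitely presented group $G$ having polynomial space function.
   Context: Space function of a group. Let $G=\langle A\mid R\rangle$ be a finite presentation; words are words over $A^{\pm1}$ and $||w||$ is the number of letters of $w$. For a finite sequence of words $W=(w_1,\dots,w_s)$ put $||W||=\sum_i||w_i||$. An elementary $R$-transformation of $W$ does one of the following to some $w_i$: inserts or removes a subword $aa^{-1}$ ($a\in A^{\pm1}$); inserts or removes a subword $r$ or $r^{-1}$ ($r\in R$); replaces $w_i$ by a cyclic conjugate (cyclic shift); if $w_i\equiv uv$, replaces the entry $w_i$ by the two entries $u,v$; removes $w_i$ from the sequence if it is the empty word. The space of a rewriting $W_0\to\dots\to W_t$ is $\max_{j}||W_j||$. For a word $w$ equal to $1$ in $G$, $space_G(w)$ is the minimum of the spaces of all rewritings starting with $(w)$ and ending with the empty sequence $(\,)$. The space function is $S_G(n)=\max\{space_G(w): w=1\text{ in }G,\ ||w||\le n\}$. For non-decreasing functions on $\mathbb N$, $f\preceq g$ means there is a positive integer $c$ with $f(n)\le cg(cn)+cn$ for all $n\in\mathbb N$. A function $f$ is called polynomial if $f\preceq g$ for some polynomial $g$. Space function of a (multi-tape) Turing machine $M$. The space of a computation is the maximum, over its configurations, of the total number of tape letters on all tapes. For an accepted input word $u$, $space_M(u)$ is the minimum of the spaces of accepting computations starting from the input configuration of $u$; $S_M(n)=\max\{space_M(u): u \text{ accepted by } M,\ ||u||\le n\}$. A finitely generated group $H$ belongs to the class $PSPACE$ if the word problem for $H$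 (with respect to a finite generating set $B$: given a word over $B\cup B^{-1}$, is it equal to $1$ in $H$?) is decidable by some deterministic Turing machine with a polynomial space function. *)

(* Defs.v *)
From Stdlib Require Import Relations.
From mathcomp Require Import all_boot all_order ssralg ssrnum poly rat.
From mathcomp Require Import boolp.

Set Implicit Arguments.
Unset Strict Implicit.
Unset Printing Implicit Defensive.

(* The minimum of P, with value 0 when P is empty. *)
Definition min_nat (P : nat -> Prop) : nat :=
  if pselect (exists n, `[< P n >]) is left exP then ex_minn exP else 0.

Definition preceq (f g : nat -> nat) : Prop :=
  exists2 c, 0 < c & forall n, f n <= c * g (c * n) + c * n.

(* A polynomial mapping nat to nat has rational coefficients, not
   necessarily natural or integral ones. *)
Definition polynomial_growth (f : nat -> nat) : Prop :=
  exists (g : nat -> nat) (p : {poly rat}),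
    [/\ {homo g : m n / m <= n},
        forall n, (g n)%:R%R = p.[n%:R]%R
      & preceq f g].

Section Words.

Variable A : finType.

(* (a, false) stands for a and (a, true) for a^-1. *)
Definition letter : finType := (A * bool)%type.
Definition word := seq letter.

Definition inv_letter (x : letter) : letter := (x.1, ~~ x.2).
Definition inv_word (w : word) : word := rev (map inv_letter w).

Definition eval_letter (G : groupType) (gen : A -> G) (x : letter) : G :=
  if x.2 then ((gen x.1)^-1)%g else gen x.1.
Definition eval (G : groupType) (gen : A -> G) (w : word) : G :=
  (\prod_(x <- w) eval_letter gen x)%g.

Definition generates (G : groupType) (gen : A -> G) : Prop :=
  forall x : G, exists w : word, eval gen w = x.

Section Presentation.

Variable R : seq word.

Inductive pres_step : word -> word -> Prop :=
| PresCancel u v x : pres_step (u ++ [:: x; inv_letter x] ++ v) (u ++ v)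
| PresRelator u v r : r \in R -> pres_step (u ++ r ++ v) (u ++ v).

(* Equality of words in the group <A | R>. *)
Definition pres_eq : word -> word -> Prop :=
  clos_refl_sym_trans word pres_step.

Definition presents (G : groupType) (gen : A -> G) : Prop :=
  generates gen /\ forall w, eval gen w = 1%g <-> pres_eq w [::].

(* What an elementary transformation may put in place of a single entry. *)
Inductive entry_step : word -> seq word -> Prop :=
| InsertCancel u v x :
    entry_step (u ++ v) [:: u ++ [:: x; inv_letter x] ++ v]
| RemoveCancel u v x :
    entry_step (u ++ [:: x; inv_letter x] ++ v) [:: u ++ v]
| InsertRelator u v r : (r \in R) || (r \in map inv_word R) ->
    entry_step (u ++ v) [:: u ++ r ++ v]
| RemoveRelator u v r : (r \in R) || (r \in map inv_word R) ->
    entry_step (u ++ r ++ v) [:: u ++ v]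
| CyclicShift u v : entry_step (u ++ v) [:: v ++ u]
| Split u v : entry_step (u ++ v) [:: u; v]
| RemoveEmpty : entry_step [::] [::].

Inductive elementary : seq word -> seq word -> Prop :=
| Elementary U V w W : entry_step w W ->
    elementary (U ++ w :: V) (U ++ W ++ V).

(* W0 :: p is a rewriting W0 -> ... -> Wt. *)
Definition rewriting (W0 : seq word) (p : seq (seq word)) : bool :=
  path (fun U V => `[< elementary U V >]) W0 p.

Definition total_length (W : seq word) : nat := \sum_(w <- W) size w.

Definition rewriting_space (W0 : seq word) (p : seq (seq word)) : nat :=
  \max_(W <- W0 :: p) total_length W.

Definition word_space (w : word) : nat :=
  min_nat (fun s => exists p, [/\ rewriting [:: w] p, last [:: w] p = [::]
                                & s = rewriting_space [:: w] p]).

Definition space_function (n : nat) : nat :=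
  \max_(k < n.+1) \max_(w : k.-tuple letter | `[< pres_eq w [::] >])
    word_space w.

(* word_space is a genuine minimum on the words used in space_function. *)
Lemma rewriting_exists (w : word) : pres_eq w [::] ->
  exists2 p, rewriting [:: w] p & last [:: w] p = [::].
Proof.
pose E u v := exists2 p, rewriting [:: u] p & last [:: u] p = [:: v].
have E1 u v : entry_step u [:: v] -> E u v.
  move=> uv; exists [:: [:: v]] => //.
  by rewrite /rewriting /= andbT; apply/asboolP; exact: (@Elementary [::] [::] u [:: v]).
have Et u v t : E u v -> E v t -> E u t.
  case=> p pP pv [q qP qt]; exists (p ++ q); last by rewrite last_cat pv.
  by rewrite /rewriting cat_path; apply/andP; split; rewrite ?pv.
have EE u v : pres_eq u v -> E u v /\ E v u.
  elim=> {u v} [u v [{}u {}v x|{}u {}v r rR]|u|u v _ []//|u v t _ [uv vu] _ [vt tv]].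
  - by split; apply: E1; constructor.
  - by split; apply: E1; constructor; rewrite rR.
  - by split; exists [::].
  - by split; apply: Et; eassumption.
move=> /EE[[p pP pw] _]; exists (rcons p [::]); last by rewrite last_rcons.
rewrite /rewriting rcons_path; apply/andP; split=> //; rewrite pw.
by apply/asboolP; apply: (@Elementary [::] [::] [::] [::]); constructor.
Qed.

End Presentation.

End Words.

Definition finitely_generated (G : groupType) : Prop :=
  exists (A : finType) (gen : A -> G), generates gen.

(* Multi-tape Turing machines, with tm_tapes.+1 tapes that are infinite to the
   right.  A head scans None on a square that carries no letter.  An
   instruction consists of a new state and, for each tape, an optional letter
   to write (None leaves the square unchanged) and a move (None: stay,
   Some false: left, Some true: right). *)
Record turing_machine (I : finType) := TuringMachine {
  tm_tapes : nat;
  tm_work : finType;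
  tm_letter : finType := (I + tm_work)%type;
  tm_state : finType;
  tm_start : tm_state;
  tm_accept : tm_state;
  tm_delta : tm_state -> {ffun 'I_tm_tapes.+1 -> option tm_letter} ->
    {set tm_state * {ffun 'I_tm_tapes.+1 -> option tm_letter * option bool}}
}.

Section Turing.

Variables (I : finType) (M : turing_machine I).

Local Notation sym := (tm_letter M).
Local Notation tape := (seq sym * seq sym)%type.

(* The tape (l, r) carries the letters rev l ++ r, and its head is on the
   square just after rev l. *)
Definition scan (t : tape) : option sym := ohead t.2.

(* A head does not move left of the first square, nor right of a square
   without letter: the letters always fill an initial segment of the tape. *)
Definition act (a : option sym * option bool) (t : tape) : tape :=
  let r := if a.1 is Some y then y :: behead t.2 else t.2 in
  match a.2, t.1, r with
  | Some false, x :: l, _ => (l, x :: r)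
  | Some true, l, x :: r' => (x :: l, r')
  | _, l, _ => (l, r)
  end.

Definition config : Type :=
  (tm_state M * {ffun 'I_(tm_tapes M).+1 -> tape})%type.

Definition init (u : seq I) : config :=
  (tm_start M, [ffun i => ([::], if i == ord0 then map inl u else [::])]).

Definition step (c d : config) : bool :=
  (c.1 != tm_accept M) &&
  [exists m in tm_delta c.1 [ffun i => scan (c.2 i)],
     d == (m.1, [ffun i => act (m.2 i) (c.2 i)])].

Definition deterministic : Prop := forall q s, #|@tm_delta I M q s| <= 1.

Definition accepting (u : seq I) (p : seq config) : bool :=
  path step (init u) p && ((last (init u) p).1 == tm_accept M).

Definition accepts (u : seq I) : Prop := exists p, accepting u p.

Definition halts (u : seq I) : Prop :=
  exists2 p, path step (init u) p & forall d, ~~ step (last (init u) p) d.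

(* This is the usual notion for deterministic machines only. *)
Definition decides (L : seq I -> Prop) : Prop :=
  forall u, halts u /\ (accepts u <-> L u).

Definition config_size (c : config) : nat :=
  \sum_i (size (c.2 i).1 + size (c.2 i).2).

Definition input_space (u : seq I) : nat :=
  min_nat (fun s => exists2 p, accepting u p
                             & s = \max_(c <- init u :: p) config_size c).

Definition tm_space_function (n : nat) : nat :=
  \max_(k < n.+1) \max_(u : k.-tuple I | `[< accepts u >]) input_space u.

End Turing.

Definition in_PSPACE (H : groupType) : Prop :=
  exists (B : finType) (gen : B -> H), generates gen /\
  exists M : turing_machine (letter B),
    [/\ deterministic M, decides M (fun w => eval gen w = 1%g)
      & polynomial_growth (tm_space_function M)].

(* Main.v *)
(* From PSPACE to presentations.  The configurations of a machine deciding the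
   word problem of H are coded by integer vectors g, and by the elements t^g of
   the free product of Z^C and <t>; a machine instruction acts on the coded
   stacks by an affine map a + mu z |-> c + nu z, so it becomes a stable letter
   which conjugates t^a to t^c and the subgroups mu Z^C to nu Z^C.  Further
   stable letters double the coordinates, so that t^g has a word whose length
   is polynomial in the number of digits of g.  Let Gamma1 be the resulting HNN
   extension, and Gamma2 the HNN extension of F x H whose stable letter e turns
   a free generator p_x into p_x x, with x in H.  A last stable letter s of
   Gamma1 x Gamma2 turns t into t e and an instruction into its product with
   the p_x of the input letter that it loads, if any.  Following a computation
   which loads v and leads from 0 to g, one obtains s^-1 t^g s = t^g e v^-1;
   hence an accepting computation on w, which returns to 0, yields w = 1, and
   these relations of H need not be imposed.  Conversely Britton's lemma shows
   that H embeds and that nothing else collapses, and every trivial word is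
   contracted pinch by pinch in polynomial space: splitting and cyclic shifts
   make it possible to contract a trivial factor apart from the rest of a word.

   From presentations to PSPACE.  A rewriting in space s is a walk among the
   strings of length O(s) over the words of bounded length, in which two
   adjacent symbols are replaced at a time; such a walk may be assumed to be
   of exponential length, and is searched for by Savitch's midpoint recursion,
   carried out by a deterministic machine in polynomial space. *)

From HB Require Import structures.
From Stdlib Require Import Relations.
Require Import Defs.
From mathcomp Require Import all_boot all_order ssralg ssrnum ssrint archimedean poly rat boolp zify.

Set Implicit Arguments.
Unset Strict Implicit.
Unset Printing Implicit Defensive.

(** * HNN extensions and normal forms *)

(** Stable letters can be crossed in both directions, so the configurations met in the subgroup
    generated by the [t^g] and the instructions include those reached by running the machine
    backwards, which no input produces. Two obstacles follow. First, the image of [t^g] under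
    conjugation by [s] has to depend on [g] alone. This is why the proof uses an invariant [schi] of
    arbitrary stack contents rather than computations, and where determinism is needed. Secondly,
    crossing [s] requires a word [v] for each [g] that occurs, found in space polynomial in the
    digits of [g], although [g] may have been reached through far larger configurations. The
    simulation is therefore given a stack of free cells, consumed as the tapes grow: while the
    machine runs, the total size is conserved, and the configurations of the loading and cleaning
    phases have short paths from 0 in any case. In the other direction, the machine never computes
    its space bound: finitely many repetitions of [S |-> S (S + 1)] exceed any polynomial given in
    advance. *)

Module Britton.
Definition some_such (T : Type) (d : T) (Q : T -> Prop) : T :=
  if pselect (exists x, Q x) is left e then projT1 (cid e) else d.

Lemma some_suchP (T : Type) (d : T) (Q : T -> Prop) x : Q x -> Q (some_such d Q).
Proof.
rewrite /some_such => Qx; case: pselect => [e|[]]; last by exists x.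
exact: projT2 (cid e).
Qed.

(** Permutations of [T]. HNN extensions are realised by their action on normal forms (van der
    Waerden's method), so that neither a quotient of words nor a confluence argument is needed. *)
Record sym (T : Type) := Sym {
  sfun :> T -> T;
  sinv : T -> T;
  sfunK : cancel sfun sinv;
  sinvK : cancel sinv sfun }.

HB.instance Definition _ (T : Type) := gen_eqMixin (sym T).
HB.instance Definition _ (T : Type) := gen_choiceMixin (sym T).

Section SymGroup.
Variable T : Type.

Lemma sym_eq (f g : sym T) : f =1 g -> f = g.
Proof.
case: f g => [f f' fK f'K] [g g' gK g'K] /= /funext fg; subst g.
have f'g' : f' = g' by apply: funext => x; rewrite -[x in LHS]g'K fK.
subst g'; congr Sym; exact: Prop_irrelevance.
Qed.

Definition sym_one : sym T := @Sym T id id (fun=> erefl) (fun=> erefl).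
Definition sym_inv (f : sym T) : sym T := Sym (@sinvK _ f) (@sfunK _ f).
Definition sym_mul (f g : sym T) : sym T :=
  Sym (can_comp (@sfunK _ f) (@sfunK _ g)) (can_comp (@sinvK _ g) (@sinvK _ f)).

Lemma sym_mulA : associative sym_mul.
Proof. by move=> f g h; apply: sym_eq. Qed.
Lemma sym_mul1 : left_id sym_one sym_mul.
Proof. by move=> f; apply: sym_eq. Qed.
Lemma sym_mulr1 : right_id sym_one sym_mul.
Proof. by move=> f; apply: sym_eq. Qed.
Lemma sym_mulV : left_inverse sym_one sym_inv sym_mul.
Proof. by move=> f; apply: sym_eq => x; exact: sfunK. Qed.
Lemma sym_mulrV : right_inverse sym_one sym_inv sym_mul.
Proof. by move=> f; apply: sym_eq => x; exact: sinvK. Qed.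

HB.instance Definition _ :=
  isGroup.Build (sym T) sym_mulA sym_mul1 sym_mulr1 sym_mulV sym_mulrV.
End SymGroup.

Local Open Scope group_scope.

(** An isomorphism between two subgroups of [P], given by its graph. Applied to quotients,
    [piso_inj] says both that [I] is functional and that it is injective. *)
Record partial_iso (P : groupType) (I : P -> P -> Prop) : Prop := PartialIso {
  piso1 : I 1 1;
  pisoM : forall a b c d, I a b -> I c d -> I (a * c) (b * d);
  pisoV : forall a b, I a b -> I a^-1 b^-1;
  piso_inj : forall a b, I a b -> (a = 1) <-> (b = 1) }.

(* Stable letters are pairs (j, e), with (j, true) the inverse of (j, false). *)
Definition linv (J : Type) (l : J * bool) : J * bool := (l.1, ~~ l.2).

Lemma linvK (J : Type) : involutive (@linv J).
Proof. by case=> j b; rewrite /linv negbK. Qed.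

Section HNN.
Variables (P : groupType) (J : eqType) (I : J -> P -> P -> Prop).
Hypothesis HI : forall j, partial_iso (I j).

(* [crosses l a b] says that a t = t b where t is the stable letter l. *)
Definition crosses (l : J * bool) (a b : P) : Prop :=
  if l.2 then I l.1 b a else I l.1 a b.
Definition dom (l : J * bool) (a : P) : Prop := exists b, crosses l a b.

Lemma crosses1 l : crosses l 1 1.
Proof. by rewrite /crosses; case: l.2; apply: (piso1 (HI _)). Qed.
Lemma crossesM l a b c d : crosses l a b -> crosses l c d -> crosses l (a * c) (b * d).
Proof. by rewrite /crosses; case: l.2; apply: (pisoM (HI _)). Qed.
Lemma crossesV l a b : crosses l a b -> crosses l a^-1 b^-1.
Proof. by rewrite /crosses; case: l.2; apply: (pisoV (HI _)). Qed.
Lemma crosses_linv l a b : crosses (linv l) a b <-> crosses l b a.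
Proof. by rewrite /crosses; case: l => j []. Qed.
Lemma crosses_inj l a b c : crosses l a b -> crosses l a c -> b = c.
Proof.
move=> /crossesV ab /(crossesM ab); rewrite mulVg => ac.
have : b^-1 * c = 1.
  by move: ac; rewrite /crosses; case: l.2 => /(piso_inj (HI _))[H1 H2]; auto.
by move/(congr1 ( *%g b)); rewrite mulVKg mulg1.
Qed.
Lemma dom1 l : dom l 1.
Proof. by exists 1; apply: crosses1. Qed.
Lemma domM l a c : dom l a -> dom l c -> dom l (a * c).
Proof. by move=> [b ab] [d cd]; exists (b * d); apply: crossesM. Qed.
Lemma domV l a : dom l a -> dom l a^-1.
Proof. by move=> [b ab]; exists b^-1; apply: crossesV. Qed.
Lemma domVE l a : dom l a^-1 <-> dom l a.
Proof. by split=> /domV //; rewrite invgK. Qed.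

Definition cross l a : P := some_such 1 (crosses l a).

Lemma crossP l a : dom l a -> crosses l a (cross l a).
Proof. by case=> b ab; apply: some_suchP ab. Qed.
Lemma crossE l a b : crosses l a b -> cross l a = b.
Proof. by move=> ab; apply: (crosses_inj (crossP (ex_intro _ b ab))). Qed.
Lemma crossM l a b : dom l a -> dom l b -> cross l (a * b) = cross l a * cross l b.
Proof. by move=> /crossP a' /crossP b'; apply/crossE/crossesM. Qed.
Lemma cross1 l : cross l 1 = 1.
Proof. exact/crossE/crosses1. Qed.

(** A representative of the coset [a * dom l]. The choice depends on the predicate alone, which is
    the same for all elements of a coset; the subgroup itself is represented by 1. *)
Definition rep l (a : P) : P :=
  if `[< dom l a >] then 1 else some_such a (fun b => dom l (a^-1 * b)).

Lemma repP l a : dom l (a^-1 * rep l a).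
Proof.
rewrite /rep; case: asboolP => [/domV|na]; first by rewrite mulg1.
by apply: (@some_suchP _ a (fun b => dom l (a^-1 * b)) a); rewrite mulVg; apply: dom1.
Qed.

Lemma repM l a b : dom l b -> rep l (a * b) = rep l a.
Proof.
move=> db; rewrite /rep.
have -> : `[< dom l (a * b) >] = `[< dom l a >].
  apply: asbool_equiv_eq; split=> [dab|da]; last exact: domM.
  by rewrite -(mulgK b a); apply/domM/domV.
case: asboolP => // nda.
have E : (fun c => dom l ((a * b)^-1 * c)) = (fun c => dom l (a^-1 * c)).
  apply: funext => c; rewrite invgM -mulgA; apply: propext; split=> d.
    by rewrite -(mulVKg b (a^-1 * c)); apply: domM.
  by apply: domM => //; apply: domV.
rewrite E /some_such; case: pselect => // -[]; exists a; rewrite mulVg; exact: dom1.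
Qed.

Lemma rep_dom l a : dom l a -> rep l a = 1.
Proof. by move=> h; rewrite /rep; case: asboolP. Qed.
Lemma rep_id l a : rep l (rep l a) = rep l a.
Proof. by rewrite -{2}(repM a (repP l a)) mulVKg. Qed.
Lemma rep_eq1 l a : rep l a = 1 -> dom l a.
Proof. by move=> h; apply/domVE; move: (repP l a); rewrite h mulg1. Qed.

(* The pair (s, p) stands for the product of the c_i l_i, for (c_i, l_i) in s,
   followed by p. *)
Notation nfword := (seq (P * (J * bool)) * P)%type.

Fixpoint nfwf (s : seq (P * (J * bool))) : bool :=
  if s is (c, l) :: s' then
    [&& c == rep l c,
       (if s' is (c', l') :: _ then ~~ ((c' == 1) && (l' == linv l)) else true)
     & nfwf s'] else true.

(** Left multiplication by [g] on normal forms: [g * c] is split into a representative and an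
    element of the subgroup, and the latter is carried across [l] to the rest. *)
Fixpoint act_base (g : P) (s : seq (P * (J * bool))) (p : P) : nfword :=
  if s is (c, l) :: s' then
    let c' := rep l (g * c) in
    let r := act_base (cross l (c'^-1 * (g * c))) s' p in
    ((c', l) :: r.1, r.2)
  else ([::], g * p).

Definition act_letter (l : J * bool) (x : nfword) : nfword :=
  match x.1 with
  | (c, l') :: s' => if (c == 1) && (l' == linv l) then (s', x.2)
                     else ((1, l) :: x.1, x.2)
  | [::] => ([:: (1, l)], x.2)
  end.

Lemma repVdom l a : dom l ((rep l a)^-1 * a).
Proof. by move: (repP l a) => /domV; rewrite invgM invgK. Qed.

(** No cancellation can appear: the factor carried across [l] lies in [dom (linv l)], so the next
    representative becomes 1 only if it lay in that subgroup, that is, if it was 1 before. *)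
Lemma nfwf_base g s p : nfwf s -> nfwf (act_base g s p).1.
Proof.
elim: s g => [//|[c l] s IH] g /= /and3P[/eqP cE hs ws]; rewrite rep_id eqxx IH //= andbT.
case: s hs ws {IH} => [//|[c1 l1] s] /= /negP hs /andP[/eqP c1E _].
apply/negP => /andP[/eqP h /eqP hl]; apply: hs; subst l1; rewrite eqxx andbT.
set b := cross _ _ in h; apply/eqP; rewrite c1E; apply: rep_dom.
have db : dom (linv l) b by exists ((rep l (g * c))^-1 * (g * c)); apply/crosses_linv/crossP/repVdom.
by rewrite -(mulKg b c1); apply: domM; [apply: domV|apply: rep_eq1].
Qed.

Lemma size_base g s p : size (act_base g s p).1 = size s.
Proof. by elim: s g => [|[c l] s IH] g //=; rewrite IH. Qed.

Lemma act_base1 s p : nfwf s -> act_base 1 s p = (s, p).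
Proof.
elim: s => [|[c l] s IH] /=; first by rewrite mul1g.
by case/and3P=> /eqP cE _ ws; rewrite mul1g -cE mulVg cross1 IH.
Qed.

Lemma act_baseM g h s p :
  act_base g (act_base h s p).1 (act_base h s p).2 = act_base (g * h) s p.
Proof.
elim: s g h => [|[c l] s IH] g h /=; first by rewrite mulgA.
have E : rep l (g * rep l (h * c)) = rep l (g * h * c).
  by rewrite -(repM (g * rep l (h * c)) (repVdom l (h * c))) -!mulgA mulVKg.
rewrite E IH -crossM; last exact: repVdom.
  by congr ((_, _) :: (act_base (cross _ _) _ _).1, (act_base (cross _ _) _ _).2);
    rewrite -!mulgA mulVKg.
by rewrite -E; apply: repVdom.
Qed.

Lemma nfwf_letter l x : nfwf x.1 -> nfwf (act_letter l x).1.
Proof.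
rewrite /act_letter; case: x => [[|[c l'] s] p] /=; first by rewrite (rep_dom (dom1 l)) eqxx.
by case: ifP => [_ /and3P[]//|h]; rewrite /= (rep_dom (dom1 l)) eqxx /= h.
Qed.

Lemma act_letterK l x : nfwf x.1 -> act_letter (linv l) (act_letter l x) = x.
Proof.
case: x => [[|[c l'] s] p] /=; first by rewrite /act_letter /= linvK !eqxx.
move=> /= /and3P[_ hs _]; rewrite /act_letter /=.
case: ifP => [/andP[/eqP c1 /eqP hl]|h] /=; last by rewrite linvK !eqxx.
by subst c l'; case: s hs => [//|[c1 l1] s] /= /negbTE->.
Qed.

(** The defining relation of the HNN extension. Multiplication by an element of the subgroup does
    not change whether the leading letter cancels with [l], so the two sides fall into the same case
    of [act_letter]. *)
Lemma act_cross l a b x : crosses l a b -> nfwf x.1 ->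
  act_base a (act_letter l x).1 (act_letter l x).2 =
  let y := act_base b x.1 x.2 in act_letter l y.
Proof.
move=> ab; have da : dom l a by exists b.
have ra : rep l (a * 1) = 1 by rewrite mulg1 rep_dom.
have N s p : act_base a ((1, l) :: s) p =
    ((1, l) :: (act_base b s p).1, (act_base b s p).2).
  by rewrite /= ra invg1 mul1g mulg1 (crossE ab).
case: x => [[|[c l'] s] p]; first by move=> _; rewrite /act_letter N.
rewrite [nfwf _]/= => /and3P[/eqP cE hs ws] /=.
have db : dom (linv l) b by exists a; apply/crosses_linv.
have E : ((rep l' (b * c) == 1) && (l' == linv l)) = ((c == 1) && (l' == linv l)).
  rewrite ![_ && (l' == _)]andbC; case: eqP => //= hl; subst l'.
  have -> : (rep (linv l) (b * c) == 1) = `[< dom (linv l) (b * c) >].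
    by apply/eqP/asboolP => [/rep_eq1 //|/rep_dom].
  apply/asboolP/eqP => [d|->]; last by rewrite mulg1.
  rewrite cE; apply: rep_dom; rewrite -(mulKg b c); apply: domM => //; exact: domV.
rewrite /act_letter /= E; case: ifP => [h|_]; last by rewrite N.
case/andP: h => /eqP c1 /eqP hl; subst c l'.
rewrite mulg1 (rep_dom db) invg1 mul1g (crossE (b := a)); last exact/crosses_linv.
by case: (act_base a s p).
Qed.

Let nf := {x : nfword | nfwf x.1}.

Definition nf_base g (x : nf) : nf :=
  exist _ (act_base g (val x).1 (val x).2) (nfwf_base g _ (valP x)).
Definition nf_letter l (x : nf) : nf :=
  exist _ (act_letter l (val x)) (nfwf_letter l (valP x)).

Lemma nf_baseK g : cancel (nf_base g) (nf_base g^-1).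
Proof. by move=> x; apply/val_inj; rewrite /= act_baseM mulVg act_base1 ?(valP x) //; case: (val x). Qed.
Lemma nf_baseVK g : cancel (nf_base g^-1) (nf_base g).
Proof. by move=> x; apply/val_inj; rewrite /= act_baseM mulgV act_base1 ?(valP x) //; case: (val x). Qed.
Lemma nf_letterK l : cancel (nf_letter l) (nf_letter (linv l)).
Proof. by move=> x; apply/val_inj; rewrite /= act_letterK ?(valP x). Qed.
Lemma nf_letterVK l : cancel (nf_letter (linv l)) (nf_letter l).
Proof. by move=> x; rewrite -{1}(linvK l) nf_letterK. Qed.

(** This is the full symmetric group on the normal forms; the HNN extension proper is its subgroup
    generated by [hbase] and [hstable]. A generated subgroup is only cut out at the end, by
    [gsub]. *)
Definition hnn : groupType := sym nf.
Definition hbase (g : P) : hnn := Sym (nf_baseK g) (nf_baseVK g).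
Definition hstable (j : J) : hnn := Sym (nf_letterK (j, false)) (nf_letterVK (j, false)).
Definition hletter (l : J * bool) : hnn := if l.2 then (hstable l.1)^-1 else hstable l.1.

Lemma hbaseM : {morph hbase : x y / x * y}.
Proof. by move=> g h; apply: sym_eq => x; apply: val_inj; rewrite /= act_baseM. Qed.
Lemma hbase1 : hbase 1 = 1.
Proof. by apply: (mulgI (hbase 1)); rewrite -hbaseM !mulg1. Qed.
Lemma hbaseV g : hbase g^-1 = (hbase g)^-1.
Proof. by apply: (mulgI (hbase g)); rewrite -hbaseM !mulgV hbase1. Qed.
Lemma hletterE l x : hletter l x = nf_letter l x.
Proof. by case: l => j []. Qed.
Lemma hletterV l : hletter (linv l) = (hletter l)^-1.
Proof. by case: l => j [] //=; rewrite /hletter /= invgK. Qed.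

Lemma hletter_crosses l a b : crosses l a b -> hbase a * hletter l = hletter l * hbase b.
Proof.
move=> ab; apply: sym_eq => x; rewrite [LHS]/= [RHS]/= !hletterE.
by apply: val_inj; rewrite /= (act_cross ab) ?(valP x).
Qed.

Fixpoint hval (s : seq (P * (J * bool))) (p : P) : hnn :=
  if s is (c, l) :: s' then hbase c * hletter l * hval s' p else hbase p.

Fixpoint pinchfree (s : seq (P * (J * bool))) : Prop :=
  if s is (c, l) :: s' then
    (if s' is (c', l') :: _ then l' = linv l -> ~ dom l' c' else True) /\ pinchfree s'
  else True.

Let nf0 : nf := exist _ ([::], 1) isT.

(** Applied to the empty normal form, a pinch-free product adds one letter per factor, because a
    cancellation in [act_letter] would be a pinch. Its length and its head can then be read off. *)
Lemma pinchfree_nf s p : pinchfree s ->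
  let x := val (hval s p nf0) in
  size x.1 = size s /\
  (if s is (c, l) :: s' then (ohead x.1 = Some (rep l c, l)) else x.2 = p).
Proof.
elim: s => [_|[c l] s IH] /=; first by rewrite mulg1.
case=> h /IH{IH}; rewrite hletterE /=.
case: (val (hval s p nf0)) => s' p' /= [sz hd].
case: s h sz hd => [|[c1 l1] s] h sz hd.
  by case: s' sz {hd} => //= _; rewrite mulg1.
case: s' sz hd => //= -[c2 l2] s' sz [hd1 hd2]; subst c2 l2; rewrite /act_letter /=.
case: ifP => [/andP[/eqP /rep_eq1 d /eqP /h[]]//|_] /=.
by rewrite size_base mulg1; case: sz => <-.
Qed.

Theorem britton s p : hval s p = 1 -> pinchfree s -> s = [::] /\ p = 1.
Proof.
move=> v1 /(@pinchfree_nf _ p) /=; rewrite v1 /=.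
by case: s {v1} => [[_ <-]|[c l] s []].
Qed.

Lemma rep_eq l a b : rep l a = rep l b -> dom l (a^-1 * b).
Proof.
move=> E; rewrite -[b](mulVKg (rep l b)) mulgA; apply: domM; last exact: repVdom.
by rewrite -E; apply: repP.
Qed.

(** Equal products have the same normal form, whose head determines the first letter and the coset
    of the first coefficient. *)
Lemma pinchfree_head s s' p p' : pinchfree s -> pinchfree s' ->
  hval s p = hval s' p' ->
  match s, s' with
  | [::], [::] => p = p'
  | (c, l) :: _, (c', l') :: _ => l = l' /\ dom l (c^-1 * c')
  | _, _ => False
  end.
Proof.
move=> /(@pinchfree_nf _ p) /= h /(@pinchfree_nf _ p') /= h' E; rewrite E {E} in h.
move: (val _) h h' => x h; case: s h => [|[c l] s]; case: s' => [|[c' l'] s'] /= [sz a] [sz' b].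
- by rewrite -a -b.
- by rewrite sz in sz'.
- by rewrite sz in sz'.
- by move: b; rewrite a => -[E hl]; subst l'; split=> //; apply: rep_eq.
Qed.

Lemma hbase_inj : injective hbase.
Proof.
move=> a b ab; have /britton[//|_] : hval [::] (a * b^-1) = 1.
  by rewrite /= hbaseM ab -hbaseM mulgV hbase1.
by move/(congr1 ( *%g^~ b)); rewrite mulgVK mul1g.
Qed.
End HNN.
End Britton.
Import Britton.

(** * Rewriting in bounded space *)

Module RewritingCalculus.
Lemma inv_letterK (A : finType) : involutive (@inv_letter A).
Proof. by case=> a b; rewrite /inv_letter negbK. Qed.

Section InvWord.
Variable A : finType.
Implicit Types u v w : word A.

Lemma inv_word_cat u v : inv_word (u ++ v) = inv_word v ++ inv_word u.
Proof. by rewrite /inv_word map_cat rev_cat. Qed.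
Lemma inv_wordK : involutive (@inv_word A).
Proof. by move=> w; rewrite /inv_word map_rev revK (mapK (@inv_letterK A)). Qed.
Lemma size_inv_word w : size (inv_word w) = size w.
Proof. by rewrite /inv_word size_rev size_map. Qed.
Lemma inv_word_cons (x : letter A) w : inv_word (x :: w) = inv_word w ++ [:: inv_letter x].
Proof. by rewrite -cat1s inv_word_cat. Qed.
End InvWord.

Section Rewriting.
Variables (A : finType) (R : seq (word A)).
Implicit Types u v w a b X Y : word A.
Implicit Types U V W : seq (word A).

Inductive rw (s : nat) : seq (word A) -> seq (word A) -> Prop :=
| Rw0 U : total_length U <= s -> rw s U U
| RwS U V W : total_length U <= s -> elementary R U V -> rw s V W -> rw s U W.

Lemma rw_trans s U V W : rw s U V -> rw s V W -> rw s U W.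
Proof. by elim=> // {}U V' {}V Us UV _ IH /IH; apply: RwS UV. Qed.
Lemma rw_le s U V : rw s U V -> total_length U <= s.
Proof. by case. Qed.
Lemma rw_ler s U V : rw s U V -> total_length V <= s.
Proof. by elim. Qed.
Lemma rw_mono s s' U V : s <= s' -> rw s U V -> rw s' U V.
Proof.
by move=> h; elim=> [{}U|{}U V' W] Us; [apply: Rw0|move=> e _; apply: RwS e];
  apply: leq_trans h.
Qed.

Lemma tl_cat U V : total_length (U ++ V) = total_length U + total_length V.
Proof. by rewrite /total_length big_cat. Qed.
Lemma tl_cons w U : total_length (w :: U) = size w + total_length U.
Proof. by rewrite /total_length big_cons. Qed.
Lemma tl0 : @total_length A [::] = 0.
Proof. by rewrite /total_length big_nil. Qed.
Lemma tl1 w : total_length [:: w] = size w.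
Proof. by rewrite tl_cons tl0 addn0. Qed.

Lemma rw_ctx s U V (X Y : seq (word A)) : rw s U V ->
  rw (s + total_length X + total_length Y) (X ++ U ++ Y) (X ++ V ++ Y).
Proof.
elim=> [{}U|{}U V' W] Us.
  by apply: Rw0; rewrite !tl_cat; lia.
move=> UV _; apply: RwS; first by rewrite !tl_cat; lia.
case: UV => U1 U2 w W' h; rewrite -!catA.
have /= := Elementary (X ++ U1) (U2 ++ Y) h.
by rewrite -!catA.
Qed.

Lemma rw_step s w W : size w <= s -> total_length W <= s -> entry_step R w W -> rw s [:: w] W.
Proof.
move=> ws Ws h; apply: (RwS (V := W)); first by rewrite tl1.
  by have := Elementary [::] [::] h; rewrite cats0.
exact: Rw0.
Qed.

Lemma rw1 s w v : size w <= s -> size v <= s -> entry_step R w [:: v] -> rw s [:: w] [:: v].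
Proof. by move=> ws vs; apply: rw_step => //; rewrite tl1. Qed.

Definition red s w := rw s [:: w] [::].

Lemma red_mono s s' w : s <= s' -> red s w -> red s' w.
Proof. exact: rw_mono. Qed.
Lemma red0 s : red s [::].
Proof. by apply: rw_step => //; [rewrite tl0|constructor]. Qed.

Lemma rw_shift s u v : size (u ++ v) <= s -> rw s [:: u ++ v] [:: v ++ u].
Proof. by move=> h; apply: rw1; rewrite // ?size_cat 1?addnC -?size_cat //; constructor. Qed.

Lemma red_shift s u v : red s (u ++ v) -> red s (v ++ u).
Proof.
move=> h; have := rw_le h; rewrite tl1 => hs; apply: rw_trans h; apply: rw_shift.
by move: hs; rewrite !size_cat addnC.
Qed.

(* Replacing a by b inside a word; the splitting operation makes this possible
   even when a b^-1 is contracted by means of cyclic shifts. *)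
Definition der s a b := forall X Y,
  rw (s + size X + size Y) [:: X ++ a ++ Y] [:: X ++ b ++ Y] /\
  rw (s + size X + size Y) [:: X ++ b ++ Y] [:: X ++ a ++ Y].

Lemma der_sym s a b : der s a b -> der s b a.
Proof. by move=> h X Y; case: (h X Y). Qed.
Lemma der_trans s a b c : der s a b -> der s b c -> der s a c.
Proof.
by move=> h h' X Y; case: (h X Y) => ? ?; case: (h' X Y) => ? ?; split; eapply rw_trans; eassumption.
Qed.
Lemma der_mono s s' a b : s <= s' -> der s a b -> der s' a b.
Proof. by move=> hs h X Y; case: (h X Y); split; (eapply rw_mono; [|eassumption]); rewrite ?leq_add2r. Qed.
Lemma der_refl s a : size a <= s -> der s a a.
Proof. by move=> h X Y; split; apply: Rw0; rewrite tl1 !size_cat; lia. Qed.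
Lemma der_rw s a b : der s a b -> rw s [:: a] [:: b].
Proof. by move/(_ [::] [::]) => []; rewrite !cats0 !addn0. Qed.
Lemma der_size s a b : der s a b -> size a <= s /\ size b <= s.
Proof. by move/der_rw => h; move: (rw_le h) (rw_ler h); rewrite !tl1. Qed.
Lemma der_red s a : der s a [::] -> red s a.
Proof. by move/der_rw => h; apply: rw_trans h _; apply: red0. Qed.
Lemma red_der_trans s a b : der s a b -> red s b -> red s a.
Proof. by move/der_rw/rw_trans; apply. Qed.

Lemma der_ctx s a b X Y : der s a b ->
  der (s + size X + size Y) (X ++ a ++ Y) (X ++ b ++ Y).
Proof.
move=> h X' Y'; have := h (X' ++ X) (Y ++ Y'); rewrite -!catA !size_cat.
by have -> : s + (size X' + size X) + (size Y + size Y') =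
             s + size X + size Y + size X' + size Y' by lia.
Qed.
Lemma der_in s t a b X Y : der s a b -> s + size X + size Y <= t ->
  der t (X ++ a ++ Y) (X ++ b ++ Y).
Proof. by move=> h ht; apply: der_mono ht _; apply: der_ctx. Qed.
Lemma der_catl s t a b Y : der s a b -> s + size Y <= t -> der t (a ++ Y) (b ++ Y).
Proof. by move=> h ht; apply: (@der_in s t a b [::] Y) => //; rewrite addn0. Qed.
Lemma der_catr s t a b X : der s a b -> s + size X <= t -> der t (X ++ a) (X ++ b).
Proof.
by move=> h ht; have := @der_in s t a b X [::] h; rewrite !cats0 addn0; apply.
Qed.

Lemma der_cancel (x : letter A) : der 2 [:: x; inv_letter x] [::].
Proof.
move=> X Y; split; apply: rw1; rewrite ?size_cat /=; try lia.
  exact: (RemoveCancel R X Y x).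
exact: (InsertCancel R X Y x).
Qed.
Lemma der_rel r : r \in R -> der (size r) r [::].
Proof.
move=> rR X Y; split; apply: rw1; rewrite ?size_cat /=; try lia.
  by apply: (@RemoveRelator A R X Y r); rewrite rR.
by apply: (@InsertRelator A R X Y r); rewrite rR.
Qed.

Lemma der_cancelw s w : 2 * size w <= s -> der s (w ++ inv_word w) [::].
Proof.
elim: w s => [|x w IH] s; first by move=> _; apply: der_refl.
rewrite [size _]/= => h.
have -> : (x :: w) ++ inv_word (x :: w) = [:: x] ++ (w ++ inv_word w) ++ [:: inv_letter x].
  by rewrite inv_word_cons /= -!catA.
apply: (der_trans (b := [:: x] ++ [::] ++ [:: inv_letter x])).
  by apply: der_in; [apply: IH; apply: leqnn|rewrite /=; lia].
by apply: der_mono (der_cancel x); lia.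
Qed.
Lemma der_cancelVw s w : 2 * size w <= s -> der s (inv_word w ++ w) [::].
Proof. by move=> h; rewrite -{2}(inv_wordK w); apply: der_cancelw; rewrite size_inv_word. Qed.

Lemma revs1 T (x : T) : rev [:: x] = [:: x]. Proof. by []. Qed.
Lemma revs2 T (x y : T) : rev [:: x; y] = [:: y; x]. Proof. by []. Qed.

(** Inversion exchanges the two parts of a split word, hence the [rev]. It turns a contraction of
    [a b^-1] into one of [b a^-1], which the symmetric relation [der] requires. *)
Lemma entry_step_inv w W : entry_step R w W ->
  entry_step R (inv_word w) (rev (map (@inv_word A) W)).
Proof.
have RI r : (r \in R) || (r \in map (@inv_word A) R) ->
    (inv_word r \in R) || (inv_word r \in map (@inv_word A) R).
  case/orP=> [h|/mapP[r' h ->]]; last by rewrite inv_wordK h.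
  by apply/orP; right; apply: map_f.
have CE x : inv_word [:: x; inv_letter x] = [:: x; inv_letter x] :> word A.
  by rewrite /inv_word /rev /= inv_letterK.
case=> [u v x|u v x|u v r /RI rR|u v r /RI rR|u v|u v|];
  rewrite ?map_cons ?revs1 ?revs2 ?inv_word_cat ?CE -?catA.
- exact: InsertCancel.
- exact: RemoveCancel.
- exact: InsertRelator.
- exact: RemoveRelator.
- exact: CyclicShift.
- exact: Defs.Split.
- exact: RemoveEmpty.
Qed.

Lemma tl_rev_inv U : total_length (rev (map (@inv_word A) U)) = total_length U.
Proof.
elim: U => [//|w U IH].
by rewrite map_cons rev_cons -cats1 tl_cat tl1 tl_cons IH size_inv_word addnC.
Qed.

Lemma rw_inv s U V : rw s U V ->
  rw s (rev (map (@inv_word A) U)) (rev (map (@inv_word A) V)).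
Proof.
elim=> [{}U|{}U V' W] Us; first by apply: Rw0; rewrite tl_rev_inv.
move=> h _; apply: RwS; rewrite ?tl_rev_inv //.
case: h => U1 U2 w W' /entry_step_inv h; rewrite !map_cat !rev_cat map_cons rev_cons.
by rewrite -cats1 -!catA; apply: Elementary.
Qed.

Lemma red_inv s w : red s w -> red s (inv_word w).
Proof. by move/rw_inv. Qed.

Lemma red_rem s w X Y : red s w ->
  rw (s + size X + size Y) [:: X ++ w ++ Y] [:: X ++ Y].
Proof.
move=> h; have := rw_le h; rewrite tl1 => hs.
apply: (rw_trans (V := [:: w ++ Y ++ X])).
  by rewrite (catA w Y X); apply: rw_shift; rewrite !size_cat; lia.
apply: (rw_trans (V := [:: w; Y ++ X])).
  by apply: rw_step; rewrite ?tl_cons ?tl0 ?size_cat; try lia; exact: Defs.Split.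
apply: (rw_trans (V := [:: Y ++ X])); last by apply: rw_shift; rewrite size_cat; lia.
have := @rw_ctx s [:: w] [::] [::] [:: Y ++ X] h; rewrite tl0 tl1 size_cat /=.
by apply: rw_mono; lia.
Qed.

(** First [b^-1 b] is inserted behind [a], so that the factor to be removed is the contractible word
    [a b^-1]. *)
Lemma red_subst s t a b X Y : red s (a ++ inv_word b) -> s + size b + size a + size X + size Y <= t ->
  rw t [:: X ++ a ++ Y] [:: X ++ b ++ Y].
Proof.
move=> h ht; have := rw_le h; rewrite tl1 size_cat size_inv_word => hs.
apply: (rw_trans (V := [:: X ++ (a ++ inv_word b) ++ b ++ Y])).
  have /der_sym d := der_cancelVw (leqnn (2 * size b)).
  have := der_rw (@der_in _ t _ _ (X ++ a) Y d _); rewrite -!catA; apply.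
  by rewrite size_cat; lia.
by apply: rw_mono (red_rem _ _ h); rewrite size_cat; lia.
Qed.

Lemma red_der s t a b : red s (a ++ inv_word b) -> s + size b + size a <= t -> der t a b.
Proof.
move=> h ht X Y; split; first by apply: red_subst h _; lia.
apply: (@red_subst s); last lia.
by move: (red_inv h); rewrite inv_word_cat inv_wordK.
Qed.

Lemma der_inv s t a b : der s a b -> s + 3 * (size a + size b) <= t -> der t (inv_word a) (inv_word b).
Proof.
move=> h ht; apply: (@red_der (s + size a + size b)); last by rewrite !size_inv_word; lia.
rewrite inv_wordK; apply: (@red_der_trans _ _ (inv_word a ++ a)).
  by apply: der_catr; [apply: der_sym h|rewrite size_inv_word; lia].
by apply: der_red; apply: der_cancelVw; have := (der_size h).1; lia.
Qed.

Lemma rw_path s U V : rw s U V -> exists p,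
  [/\ rewriting R U p, last U p = V & rewriting_space U p <= s].
Proof.
elim=> [{}U|{}U W V' Us UV _ [p [rp lp hp]]].
  by exists [::]; rewrite /rewriting_space big_seq1.
exists (W :: p); split=> //.
  by rewrite /rewriting /=; apply/andP; split; [apply/asboolP|].
by rewrite /rewriting_space big_cons geq_max Us.
Qed.

Lemma red_space s w : red s w -> word_space R w <= s.
Proof.
case/rw_path=> p [rp lp hp]; rewrite /word_space /min_nat; case: pselect => [e|[]].
  case: ex_minnP => m _ /(_ (rewriting_space [:: w] p)) hm; apply: leq_trans hp; apply: hm.
  by apply/asboolP; exists p.
by exists (rewriting_space [:: w] p); apply/asboolP; exists p.
Qed.

Lemma path_rw U p : rewriting R U p -> rw (rewriting_space U p) U (last U p).
Proof.
elim: p U => [|V p IH] U /=.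
  by move=> _; apply: Rw0; rewrite /rewriting_space big_seq1.
rewrite /rewriting /= => /andP[/asboolP UV /IH h].
apply: RwS UV _; first by rewrite /rewriting_space big_cons leq_maxl.
by apply: rw_mono h; rewrite /rewriting_space [leqRHS]big_cons leq_maxr.
Qed.

Lemma space_red w : pres_eq R w [::] -> red (word_space R w) w.
Proof.
move=> /rewriting_exists[p0 rp0 lp0]; rewrite /word_space /min_nat.
case: pselect => [e|[]]; last first.
  by exists (rewriting_space [:: w] p0); apply/asboolP; exists p0.
by case: ex_minnP => m /asboolP[p [/path_rw rp lp ->]] _; rewrite /red; move: rp; rewrite lp.
Qed.
End Rewriting.
End RewritingCalculus.
Import RewritingCalculus.

(** * The group of affine rules *)

Module RuleGroups.
Import GRing.Theory.
Local Open Scope group_scope.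

Lemma not_pinchfree (P : groupType) (J : eqType) (I : J -> P -> P -> Prop)
    (s : seq (P * (J * bool))) : ~ pinchfree I s ->
  exists s1 c l c' s2, s = s1 ++ (c, l) :: (c', linv l) :: s2 /\ dom I (linv l) c'.
Proof.
elim: s => [[]//|[c l] s IH] /= h.
have [/IH[s1 [c1 [l1 [c2 [s2 [-> d]]]]]]|ps] := pselect (~ pinchfree I s).
  by exists ((c, l) :: s1), c1, l1, c2, s2.
case: s {IH} h ps => [|[c' l'] s] h ps; first by case: h.
have [[E d]|nd] := pselect (l' = linv l /\ dom I l' c').
  by subst l'; exists [::], c, l, c', s.
by case: h; split; [move=> E d; apply: nd|apply: contrapT].
Qed.

(* An additive group, written multiplicatively. *)
Definition mul_of (V : zmodType) : Type := V.
HB.instance Definition _ (V : zmodType) := Choice.on (mul_of V).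
HB.instance Definition _ (V : zmodType) := isGroup.Build (mul_of V)
  (@addrA V) (@add0r V) (@addr0 V) (@addNr V) (@addrN V).

(** With trivial associated subgroups the HNN extension is the free product of [P] and the free
    group on [J]. *)
Definition trivial_iso (P : groupType) (J : eqType) (_ : J) (a b : P) : Prop := a = 1 /\ b = 1.
Lemma trivial_isoP (P : groupType) (J : eqType) (j : J) : partial_iso (@trivial_iso P J j).
Proof.
split=> [//|a b c d [-> ->] [-> ->]|a b [-> ->]|a b [-> ->]]; rewrite /trivial_iso ?mulg1 ?invg1 //.
Qed.

Section FreeProduct.
Variable V : zmodType.
Implicit Types g v : V.

(* K is the free product of V and of an infinite cyclic group <t>.  A pair
   (tau, v) stands for the product of the conjugates (t^e)^g with (g, e) in tau,
   followed by v. *)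
Notation KI := (@trivial_isoP (mul_of V) unit).
Definition kgroup : groupType := hnn (@trivial_iso (mul_of V) unit).
Definition kvec (v : V) : kgroup := hbase KI (v : mul_of V).
Definition kt (e : bool) : kgroup := hletter KI (tt, e).

Lemma kvecD u v : kvec (u + v)%R = kvec u * kvec v. Proof. exact: hbaseM. Qed.
Lemma kvec0 : kvec 0%R = 1. Proof. exact: hbase1. Qed.
Lemma kvecN v : kvec (- v)%R = (kvec v)^-1. Proof. exact: hbaseV. Qed.
Lemma ktV e : kt (~~ e) = (kt e)^-1. Proof. exact: (hletterV _ (tt, e)). Qed.

Definition tconj (x : V * bool) : kgroup := kvec (- x.1)%R * kt x.2 * kvec x.1.
Definition tinv (x : V * bool) : V * bool := (x.1, ~~ x.2).
Fixpoint tprod (tau : seq (V * bool)) : kgroup :=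
  if tau is x :: tau' then tconj x * tprod tau' else 1.
Definition kval tau v := tprod tau * kvec v.
Definition tshift v (tau : seq (V * bool)) := [seq ((x.1 - v)%R, x.2) | x <- tau].
Definition tinvs (tau : seq (V * bool)) := rev (map tinv tau).

Lemma tconjV x : tconj (tinv x) = (tconj x)^-1.
Proof. by rewrite /tconj /= ktV kvecN !invgM invgK mulgA. Qed.
Lemma tinvK : involutive tinv. Proof. by case=> g e; rewrite /tinv negbK. Qed.
Lemma tprod_cat s1 s2 : tprod (s1 ++ s2) = tprod s1 * tprod s2.
Proof. by elim: s1 => [|x s IH] /=; rewrite ?mul1g // IH mulgA. Qed.
Lemma tprodV s : tprod (tinvs s) = (tprod s)^-1.
Proof.
elim: s => [|x s IH]; first by rewrite invg1.
by rewrite /tinvs /= rev_cons -cats1 tprod_cat -/(tinvs s) IH /= mulg1 tconjV invgM.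
Qed.
Lemma kvec_tprod v s : kvec v * tprod s = tprod (tshift v s) * kvec v.
Proof.
elim: s => [|[g e] s IH] /=; first by rewrite mulg1 mul1g.
rewrite mulgA -!mulgA -IH /tconj /= !mulgA; congr (_ * _).
by rewrite opprB !kvecD !kvecN !mulgA mulgVK.
Qed.
Lemma kvalM s v s' v' : kval s v * kval s' v' = kval (s ++ tshift v s') (v + v')%R.
Proof. by rewrite /kval tprod_cat kvecD -!mulgA; congr (_ * _); rewrite !mulgA kvec_tprod. Qed.
Lemma kvalV s v : (kval s v)^-1 = kval (tshift (- v)%R (tinvs s)) (- v)%R.
Proof. by rewrite /kval invgM -tprodV -kvecN kvec_tprod. Qed.
Lemma kval_vec v : kval [::] v = kvec v. Proof. by rewrite /kval mul1g. Qed.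
Lemma kval0 : kval [::] 0%R = 1. Proof. by rewrite kval_vec kvec0. Qed.

Fixpoint treduced (tau : seq (V * bool)) : bool :=
  if tau is x :: tau' then
    (if tau' is y :: _ then y != tinv x else true) && treduced tau'
  else true.

Lemma not_treduced s : ~~ treduced s -> exists s1 x s2, s = s1 ++ x :: tinv x :: s2.
Proof.
elim: s => [//|x s IH] /=; rewrite negb_and => /orP[|/IH[s1 [y [s2 ->]]]]; last by exists (x :: s1), y, s2.
by case: s {IH} => [//|y s]; rewrite negbK => /eqP->; exists [::], x, s.
Qed.

(** A product of conjugates as an alternating word: between the letters with indices [g] and [g']
    stands the vector [g - g'], and [u] is a vector in front of everything. A pinch occurs exactly
    where [tau] is not reduced. *)
Fixpoint khval (u : V) (tau : seq (V * bool)) v : seq (mul_of V * (unit * bool)) * mul_of V :=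
  if tau is x :: tau' then
    let r := khval x.1 tau' v in (((u - x.1)%R, (tt, x.2)) :: r.1, r.2)
  else ([::], (u + v)%R).

Lemma khvalE u s v : hval KI (khval u s v).1 (khval u s v).2 = kvec u * kval s v.
Proof.
elim: s u => [|[g e] s IH] u /=; first by rewrite kval_vec -kvecD.
by rewrite IH /kval /= /tconj /= -/(kvec _) -/(kt _) kvecD !mulgA.
Qed.

Lemma khval_pinchfree u s v : treduced s -> pinchfree (@trivial_iso (mul_of V) unit) (khval u s v).1.
Proof.
elim: s u => [//|[g e] s IH] u /= /andP[h /IH{IH} r]; split; last exact: r.
case: s h {r} => [//|[g' e'] s] /= h [E] [b]; rewrite /crosses /= E => hb; case/eqP: h.
congr (_, _) => //; symmetry; apply/eqP; rewrite -subr_eq0; apply/eqP.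
by case: e E hb => _ /= [].
Qed.

(** Uniqueness of normal forms in the free product: by [pinchfree_head] the first conjugates of two
    reduced products agree, and they can be cancelled. *)
Lemma kval_inj s v s' v' : treduced s -> treduced s' ->
  kval s v = kval s' v' -> s = s' /\ v = v'.
Proof.
elim: s s' => [|[g e] s IH] [|[g' e'] s'] rs rs' E.
- by split=> //; move: E; rewrite !kval_vec => /(@hbase_inj _ _ _ KI).
all: have /= := pinchfree_head (khval_pinchfree 0 v rs) (khval_pinchfree 0 v' rs')
       (etrans (khvalE _ _ _) (etrans (congr1 (mul _) E) (esym (khvalE _ _ _)))).
- by [].
- by [].
case=> -[ee] [b]; rewrite /crosses /= => hb; subst e'.
have gg : (- (0 - g) + (0 - g'))%R = 0%R by case: (e) hb => -[].
have {}gg : g = g' by apply/eqP; move: gg; rewrite !sub0r opprK => /eqP; rewrite subr_eq0.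
subst g'; have {}E : kval s v = kval s' v'.
  by apply: (mulgI (tconj (g, e))); rewrite /kval !mulgA; exact: E.
by case/andP: rs => _ rs; case/andP: rs' => _ rs'; have [-> ->] := IH _ rs rs' E.
Qed.

Lemma kval_eq1 s v : kval s v = 1 -> v = 0%R /\ (s = [::] \/ ~~ treduced s).
Proof.
suff : forall n, size s <= n -> kval s v = 1 -> v = 0%R.
  move=> h E; split; first exact: h E; have [r|] := boolP (treduced s); last by right.
  by left; have [] := @kval_inj s v [::] 0%R r isT; rewrite ?kval0.
move=> n; elim: n s => [|n IH] s hs E; have [r|/not_treduced[s1 [x [s2 Es]]]] := boolP (treduced s);
  try by have [] := @kval_inj s v [::] 0%R r isT; rewrite ?kval0.
  by rewrite Es size_cat /= addnS in hs.
apply: (IH (s1 ++ s2)); first by move: hs; rewrite Es !size_cat /=; lia.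
by move: E; rewrite Es /kval !tprod_cat /= tconjV mulVKg.
Qed.
End FreeProduct.

Section Affine.
Variables (C : finType) (L : finType).
Notation vec := {ffun C -> int}.
Variables (ra rc : L -> vec) (rm rn : L -> C -> nat).
(** The two multipliers of a coordinate vanish together; otherwise [a + mu z |-> c + nu z] would not
    be a bijection between the two ranges. *)
Hypothesis rmn : forall l i, (rm l i == 0%N) = (rn l i == 0%N).

Definition scale (m : C -> nat) (z : vec) : vec := [ffun i => ((m i)%:Z * z i)%R].
Definition aff (a : vec) m z : vec := (a + scale m z)%R.

Definition src (l : L * bool) : vec -> vec :=
  if l.2 then aff (rc l.1) (rn l.1) else aff (ra l.1) (rm l.1).
Definition src0 (l : L * bool) : vec -> vec := scale (if l.2 then rn l.1 else rm l.1).

Lemma scaleD m : {morph scale m : x y / (x + y)%R}.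
Proof. by move=> x y; apply/ffunP=> i; rewrite !ffunE mulrDr. Qed.
Lemma scaleN m : {morph scale m : x / (- x)%R}.
Proof. by move=> x; apply/ffunP=> i; rewrite !ffunE mulrN. Qed.
Lemma scale0 m : scale m 0%R = 0%R.
Proof. by apply/ffunP=> i; rewrite !ffunE mulr0. Qed.

Lemma srcB l z v : (src l z - src0 l v)%R = src l (z - v)%R.
Proof. by rewrite /src /src0 /aff; case: l => l [] /=; rewrite scaleD scaleN addrA. Qed.
Lemma src0_eq l z z' : src0 l z = src0 l z' -> src0 (linv l) z = src0 (linv l) z'.
Proof.
move=> /ffunP E; apply/ffunP => i; have := E i; rewrite !ffunE /=.
have := rmn l.1 i; case: l {E} => l [] /=; case: (rm l i) (rn l i) => [|a] [|b] //= _; nia.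
Qed.
Lemma src_eq l z z' : src l z = src l z' -> src (linv l) z = src (linv l) z'.
Proof.
case: l => l e E; have : src0 (l, e) z = src0 (l, e) z'.
  by move: E; rewrite /src /src0 /aff; case: e => /=; move/addrI.
by move/src0_eq; rewrite /src /src0 /linv /aff; case: e {E} => /= ->.
Qed.
Lemma src00 l : src0 l 0%R = 0%R. Proof. exact: scale0. Qed.
Lemma src0D l : {morph src0 l : x y / (x + y)%R}. Proof. exact: scaleD. Qed.
Lemma src0N l : {morph src0 l : x / (- x)%R}. Proof. exact: scaleN. Qed.

Notation K := (kgroup {ffun C -> int}).
Definition tmap (f : vec -> vec) (s : seq (vec * bool)) := [seq (f x.1, x.2) | x <- s].

(** The associated subgroups are generated by the [t^(src z)] and the vectors [src0 v].
    Corresponding elements share the parameters [s] and [v]. *)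
Definition rule_iso (l : L) (k k' : K) : Prop := exists s v,
  k = kval (tmap (src (l, false)) s) (src0 (l, false) v) /\
  k' = kval (tmap (src (l, true)) s) (src0 (l, true) v).

Lemma tmap_tinvs f s : tmap f (tinvs s) = tinvs (tmap f s).
Proof. by rewrite /tmap /tinvs map_rev -!map_comp; congr rev; apply: eq_map. Qed.
Lemma tmap_shift l v s : tshift (src0 l v) (tmap (src l) s) = tmap (src l) (tshift v s).
Proof. by rewrite /tshift /tmap -!map_comp; apply: eq_map => x /=; rewrite srcB. Qed.
Lemma tmap_cat f s s' : tmap f (s ++ s') = tmap f s ++ tmap f s'.
Proof. exact: map_cat. Qed.
Lemma tprod_cancel (s1 s2 : seq (vec * bool)) x : tprod (s1 ++ x :: tinv x :: s2) = tprod (s1 ++ s2).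
Proof. by rewrite !tprod_cat /= tconjV mulVKg. Qed.

(** If two neighbours cancel on one side, their parameters have the same image there and hence, by
    [src_eq], on the other side: both products shorten together. This is why [rule_iso] is a
    bijection. *)
Lemma tmap_not_reduced l s : ~~ treduced (tmap (src l) s) ->
  exists s', [/\ size s' < size s, tprod (tmap (src l) s') = tprod (tmap (src l) s)
    & tprod (tmap (src (linv l)) s') = tprod (tmap (src (linv l)) s)].
Proof.
move=> /not_treduced[s1 [x [s2 E]]].
have [s1' [r' [Es E1 E2]]] : exists s1' s2', [/\ s = s1' ++ s2', tmap (src l) s1' = s1
    & tmap (src l) s2' = x :: tinv x :: s2].
  exists (take (size s1) s), (drop (size s1) s); split; first by rewrite cat_take_drop.
    by rewrite /tmap map_take -/(tmap _ _) E take_size_cat.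
  by rewrite /tmap map_drop -/(tmap _ _) E drop_size_cat.
case: r' E2 Es => [//|y1 [//|y2 s2']] E2 Es.
have [Ey Eb] : src l y1.1 = src l y2.1 /\ y2.2 = ~~ y1.2 by case: E2 => <- [/= -> ->].
have c l' : src l' y1.1 = src l' y2.1 ->
    tprod (tmap (src l') (s1' ++ s2')) = tprod (tmap (src l') s).
  move=> El; rewrite Es !tmap_cat -[tmap _ (y1 :: y2 :: s2')]/(_ :: _ :: tmap _ s2') /=.
  by rewrite -El Eb -/(tinv (src l' y1.1, y1.2)) tprod_cancel.
exists (s1' ++ s2'); split; [by rewrite Es !size_cat /=; lia|exact: c|exact/c/src_eq].
Qed.

Lemma tmap_reduce l s : exists s', [/\ treduced (tmap (src l) s'),
    tprod (tmap (src l) s') = tprod (tmap (src l) s)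
    & tprod (tmap (src (linv l)) s') = tprod (tmap (src (linv l)) s)].
Proof.
elim: (size s) {-2}s (leqnn (size s)) => [|n IH] {}s hs;
  have [r|/tmap_not_reduced[s' [h E1 E2]]] := boolP (treduced (tmap (src l) s)); try by exists s.
  by move: (leq_trans h hs); rewrite ltn0.
have [|s1 [r F1 F2]] := IH s'; first by lia.
by exists s1; rewrite F1 F2.
Qed.

Lemma kval_src_eq1 l s v : kval (tmap (src l) s) (src0 l v) = 1 ->
  kval (tmap (src (linv l)) s) (src0 (linv l) v) = 1.
Proof.
move=> E; have [s' [r E1 E2]] := tmap_reduce l s.
move: E; rewrite /kval -E1 -E2 -!/(kval _ _) => E.
have [v0 [s0|]] := kval_eq1 E; last by rewrite r.
have -> : src0 (linv l) v = 0%R.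
  by rewrite -(src00 (linv l)); apply: src0_eq; rewrite src00.
by case: s' s0 {r E E1 E2} => //= _; rewrite kval0.
Qed.

Lemma rule_isoP l : partial_iso (rule_iso l).
Proof.
split.
- by exists [::], 0%R; rewrite !src00 /= kval0.
- move=> a b c d [s [v [-> ->]]] [s' [v' [-> ->]]].
  by exists (s ++ tshift v s'), (v + v')%R; rewrite !kvalM !tmap_shift !tmap_cat !src0D.
- move=> a b [s [v [-> ->]]]; exists (tshift (- v) (tinvs s))%R, (- v)%R.
  by rewrite !kvalV -!src0N -!tmap_tinvs !tmap_shift.
- by move=> a b [s [v [-> ->]]]; split=> /kval_src_eq1.
Qed.

Lemma rule_crosses (l : L * bool) k k' : crosses rule_iso l k k' <-> exists s v,
  k = kval (tmap (src l) s) (src0 l v) /\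
  k' = kval (tmap (src (linv l)) s) (src0 (linv l) v).
Proof. by case: l => l [] /=; split=> -[s [v [-> ->]]]; exists s, v. Qed.

(* Membership in an associated subgroup is read off the reduced form, letter by letter. *)
Lemma rule_dom (l : L * bool) s v : treduced s -> dom rule_iso l (kval s v) ->
  exists s' v', s = tmap (src l) s' /\ v = src0 l v'.
Proof.
move=> rs [k' /rule_crosses[s1 [v1 [E _]]]]; have [s' [r' E1 _]] := tmap_reduce l s1.
by move: E; rewrite {2}/kval -E1 => /(kval_inj rs r')[-> ->]; exists s', v1.
Qed.

Definition rgroup : groupType := hnn rule_iso.
Definition rbase (k : K) : rgroup := hbase rule_isoP k.
Definition rletter (l : L * bool) : rgroup := hletter rule_isoP l.
End Affine.
End RuleGroups.
Import RuleGroups.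

(** * Arithmetic with words for integer vectors *)

Module WordArithmetic.
Import GRing.Theory.

Definition relator (A : finType) (u v : word A) : word A := u ++ inv_word v.

Lemma size_nil T : size (@nil T) = 0. Proof. by []. Qed.
Lemma size_cons T (x : T) s : size (x :: s) = (size s).+1. Proof. by []. Qed.

Ltac sz := rewrite ?(size_cat, size_inv_word, size_nil, size_cons, size_nseq, size_map); lia.

Section DerExtra.
Variables (A : finType) (R : seq (word A)).
Implicit Types u v w a b : word A.
Notation der := (der R).

Lemma der_relE u v : relator u v \in R -> der (2 * (size u + size v)) u v.
Proof.
move=> h; apply: (@red_der _ _ (size u + size v)); last lia.
by apply: der_red; have := der_rel h; rewrite /relator size_cat size_inv_word.
Qed.

Lemma der_pass_inv s t a b w : der s (a ++ w) (w ++ b) ->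
  s + 2 * size a + 2 * size b <= t -> der t (inv_word a ++ w) (w ++ inv_word b).
Proof.
move=> h ht; have [ha hb] := der_size h; rewrite !size_cat in ha hb.
apply: (der_trans (b := inv_word a ++ (w ++ b) ++ inv_word b)).
  have d := der_sym (der_cancelw R (leqnn (2 * size b))).
  have := @der_in _ _ _ t _ _ (inv_word a ++ w) [::] d; rewrite !cats0 -!catA; apply.
  by sz.
apply: (der_trans (b := inv_word a ++ (a ++ w) ++ inv_word b)).
  by apply: der_in (der_sym h) _; rewrite !size_inv_word; lia.
have d := der_cancelVw R (leqnn (2 * size a)).
have := @der_in _ _ _ t _ _ [::] (w ++ inv_word b) d; rewrite cat0s -!catA; apply.
by sz.
Qed.

Lemma der_pass_cat s s' t a b c d w : der s (a ++ w) (w ++ c) -> der s' (b ++ w) (w ++ d) ->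
  s' + size a <= t -> s + size d <= t -> der t ((a ++ b) ++ w) (w ++ c ++ d).
Proof.
move=> h h' ht ht'; apply: (der_trans (b := (a ++ w) ++ d)).
  by rewrite -!catA; apply: der_catr h' _; lia.
by rewrite [w ++ _]catA; apply: der_catl h _; lia.
Qed.

(* If the words p n behave like powers of a and the words q n like powers of b,
   and if w conjugates b into a, then it conjugates q n into p n; the induction on
   n takes long but needs no space. *)
Lemma der_pass_pow s t (p q : nat -> word A) a b w m n :
  (forall n, n < m -> der s (p n ++ a) (p n.+1)) ->
  (forall n, n < m -> der s (q n ++ b) (q n.+1)) ->
  p 0 = [::] -> q 0 = [::] -> der s (a ++ w) (w ++ b) ->
  (forall n, n <= m -> size (p n) <= s) -> (forall n, n <= m -> size (q n) <= s) ->
  20 * s <= t -> n <= m -> der t (p n ++ w) (w ++ q n).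
Proof.
move=> hp hq p0 q0 h sp sq ht hn; have [] := der_size h; rewrite !size_cat => hw hb.
have hpn := sp _ hn; have hqn := sq _ hn.
(* The word [p k w (q k)^-1] stays equal to [w]: each turn of the loop moves one [a] across [w] as
   [b], which cancels. *)
suff H k : k <= m -> der (15 * s) (p k ++ w ++ inv_word (q k)) w.
  apply: (der_trans (b := (p n ++ w ++ inv_word (q n)) ++ q n)).
    have d := der_sym (der_cancelVw R (leqnn (2 * size (q n)))).
    have := @der_in _ _ _ t _ _ (p n ++ w) [::] d; rewrite !cats0 -!catA; apply.
    by sz.
  by apply: der_catl (H _ hn) _; lia.
elim: k => [_|k IH hk]; first by rewrite p0 q0 cats0 cat0s; apply: der_refl; lia.
have hk' := ltnW hk; have h1 := sp _ hk'; have h2 := sq _ hk'; have h3 := sq _ hk; have h4 := sp _ hk.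
apply: der_trans (IH hk').
apply: (der_trans (b := (p k ++ a) ++ w ++ inv_word (q k.+1))).
  by apply: der_catl (der_sym (hp _ hk)) _; rewrite size_cat size_inv_word; lia.
apply: (der_trans (b := (p k ++ a ++ w) ++ inv_word (q k ++ b))).
  rewrite catA -!catA [a ++ w ++ _]catA [p k ++ _]catA.
  have d : der (10 * s) (inv_word (q k.+1)) (inv_word (q k ++ b)).
    by apply: der_inv (der_sym (hq _ hk)) _; rewrite size_cat; lia.
  have := @der_catr _ _ _ (15 * s) _ _ (p k ++ a ++ w) d; rewrite -!catA; apply.
  by rewrite !size_cat; lia.
apply: (der_trans (b := (p k ++ w ++ b) ++ inv_word (q k ++ b))).
  rewrite -!catA [a ++ w ++ _]catA [w ++ b ++ _]catA; apply: der_in h _.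
  by rewrite !size_inv_word !size_cat; lia.
have := @der_in _ _ _ (15 * s) _ _ (p k ++ w) (inv_word (q k)) (der_cancelw R (leqnn (2 * size b))).
by rewrite inv_word_cat cat0s -!catA; apply; sz.
Qed.
End DerExtra.

Section VectorWords.
Variables (C L A : finType) (R : seq (word A)).
Notation vec := {ffun C -> int}.
Notation der := (der R).
Variables (gx : C -> A) (gt : A) (gl : L -> A) (dbl : C -> L).
Variables (ra rc : L -> vec) (rm rn : L -> C -> nat).

Notation pos a := ((a, false) : letter A).
Notation neg a := ((a, true) : letter A).

(** Horner's scheme in base 2: conjugation by the doubling letter of [i] doubles the exponent of
    [x_i], and an odd digit appends one [x_i]. The fuel [n] suffices for all halvings. *)
Fixpoint binw_rec (f : nat) (i : C) (n : nat) : word A :=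
  if f is f'.+1 then
    if n == 0 then [::]
    else neg (gl (dbl i)) :: binw_rec f' i n./2 ++ pos (gl (dbl i)) :: nseq (odd n) (pos (gx i))
  else [::].
Fact binw_key : unit. Proof. by []. Qed.
Definition binw := locked_with binw_key (fun i n => binw_rec n i n).
Lemma binw_unlock i n : binw i n = binw_rec n i n. Proof. by rewrite /binw unlock. Qed.
Definition intw i (z : int) : word A :=
  match z with Posz n => binw i n | Negz n => inv_word (binw i n.+1) end.
Definition vecw (v : vec) : word A := flatten [seq intw i (v i) | i <- enum C].
Definition conjw (g : vec) (e : bool) : word A := inv_word (vecw g) ++ (gt, e) :: vecw g.

Lemma binw0 i : binw i 0 = [::]. Proof. by rewrite binw_unlock. Qed.
Lemma binwE i n : 0 < n ->
  binw i n = neg (gl (dbl i)) :: binw i n./2 ++ pos (gl (dbl i)) :: nseq (odd n) (pos (gx i)).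
Proof.
have E f f' m : m <= f -> m <= f' -> binw_rec f i m = binw_rec f' i m.
  elim: f f' m => [|f IH] [|f'] m //=; try by rewrite leqn0 => /eqP->.
    by move=> _; rewrite leqn0 => /eqP->.
  by move=> h h'; case: eqP => // m0; rewrite (IH f') //; lia.
case: n => // n _; rewrite !binw_unlock /=; congr (_ :: _ ++ _).
by apply: E => //; lia.
Qed.

(** Each binary digit costs two stable letters and at most one [x_i]. *)
Lemma size_binw i n b : n < 2 ^ b -> size (binw i n) <= 3 * b.
Proof.
elim: b n => [|b IH] n; first by rewrite expn0; case: n => // _; rewrite binw0.
case: n => [_|n h]; first by rewrite binw0.
 rewrite binwE // size_cons size_cat size_cons size_nseq.
rewrite expnS in h; have := IH n.+1./2 ltac:(lia).
by have := leq_b1 (odd n.+1); lia.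
Qed.

Lemma intwN i n : intw i (- n%:Z)%R = inv_word (binw i n).
Proof. by case: n => //; rewrite oppr0 /= binw0. Qed.
Lemma size_intw i z b : `|z|%N < 2 ^ b -> size (intw i z) <= 3 * b.
Proof. by case: z => n h; rewrite /intw ?size_inv_word size_binw. Qed.
Variable (M b W : nat).
Hypotheses (rmM : forall l i, rm l i <= M) (rnM : forall l i, rn l i <= M).
Hypotheses (rm_dbl : forall i, rm (dbl i) i = 1) (rn_dbl : forall i, rn (dbl i) i = 2).
Hypothesis relX : forall i j, relator [:: pos (gx i); pos (gx j)] [:: pos (gx j); pos (gx i)] \in R.
Hypothesis relL : forall l i,
  relator (nseq (rm l i) (pos (gx i)) ++ [:: pos (gl l)]) (pos (gl l) :: nseq (rn l i) (pos (gx i))) \in R.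
Hypothesis relT : forall l,
  relator (conjw (ra l) false ++ [:: pos (gl l)]) (pos (gl l) :: conjw (rc l) false) \in R.
(** [W] bounds the words of numbers and of vectors with entries of [b] binary digits, and leaves
    room for the relators, whose length depends on [M]. *)
Hypothesis W1 : 3 * b + 20 + 8 * M <= W.
Hypothesis W2 : #|C| * (3 * b) <= W.

Definition small (v : vec) := forall i, `|v i|%N < 2 ^ b.

(** Addition with carry: behind a digit 1 the new letter yields [x_i^2], which crosses the doubling
    letter to the left as a single [x_i], one digit higher, where the induction continues. *)
Lemma binw_succ i n : n.+1 < 2 ^ b -> der W (binw i n ++ [:: pos (gx i)]) (binw i n.+1).
Proof.
suff H b' : n.+1 < 2 ^ b' -> der (3 * b' + 20) (binw i n ++ [:: pos (gx i)]) (binw i n.+1).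
  by move=> /H; apply: der_mono; lia.
have dl := der_relE (relL (dbl i) i); rewrite rm_dbl rn_dbl in dl.
elim: b' n => [|b' IH] n; first by rewrite expn0.
case: n => [|n] h.
  rewrite [binw i 1]binwE // !binw0; apply: der_sym.
  have d := der_cancel R (neg (gl (dbl i))).
  by apply: (@der_in _ _ _ _ _ _ [::] [:: pos (gx i)] d); sz.
have [odn|evn] := boolP (odd n.+1); last first.
  have E : n.+2./2 = n.+1./2 by lia.
  have <- : binw i n.+1 ++ [:: pos (gx i)] = binw i n.+2.
    rewrite [binw i n.+2]binwE // [binw i n.+1]binwE // E /= -/(odd n.+1) (negbTE evn) /=.
    by rewrite -catA.
  by apply: der_refl; have := size_binw i (ltnW h); sz.
have E : n.+2./2 = n.+1./2.+1 by lia.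
have hh : n.+1./2.+1 < 2 ^ b' by move: h; rewrite expnS; lia.
have sb := size_binw i hh; have sb' := size_binw i (ltnW hh).
rewrite [binw i n.+2]binwE // E [odd n.+2]/= -/(odd n.+1) odn [binw i n.+1]binwE // odn /=.
set m := n.+1./2 in E hh sb sb' *.
apply: (der_trans (b := [:: neg (gl (dbl i))] ++ (binw i m ++ [:: pos (gx i)]) ++ [:: pos (gl (dbl i))])).
  have d : der 12 [:: pos (gl (dbl i)); pos (gx i); pos (gx i)] [:: pos (gx i); pos (gl (dbl i))].
    exact: der_mono (der_sym dl).
  have := @der_catr _ _ _ (3 * b'.+1 + 20) _ _ (neg (gl (dbl i)) :: binw i m) d ltac:(sz).
  by rewrite /= -!catA.
by apply: der_in (IH _ hh) _; sz.
Qed.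
Lemma binwW i n : n < 2 ^ b -> size (binw i n) <= W.
Proof. by move/(size_binw i); lia. Qed.
Lemma intwW i z : `|z|%N < 2 ^ b -> size (intw i z) <= W.
Proof. by move/(size_intw i); lia. Qed.

Lemma binw_addn i n k : n + k < 2 ^ b -> der (W + k) (binw i n ++ nseq k (pos (gx i))) (binw i (n + k)).
Proof.
elim: k n => [|k IH] n h.
  rewrite addn0 in h *; rewrite [nseq 0 _]/= cats0 addn0; apply: der_refl; exact: binwW.
have h' : n.+1 + k < 2 ^ b by lia.
have E : n.+1 + k = n + k.+1 by lia.
rewrite -E; apply: (der_trans (b := binw i n.+1 ++ nseq k (pos (gx i)))).
  rewrite -[nseq k.+1 _]cat1s catA; apply: der_catl (binw_succ _ _) _; first lia.
  by sz.
by apply: der_mono (IH _ h'); lia.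
Qed.

Lemma binw_pass S w i j k k' n : 2 * W <= S -> k <= M -> k' <= M ->
  k * n < 2 ^ b -> k' * n < 2 ^ b ->
  der S (nseq k (pos (gx i)) ++ w) (w ++ nseq k' (pos (gx j))) ->
  der (20 * S) (binw i (k * n) ++ w) (w ++ binw j (k' * n)).
Proof.
move=> hS hk hk' h h' d.
have B l m m' : m' <= n -> l * n < 2 ^ b -> m <= m' -> l * m < 2 ^ b by nia.
apply: (der_pass_pow (s := S) (a := nseq k (pos (gx i))) (b := nseq k' (pos (gx j))) (m := n)
  (p := fun n => binw i (k * n)) (q := fun n => binw j (k' * n))) => //.
- move=> m hm; rewrite mulnS addnC; apply: der_mono (binw_addn _ _); first lia.
  by have := B k _ _ hm h (leqnn _); lia.
- move=> m hm; rewrite mulnS addnC; apply: der_mono (binw_addn _ _); first lia.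
  by have := B k' _ _ hm h' (leqnn _); lia.
- by rewrite muln0 binw0.
- by rewrite muln0 binw0.
- by move=> m hm; have := binwW i (B k _ _ hm h (leqnn _)); lia.
- by move=> m hm; have := binwW j (B k' _ _ hm h' (leqnn _)); lia.
Qed.

Lemma intw_pass S w i j k k' (z : int) : 2 * W <= S -> k <= M -> k' <= M ->
  k * `|z| < 2 ^ b -> k' * `|z| < 2 ^ b ->
  der S (nseq k (pos (gx i)) ++ w) (w ++ nseq k' (pos (gx j))) ->
  der (25 * S) (intw i (k%:Z * z)%R ++ w) (w ++ intw j (k'%:Z * z)%R).
Proof.
move=> hS hk hk' h h' d; have := binw_pass hS hk hk' h h' d.
have h1 := binwW i h; have h2 := binwW j h'.
case: z h h' h1 h2 => n h h' h1 h2 /= d'; rewrite ?NegzE ?mulrN -?PoszM ?intwN.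
  by apply: der_mono d'; lia.
by apply: der_pass_inv d' _; rewrite /= in h1 h2 *; lia.
Qed.

Lemma intw_comm1 i j (z : int) : 1 <= M -> `|z|%N < 2 ^ b ->
  der (50 * W) (intw j z ++ [:: pos (gx i)]) ([:: pos (gx i)] ++ intw j z).
Proof.
move=> M1 h; have := @intw_pass (2 * W) [:: pos (gx i)] j j 1 1 z (leqnn _) M1 M1.
rewrite !mul1n mul1r => /(_ h h) H; apply: der_mono (H _); first lia.
by apply: der_mono (der_relE (relX j i)); sz.
Qed.

Lemma intw_comm i j (z z' : int) : 1 <= M -> `|z|%N < 2 ^ b -> `|z'|%N < 2 ^ b ->
  der (1250 * W) (intw i z ++ intw j z') (intw j z' ++ intw i z).
Proof.
move=> M1 h h'; have := @intw_pass (50 * W) (intw j z') i i 1 1 z _ M1 M1.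
rewrite !mul1n mul1r => /(_ _ h h) H; apply: der_mono (H _ _); try lia.
exact/der_sym/intw_comm1.
Qed.

Lemma intw_succ i (z : int) : 1 <= M -> `|z|%N < 2 ^ b -> `|(z + 1)%R|%N < 2 ^ b ->
  der (80 * W) (intw i z ++ [:: pos (gx i)]) (intw i (z + 1)%R).
Proof.
move=> M1; case: z => n h h'.
  have -> : (n%:Z + 1)%R = n.+1 by lia.
  by apply: der_mono (binw_succ _ _); [lia|move: h'; lia].
have -> : (Negz n + 1)%R = (- n%:Z)%R by lia.
rewrite intwN /=; have h1 : n.+1 < 2 ^ b by move: h; lia.
have s1 := binwW i h1; have s2 := binwW i (ltnW h1).
(* For a negative number the successor removes a letter: [x^-(n+1)] is rewritten as [x^-n x^-1],
   which uses that [x] commutes with the word of [x^n]. *)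
have d : der (60 * W) (inv_word (binw i n.+1)) (inv_word ([:: pos (gx i)] ++ binw i n)).
  apply: (@der_inv _ _ (52 * W)); last by sz.
  apply: (der_trans (b := binw i n ++ [:: pos (gx i)])).
    by apply: der_sym; apply: der_mono (binw_succ _ h1); lia.
  by apply: der_mono (@intw_comm1 i i n%:Z M1 _); [lia|exact: ltnW].
apply: (der_trans (b := inv_word ([:: pos (gx i)] ++ binw i n) ++ [:: pos (gx i)])).
  by apply: der_catl d _; sz.
rewrite inv_word_cat -catA -[X in der _ _ X]cats0.
by apply: der_catr (der_cancel R (neg (gx i))) _; sz.
Qed.

(** The summand [n] is transferred one unit at a time. This may take exponentially many steps in the
    number of digits, but every intermediate word has length [O(W)]. *)
Lemma intw_addn i (z : int) n : 1 <= M -> `|z|%N < 2 ^ b -> `|(z + n%:Z)%R|%N < 2 ^ b -> n < 2 ^ b ->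
  der (110 * W) (intw i (z + n%:Z)%R ++ inv_word (binw i n)) (intw i z).
Proof.
move=> M1 hz; elim: n => [|n IH] h hn.
  by rewrite addr0 binw0 cats0; apply: der_refl; have := intwW i hz; lia.
have h1 : `|(z + n%:Z)%R|%N < 2 ^ b by lia.
have s1 := binwW i hn; have s2 := binwW i (ltnW hn); have s3 := intwW i h1; have s4 := intwW i h.
have E : (z + n.+1%:Z = (z + n%:Z) + 1)%R by lia.
apply: der_trans (IH h1 (ltnW hn)).
apply: (der_trans (b := (intw i (z + n%:Z)%R ++ [:: pos (gx i)]) ++ inv_word (binw i n.+1))).
  have d := @intw_succ i (z + n%:Z)%R M1 h1; rewrite -E in d.
  by apply: der_catl (der_sym (d h)) _; sz.
apply: (der_trans (b := (intw i (z + n%:Z)%R ++ [:: pos (gx i)]) ++ inv_word (binw i n ++ [:: pos (gx i)]))).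
  apply: der_catr; last first.
    by rewrite size_cat; instantiate (1 := 100 * W); sz.
  apply: (@der_inv _ _ (1 * W)); last by sz.
  by apply: der_sym; rewrite mul1n; exact: binw_succ.
rewrite inv_word_cat -!catA; apply: der_catr; last by instantiate (1 := 100 * W); sz.
exact: (@der_catl _ _ 2 (100 * W) _ [::] (inv_word (binw i n)) (der_cancel R (pos (gx i))) ltac:(sz)).
Qed.

Lemma intw_add i (z z' : int) : 1 <= M -> `|z|%N < 2 ^ b -> `|z'|%N < 2 ^ b -> `|(z + z')%R|%N < 2 ^ b ->
  der (120 * W) (intw i z ++ intw i z') (intw i (z + z')%R).
Proof.
move=> M1 h; case: z' => n h' hh.
  have s1 : size (binw i n) <= W := binwW i h'.
  have s2 := intwW i h; have s3 := intwW i hh.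
  rewrite [intw i (Posz n)]/=.
  apply: (der_trans (b := (intw i (z + n%:Z)%R ++ inv_word (binw i n)) ++ binw i n)).
    by apply: der_catl (der_sym (intw_addn i M1 h hh h')) _; sz.
  rewrite -catA -[X in der _ _ X]cats0; apply: der_catr (der_cancelVw R (leqnn (2 * size (binw i n)))) _.
  by sz.
have E : (z + Negz n + n.+1%:Z)%R = z by lia.
have := @intw_addn i (z + Negz n)%R n.+1 M1 hh; rewrite E => /(_ h h').
by apply: der_mono; lia.
Qed.

Section VectorArith.
Hypothesis M1 : 1 <= M.

Definition lvecw (r : seq C) (v : vec) : word A := flatten [seq intw i (v i) | i <- r].

Lemma lvecw_cons i r v : lvecw (i :: r) v = intw i (v i) ++ lvecw r v.
Proof. by []. Qed.

Lemma size_lvecw r v : small v -> size (lvecw r v) <= size r * (3 * b).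
Proof.
move=> sv; elim: r => [//|i r IH]; rewrite /lvecw /= size_cat mulSn leq_add //.
exact: size_intw.
Qed.

Lemma vecwW v : small v -> size (vecw v) <= W.
Proof. by move=> /(size_lvecw (enum C)); rewrite -cardE => h; apply: leq_trans h W2. Qed.

Lemma lvecw_pass S r (f g : vec) w : (forall i, der S (intw i (f i) ++ w) (w ++ intw i (g i))) -> size w <= S ->
  der (S + size (lvecw r f) + size (lvecw r g)) (lvecw r f ++ w) (w ++ lvecw r g).
Proof.
move=> h hw; elim: r => [|i r IH]; first by rewrite /lvecw /= cats0; apply: der_refl; rewrite !addn0.
apply: (der_pass_cat (h i) IH); rewrite !lvecw_cons; sz.
Qed.

Lemma vecw_pass S (f g : vec) w : small f -> small g ->
  (forall i, der S (intw i (f i) ++ w) (w ++ intw i (g i))) -> size w <= S ->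
  der (S + 2 * W) (vecw f ++ w) (w ++ vecw g).
Proof.
move=> sf sg h hw; apply: der_mono (lvecw_pass (enum C) h hw).
by have := vecwW sf; have := vecwW sg; rewrite /vecw /lvecw; lia.
Qed.

Lemma lvecw_add r v w : small v -> small w -> small (v + w)%R ->
  der (1300 * W + size r * (9 * b)) (lvecw r v ++ lvecw r w) (lvecw r (v + w)%R).
Proof.
move=> sv sw svw; elim: r => [|i r IH]; first by apply: der_refl.
have E u : lvecw (i :: r) u = intw i (u i) ++ lvecw r u by [].
have n1 := size_intw i (sv i); have n2 := size_intw i (sw i); have n3 := size_intw i (svw i).
have m1 := size_lvecw r sv; have m2 := size_lvecw r sw; have m3 := size_lvecw r svw.
rewrite !E size_cons.
have p : der (1250 * W + size (lvecw r v) + size (lvecw r v))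
    (lvecw r v ++ intw i (w i)) (intw i (w i) ++ lvecw r v).
  apply: lvecw_pass; last by have := intwW i (sw i); lia.
  by move=> j; apply: intw_comm.
apply: (der_trans (b := intw i (v i) ++ (intw i (w i) ++ lvecw r v) ++ lvecw r w)).
  by rewrite -!catA (catA (lvecw r v) (intw i (w i))) (catA (intw i (w i)) (lvecw r v)); apply: der_in p _; nia.
have sa : `|(v i + w i)%R|%N < 2 ^ b by have := svw i; rewrite ffunE.
apply: (der_trans (b := intw i (v i + w i)%R ++ (lvecw r v ++ lvecw r w))).
  rewrite -!catA (catA (intw i (v i)) (intw i (w i))); apply: der_catl (intw_add i M1 (sv i) (sw i) sa) _.
  by rewrite size_cat; nia.
have -> : intw i ((v + w)%R i) = intw i (v i + w i)%R by rewrite ffunE.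
by apply: der_catr IH _; have := size_intw i sa; nia.
Qed.

Lemma vecw_add v w : small v -> small w -> small (v + w)%R ->
  der (1303 * W) (vecw v ++ vecw w) (vecw (v + w)%R).
Proof.
move=> sv sw svw; have := lvecw_add (enum C) sv sw svw; apply: der_mono.
by have h : size (enum C) * (3 * b) <= W; [rewrite -cardE|lia].
Qed.

Lemma vecw0 : vecw 0%R = [::].
Proof.
rewrite /vecw; elim: (enum C) => [//|i r /= ->].
by rewrite ffunE /= binw0.
Qed.

Lemma vecwN v : small v -> der (1320 * W) (inv_word (vecw v)) (vecw (- v)%R).
Proof.
move=> sv; have sn : small (- v)%R by move=> i; rewrite ffunE abszN.
have s0 : small 0%R by move=> i; rewrite ffunE expn_gt0.
have w1 := vecwW sv; have w2 := vecwW sn.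
apply: (der_trans (b := inv_word (vecw v) ++ vecw v ++ vecw (- v)%R)).
  have := @vecw_add v (- v)%R sv sn; rewrite subrr vecw0 => /(_ s0) d.
  by rewrite -[X in der _ X _]cats0; apply: der_catr (der_sym d) _; sz.
by rewrite catA; apply: (@der_catl _ _ (2 * size (vecw v)) _ _ [::]); [exact: der_cancelVw|lia].
Qed.

Lemma size_conjw g e : small g -> size (conjw g e) <= 2 * W + 1.
Proof. by move=> /vecwW h; rewrite /conjw; sz. Qed.
Lemma conjwN g e : inv_word (conjw g e) = conjw g (~~ e).
Proof. by rewrite /conjw inv_word_cat inv_word_cons inv_wordK -catA. Qed.

Lemma vecw_conjw v g e : small v -> small g -> small (g - v)%R ->
  der (1400 * W) (vecw v ++ conjw g e) (conjw (g - v)%R e ++ vecw v).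
Proof.
move=> sv sg sgv; have w1 := vecwW sv; have w2 := vecwW sg; have w3 := vecwW sgv.
have d : der (1303 * W) (vecw (g - v)%R ++ vecw v) (vecw g).
  by have := vecw_add sgv sv; rewrite subrK; apply.
have di : der (1320 * W) (inv_word (vecw g)) (inv_word (vecw v) ++ inv_word (vecw (g - v)%R)).
  by rewrite -inv_word_cat; apply: der_inv (der_sym d) _; sz.
rewrite /conjw -catA -cat1s -(cat1s (gt, e) (vecw (g - v)%R)) -!catA.
apply: (der_trans (b := vecw v ++ (inv_word (vecw v) ++ inv_word (vecw (g - v)%R)) ++ [:: (gt, e)] ++ vecw g)).
  by apply: der_in di _; sz.
apply: (der_trans (b := inv_word (vecw (g - v)%R) ++ [:: (gt, e)] ++ vecw g)).
  rewrite -catA catA; apply: (@der_catl _ _ (2 * size (vecw v)) _ _ [::]); first exact: der_cancelw.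
  by sz.
have := @der_catr _ _ _ (1400 * W) _ _ (inv_word (vecw (g - v)%R) ++ [:: (gt, e)]) (der_sym d) ltac:(sz).
by rewrite -!catA.
Qed.

Definition stw (l : L * bool) : word A := [:: (gl l.1, l.2)].

Lemma der_pass_letter s t a a' l : der s (a ++ [:: pos (gl l)]) ([:: pos (gl l)] ++ a') ->
  s + 4 <= t -> der t (a' ++ [:: neg (gl l)]) ([:: neg (gl l)] ++ a).
Proof.
move=> d ht; have [] := der_size d; rewrite !size_cat => h1 h2.
apply: (der_trans (b := [:: neg (gl l)] ++ ([:: pos (gl l)] ++ a') ++ [:: neg (gl l)])).
  have c := der_sym (der_cancel R (neg (gl l))).
  have := @der_catl _ _ 2 t _ _ (a' ++ [:: neg (gl l)]) c; rewrite cat0s -!catA; apply.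
  by move: h2; sz.
apply: (der_trans (b := [:: neg (gl l)] ++ (a ++ [:: pos (gl l)]) ++ [:: neg (gl l)])).
  by apply: der_in (der_sym d) _; sz.
have := @der_catr _ _ _ t _ _ ([:: neg (gl l)] ++ a) (der_cancel R (pos (gl l))) ltac:(sz).
by rewrite cats0 -!catA.
Qed.

Lemma vecw_letter (l : L * bool) v : small (src0 rm rn l v) -> small (src0 rm rn (linv l) v) ->
  der (60 * W) (vecw (src0 rm rn l v) ++ stw l) (stw l ++ vecw (src0 rm rn (linv l) v)).
Proof.
suff H k : small (src0 rm rn (k, false) v) -> small (src0 rm rn (k, true) v) ->
    der (55 * W) (vecw (src0 rm rn (k, false) v) ++ [:: pos (gl k)])
      ([:: pos (gl k)] ++ vecw (src0 rm rn (k, true) v)).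
  case: l => k [] h h'; last by apply: der_mono (H k h h'); lia.
  by apply: der_pass_letter (H k h' h) _; lia.
move=> h h'; apply: der_mono (vecw_pass (S := 25 * (2 * W)) h h' _ _); [lia| |by sz].
have h1 i : rm k i * `|v i| < 2 ^ b by have := h i; rewrite ffunE abszM.
have h2 i : rn k i * `|v i| < 2 ^ b by have := h' i; rewrite ffunE abszM.
move=> i; rewrite !ffunE; apply: intw_pass => //.
apply: der_mono (der_relE (relL k i)).
by have := rmM k i; have := rnM k i; sz.
Qed.

(** The index is split as [a + mu z]: the relator of [relT] moves [t^a] across the letter, and
    [vecw_letter] moves the conjugating vector [mu z]. *)
Lemma conjw_letter (l : L * bool) z e :
  small (ra l.1) -> small (rc l.1) -> small (src0 rm rn l z) -> small (src0 rm rn (linv l) z) ->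
  small (src ra rc rm rn l z) -> small (src ra rc rm rn (linv l) z) ->
  der (1500 * W) (conjw (src ra rc rm rn l z) e ++ stw l) (stw l ++ conjw (src ra rc rm rn (linv l) z) e).
Proof.
suff H k : small (ra k) -> small (rc k) ->
    small (src0 rm rn (k, false) z) -> small (src0 rm rn (k, true) z) ->
    small (src ra rc rm rn (k, false) z) -> small (src ra rc rm rn (k, true) z) ->
    der (1450 * W) (conjw (src ra rc rm rn (k, false) z) false ++ [:: pos (gl k)])
      ([:: pos (gl k)] ++ conjw (src ra rc rm rn (k, true) z) false).
  case: l => k [] ha hc h0 h0' h h'.
    have d := der_pass_letter (H k ha hc h0' h0 h' h) (leqnn _).
    have n1 := size_conjw false h; have n2 : size (conjw (src ra rc rm rn (k, false) z) false) <= _ := size_conjw false h'.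
    by case: e; [rewrite -!(conjwN _ false); apply: der_pass_inv d _|apply: der_mono d]; lia.
  have d := H k ha hc h0 h0' h h'.
  have n1 := size_conjw false h; have n2 : size (conjw (src ra rc rm rn (k, true) z) false) <= _ := size_conjw false h'.
  by case: e; [rewrite -!(conjwN _ false); apply: der_pass_inv d _|apply: der_mono d]; lia.
move=> ha hc h0 h0' h h'.
set u := src0 _ _ _ _ in h0 *; set u' := src0 _ _ _ _ in h0' *.
have E : src ra rc rm rn (k, false) z = (ra k + u)%R by [].
have E' : src ra rc rm rn (k, true) z = (rc k + u')%R by [].
rewrite E E' in h h' *; have t' : der (60 * W) (vecw u ++ [:: pos (gl k)]) ([:: pos (gl k)] ++ vecw u') :=
  vecw_letter (l := (k, false)) h0 h0'.
have wa := vecwW ha; have wc := vecwW hc; have w0 := vecwW h0; have w0' := vecwW h0'.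
have w := vecwW h; have w' := vecwW h'.
have e1 (x y : vec) e0 : small x -> small y -> small (x + y)%R ->
    der (1400 * W) (conjw (x + y)%R e0) (inv_word (vecw y) ++ conjw x e0 ++ vecw y).
  move=> sx sy sxy; have n1 := vecwW sx; have n2 := vecwW sy; have n3 := vecwW sxy.
  have d := der_sym (vecw_add sx sy sxy).
  apply: (der_trans (b := inv_word (vecw (x + y)%R) ++ [:: (gt, e0)] ++ (vecw x ++ vecw y))).
    have := @der_catr _ _ _ (1400 * W) _ _ (inv_word (vecw (x + y)%R) ++ [:: (gt, e0)]) d ltac:(sz).
    by rewrite -!catA.
  have di : der (1320 * W) (inv_word (vecw (x + y)%R)) (inv_word (vecw y) ++ inv_word (vecw x)).
    by rewrite -inv_word_cat; apply: der_inv d _; sz.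
  have := @der_catl _ _ _ (1400 * W) _ _ ([:: (gt, e0)] ++ vecw x ++ vecw y) di ltac:(sz).
  by rewrite /conjw -!catA.
apply: (der_trans (b := (inv_word (vecw u) ++ conjw (ra k) false ++ vecw u) ++ [:: pos (gl k)])).
  by apply: der_catl (e1 _ _ _ ha h0 h) _; sz.
apply: (der_trans (b := (inv_word (vecw u) ++ conjw (ra k) false) ++ [:: pos (gl k)] ++ vecw u')).
  have := @der_catr _ _ _ (1450 * W) _ _ (inv_word (vecw u) ++ conjw (ra k) false) t'.
  by rewrite -!catA; apply; have := size_conjw false ha; sz.
have n1 := size_conjw false ha; have n2 := size_conjw false hc.
apply: (der_trans (b := inv_word (vecw u) ++ ([:: pos (gl k)] ++ conjw (rc k) false) ++ vecw u')).
  have d0 : der (10 * W) (conjw (ra k) false ++ [:: pos (gl k)]) ([:: pos (gl k)] ++ conjw (rc k) false).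
    by apply: der_mono (der_relE (relT k)); sz.
  have := @der_in _ _ _ (1450 * W) _ _ (inv_word (vecw u)) (vecw u') d0 ltac:(sz).
  by rewrite -!catA.
apply: (der_trans (b := ([:: pos (gl k)] ++ inv_word (vecw u')) ++ conjw (rc k) false ++ vecw u')).
  have ti : der (65 * W) (inv_word (vecw u) ++ [:: pos (gl k)]) ([:: pos (gl k)] ++ inv_word (vecw u')).
    by apply: der_pass_inv t' _; lia.
  have := @der_catl _ _ _ (1450 * W) _ _ (conjw (rc k) false ++ vecw u') ti ltac:(sz).
  by rewrite -!catA.
by rewrite -catA; apply: der_catr (der_sym (e1 _ _ _ hc h0' h')) _; sz.
Qed.
End VectorArith.
End VectorWords.
End WordArithmetic.
Import WordArithmetic.

(** * The homomorphism psi on reachable configurations and marked instructions *)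

Module MarkedLetters.
Import GRing.Theory.
Local Open Scope group_scope.

Section Sequences.
Variables (P : groupType) (J : eqType) (I : J -> P -> P -> Prop).
Hypothesis HI : forall j, partial_iso (I j).
Variables (B : Type) (f : B -> P) (op : B -> B -> B).
Hypothesis fM : forall x y, f (op x y) = f x * f y.

Definition fmap (s : seq (B * (J * bool))) := [seq (f x.1, x.2) | x <- s].
Definition hv s k := hval HI (fmap s) (f k).
Fixpoint hpre (s : seq (B * (J * bool))) : hnn I :=
  if s is x :: s' then hbase HI (f x.1) * hletter HI x.2 * hpre s' else 1.

Definition lmul x (s : seq (B * (J * bool))) k :=
  if s is (y, l) :: s' then ((op x y, l) :: s', k) else ([::], op x k).

Lemma hv_cons x l s k : hv ((x, l) :: s) k = hbase HI (f x) * hletter HI l * hv s k.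
Proof. by []. Qed.
Lemma hv_cat s s' k : hv (s ++ s') k = hpre s * hv s' k.
Proof. by elim: s => [|[x l] s IH]; rewrite ?mul1g // cat_cons hv_cons IH /= !mulgA. Qed.
Lemma hv_lmul x s k : hv (lmul x s k).1 (lmul x s k).2 = hbase HI (f x) * hv s k.
Proof.
case: s => [|[y l] s]; first by rewrite /hv /= fM hbaseM.
by rewrite !hv_cons fM hbaseM !mulgA.
Qed.

Lemma hv_pinch s : ~ pinchfree I (fmap s) -> exists s1 b1 l b2 s2,
  s = s1 ++ (b1, l) :: (b2, linv l) :: s2 /\ dom I (linv l) (f b2).
Proof.
case/not_pinchfree=> s1 [c [l [c' [s2 [E d]]]]].
move: E; rewrite /fmap => E.
have E1 : [seq (f x.1, x.2) | x <- take (size s1) s] = s1 by rewrite map_take E take_size_cat.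
have E2 : [seq (f x.1, x.2) | x <- drop (size s1) s] = (c, l) :: (c', linv l) :: s2.
  by rewrite map_drop E drop_size_cat.
case: (drop _ s) E2 (cat_take_drop (size s1) s) => [//|[b1 l1] [//|[b2 l2] s3]] /= [_ hl hb hl2 _] Es; subst l1 l2 c'.
exists (take (size s1) s), b1, l, b2, s3; split; [exact: esym Es|exact: d].
Qed.
End Sequences.

Section Marked.
Variables (C L : finType).
Notation vec := {ffun C -> int}.
Variables (ra rc : L -> vec) (rm rn : L -> C -> nat).
Hypothesis rmn : forall l i, (rm l i == 0%N) = (rn l i == 0%N).
Notation src := (src ra rc rm rn).
Notation src0 := (src0 rm rn).
Notation iso := (@rule_isoP C L ra rc rm rn rmn).
Notation rgroup := (rgroup ra rc rm rn).
Notation rbase := (hbase iso).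
Notation rletter := (hletter iso).
Variable ml : pred L.

Definition move (l : L * bool) (g g' : vec) : Prop := exists z, g = src l z /\ g' = src (linv l) z.
(** The orbit of 0 under the marked letters in both directions, since [l] ranges over the letters
    and their inverses. *)
Inductive reach : vec -> Prop :=
| Reach0 : reach 0%R
| ReachS l g g' : ml l.1 -> reach g -> move l g g' -> reach g'.

Lemma move_sym l g g' : move l g g' -> move (linv l) g' g.
Proof. by case=> z [-> ->]; exists z; rewrite linvK. Qed.

Variables (Q : groupType) (psit : vec -> Q) (psil : L -> Q).
Definition psilet (l : L * bool) : Q := if l.2 then (psil l.1)^-1 else psil l.1.
(** The images have to respect the conjugations of [t^g] by marked letters, as far as reachable
    vectors are concerned. *)
Hypothesis psit_move : forall l g g', ml l.1 -> reach g -> move l g g' ->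
  psit g' = (psilet l)^-1 * psit g * psilet l.

Definition okt (s : seq (vec * bool)) := forall x, x \in s -> reach x.1.
Definition psix (x : vec * bool) : Q := if x.2 then (psit x.1)^-1 else psit x.1.
Fixpoint psiprod (s : seq (vec * bool)) : Q := if s is x :: s' then psix x * psiprod s' else 1.

Notation dseq := (seq (seq (vec * bool) * (L * bool))).
(** Under [okd], the pair [ds], [dt] spells an element of the subgroup generated by the reachable
    [t^g] and the marked letters; [dv] is its value in the HNN extension, and [psiv] its intended
    image. *)
Definition dv (ds : dseq) dt : rgroup := hv iso (@tprod vec) ds dt.
Fixpoint psiv (ds : dseq) dt : Q :=
  if ds is (s, l) :: ds' then psiprod s * psilet l * psiv ds' dt else psiprod dt.
Definition okd (ds : dseq) dt := okt dt /\ forall x, x \in ds -> ml x.2.1 /\ okt x.1.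

Lemma psiprod_cat s s' : psiprod (s ++ s') = psiprod s * psiprod s'.
Proof. by elim: s => [|x s IH] /=; rewrite ?mul1g // IH mulgA. Qed.
Lemma psilet_linv l : psilet (linv l) = (psilet l)^-1.
Proof. by case: l => l [] //=; rewrite /psilet /= invgK. Qed.
Lemma psix_tinv x : psix (tinv x) = (psix x)^-1.
Proof. by case: x => g [] //=; rewrite /psix /= invgK. Qed.
Lemma okt_cat s s' : okt (s ++ s') <-> okt s /\ okt s'.
Proof.
split=> [h|[h h'] x]; last by rewrite mem_cat => /orP[/h|/h'].
by split=> x xs; apply: h; rewrite mem_cat xs ?orbT.
Qed.
Lemma okd_cons s l ds dt : okd ((s, l) :: ds) dt <-> [/\ ml l.1, okt s & okd ds dt].
Proof.
split=> [[h h']|[h1 h2 [h3 h4]]].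
  have [h1 h2] := h' _ (mem_head _ _); split=> //; split=> // x xs.
  by apply: h'; rewrite inE xs orbT.
by split=> // x; rewrite inE => /predU1P[->|/h4].
Qed.
Lemma okd_cat ds ds' dt : okd (ds ++ ds') dt <-> (forall x, x \in ds -> ml x.2.1 /\ okt x.1) /\ okd ds' dt.
Proof.
split=> [[h h']|[h [h1 h2]]]; last by split=> // x; rewrite mem_cat => /orP[/h|/h2].
by split; [|split=> //] => x xs; apply: h'; rewrite mem_cat xs ?orbT.
Qed.

Lemma tfree s : exists s', [/\ treduced s', tprod s' = tprod s, psiprod s' = psiprod s,
  {subset s' <= s} & size s' <= size s].
Proof.
elim: (size s) {-2}s (leqnn (size s)) => [|n IH] {}s hs;
  (have [r|/not_treduced[s1 [x [s2 E]]]] := boolP (treduced s); first by exists s; split).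
  by rewrite E size_cat /= addnS in hs.
have [|s' [h1 h2 h3 h4 h5]] := IH (s1 ++ s2); first by rewrite E !size_cat /= in hs *; lia.
exists s'; split=> //.
- by rewrite h2 E tprod_cancel.
- by rewrite h3 E !psiprod_cat /= psix_tinv mulVKg.
- by move=> z /h4; rewrite E !mem_cat !inE => /orP[->//|->]; rewrite !orbT.
- by apply: leq_trans h5 _; rewrite E !size_cat /=; lia.
Qed.

Lemma tprod_eq1 s : tprod s = 1 -> psiprod s = 1.
Proof.
have [s' [r <- <- _ _]] := tfree s => E.
by have [|] := @kval_inj _ s' 0%R [::] 0%R r isT; rewrite /kval ?E // => ->.
Qed.

(* Crossing a marked letter keeps the psi-value consistent. *)
Lemma psi_cross l z : ml l.1 -> okt (tmap (src l) z) ->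
  okt (tmap (src (linv l)) z) /\
  psilet (linv l) * psiprod (tmap (src l) z) * psilet l = psiprod (tmap (src (linv l)) z).
Proof.
move=> ml1; rewrite psilet_linv; elim: z => [|[g e] z IH] h /=.
  by rewrite mulg1 mulVg.
have hg : reach (src l g) by apply: (h (src l g, e)); rewrite mem_head.
have mv : move l (src l g) (src (linv l) g) by exists g.
have [|ok E] := IH; first by move=> x xs; apply: h; rewrite inE xs orbT.
split.
  by move=> x; rewrite inE => /predU1P[->|/ok//]; apply: ReachS ml1 hg mv.
have -> : psix (src (linv l) g, e) = (psilet l)^-1 * psix (src l g, e) * psilet l.
  by rewrite /psix /= (psit_move ml1 hg mv); case: e {h}; rewrite // !invgM invgK mulgA.
by rewrite -E !mulgA mulgK.
Qed.

(** The inner product of a pinch has vector part 0, so crossing the letter merely moves the index of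
    each [t^g] along a marked rule. The indices stay reachable, and [psi_cross] preserves the
    image. *)
Lemma dpinch ds dt : okd ds dt -> ~ pinchfree (rule_iso ra rc rm rn) (fmap (@tprod vec) ds) ->
  exists ds' dt', [/\ okd ds' dt', size ds' < size ds, dv ds' dt' = dv ds dt & psiv ds' dt' = psiv ds dt].
Proof.
move=> ok np; have [s1 [b1 [l [b2 [s2 [E d]]]]]] := hv_pinch np.
move: ok; rewrite E => /okd_cat[ok1 /okd_cons[ml1 okb1 /okd_cons[_ okb2 ok2]]].
have [t [r Et Ep sub _]] := tfree b2.
have [z [v [Ez v0]]] : exists z v, t = tmap (src (linv l)) z /\ 0%R = src0 (linv l) v.
  have d' : dom (rule_iso ra rc rm rn) (linv l) (kval t 0%R) by rewrite /kval kvec0 mulg1 Et.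
  exact: (rule_dom rmn r d').
have [||okz Ez'] := @psi_cross (linv l) z.
- by [].
- by rewrite -Ez => x /sub/okb2.
rewrite linvK in okz Ez'.
pose r' := lmul cat (b1 ++ tmap (src l) z) s2 dt.
have cr : rletter l * rbase (tprod b2) * rletter (linv l) = rbase (tprod (tmap (src l) z)).
  have := @hletter_crosses _ _ _ iso (linv l) (tprod b2) (tprod (tmap (src l) z)).
  rewrite hletterV -mulgA => ->; first by rewrite mulVKg.
  apply/rule_crosses; exists z, 0%R.
  by rewrite !src00 /kval kvec0 !mulg1 linvK -Ez Et.
exists (s1 ++ r'.1), r'.2; split.
- have okc : okt (b1 ++ tmap (src l) z) by apply/okt_cat.
  rewrite /r'; case: (s2) ok2 => [|[b3 l3] s3] /=.
    by move=> [h _]; rewrite cats0; split; [apply/okt_cat|].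
  move=> /okd_cons[h1 h2 h3]; apply/okd_cat; split=> //; apply/okd_cons; split=> //.
  exact/okt_cat.
- by rewrite /r'; case: (s2) => [|[b3 l3] s3]; rewrite !size_cat /=; lia.
- rewrite /dv !hv_cat; congr (_ * _); rewrite /r' hv_lmul; last exact: tprod_cat.
  by rewrite !hv_cons tprod_cat hbaseM -cr !mulgA.
have pc a b : psiv (a ++ b.1) b.2 = psiv (a ++ [::]) [::] * psiv b.1 b.2.
  by elim: a => [|[x m] a IH] /=; rewrite ?mul1g // IH !mulgA.
rewrite (pc s1 r') (pc s1 (_, dt)); congr (_ * _); rewrite /r' /=.
have -> : psiv (lmul cat (b1 ++ tmap (src l) z) s2 dt).1 (lmul cat (b1 ++ tmap (src l) z) s2 dt).2
   = psiprod (b1 ++ tmap (src l) z) * psiv s2 dt.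
  by case: (s2) => [|[b3 l3] s3] /=; rewrite psiprod_cat ?mulgA.
by rewrite psiprod_cat -Ez' -Ez Ep !mulgA.
Qed.

Lemma dnormal ds dt : okd ds dt -> exists ds' dt', [/\ okd ds' dt',
  pinchfree (rule_iso ra rc rm rn) (fmap (@tprod vec) ds'), dv ds' dt' = dv ds dt & psiv ds' dt' = psiv ds dt].
Proof.
elim: (size ds) {-2}ds (leqnn (size ds)) dt => [|n IH] {}ds hs dt ok;
  have [p|np] := pselect (pinchfree (rule_iso ra rc rm rn) (fmap (@tprod vec) ds)); try by exists ds, dt.
  by move: hs np; case: ds {ok} => // _ [].
have [ds1 [dt1 [ok1 s1 <- <-]]] := dpinch ok np.
by apply: IH => //; lia.
Qed.

(** Hence psi is well defined: pinches are removed without changing [psiv], and by Britton's lemma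
    only a product of conjugates [t^g] remains, whose cancellations are free. *)
Lemma psi_wd ds dt : okd ds dt -> dv ds dt = 1 -> psiv ds dt = 1.
Proof.
move=> /dnormal[ds1 [dt1 [_ p <- <-]]] E.
have [/eqP Es E1] := britton E p.
by case: ds1 Es {p E} => //= _; apply: tprod_eq1.
Qed.
End Marked.
End MarkedLetters.
Import MarkedLetters.

(** * Contraction of words of the rule group, pinch by pinch *)

Module Contraction.
Import GRing.Theory.

Lemma common_prefix (T : eqType) (s t : seq T) : exists c s' t', [/\ s = c ++ s', t = c ++ t' &
  if s' is x :: _ then (if t' is y :: _ then x != y else true) else true].
Proof.
elim: s t => [|x s IH] t; first by exists [::], [::], t.
case: t => [|y t]; first by exists [::], (x :: s), [::].
have [->|ne] := eqVneq x y; last by exists [::], (x :: s), (y :: t).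
by have [c [s' [t' [-> -> h]]]] := IH t; exists (y :: c), s', t'.
Qed.

Section Reduced.
Variable V : zmodType.
Definition noncancel (x y : V * bool) := y != tinv x.
Lemma treducedE (s : seq (V * bool)) : treduced s = sorted noncancel s.
Proof.
elim: s => [//|x s IH]; rewrite [treduced _]/= IH; case: s {IH} => [|y s] //=.
Qed.
Lemma treduced_catr (s t : seq (V * bool)) : treduced (s ++ t) -> treduced t.
Proof. by elim: s => [//|x s IH] /= /andP[_ /IH]. Qed.
Lemma treduced_tinvs (s : seq (V * bool)) : treduced s -> treduced (tinvs s).
Proof.
rewrite !treducedE /tinvs rev_sorted sorted_map; apply: sub_sorted => x y; rewrite /noncancel /= tinvK.
by rewrite eq_sym.
Qed.
(** Once the longest common prefix is removed, nothing cancels where the two remainders meet. *)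
Lemma treduced_quotient (c s t : seq (V * bool)) : treduced (c ++ s) -> treduced (c ++ t) ->
  (if s is x :: _ then (if t is y :: _ then x != y else true) else true) -> treduced (tinvs t ++ s).
Proof.
move=> /treduced_catr rs /treduced_catr rt; case: s rs => [|x s] rs; first by rewrite cats0 => _; apply: treduced_tinvs.
case: t rt => [//|y t] rt ne; move: (treduced_tinvs rt); rewrite !treducedE in rs *.
rewrite /tinvs /= rev_cons -cats1 -catA /=; set r := rev _.
case: r => [|z r] /=; first by rewrite /noncancel tinvK ne.
rewrite cat_path [path _ _ [:: _]]/= andbT => /andP[h1 h2]; rewrite cat_path h1 /= h2 /noncancel tinvK ne; exact: rs.
Qed.
End Reduced.

Section RuleWords.
Variables (C L A : finType) (R : seq (word A)).
Notation vec := {ffun C -> int}.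
Notation der := (der R).
Notation red := (red R).
Variables (gx : C -> A) (gt : A) (gl : L -> A) (dbl : C -> L).
Variables (ra rc : L -> vec) (rm rn : L -> C -> nat).
Notation vecw := (vecw gx gl dbl).
Notation conjw := (conjw gx gt gl dbl).
Notation stw := (stw gl).
Notation pos a := ((a, false) : letter A).
Notation src := (src ra rc rm rn).
Notation src0 := (src0 rm rn).
Variable (M b W j0 : nat).
Hypotheses (rmM : forall l i, rm l i <= M) (rnM : forall l i, rn l i <= M).
Hypothesis rmn : forall l i, (rm l i == 0%N) = (rn l i == 0%N).
Hypotheses (raS : forall l, small j0 (ra l)) (rcS : forall l, small j0 (rc l)).
Hypotheses (rm_dbl : forall i, rm (dbl i) i = 1) (rn_dbl : forall i, rn (dbl i) i = 2).
Hypothesis relX : forall i j, relator [:: pos (gx i); pos (gx j)] [:: pos (gx j); pos (gx i)] \in R.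
Hypothesis relL : forall l i,
  relator (nseq (rm l i) (pos (gx i)) ++ [:: pos (gl l)]) (pos (gl l) :: nseq (rn l i) (pos (gx i))) \in R.
Hypothesis relT : forall l,
  relator (conjw (ra l) false ++ [:: pos (gl l)]) (pos (gl l) :: conjw (rc l) false) \in R.
Hypothesis W1 : 3 * b + 20 + 8 * M <= W.
Hypothesis W2 : #|C| * (3 * b) <= W.
Hypothesis M1 : 1 <= M.

Notation kel := (seq (vec * bool) * vec)%type.
Definition kvl (k : kel) : kgroup vec := kval k.1 k.2.
Definition kmul (k k' : kel) : kel := (k.1 ++ tshift k.2 k'.1, (k.2 + k'.2)%R).
Definition tsmall j (s : seq (vec * bool)) := forall x, x \in s -> small j x.1.
Definition ksmall j (k : kel) := tsmall j k.1 /\ small j k.2.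
Definition tw (s : seq (vec * bool)) : word A := flatten [seq conjw x.1 x.2 | x <- s].
Definition kw (k : kel) : word A := tw k.1 ++ vecw k.2.
Notation kseq := (seq (kel * (L * bool))).
Definition sw (s : kseq) k : word A := flatten [seq kw x.1 ++ stw x.2 | x <- s] ++ kw k.
Definition tsize (s : kseq) (k : kel) := sumn [seq size x.1.1 | x <- s] + size k.1.
Definition ssmall j (s : kseq) k := (forall x, x \in s -> ksmall j x.1) /\ ksmall j k.
Notation U := (2 * W + 2).
Notation iso := (@rule_isoP C L ra rc rm rn rmn).

Lemma small_le j j' (v : vec) : j <= j' -> small j v -> small j' v.
Proof. by move=> h s i; apply: leq_trans (s i) _; rewrite leq_exp2l. Qed.
Lemma tsmall_le j j' s : j <= j' -> tsmall j s -> tsmall j' s.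
Proof. by move=> h s1 x /s1; apply: small_le. Qed.
Lemma ksmall_le j j' k : j <= j' -> ksmall j k -> ksmall j' k.
Proof. by move=> h [h1 h2]; split; [apply: tsmall_le h1|apply: small_le h2]. Qed.
Lemma small0 j : small j (0%R : vec).
Proof. by move=> i; rewrite ffunE expn_gt0. Qed.
Lemma not_tred (s : seq (vec * bool)) : ~~ treduced s ->
  exists (s1 : seq (vec * bool)) (x : vec * bool) (s2 : seq (vec * bool)), s = s1 ++ x :: tinv x :: s2.
Proof. exact: not_treduced. Qed.
Lemma size_tshift v (s : seq (vec * bool)) : size (tshift v s) = size s.
Proof. exact: size_map. Qed.
Lemma vaddE (v w : vec) i : (v + w)%R i = (v i + w i)%R. Proof. by rewrite ffunE. Qed.
Lemma vsubE (v w : vec) i : (v - w)%R i = (v i - w i)%R. Proof. by rewrite !ffunE. Qed.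
Lemma src0E l z i : src0 l z i = ((if l.2 then rn l.1 i else rm l.1 i)%:Z * z i)%R.
Proof. by rewrite /RuleGroups.src0 ffunE; case: l => l []. Qed.
Lemma srcE l z i : src l z i = ((if l.2 then rc l.1 i else ra l.1 i) + src0 l z i)%R.
Proof. by rewrite src0E /RuleGroups.src /aff; case: l => l []; rewrite !ffunE. Qed.
Lemma smallB j (v w : vec) : small j v -> small j w -> small j.+1 (v - w)%R.
Proof. by move=> h h' i; rewrite vsubE expnS; move: (h i) (h' i); lia. Qed.
Lemma smallD j (v w : vec) : small j v -> small j w -> small j.+1 (v + w)%R.
Proof. by move=> h h' i; rewrite vaddE expnS; move: (h i) (h' i); lia. Qed.
Lemma tsmall_cat j s s' : tsmall j (s ++ s') <-> tsmall j s /\ tsmall j s'.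
Proof.
split=> [h|[h h'] x]; last by rewrite mem_cat => /orP[/h|/h'].
by split=> x xs; apply: h; rewrite mem_cat xs ?orbT.
Qed.
Lemma tsmall_cons j x s : tsmall j (x :: s) <-> small j x.1 /\ tsmall j s.
Proof.
split=> [h|[h h'] y]; last by rewrite inE => /predU1P[->|/h'].
by split=> [|y ys]; apply: h; rewrite inE ?eqxx ?ys ?orbT.
Qed.
Lemma ssmall_cons j x s k : ssmall j (x :: s) k <-> ksmall j x.1 /\ ssmall j s k.
Proof.
split=> [[h h']|[h [h1 h2]]].
  by split; [apply: h; rewrite mem_head|split=> // y ys; apply: h; rewrite inE ys orbT].
by split=> // y; rewrite inE => /predU1P[->|/h1].
Qed.
Lemma ssmall_cat j s s' k : ssmall j (s ++ s') k <-> ssmall j s ([::], 0%R) /\ ssmall j s' k.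
Proof.
split=> [[h h']|[[h _] [h1 h2]]].
  split; split=> //; [|by split; [|exact: small0]|]; move=> x xs; apply: h; rewrite mem_cat xs ?orbT //.
by split=> // x; rewrite mem_cat => /orP[/h|/h1].
Qed.
Lemma ssmall_le j j' s k : j <= j' -> ssmall j s k -> ssmall j' s k.
Proof. by move=> h [h1 h2]; split; [move=> x /h1|move: h2]; apply: ksmall_le. Qed.

Lemma tw_cons x s : tw (x :: s) = conjw x.1 x.2 ++ tw s. Proof. by []. Qed.
Lemma tw_cat s s' : tw (s ++ s') = tw s ++ tw s'.
Proof. by rewrite /tw map_cat flatten_cat. Qed.
Lemma sw_cons x s k : sw (x :: s) k = kw x.1 ++ stw x.2 ++ sw s k.
Proof. by rewrite /sw /= -!catA. Qed.
Lemma sw_cat s s' k : sw (s ++ s') k = flatten [seq kw x.1 ++ stw x.2 | x <- s] ++ sw s' k.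
Proof. by rewrite /sw map_cat flatten_cat -catA. Qed.
Lemma tsize_cons x s k : tsize (x :: s) k = size x.1.1 + tsize s k.
Proof. by rewrite /tsize /= addnA. Qed.
Lemma tsize_cat s s' k : tsize (s ++ s') k = sumn [seq size x.1.1 | x <- s] + tsize s' k.
Proof. by rewrite /tsize map_cat sumn_cat addnA. Qed.

Lemma vecw_sz v : small b v -> size (vecw v) <= W.
Proof. by move=> h; eapply vecwW; eassumption. Qed.
Lemma conjw_sz v e : small b v -> size (conjw v e) <= 2 * W + 1.
Proof. by move=> h; eapply size_conjw; eassumption. Qed.
Lemma tw_sz s : tsmall b s -> size (tw s) <= size s * U.
Proof.
elim: s => [//|x s IH] /tsmall_cons[h /IH h']; rewrite tw_cons size_cat size_cons mulSn.
by have := conjw_sz x.2 h; lia.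
Qed.
Lemma kw_sz k : ksmall b k -> size (kw k) < (size k.1).+1 * U.
Proof. by case=> /tw_sz h /vecw_sz h'; rewrite /kw size_cat mulSn; lia. Qed.
Lemma pre_sz s : ssmall b s ([::], 0%R) ->
  size (flatten [seq kw x.1 ++ stw x.2 | x <- s]) <= (sumn [seq size x.1.1 | x <- s] + size s) * U.
Proof.
elim: s => [//|x s IH] /ssmall_cons[/kw_sz h1 /IH h2].
have e : size (stw x.2) = 1 by [].
have -> : flatten [seq kw y.1 ++ stw y.2 | y <- x :: s] = (kw x.1 ++ stw x.2) ++ flatten [seq kw y.1 ++ stw y.2 | y <- s] by [].
have -> : sumn [seq size y.1.1 | y <- x :: s] = size x.1.1 + sumn [seq size y.1.1 | y <- s] by [].
rewrite (size_cat (kw x.1 ++ _)) (size_cat (kw x.1)) size_cons e addn1; apply: leq_trans (leq_add h1 h2) _.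
by rewrite -mulnDl leq_mul2r; apply/orP; right; lia.
Qed.
Lemma sw_sz s k : ssmall b s k -> size (sw s k) <= (tsize s k + size s + 1) * U.
Proof.
move=> h; have /pre_sz h1 : ssmall b s ([::], 0%R) by case: h => h _; split=> //; split; [|exact: small0].
have /kw_sz h2 : ksmall b k by case: h.
by rewrite /sw size_cat /tsize; nia.
Qed.

Lemma flat_pass S (T : eqType) (r : seq T) (f g : T -> word A) w :
  (forall x, x \in r -> der S (f x ++ w) (w ++ g x)) -> size w <= S ->
  der (S + size (flatten (map f r)) + size (flatten (map g r)))
    (flatten (map f r) ++ w) (w ++ flatten (map g r)).
Proof.
move=> h hw; elim: r h => [|x r IH] h; first by rewrite /= cats0; apply: der_refl; rewrite !addn0.
have hr : forall y, y \in r -> der S (f y ++ w) (w ++ g y) by move=> y yr; apply: h; rewrite inE yr orbT.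
have E h0 : flatten (map h0 (x :: r)) = h0 x ++ flatten (map h0 r) :> word A by [].
rewrite !E; move: (IH hr); set F := flatten (map f r); set G := flatten (map g r) => IH'.
by apply: der_pass_cat (h x (mem_head _ _)) IH' _ _; sz.
Qed.

Lemma vecw_tw j v s : j.+1 <= b -> small j v -> tsmall j s ->
  der (1400 * W + 2 * size s * U) (vecw v ++ tw s) (tw (tshift v s) ++ vecw v).
Proof.
move=> jb sv ss; apply: der_sym.
have E : tw (tshift v s) = flatten [seq conjw (x.1 - v)%R x.2 | x <- s] by rewrite /tw /tshift -map_comp.
have hw : size (vecw v) <= 1400 * W by have := vecw_sz (small_le (ltnW jb) sv); lia.
have h : forall x, x \in s -> der (1400 * W) (conjw (x.1 - v)%R x.2 ++ vecw v) (vecw v ++ conjw x.1 x.2).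
  move=> x xs; apply: der_sym; eapply vecw_conjw; try eassumption.
  - exact: small_le (ltnW jb) sv.
  - exact: small_le (ltnW jb) (ss _ xs).
  - by apply: small_le jb _; apply: smallB (ss _ xs) sv.
rewrite E; apply: der_mono (flat_pass h hw); rewrite -E -/(tw s).
have := tw_sz (tsmall_le (ltnW jb) ss).
have h2 : tsmall b (tshift v s).
  by move=> x /mapP[y ys ->]; apply: small_le jb _; apply: smallB (ss _ ys) sv.
by have := tw_sz h2; rewrite size_tshift; lia.
Qed.

Lemma kmul_small j k k' : ksmall j k -> ksmall j k' -> ksmall j.+1 (kmul k k').
Proof.
move=> [h1 h2] [h3 h4]; split; last exact: smallD.
apply/tsmall_cat; split; first exact: tsmall_le h1.
by move=> x /mapP[y /h3 hy ->]; apply: smallB.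
Qed.
Lemma kvlM k k' : kvl (kmul k k') = (kvl k * kvl k')%g.
Proof. by rewrite /kvl kvalM. Qed.
Lemma size_kmul k k' : size (kmul k k').1 = size k.1 + size k'.1.
Proof. by rewrite size_cat size_tshift. Qed.

Lemma kw_mul j k k' : j.+1 <= b -> ksmall j k -> ksmall j k' ->
  der (1500 * W + (size k.1 + size k'.1 + 1) * (3 * U)) (kw k ++ kw k') (kw (kmul k k')).
Proof.
move=> jb [h1 h2] [h3 h4]; rewrite /kw /kmul /= tw_cat.
have s1 := tw_sz (tsmall_le (ltnW jb) h1); have s3 := tw_sz (tsmall_le (ltnW jb) h3).
have s2 := vecw_sz (small_le (ltnW jb) h2); have s4 := vecw_sz (small_le (ltnW jb) h4).
have s5 := vecw_sz (small_le jb (smallD h2 h4)).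
have s6 : size (tw (tshift k.2 k'.1)) <= size k'.1 * U.
  rewrite -(size_tshift k.2); apply: tw_sz => x /mapP[y ys ->].
  by apply: small_le jb _; apply: smallB (h3 _ ys) h2.
apply: (der_trans (b := tw k.1 ++ (tw (tshift k.2 k'.1) ++ vecw k.2) ++ vecw k'.2)).
  have := @der_in _ _ _ (1500 * W + (size k.1 + size k'.1 + 1) * (3 * U)) _ _ (tw k.1) (vecw k'.2)
    (vecw_tw jb h2 h3); rewrite -!catA; apply; nia.
have d : der (1303 * W) (vecw k.2 ++ vecw k'.2) (vecw (k.2 + k'.2)%R).
  eapply vecw_add; try eassumption; apply: small_le (jb) _; [exact: small_le h2|exact: small_le h4|exact: smallD].
have := @der_catr _ _ _ (1500 * W + (size k.1 + size k'.1 + 1) * (3 * U)) _ _ (tw k.1 ++ tw (tshift k.2 k'.1)) d.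
by rewrite -!catA; apply; rewrite size_cat; nia.
Qed.

Lemma kw_lmul j k s kf : j.+1 <= b -> ksmall j k -> ssmall j s kf ->
  [/\ der (1500 * W + (size k.1 + tsize s kf + size s + 1) * (5 * U)) (kw k ++ sw s kf) (sw (lmul kmul k s kf).1 (lmul kmul k s kf).2),
   ssmall j.+1 (lmul kmul k s kf).1 (lmul kmul k s kf).2,
   size (lmul kmul k s kf).1 = size s & tsize (lmul kmul k s kf).1 (lmul kmul k s kf).2 = size k.1 + tsize s kf].
Proof.
move=> jb hk; case: s => [|[k1 l] s] hs.
  have hf : ksmall j kf by case: hs.
  split=> //; last by rewrite /tsize /= size_kmul.
  - by rewrite /sw /=; apply: der_mono (kw_mul jb hk hf); rewrite /tsize /=; nia.
  - by split=> //; apply: kmul_small.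
move/ssmall_cons: (hs) => [h1 h2]; split=> //.
- rewrite !sw_cons [(k1, l).1]/= [(k1, l).2]/= [(kmul k k1, l).1]/= [(kmul k k1, l).2]/=.
  rewrite catA; apply: der_catl (kw_mul jb hk h1) _.
  have e : size (stw l) = 1 by []; have := sw_sz (ssmall_le (ltnW jb) h2).
  by rewrite size_cat e tsize_cons /=; nia.
- by apply/ssmall_cons; split; [exact: kmul_small|apply: ssmall_le h2].
- by rewrite !tsize_cons /= size_kmul addnA.
Qed.

Lemma tred_word s : tsmall b s -> exists s', [/\ treduced s', tprod s' = tprod s, {subset s' <= s},
  size s' <= size s & der ((size s).+1 * U) (tw s) (tw s')].
Proof.
elim: (size s) {-2}s (leqnn (size s)) => [|n IH] {}s hs ss;
  (have [r|/not_tred[s1 [x [s2 E]]]] := boolP (treduced s); first by exists s; split=> //; apply: der_refl; have := tw_sz ss; nia).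
  by rewrite E size_cat /= addnS in hs.
have sz12 : (size (s1 ++ s2)).+2 = size s by rewrite E !size_cat /=; lia.
have sub12 : {subset s1 ++ s2 <= s} by move=> z; rewrite E !mem_cat !inE => /orP[->//|->]; rewrite !orbT.
have ss12 : tsmall b (s1 ++ s2) by move=> z /sub12/ss.
have [||s' [h1 h2 h4 h5 h6]] := IH (s1 ++ s2) => //; first by lia.
exists s'; split=> //.
- by rewrite h2 E tprod_cancel.
- by move=> z /h4/sub12.
- by lia.
apply: (der_trans (b := tw (s1 ++ s2))); last by apply: der_mono h6; nia.
rewrite E !tw_cat !tw_cons /tinv /= -conjwN.
have := @der_in _ R _ ((size (s1 ++ [:: x, (x.1, ~~ x.2) & s2])).+1 * U) _ _ (tw s1) (tw s2) (der_cancelw R (leqnn (2 * size (conjw x.1 x.2)))).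
rewrite cat0s -!catA; apply.
move/tsmall_cat: ss12 => [/tw_sz t1 /tw_sz t2]; have sx : small b x.1 by apply: ss; rewrite E mem_cat mem_head orbT.
by have := conjw_sz x.2 sx; rewrite size_cat !size_cons; nia.
Qed.

(* Crossing a stable letter multiplies the entries by a constant at most. *)
Lemma src0_small j l z : small j (src0 l z) -> small (j + M) (src0 (linv l) z).
Proof.
move=> h i; have := h i; rewrite !src0E.
have e : M < 2 ^ M by exact: ltn_expl.
have := rmn l.1 i; have := rmM l.1 i; have := rnM l.1 i.
rewrite expnD; case: l {h} => l [] /=; move: (z i) => x;
case: (rm l i) (rn l i) => [|m] [|n] //= hn hm _ h1; rewrite ?mul0r ?muln_gt0 ?expn_gt0 //; nia.
Qed.
Lemma src_small j l z : j0 <= j -> small j (src l z) ->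
  [/\ small j.+1 (src0 l z), small (j + M).+1 (src0 (linv l) z) & small (j + M).+2 (src (linv l) z)].
Proof.
move=> jj h; have a := small_le jj (raS l.1); have c := small_le jj (rcS l.1).
have h1 : small j.+1 (src0 l z).
  move=> i; have := h i; rewrite srcE; have := a i; have := c i; rewrite expnS.
  by move: (src0 l z i) => x; case: (l.2); lia.
have h2 : small (j + M).+1 (src0 (linv l) z) by have := src0_small h1; rewrite addSn.
split=> // i; have := h2 i; rewrite srcE; have := a i; have := c i.
rewrite !expnS expnD; have e : 2 ^ j <= 2 ^ j * 2 ^ M by rewrite leq_pmulr ?expn_gt0.
by move: (src0 (linv l) z i) => x; rewrite /linv /=; case: (l.2) => /=; lia.
Qed.
Lemma kw_letter j l z v : j0 <= j -> (j + M).+2 <= b -> tsmall j (tmap (src l) z) -> small j (src0 l v) ->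
  ksmall (j + M).+2 (tmap (src (linv l)) z, src0 (linv l) v) /\
  der (2000 * W + (size z + 1) * (3 * U)) (kw (tmap (src l) z, src0 l v) ++ stw l)
    (stw l ++ kw (tmap (src (linv l)) z, src0 (linv l) v)).
Proof.
move=> jj jb sz1 sv.
have bb : j <= b by lia.
have s1 : tsmall (j + M).+2 (tmap (src (linv l)) z).
  move=> x /mapP[y yz ->]; have [] // := @src_small j l y.1 jj _.
  by apply: (sz1 (src l y.1, y.2)); apply: (map_f (fun x => (src l x.1, x.2))).
have s2 : small (j + M).+2 (src0 (linv l) v).
  by apply: small_le (src0_small sv); lia.
split=> //.
have e1 : size (tmap (src l) z) = size z by exact: size_map.
have e2 : size (tmap (src (linv l)) z) = size z by exact: size_map.
have t1 := tw_sz (tsmall_le bb sz1); have t2 := tw_sz (tsmall_le jb s1); rewrite e1 in t1; rewrite e2 in t2.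
have v1 := vecw_sz (small_le bb sv); have v2 := vecw_sz (small_le jb s2).
have dv' : der (60 * W) (vecw (src0 l v) ++ stw l) (stw l ++ vecw (src0 (linv l) v)).
  by eapply vecw_letter; try eassumption; [exact: small_le bb sv|exact: small_le jb s2].
have dt' : der (1500 * W + size z * (2 * U)) (tw (tmap (src l) z) ++ stw l) (stw l ++ tw (tmap (src (linv l)) z)).
  have E f : tw (tmap f z) = flatten [seq conjw (f x.1) x.2 | x <- z] by rewrite /tw /tmap -map_comp.
  have h x : x \in z -> der (1500 * W) (conjw (src l x.1) x.2 ++ stw l) (stw l ++ conjw (src (linv l) x.1) x.2).
    move=> xz; have hx : small j (src l x.1).
      by apply: (sz1 (src l x.1, x.2)); apply: (map_f (fun x => (src l x.1, x.2))).
    have [h1 h2 h3] := src_small jj hx.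
    eapply conjw_letter; try eassumption.
    - by apply: small_le (raS _); lia.
    - by apply: small_le (rcS _); lia.
    - by apply: small_le h1; lia.
    - by apply: small_le h2; lia.
    - by apply: small_le hx.
    - by apply: small_le h3; lia.
  have hst : size (stw l) <= 1500 * W by have -> : size (stw l) = 1 by []; lia.
  by have := flat_pass h hst; rewrite -!E; apply: der_mono; lia.
rewrite /kw /=; apply: der_pass_cat dt' dv' _ _; lia.
Qed.

Definition SP n := n * (20 * U) + 3000 * W.

(** Crossing the letter adds at most [M + 2] binary digits, and each of the two multiplications into
    neighbouring coefficients adds one more, which fits into [M + 8]. The number of conjugates [t^g]
    does not grow, since neither free reduction nor crossing creates any. *)
Lemma pinch_step j s k : j0 <= j -> j + (M + 8) <= b -> ssmall j s k ->
  ~ pinchfree (rule_iso ra rc rm rn) (fmap kvl s) ->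
  exists s' k', [/\ size s' < size s, tsize s' k' <= tsize s k, ssmall (j + (M + 8)) s' k',
    hv iso kvl s' k' = hv iso kvl s k & der (SP (tsize s k + size s + 1)) (sw s k) (sw s' k')].
Proof.
move=> jj jb ss np; have [s1 [b1 [l [b2 [s2 [E d]]]]]] := hv_pinch np.
have bb : j <= b by lia.
move: ss; rewrite E => /ssmall_cat[ss1 /ssmall_cons[/= sb1 /ssmall_cons[/= sb2 ss2]]].
have [t [r Et sub szt dt]] := tred_word (tsmall_le bb sb2.1).
have [z [v [Ez Ev]]] : exists z v, t = tmap (src (linv l)) z /\ b2.2 = src0 (linv l) v.
  by apply: (rule_dom rmn r); move: d; rewrite /kvl /kval Et.
have hz : tsmall j (tmap (src (linv l)) z) by rewrite -Ez => x /sub/sb2.1.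
have hv' : small j (src0 (linv l) v) by rewrite -Ev; exact: sb2.2.
have [|k2s dl] := kw_letter jj _ hz hv'; first by lia.
rewrite linvK in k2s dl; set k2 := (tmap (src l) z, src0 l v) in k2s dl.
have szz : size z = size t by rewrite Ez size_map.
have szk2 : size k2.1 = size z by exact: size_map.
have hzb : size z <= size b2.1 by rewrite szz.
have [||d1 h1 n1 t1] := @kw_lmul (j + M).+2 k2 s2 k _ k2s; [lia|by apply: ssmall_le ss2; lia|].
set r1 := lmul kmul k2 s2 k in d1 h1 n1 t1.
have [||d2 h2 n2 t2] := @kw_lmul (j + M).+3 b1 r1.1 r1.2 _ _ h1; [lia|by apply: ksmall_le sb1; lia|].
set r2 := lmul kmul b1 r1.1 r1.2 in d2 h2 n2 t2.
have e : size (stw l) = 1 by []. have e' : size (stw (linv l)) = 1 by [].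
have p1 := pre_sz (ssmall_le bb ss1); have p2 := kw_sz (ksmall_le bb sb1).
have p3 := kw_sz (ksmall_le bb sb2); have p4 := sw_sz (ssmall_le bb ss2).
have p5 : size (kw k2) < (size z).+1 * U by rewrite -szk2; apply: kw_sz; apply: ksmall_le k2s; lia.
have p6 : size (sw r1.1 r1.2) <= (size z + tsize s2 k + size s2 + 1) * U.
  by rewrite -szk2 -t1 -n1; apply: sw_sz; apply: ssmall_le h1; lia.
have p7 : size (sw r2.1 r2.2) <= (size b1.1 + (size z + tsize s2 k) + size s2 + 1) * U.
  by rewrite -szk2 -t1 -t2 -n1 -n2; apply: sw_sz; apply: ssmall_le h2; lia.
have p8 : size (vecw b2.2) <= W by apply: vecw_sz; exact: small_le sb2.2.
have eT : tsize (s1 ++ (b1, l) :: (b2, linv l) :: s2) k =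
    sumn [seq size x.1.1 | x <- s1] + (size b1.1 + (size b2.1 + tsize s2 k)).
  by rewrite tsize_cat !tsize_cons.
have eN : size (s1 ++ (b1, l) :: (b2, linv l) :: s2) = size s1 + (size s2).+2 by rewrite size_cat.
exists (s1 ++ r2.1), r2.2; split.
- by rewrite eN size_cat n2 n1 ltn_add2l ltnS leqnSn.
- by rewrite eT tsize_cat t2 t1 szk2 !leq_add2l leq_add2r.
- apply/ssmall_cat; split; first by apply: ssmall_le ss1; lia.
  by apply: ssmall_le h2; lia.
- rewrite !hv_cat; congr (_ * _)%g; rewrite /r2 hv_lmul; last exact: kvlM.
  rewrite /r1 hv_lmul; last exact: kvlM.
  rewrite !hv_cons -!mulgA; congr (_ * _)%g; rewrite !mulgA; congr (_ * _)%g.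
  have := @hletter_crosses _ _ _ iso (linv l) (kvl b2) (kvl k2).
  rewrite hletterV -!mulgA => ->; first by rewrite mulVKg.
  apply/rule_crosses; exists z, v; rewrite linvK; split=> //.
  by rewrite /kvl /kval Ev -Ez Et.
rewrite !sw_cat !sw_cons [(b1, l).1]/= [(b1, l).2]/= [(b2, linv l).1]/= [(b2, linv l).2]/= eT eN /SP.
set Pre := flatten _ in p1 *; set Su := sumn _ in p1 *.
have hzU : size z * U <= size b2.1 * U by rewrite leq_mul2r hzb orbT.
set B := (X in der X _ _).
apply: (der_trans (b := (Pre ++ kw b1 ++ stw l) ++ (tw t ++ vecw b2.2) ++ stw (linv l) ++ sw s2 k)).
  have dk : der ((size b2.1).+1 * U + W) (kw b2) (tw t ++ vecw b2.2) by apply: der_catl dt _; lia.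
  have hs : (size b2.1).+1 * U + W + size (Pre ++ kw b1 ++ stw l) + size (stw (linv l) ++ sw s2 k) <= B.
    rewrite /B; by rewrite (size_cat Pre) (size_cat (kw b1)) (size_cat (stw _)) e e'; move: p1 p2 p3 p4 p5 p6 hzU; move: (size s1) (size s2) (size z) (size b1.1) (size b2.1) (tsize s2 k) (size Pre) (size (kw b1)) (size (kw k2)) (size (kw b2)) (size (sw s2 k)) (size (sw r1.1 r1.2)); clear; lia.
  by have := der_in dk hs; rewrite -!catA.
apply: (der_trans (b := (Pre ++ kw b1 ++ stw l) ++ (stw (linv l) ++ kw k2) ++ sw s2 k)).
  have hs : 2000 * W + (size z + 1) * (3 * U) + size (Pre ++ kw b1 ++ stw l) + size (sw s2 k) <= B.
    rewrite /B; by rewrite (size_cat Pre) (size_cat (kw b1)) e; move: p1 p2 p3 p4 p5 p6 hzU; move: (size s1) (size s2) (size z) (size b1.1) (size b2.1) (tsize s2 k) (size Pre) (size (kw b1)) (size (kw k2)) (size (kw b2)) (size (sw s2 k)) (size (sw r1.1 r1.2)); clear; lia.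
  by have := der_in dl hs; rewrite [kw (tmap _ _, _)]/kw /= -Ez -Ev -!catA.
apply: (der_trans (b := (Pre ++ kw b1) ++ (kw k2 ++ sw s2 k))).
  have hs : 2 + size (Pre ++ kw b1) + size (kw k2 ++ sw s2 k) <= B.
    rewrite /B; by rewrite (size_cat Pre) (size_cat (kw k2)); move: p1 p2 p3 p4 p5 p6 hzU; move: (size s1) (size s2) (size z) (size b1.1) (size b2.1) (tsize s2 k) (size Pre) (size (kw b1)) (size (kw k2)) (size (kw b2)) (size (sw s2 k)) (size (sw r1.1 r1.2)); clear; lia.
  by have := der_in (der_cancel R (gl l.1, l.2)) hs; rewrite cat0s -!catA.
apply: (der_trans (b := Pre ++ (kw b1 ++ sw r1.1 r1.2))).
  have hs : 1500 * W + (size k2.1 + tsize s2 k + size s2 + 1) * (5 * U) + size (Pre ++ kw b1) <= B.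
    rewrite /B; by rewrite (size_cat Pre) szk2; move: p1 p2 p3 p4 p5 p6 hzU; move: (size s1) (size s2) (size z) (size b1.1) (size b2.1) (tsize s2 k) (size Pre) (size (kw b1)) (size (kw k2)) (size (kw b2)) (size (sw s2 k)) (size (sw r1.1 r1.2)); clear; lia.
  by have := der_catr d1 hs; rewrite -!catA.
by apply: der_catr d2 _; rewrite t1 n1 szk2 /B; move: p1 p2 p3 p4 p5 p6 hzU; move: (size s1) (size s2) (size z) (size b1.1) (size b2.1) (tsize s2 k) (size Pre) (size (kw b1)) (size (kw k2)) (size (kw b2)) (size (sw s2 k)) (size (sw r1.1 r1.2)); clear; lia.
Qed.

Lemma contract_base j s k : j <= b -> ssmall j s k -> hv iso kvl s k = 1%g ->
  pinchfree (rule_iso ra rc rm rn) (fmap kvl s) -> red (SP (tsize s k + size s + 1)) (sw s k).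
Proof.
move=> bb ss hv1 p; have [Es Ek] := britton hv1 p.
have {}Es : s = [::] by case: (s) Es.
subst s; have [t [r Et sub szt dt]] := tred_word (tsmall_le bb ss.2.1).
have [Ez Ev] : t = [::] /\ k.2 = 0%R by apply: kval_inj => //; rewrite kval0 -Ek /kvl /kval Et.
apply: der_red; rewrite /sw /= /kw Ev vecw0 cats0; move: dt; rewrite Ez; apply: der_mono.
by rewrite /SP /tsize /=; nia.
Qed.

(** At most [n] pinches are removed, and each adds a constant number of digits, so the numbers of
    digits grow only linearly in [n]. *)
Theorem contract_seq n j s k : size s <= n -> j0 <= j -> j + (M + 8) * n <= b -> ssmall j s k ->
  hv iso kvl s k = 1%g -> red (SP (tsize s k + size s + 1)) (sw s k).
Proof.
elim: n j s k => [|n IH] j s k sn jj jb ss hv1;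
  (have [p|np] := pselect (pinchfree (rule_iso ra rc rm rn) (fmap kvl s));
    first by apply: (@contract_base j) => //; lia).
  by move: sn np; case: (s) => // _ [].
have [|s' [k' [h1 h2 h3 h4 h5]]] := pinch_step jj _ ss np; first by nia.
apply: red_der_trans h5 _.
have r : red (SP (tsize s' k' + size s' + 1)) (sw s' k').
  by apply: (IH (j + (M + 8))) => //; rewrite ?h4 //; nia.
by apply: red_mono r; rewrite /SP; nia.
Qed.
Section MarkedWords.
Notation rbase := (hbase iso).
Notation rletter := (hletter iso).
Variable ml : pred L.
Notation reach := (reach ra rc rm rn ml).
Notation okt := (okt ra rc rm rn ml).
Notation okd := (okd ra rc rm rn ml).
Notation dseq := (seq (seq (vec * bool) * (L * bool))).
Notation dv := (@dv C L ra rc rm rn rmn).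
Definition dsk (ds : dseq) : kseq := [seq ((x.1, 0%R), x.2) | x <- ds].

(** The trivial homomorphism is an instance of psi. It makes [psi_cross] and [dnormal] available
    where only membership in the subgroup matters. *)
Lemma psi1_move (l : L * bool) (g g' : vec) : ml l.1 -> reach g -> move ra rc rm rn l g g' ->
  (1 = (psilet (fun=> 1) l)^-1 * 1 * psilet (fun=> 1) l :> kgroup vec)%g.
Proof. by rewrite /psilet; case: l => l [] _ _ _ /=; rewrite ?invgK ?invg1 !mulg1. Qed.

Lemma okt_src l z : ml l.1 -> okt (tmap (src l) z) -> okt (tmap (src (linv l)) z).
Proof. by move=> h /(psi_cross psi1_move h)[]. Qed.

Lemma dnormal1 ds dt : okd ds dt -> exists ds' dt', [/\ okd ds' dt',
  pinchfree (rule_iso ra rc rm rn) (fmap (@tprod vec) ds') & dv ds' dt' = dv ds dt].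
Proof.
by move=> /(dnormal rmn psi1_move)[ds' [dt' [h1 h2 h3 _]]]; exists ds', dt'.
Qed.

(* Peeling off the first letter of an element of <t, marked letters> given by a
   pinch-free sequence; t1 is a matching normal form. *)
Lemma peel j k1 l t1 : j0 <= j -> (j + M).+3 <= b -> ml l.1 -> ksmall j k1 -> okt t1 ->
  dom (rule_iso ra rc rm rn) l ((kvl k1)^-1 * tprod t1)%g ->
  exists c k2 t2, [/\ okt c, okt t2, tsmall j c, ksmall (j + M).+2 k2 & size c + size k2.1 <= size k1.1] /\
    [/\ (rbase (tprod t1) * rletter l = rbase (tprod c) * rletter l * rbase (tprod t2))%g,
        (rbase (kvl k1) * rletter l = rbase (tprod c) * rletter l * rbase (kvl k2))%g &
        der ((size k1.1 + 1) * (5 * U) + 2000 * W) (kw k1 ++ stw l) (tw c ++ stw l ++ kw k2)].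
Proof.
move=> jj jb mll sk okt1 d; have bb : j <= b by lia.
have [s [rs Es subs szs ds]] := tred_word (tsmall_le bb sk.1).
have [t [rt Et _ subt _]] := @tfree C _ (fun=> 1%g : kgroup vec) t1.
have [c [s' [t' [Ec Ec' hd]]]] := common_prefix s t.
(* Cancelling the common prefix [c] makes [t1^-1 k1] reduced. Then [rule_dom] parametrises both
   remainders, so that each of them can cross [l] by itself. *)
have rq : treduced (tinvs t' ++ s') by move: rs rt; rewrite Ec Ec' => h1 h2; apply: treduced_quotient h1 h2 _; move: hd; case: (s') (t') => [|? ?] [|? ?].
have [z [v [Ez Ev]]] : exists z v, tinvs t' ++ s' = tmap (src l) z /\ k1.2 = src0 l v.
  apply: (rule_dom rmn rq); move: d => /(domV iso); congr (dom _ _ _).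
  rewrite /kvl /kval -Es -Et Ec Ec' !tprod_cat tprodV !invgM !invgK !mulgA.
  by rewrite -(mulgA _ (tprod c)^-1%g) mulVg mulg1.
pose z1 := take (size t') z; pose z2 := drop (size t') z.
have szt : size (tinvs t') = size t' by rewrite /tinvs size_rev size_map.
have E1 : tinvs t' = tmap (src l) z1.
  by rewrite /tmap /z1 map_take -/(tmap _ _) -Ez -szt take_size_cat.
have E2 : s' = tmap (src l) z2.
  by rewrite /tmap /z2 map_drop -/(tmap _ _) -Ez -szt drop_size_cat.
have E3 : t' = tmap (src l) (tinvs z1).
  rewrite tmap_tinvs -E1 /tinvs map_rev revK -map_comp map_id_in // => x _; exact: tinvK.
have okt' : okt t by move=> x /subt/okt1.
move: (okt'); rewrite Ec' => /okt_cat[okc okt2].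
have st' : tsmall j s' by move=> x xs; apply: sk.1; apply: subs; rewrite Ec mem_cat xs orbT.
have sc : tsmall j c by move=> x xs; apply: sk.1; apply: subs; rewrite Ec mem_cat xs.
rewrite E2 in st'; have sv : small j (src0 l v) by rewrite -Ev; exact: sk.2.
have [|s2 d2] := kw_letter jj _ st' sv; first by lia.
exists c, (tmap (src (linv l)) z2, src0 (linv l) v), (tmap (src (linv l)) (tinvs z1)).
have szz : size z2 = size s' by rewrite E2 size_map.
have szc : size c + size s' <= size k1.1 by rewrite -size_cat -Ec.
split; split=> //.
- by apply: okt_src => //; rewrite -E3.
- by rewrite size_map szz.
- have := @hletter_crosses _ _ _ iso l (tprod t') (tprod (tmap (src (linv l)) (tinvs z1))).
  rewrite -Et Ec' tprod_cat hbaseM -!mulgA => -> //.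
  apply/rule_crosses; exists (tinvs z1), 0%R; rewrite !src00 /kval kvec0 !mulg1; split=> //.
  by rewrite -E3.
- have -> : kvl k1 = (tprod c * kvl (tmap (src l) z2, src0 l v))%g.
    by rewrite /kvl /kval -Es Ec tprod_cat E2 Ev mulgA.
  rewrite hbaseM -!mulgA; congr (_ * _)%g.
  by apply: hletter_crosses; apply/rule_crosses; exists z2, v.
have p1 := tw_sz (tsmall_le bb sc); have p2 := vecw_sz (small_le bb sk.2).
have e : size (stw l) = 1 by [].
set B := (X in der X _ _).
apply: (der_trans (b := (tw s ++ vecw k1.2) ++ stw l)).
  rewrite /kw -!catA; apply: der_catl ds _; rewrite size_cat e /B; lia.
rewrite Ec tw_cat E2 Ev.
have hs : 2000 * W + (size z2 + 1) * (3 * U) + size (tw c) <= B.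
  have : (size c + size z2) * U <= size k1.1 * U by rewrite leq_mul2r szz szc orbT.
  by rewrite /B; move: p1; move: (size c) (size z2) (size k1.1) (size (tw c)); clear; lia.
by have := der_catr d2 hs; rewrite /kw /= -!catA.
Qed.

(** To cross the letter [s], an arbitrary word has to be rewritten in the generators [t^g] and
    marked letters. The given [ds] proves membership but may be huge; its pinch-free form only
    guides the peeling of [s], and the new sequence inherits its size from [s]. *)
Theorem dform n j s k ds dt : size s <= n -> j0 <= j -> j + (M + 8) * n.+1 <= b -> ssmall j s k ->
  okd ds dt -> hv iso kvl s k = dv ds dt -> exists ds' dt',
  [/\ okd ds' dt', size ds' <= size s, ssmall b (dsk ds') (dt', 0%R),
      tsize (dsk ds') (dt', 0%R) <= tsize s k & dv ds' dt' = dv ds dt] /\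
  der (SP (tsize s k + size s + 1)) (sw s k) (sw (dsk ds') (dt', 0%R)).
Proof.
elim: n j s k ds dt => [|n IH] j s k ds dt sn jj jb ss ok E;
  (have [p|np] := pselect (pinchfree (rule_iso ra rc rm rn) (fmap kvl s)); last first).
- by move: sn np; case: (s) => // _ [].
- move: ok E => /dnormal1[ds1 [dt1 [ok1 p1 <-]]] E.
  have bb : j <= b by lia.
  have := pinchfree_head p p1 E; case: s sn ss p {E} => // _ ss _; case: ds1 ok1 p1 => // ok1 _ E.
  have [t [r Et sub szt d]] := tred_word (tsmall_le bb ss.2.1).
  have [t1 [r1 Et1 _ sub1 _]] := @tfree C _ (fun=> 1%g : kgroup vec) dt1.
  have [Ett Ev] : t = t1 /\ k.2 = 0%R by apply: kval_inj => //; rewrite /kval Et Et1 kvec0 mulg1 -E.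
  subst t1; exists [::], t; split.
    split=> //; [by split=> // x /sub1; apply: ok1.1|split=> //; split; [|exact: small0]|].
    + by move=> x /sub h; exact: (tsmall_le bb ss.2.1 h).
    + by rewrite /dv /hv /= Et1.
  rewrite /sw /= /kw Ev vecw0 !cats0; apply: der_mono d; rewrite /SP /tsize /=; lia.
- have [|s' [k' [h1 h2 h3 h4 h5]]] := pinch_step jj _ ss np; first by lia.
  rewrite -h4 in E; have [|||ds' [dt' [[g1 g2 g3 g4 g5] g6]]] := IH _ s' k' ds dt _ _ _ h3 ok E; try lia.
  exists ds', dt'; split; first by split=> //; lia.
  apply: der_trans h5 _; apply: der_mono g6; rewrite /SP.
  by rewrite leq_add2r leq_mul2r; apply/orP; right; lia.
move: ok E => /dnormal1[ds1 [dt1 [ok1 p1 <-]]] E.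
have bb : j <= b by lia.
have := pinchfree_head p p1 E; case: s sn ss p E => [|[k1 l] s] sn ss p E; case: ds1 ok1 p1 E => [|[t1 l1] ds1] ok1 p1 E //.
  move=> {}E; have [t [r Et sub szt d]] := tred_word (tsmall_le bb ss.2.1).
  have [t1 [r1 Et1 _ sub1 _]] := @tfree C _ (fun=> 1%g : kgroup vec) dt1.
  have [Ett Ev] : t = t1 /\ k.2 = 0%R by apply: kval_inj => //; rewrite /kval Et Et1 kvec0 mulg1 -E.
  subst t1; exists [::], t; split.
    split=> //; [by split=> // x /sub1; apply: ok1.1|split=> //; split; [|exact: small0]|].
    + by move=> x /sub h; exact: (tsmall_le bb ss.2.1 h).
    + by rewrite /dv /hv /= Et1.
  rewrite /sw /= /kw Ev vecw0 !cats0; apply: der_mono d; rewrite /SP /tsize /=; lia.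
rewrite [X in X -> _]/= => -[hl d]; subst l1; move/okd_cons: ok1 => [mll ok1 okds].
move/ssmall_cons: ss => [/= sk1 ss].
have [|c [k2 [t2 [[okc okt2 sc s2 sz2] [v1 v2 d2]]]]] := peel jj _ mll sk1 ok1 d; first by lia.
have [||d3 h3 n3 z3] := @kw_lmul (j + M).+2 k2 s k _ s2; [by lia|by apply: ssmall_le ss; lia|].
set r := lmul kmul k2 s k in d3 h3 n3 z3.
pose dr := lmul cat t2 ds1 dt1.
have okr : okd dr.1 dr.2.
  rewrite /dr; case: (ds1) okds => [|[t3 l3] ds3] /=.
    by move=> [h _]; split; [apply/okt_cat|].
  by move=> /okd_cons[h1 h2 h4]; apply/okd_cons; split=> //; apply/okt_cat.
have Er : hv iso kvl r.1 r.2 = dv dr.1 dr.2.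
  rewrite /r /dr /dv !hv_lmul; [|exact: tprod_cat|exact: kvlM].
  move: E; rewrite /dv !hv_cons v1 v2 -!mulgA => /mulgI/mulgI; exact.
have [||||ds' [dt' [[g1 g2 g3 g4 g5] g6]]] := IH (j + (M + 8)) r.1 r.2 dr.1 dr.2 _ _ _ _ okr Er; rewrite ?n3 //; try lia.
  by apply: ssmall_le h3; lia.
exists ((c, l) :: ds'), dt'; split.
  split.
  - by apply/okd_cons.
  - by rewrite /= ltnS -n3.
  - apply/ssmall_cons; split=> //=; split; [exact: tsmall_le sc|exact: small0].
  - by rewrite tsize_cons /= in sz2 *; move: g4; rewrite z3 tsize_cons /=; lia.
  - move: g5; rewrite /dv !hv_cons v1 /dr => ->; rewrite hv_lmul; last exact: tprod_cat.
    by rewrite !mulgA.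
have p1' := tw_sz (tsmall_le bb sc); have e : size (stw l) = 1 by [].
have q1 := sw_sz (ssmall_le bb ss).
have szU : (size c + size k2.1) * U <= size k1.1 * U by rewrite leq_mul2r sz2 orbT.
rewrite !sw_cons [(k1, l).1]/= [(k1, l).2]/= tsize_cons [(k1, l).1]/=.
set B := (X in der X _ _).
apply: (der_trans (b := (tw c ++ stw l ++ kw k2) ++ sw s k)).
  by rewrite catA; apply: der_catl d2 _; rewrite /B /SP; move: q1; move: (size s) (size k1.1) (tsize s k) (size (sw s k)); clear; lia.
apply: (der_trans (b := (tw c ++ stw l) ++ sw r.1 r.2)).
  have hs : 1500 * W + (size k2.1 + tsize s k + size s + 1) * (5 * U) + size (tw c ++ stw l) <= B.
    rewrite (size_cat (tw c)) e /B /SP.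
    by move: p1' szU; move: (size s) (size k1.1) (size k2.1) (size c) (tsize s k) (size (tw c)); clear; lia.
  by have := der_catr d3 hs; rewrite -!catA.
have -> : kw (c, 0%R) = tw c by rewrite /kw /= vecw0 cats0.
have hs : SP (tsize r.1 r.2 + size r.1 + 1) + size (tw c ++ stw l) <= B.
  rewrite z3 n3 (size_cat (tw c)) e /B /SP.
  by move: p1' szU; move: (size s) (size k1.1) (size k2.1) (size c) (tsize s k) (size (tw c)); clear; lia.
by have := der_catr g6 hs; rewrite -!catA.
Qed.
End MarkedWords.
End RuleWords.
End Contraction.
Import Contraction.

(** * Space functions of HNN extensions of direct products *)

Module GraphExtension.
Ltac same_sizes := repeat match goal with
  | _ : context [@size ?T1 ?s] |- context [@size ?T2 ?s] =>
      tryif constr_eq T1 T2 then fail else change (@size T1 s) with (@size T2 s) in *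
  | _ : context [@size ?T1 ?s], _ : context [@size ?T2 ?s] |- _ =>
      tryif constr_eq T1 T2 then fail else change (@size T1 s) with (@size T2 s) in *
  | |- context [@size ?T1 ?s] => match goal with |- context [@size ?T2 ?s] =>
      tryif constr_eq T1 T2 then fail else change (@size T1 s) with (@size T2 s) in * end
  end.
Ltac slia := same_sizes; lia.

(** Monotone functions of polynomial growth. They are closed under sums, products and composition,
    so space bounds can be assembled without exhibiting polynomials. *)
Record pfun := PFun {
  pf :> nat -> nat;
  pfP : exists c, forall n, pf n <= c * n.+1 ^ c;
  pf_homo : {homo pf : m n / m <= n} }.

Lemma pcstP k : exists c, forall n, (fun=> k) n <= c * n.+1 ^ c.
Proof. by exists k => n; rewrite leq_pmulr // expn_gt0. Qed.
Definition pcst k : pfun := @PFun (fun=> k) (pcstP k) (fun _ _ _ => leqnn k).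
Lemma pidP : exists c, forall n, id n <= c * n.+1 ^ c.
Proof. by exists 1 => n; rewrite mul1n expn1 /=. Qed.
Definition pid : pfun := @PFun id pidP (fun _ _ h => h).
Lemma paddP (f g : pfun) : exists c, forall n, f n + g n <= c * n.+1 ^ c.
Proof.
have [c hc] := pfP f; have [d hd] := pfP g; exists (c + d) => n.
rewrite mulnDl; apply: leq_add; [apply: leq_trans (hc n) _|apply: leq_trans (hd n) _].
  by rewrite leq_mul2l leq_pexp2l ?leq_addr ?orbT.
by rewrite leq_mul2l leq_pexp2l ?leq_addl ?orbT.
Qed.
Definition padd (f g : pfun) : pfun :=
  PFun (paddP f g) (fun m n h => leq_add (pf_homo f h) (pf_homo g h)).
Lemma pmulP (f g : pfun) : exists c, forall n, f n * g n <= c * n.+1 ^ c.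
Proof.
have [c hc] := pfP f; have [d hd] := pfP g; exists (c * d + c + d) => n.
apply: leq_trans (leq_mul (hc n) (hd n)) _.
rewrite mulnACA -expnD; apply: leq_mul; first by rewrite -addnA leq_addr.
by rewrite leq_pexp2l // -addnA leq_addl.
Qed.
Definition pmul (f g : pfun) : pfun :=
  PFun (pmulP f g) (fun m n h => leq_mul (pf_homo f h) (pf_homo g h)).
Lemma leq_exp_base a b c : a <= b -> a ^ c <= b ^ c.
Proof. by move=> h; elim: c => // c IH; rewrite !expnS leq_mul. Qed.
Lemma pcompP (f g : pfun) : exists c, forall n, f (g n) <= c * n.+1 ^ c.
Proof.
have [c hc] := pfP f; have [d hd] := pfP g; exists (c * d.+1 ^ c + d * c) => n.
apply: leq_trans (hc _) _.
have h : (g n).+1 <= d.+1 * n.+1 ^ d.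
  by rewrite mulSn -add1n leq_add ?expn_gt0.
apply: (@leq_trans (c * (d.+1 ^ c * n.+1 ^ (d * c)))).
  by rewrite leq_mul2l expnM -expnMn leq_exp_base ?orbT.
rewrite mulnA; apply: leq_mul; first exact: leq_addr.
by rewrite leq_pexp2l // leq_addl.
Qed.
Definition pfcomp (f g : pfun) : pfun :=
  PFun (pcompP f g) (fun m n h => pf_homo f (pf_homo g h)).

Section Eval.
Variables (A : finType) (G : groupType) (gen : A -> G).
Lemma eval0 : eval gen [::] = 1%g. Proof. exact: big_nil. Qed.
Lemma eval_cons x w : eval gen (x :: w) = (eval_letter gen x * eval gen w)%g.
Proof. exact: big_cons. Qed.
Lemma eval_cat u v : eval gen (u ++ v) = (eval gen u * eval gen v)%g.
Proof. exact: big_cat. Qed.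
Lemma eval1 x : eval gen [:: x] = eval_letter gen x.
Proof. by rewrite eval_cons eval0 mulg1. Qed.
Lemma eval_inv_letter x : eval_letter gen (inv_letter x) = ((eval_letter gen x)^-1)%g.
Proof. by case: x => a []; rewrite /eval_letter /= ?invgK. Qed.
Lemma eval_inv w : eval gen (inv_word w) = ((eval gen w)^-1)%g.
Proof.
elim: w => [|x w IH]; first by rewrite eval0 invg1.
by rewrite inv_word_cons eval_cat IH eval1 eval_cons invgM eval_inv_letter.
Qed.
Lemma eval_relator u v : eval gen (relator u v) = 1%g <-> eval gen u = eval gen v.
Proof. by rewrite eval_cat eval_inv; split=> [/eqP|->]; [move=> /eqP E; rewrite -(mulgVK (eval gen v) (eval gen u)) E mul1g|rewrite mulgV]. Qed.
Lemma eval_eq1 (l : pred A) (w : word A) : (forall a, l a -> gen a = 1%g) -> all (fun x : letter A => l x.1) w -> eval gen w = 1%g.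
Proof.
move=> h; elim: w => [_|x w IH /= /andP[/h hx /IH E]]; first exact: eval0.
by rewrite eval_cons E mulg1 /eval_letter hx; case: x.2; rewrite ?invg1.
Qed.
End Eval.

Lemma all_inv (A : finType) (l : pred A) w :
  all (fun x : letter A => l x.1) (inv_word w) = all (fun x : letter A => l x.1) w.
Proof. by rewrite /inv_word all_rev all_map. Qed.

Section Commute.
Variables (A : finType) (R : seq (word A)).
Notation der := (der R).
Notation pos a := ((a, false) : letter A).
Variables l1 l2 : pred A.
Hypothesis comm : forall a b, l1 a -> l2 b -> relator [:: pos a; pos b] [:: pos b; pos a] \in R.
Notation on1 w := (all (fun x : letter A => l1 x.1) w).
Notation on2 w := (all (fun x : letter A => l2 x.1) w).
Lemma comm_letter (x y : letter A) : l1 x.1 -> l2 y.1 -> der 20 [:: y; x] [:: x; y].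
Proof.
case: x y => a d [b d'] /= ha hb.
have h1 : der 8 ([:: pos b] ++ [:: pos a]) ([:: pos a] ++ [:: pos b]).
  exact: der_sym (der_relE (comm ha hb)).
have h2 : der 12 ([:: (b, d')] ++ [:: pos a]) ([:: pos a] ++ [:: (b, d')]).
  by case: d'; [apply: (der_pass_inv h1); rewrite /=; slia|apply: der_mono h1].
case: d; last by apply: der_mono h2.
have h3 := der_sym h2; have := der_pass_inv h3 (leqnn _); rewrite /inv_word /= => h4.
by apply: der_sym; apply: der_mono h4.
Qed.
Lemma comm_letter_word (y : letter A) (p : word A) : l2 y.1 -> on1 p -> der (20 + size p) (y :: p) (p ++ [:: y]).
Proof.
move=> hy; elim: p => [_|x p IH /= /andP[hx hp]]; first by apply: der_refl; rewrite /=.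
apply: (der_trans (b := x :: y :: p)).
  by apply: (der_catl (Y := p) (comm_letter hx hy)); slia.
by apply: (der_catr (X := [:: x]) (IH hp)); rewrite /=; slia.
Qed.
Lemma comm_word (p q : word A) : on1 p -> on2 q -> der (20 + size p + size q) (q ++ p) (p ++ q).
Proof.
move=> hp; elim: q => [_|y q IH /= /andP[hy hq]]; first by rewrite cats0; apply: der_refl; rewrite /=; slia.
apply: (der_trans (b := y :: p ++ q)); first by apply: (der_catr (X := [:: y]) (IH hq)); rewrite /=; slia.
have := der_catl (Y := q) (comm_letter_word hy hp) (leqnn _).
by rewrite -catA /= => h; apply: der_mono h; slia.
Qed.
End Commute.

(* The HNN extension of P1 x P2 in which the stable letter conjugates (d, 1) to
   (d, psi d), psi being a homomorphism with graph Psi from a subgroup of P1 to RewritingCalculus. *)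
Section GraphIso.
Variables (P1 P2 : groupType) (Psi : P1 -> P2 -> Prop).
Hypothesis Psi1 : Psi 1%g 1%g.
Hypothesis PsiM : forall a b c d, Psi a b -> Psi c d -> Psi (a * c)%g (b * d)%g.
Hypothesis PsiV : forall a b, Psi a b -> Psi (a^-1)%g (b^-1)%g.
Hypothesis Psi_fun : forall b, Psi 1%g b -> b = 1%g.
Definition graph_iso (_ : unit) (a b : P1 * P2) : Prop :=
  [/\ a.2 = 1%g, b.1 = a.1 & Psi a.1 b.2].
Lemma graph_isoP j : partial_iso (graph_iso j).
Proof.
split.
- by split.
- by case=> a a' [b b'] [c c'] [d d'] [/= -> -> h] [/= -> -> h']; split; [exact: mulg1|by []|exact: PsiM h h'].
- by case=> a a' [b b'] [/= -> -> h]; split; [exact: invg1|by []|exact: PsiV h].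
case=> a a' [b b'] [/= -> -> h]; split=> -[]; first by move=> e; move: h; rewrite e => /Psi_fun ->.
by move=> -> _.
Qed.
Lemma Psi_eq a b c : Psi a b -> Psi a c -> b = c.
Proof.
move=> h h'; have := PsiM h (PsiV h'); rewrite mulgV => /Psi_fun E.
by rewrite -(mulgVK c b) E mul1g.
Qed.
Definition ghnn : groupType := hnn graph_iso.
End GraphIso.

Section GraphHNN.
Variables (A : finType) (R : seq (word A)) (P1 P2 : groupType) (Psi : P1 -> P2 -> Prop).
Hypothesis Psi1 : Psi 1%g 1%g.
Hypothesis PsiM : forall a b c d, Psi a b -> Psi c d -> Psi (a * c)%g (b * d)%g.
Hypothesis PsiV : forall a b, Psi a b -> Psi (a^-1)%g (b^-1)%g.
Hypothesis Psi_fun : forall b, Psi 1%g b -> b = 1%g.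
Notation iso := (graph_isoP Psi1 PsiM PsiV Psi_fun).
Notation der := (der R).
Notation red := (red R).
Notation pos a := ((a, false) : letter A).
Variables (l1 l2 : pred A) (e : A) (g1 : A -> P1) (g2 : A -> P2).
Notation on1 w := (all (fun x : letter A => l1 x.1) w).
Notation on2 w := (all (fun x : letter A => l2 x.1) w).
Hypothesis l1e : ~~ l1 e.
Hypothesis l2e : ~~ l2 e.
Hypothesis g1_2 : forall a, l2 a -> g1 a = 1%g.
Hypothesis g2_1 : forall a, l1 a -> g2 a = 1%g.
Definition ggen (a : A) : ghnn Psi := if a == e then hstable iso tt else hbase iso (g1 a, g2 a).
Lemma ggen_base (w : word A) : all (fun x : letter A => x.1 != e) w -> eval ggen w = hbase iso (eval g1 w, eval g2 w).
Proof.
elim: w => [_|[a d] w IH /= /andP[/negPf h /IH E]]; first by rewrite !eval0 hbase1.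
rewrite !eval_cons E -[RHS]/(hbase iso ((eval_letter g1 (a, d), eval_letter g2 (a, d)) * (eval g1 w, eval g2 w))).
by rewrite hbaseM; congr (_ * _)%g; rewrite /eval_letter /ggen /= h; case: d => //; rewrite -hbaseV.
Qed.
Hypothesis comm : forall a b, l1 a -> l2 b -> relator [:: pos a; pos b] [:: pos b; pos a] \in R.
Variables f1 f2 fy : pfun.
Hypothesis h1 : forall w, on1 w -> eval g1 w = 1%g -> red (f1 (size w)) w.
Hypothesis h2 : forall w, on2 w -> eval g2 w = 1%g -> red (f2 (size w)) w.
(** An effective form of [Psi]: for a word [w] in its domain, the image has a word [y] of polynomial
    length, and [e^-1 w e = w y] is derivable in polynomial space. *)
Hypothesis hy : forall w q, on1 w -> Psi (eval g1 w) q -> exists y,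
  [/\ on2 y, size y <= fy (size w), eval g2 y = q &
     der (fy (size w)) ((e, true) :: w ++ [:: pos e]) (w ++ y)].

Notation bel := (word A * word A)%type.
Notation bseq := (seq (bel * (unit * bool))).
Definition bval (b : bel) : P1 * P2 := (eval g1 b.1, eval g2 b.2).
Definition bmul (b b' : bel) : bel := (b.1 ++ b'.1, b.2 ++ b'.2).
Definition bw (b : bel) := b.1 ++ b.2.
Definition okb (b : bel) := on1 b.1 && on2 b.2.
Definition gw (s : bseq) (k : bel) : word A :=
  flatten [seq bw x.1 ++ [:: (e, x.2.2)] | x <- s] ++ bw k.
Definition okg (s : bseq) k := all (fun x => okb x.1) s && okb k.
Definition tot1 (s : bseq) (k : bel) := sumn [seq size x.1.1 | x <- s] + size k.1.
Definition tot2 (s : bseq) (k : bel) := sumn [seq size x.1.2 | x <- s] + size k.2.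
Lemma bvalM b b' : bval (bmul b b') = (bval b * bval b')%g.
Proof. by rewrite /bval /= !eval_cat. Qed.
Lemma gw_cons x s k : gw (x :: s) k = bw x.1 ++ [:: (e, x.2.2)] ++ gw s k.
Proof. by rewrite /gw /= -!catA. Qed.
Lemma gw_cat s s' k : gw (s ++ s') k = flatten [seq bw x.1 ++ [:: (e, x.2.2)] | x <- s] ++ gw s' k.
Proof. by rewrite /gw map_cat flatten_cat -catA. Qed.
Lemma tot1_cons x s k : tot1 (x :: s) k = size x.1.1 + tot1 s k.
Proof. by rewrite /tot1 /= addnA. Qed.
Lemma tot2_cons x s k : tot2 (x :: s) k = size x.1.2 + tot2 s k.
Proof. by rewrite /tot2 /= addnA. Qed.
Lemma size_gw s k : size (gw s k) = tot1 s k + tot2 s k + size s.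
Proof.
elim: s => [|x s IH]; first by rewrite /gw /tot1 /tot2 /bw /= size_cat addn0.
rewrite gw_cons (size_cat (bw _)) (size_cat [:: _]) IH tot1_cons tot2_cons /bw size_cat /=; move: (size x.1.1) (size x.1.2) (tot1 s k) (tot2 s k) (size s); clear; lia.
Qed.
Lemma tot1_cat s s' k : tot1 (s ++ s') k = sumn [seq size x.1.1 | x <- s] + tot1 s' k.
Proof. by rewrite /tot1 map_cat sumn_cat addnA. Qed.
Lemma tot2_cat s s' k : tot2 (s ++ s') k = sumn [seq size x.1.2 | x <- s] + tot2 s' k.
Proof. by rewrite /tot2 map_cat sumn_cat addnA. Qed.

Lemma gw_lmul b s k (r := lmul bmul b s k) : okb b -> okg s k ->
  [/\ okg r.1 r.2, size r.1 = size s, tot1 r.1 r.2 = size b.1 + tot1 s k,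
      tot2 r.1 r.2 = size b.2 + tot2 s k &
      der (20 + size (bw b) + size (gw s k)) (bw b ++ gw s k) (gw r.1 r.2)].
Proof.
have key k1 : okb b -> okb k1 -> okb (bmul b k1) /\
    der (20 + size (bw b) + size (bw k1)) (bw b ++ bw k1) (bw (bmul b k1)).
  move=> /andP[ob1 ob2] /andP[ok1 ok2]; split; first by rewrite /okb /= !all_cat ob1 ob2 ok1 ok2.
  have := der_in (X := b.1) (Y := k1.2) (comm_word comm ok1 ob2) (leqnn _).
  rewrite /bw /= -!catA => d; apply: der_mono d; rewrite !size_cat; slia.
rewrite {}/r; case: s => [|[k1 l] s] ob; rewrite /okg /=.
  move=> /(key k ob)[o d]; split=> //; rewrite ?/tot1 ?/tot2 /= ?size_cat //; slia.
case/andP=> /andP[ok1 os] ok; have [o d] := key k1 ob ok1; split=> //.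
- by rewrite /= o os ok.
- by rewrite /tot1 /= size_cat !addnA.
- by rewrite /tot2 /= size_cat !addnA.
rewrite !gw_cons /= catA; apply: der_catl d _.
by rewrite size_cat -!addnA.
Qed.

Lemma gw_word (w : word A) : all (fun x : letter A => [|| l1 x.1, l2 x.1 | x.1 == e]) w -> exists s k,
  [/\ okg s k, size s <= size w, tot1 s k <= size w, tot2 s k <= size w &
   hv iso bval s k = eval ggen w /\ der (20 + 3 * size w) w (gw s k)].
Proof.
elim: w => [_|x w IH /= /andP[hx hw]].
  exists [::], ([::], [::]); split=> //; split; last exact: der_refl.
  by rewrite eval0 /hv /= /bval /= !eval0 hbase1.
have [s [k [h ss t1 t2 [v d]]]] := IH hw.
have sg : size (gw s k) <= 3 * size w by rewrite size_gw; slia.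
have [ex|ne] := eqVneq x.1 e.
  exists ((([::], [::]), (tt, x.2)) :: s), k; split; rewrite ?/tot1 ?/tot2 /= ?ltnS //; try by rewrite ltnW.
  split; last by rewrite gw_cons /=; case: x {hx} ex => _ d' /= ->; apply: (der_catr (X := [:: _]) d); rewrite /=; slia.
  rewrite hv_cons v eval_cons; congr (_ * _)%g; rewrite /bval /= !eval0 hbase1 mul1g.
  by rewrite /eval_letter /ggen ex eqxx.
pose b : bel := if l1 x.1 then ([:: x], [::]) else ([::], [:: x]).
have ob : okb b.
  by rewrite /b /okb; case: ifP => //= hx1; rewrite ?hx1 //; move: hx; rewrite hx1 (negPf ne) orbF /= => ->.
have Eb : bw b = [:: x] by rewrite /b; case: ifP.
have [o ss' t1' t2' d'] := gw_lmul ob h.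
have sb1 : size b.1 <= 1 by rewrite /b; case: ifP.
have sb2 : size b.2 <= 1 by rewrite /b; case: ifP.
exists (lmul bmul b s k).1, (lmul bmul b s k).2; split=> //; rewrite ?ss' ?t1' ?t2' /=; try (clear -ss t1 t2 sb1 sb2; slia).
split.
  rewrite hv_lmul; last exact: bvalM.
  rewrite v eval_cons; congr (_ * _)%g; rewrite -(eval1 ggen) ggen_base /= ?ne //; congr (hbase _ (_, _)).
    by rewrite /b; case: ifP => //= hx1; rewrite eval0 (eval_eq1 g1_2) //=; move: hx; rewrite hx1 (negPf ne) orbF /= => ->.
  by rewrite /b; case: ifP => //= hx1; rewrite eval0 (eval_eq1 g2_1) //= hx1.
apply: (der_trans (b := bw b ++ gw s k)).
  by rewrite Eb; apply: (der_catr (X := [:: x]) d); rewrite /=; slia.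
by apply: der_mono d'; rewrite Eb /=; slia.
Qed.

Section Bounds.
Variables n N T : nat.
Hypothesis NT : 40 + 20 * (n + N + fy n) + f2 (N + fy n) + fy n <= T.

Lemma fyn m : m <= n -> fy m <= fy n. Proof. exact: pf_homo. Qed.

(* The P1-part of a pinched word survives while its P2-part changes by psi. *)
Lemma pinch_word b2 l : okb b2 -> size b2.1 <= n -> size b2.2 <= N -> dom (graph_iso Psi) (linv l) (bval b2) ->
  exists b, [/\ okb b, size b.1 = size b2.1, size b.2 <= fy n,
    (hletter iso l * hbase iso (bval b2) * hletter iso (linv l) = hbase iso (bval b))%g &
    der (f2 (N + fy n) + fy n + 3 * (n + N + fy n) + 20) ((e, l.2) :: bw b2 ++ [:: (e, ~~ l.2)]) (bw b)].
Proof.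
case: b2 => p q; rewrite /okb /= => /andP[op oq] sp sq [a].
have main x y : crosses (graph_iso Psi) (linv l) x y -> (hletter iso l * hbase iso x * hletter iso (linv l) = hbase iso y)%g.
  by move=> h; have := hletter_crosses iso h; rewrite hletterV -mulgA => ->; rewrite mulVKg.
move=> cr; case: l cr main => [[] []] /= cr main.
  case: (cr) => /= q1 a1 ha.
  have [y [oy sy ey dy]] := hy op ha; have sy' := leq_trans sy (fyn sp).
  exists (p, y); split; rewrite //= ?op //.
    by rewrite (main _ _ cr) (surjective_pairing a) a1 /bval /= ey.
  apply: (der_trans (b := (e, true) :: p ++ [:: pos e])).
    have dq : der (f2 (N + fy n) + N) q [::].
      apply: (@red_der _ _ (f2 (size q))); first by rewrite /inv_word /= cats0; apply: h2.
      rewrite addn0; apply: leq_add => //; apply: pf_homo; slia.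
    have := der_in (X := (e, true) :: p) (Y := [:: pos e]) dq (leqnn _); rewrite /bw /= -catA => d.
    by apply: der_mono d; slia.
  by apply: der_mono dy; have := fyn sp; slia.
case: (cr) => /= a2 q1 ha; rewrite -q1 in ha.
have [y [oy sy ey dy]] := hy op ha; have sy' := leq_trans sy (fyn sp).
exists (p, [::]); split; rewrite //= ?op //.
  by rewrite (main _ _ cr) (surjective_pairing a) -q1 a2 /bval /= eval0.
have dq : der (f2 (N + fy n) + N + fy n) q y.
  apply: (@red_der _ _ (f2 (N + fy n))); last by slia.
  apply: (red_mono (s := f2 (size (q ++ inv_word y)))).
    by apply: pf_homo; rewrite size_cat size_inv_word; slia.
  apply: h2; first by rewrite all_cat oq all_inv.
  by rewrite eval_cat eval_inv ey mulgV.
rewrite /bw /= cats0.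
apply: (der_trans (b := [:: pos e] ++ (p ++ y) ++ [:: (e, true)])).
  have := der_in (X := pos e :: p) (Y := [:: (e, true)]) dq (leqnn _); rewrite /= -!catA => d.
  by apply: der_mono d; slia.
apply: (der_trans (b := [:: pos e] ++ ((e, true) :: p ++ [:: pos e]) ++ [:: (e, true)])).
  by apply: der_in (der_sym dy) _; rewrite /=; have := fyn sp; slia.
apply: (der_trans (b := p ++ [:: pos e; (e, true)])).
  have := der_catl (Y := p ++ [:: pos e; (e, true)]) (der_cancel R (pos e)) (leqnn _); rewrite /= -!catA => d.
  by apply: der_mono d; rewrite size_cat /=; slia.
by have := der_catr (X := p) (der_cancel R (pos e)) (leqnn _); rewrite cats0 => d; apply: der_mono d; slia.
Qed.

Lemma graph_base s k : okg s k -> tot1 s k <= n -> tot2 s k + size s * fy n <= N ->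
  hv iso bval s k = 1%g -> pinchfree (graph_iso Psi) (fmap bval s) -> red (T + f1 n) (gw s k).
Proof.
move=> o t1 t2 v pf; have [Es [e1 e2]] := britton v pf; have {}Es : s = [::] by case: (s) Es.
  subst s; case/andP: o => _ /andP[ok1 ok2]; rewrite /tot1 /tot2 /= in t1 t2.
  have t1' : size k.1 <= n := t1. have t2' : size k.2 <= N by move: t2; rewrite add0n mul0n addn0.
  apply: (@red_der_trans _ _ _ _ k.1); last by apply: red_mono (h1 ok1 e1); have := pf_homo f1 t1'; lia.
  have dq : der (f2 N + N) k.2 [::].
    apply: (@red_der _ _ (f2 (size k.2))); first by rewrite /inv_word /= cats0; apply: h2.
    have : f2 (size k.2) <= f2 N by apply: pf_homo; lia.
    by rewrite /=; lia.
  have := der_catr (X := k.1) dq (leqnn _); rewrite cats0 => d; apply: der_mono d.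
  have : f2 N <= f2 (N + fy n) by apply: pf_homo; lia.
  by lia.
Qed.

(** The total length of the first components never changes, while a pinch adds at most [fy n] to
    that of the second ones and removes two stable letters. Hence [tot2 s k + size s * fy n] does
    not grow. *)
Lemma graph_contract m s k : size s <= m -> okg s k -> tot1 s k <= n -> size s <= n ->
  tot2 s k + size s * fy n <= N -> hv iso bval s k = 1%g -> red (T + f1 n) (gw s k).
Proof.
elim: m s k => [|m IH] s k sm o t1 sn t2 v;
  (have [pf|np] := pselect (pinchfree (graph_iso Psi) (fmap bval s)); first exact: graph_base).
- by move: sm np; case: (s) => // _ [].
- have [s1 [b1 [l [b2 [s2 [E d]]]]]] := hv_pinch np.
  have eN : size s = size s1 + (size s2).+2 by rewrite E size_cat.
  have eT1 : tot1 s k = sumn [seq size x.1.1 | x <- s1] + (size b1.1 + (size b2.1 + tot1 s2 k)).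
    by rewrite E tot1_cat /tot1 /= !addnA.
  have eT2 : tot2 s k = sumn [seq size x.1.2 | x <- s1] + (size b1.2 + (size b2.2 + tot2 s2 k)).
    by rewrite E tot2_cat /tot2 /= !addnA.
  move: (o); rewrite E /okg all_cat /= => /andP[/andP[os1 /andP[ob1 /andP[ob2 os2]]] ok].
  have [||b [ob sb1 sb2 vb db]] := pinch_word ob2 _ _ d; [by lia|by lia|].
  have o2 : okg s2 k by rewrite /okg os2.
  have [o3 n3 p3 q3 d3] := gw_lmul ob o2; have v3 := hv_lmul iso bvalM b s2 k.
  move: (lmul bmul b s2 k) o3 n3 p3 q3 d3 v3 => r3 o3 n3 p3 q3 d3 v3.
  have [o4 n4 p4 q4 d4] := gw_lmul ob1 o3; have v4 := hv_lmul iso bvalM b1 r3.1 r3.2.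
  move: (lmul bmul b1 r3.1 r3.2) o4 n4 p4 q4 d4 v4 => r4 o4 n4 p4 q4 d4 v4.
  have u1 : tot1 (s1 ++ r4.1) r4.2 = tot1 s k by rewrite eT1 tot1_cat p4 p3 sb1.
  have u2 : tot2 (s1 ++ r4.1) r4.2 <= tot2 s k + fy n.
    rewrite eT2 tot2_cat q4 q3; move: sb2; clear; move: (size b.2) (sumn _) (tot2 _ _) (size b1.2) (size b2.2) (fy n) => *; lia.
  have u3 : size (s1 ++ r4.1) + 2 = size s by rewrite size_cat n4 n3 eN; move: (size s1) (size s2); clear; lia.
  have sg : size (gw s k) <= n + N + n by rewrite size_gw; move: t1 t2 sn; clear; move: (tot1 _ _) (tot2 _ _) (size s) (_ * _) => *; lia.
  have sE : size (gw s k) = size (flatten [seq bw x.1 ++ [:: (e, x.2.2)] | x <- s1]) +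
      (size (bw b1) + (1 + (size (bw b2) + (1 + size (gw s2 k))))).
    by rewrite E gw_cat !gw_cons size_cat (size_cat (bw b1)) (size_cat [:: _]) (size_cat (bw b2)) (size_cat [:: _]).
  have sb : size (bw b) <= n + fy n.
    by rewrite /bw size_cat sb1; move: t1 sb2; rewrite eT1; clear; move: (size b.2) (sumn _) (tot1 _ _) (size b1.1) (size b2.1) (fy n) => *; lia.
  have fyN : fy n <= N.
    by move: t2; rewrite eN; clear; move: (tot2 _ _) (size _) (size _) => x y z; rewrite addnS mulSn; move: (_ * _) => *; lia.
  apply: (@red_der_trans _ _ _ _ (gw (s1 ++ r4.1) r4.2)).
    rewrite gw_cat (gw_cat _ r4.1) !gw_cons; move: sE; move: (flatten _) => F sE.
    have [_ sr3] := der_size d3.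
    move: (size (gw s k)) sE sg => z sE sg.
    apply: (der_trans (b := (F ++ bw b1) ++ bw b ++ gw s2 k)).
      have := der_in (X := F ++ bw b1) (Y := gw s2 k) db (leqnn _); rewrite /= -!catA /= => dd.
      by apply: der_mono dd; rewrite (size_cat F (bw b1)); move: NT sb sg sE; move: (fy n) (f2 _); clear => *; slia.
    apply: (der_trans (b := (F ++ bw b1) ++ gw r3.1 r3.2)).
      by apply: der_catr d3 _; rewrite (size_cat F (bw b1)); move: NT sb sg sE; move: (fy n) (f2 _); clear => *; slia.
    by rewrite -catA; apply: der_catr d4 _; move: NT sb sg sE sr3; move: (fy n) (f2 _); clear => *; slia.
  apply: IH => //; [by clear -u3 sm; slia| |by rewrite u1|by clear -u3 sn; slia| |].
  - by rewrite /okg all_cat os1.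
  - apply: leq_trans t2; rewrite -u3 mulnDl; move: u2; move: (size _) (tot2 _ _) (tot2 _ _) (fy n); clear => *; lia.
  move: v; rewrite E !hv_cat => <-; congr (_ * _)%g.
  rewrite v4 v3.
  by rewrite !hv_cons -vb !mulgA.
Qed.
End Bounds.

Theorem graph_space : exists F : pfun, forall w : word A,
  all (fun x : letter A => [|| l1 x.1, l2 x.1 | x.1 == e]) w -> eval ggen w = 1%g -> red (F (size w)) w.
Proof.
pose N := padd pid (pmul pid fy).
pose T := padd (padd (padd (pcst 40) (pmul (pcst 20) (padd (padd pid N) fy))) (pfcomp f2 (padd N fy))) fy.
exists (padd (padd T f1) (padd (pcst 20) (pmul (pcst 3) pid))) => w hw v.
have [s [k [o ss t1 t2 [v' d]]]] := gw_word hw.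
apply: (@red_der_trans _ _ _ _ (gw s k)); first by apply: der_mono d; rewrite /=; lia.
apply: (red_mono (s := T (size w) + f1 (size w))); first by rewrite /=; lia.
apply: (@graph_contract (size w) (N (size w)) (T (size w)) _ (size s)) => //; last by rewrite v'.
by rewrite /=; apply: leq_add => //; rewrite leq_mul2r ss orbT.
Qed.
End GraphHNN.
End GraphExtension.
Import GraphExtension.

(** * A polynomial space bound for the rule group *)

Module RuleGroupWords.
Import GRing.Theory.

Section RuleGroupWords.
Variables (C L A : finType) (R : seq (word A)).
Notation vec := {ffun C -> int}.
Notation der := (der R).
Notation red := (red R).
Variables (gx : C -> A) (gt : A) (gl : L -> A) (dbl : C -> L).
Variables (ra rc : L -> vec) (rm rn : L -> C -> nat).
Notation vecw := (vecw gx gl dbl).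
Notation conjw := (conjw gx gt gl dbl).
Notation stw := (stw gl).
Notation pos a := ((a, false) : letter A).
Notation src := (src ra rc rm rn).
Notation src0 := (src0 rm rn).
Notation tw := (tw gx gt gl dbl).
Notation kw := (kw gx gt gl dbl).
Notation sw := (sw gx gt gl dbl).
Notation tsize := Contraction.tsize.
Variable (M j0 : nat).
Hypotheses (rmM : forall l i, rm l i <= M) (rnM : forall l i, rn l i <= M).
Hypothesis rmn : forall l i, (rm l i == 0%N) = (rn l i == 0%N).
Hypotheses (raS : forall l, small j0 (ra l)) (rcS : forall l, small j0 (rc l)).
Hypotheses (rm_dbl : forall i, rm (dbl i) i = 1) (rn_dbl : forall i, rn (dbl i) i = 2).
Hypothesis M1 : 1 <= M.
Notation iso := (@rule_isoP C L ra rc rm rn rmn).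
Notation rbase := (hbase iso).
Notation rletter := (hletter iso).
Notation rgroup := (rgroup ra rc rm rn).
Variable g1 : A -> rgroup.
Definition dlt (i : C) (z : int) : vec := [ffun k => if k == i then z else 0%R].
Hypothesis g1x : forall i, g1 (gx i) = rbase (kvec (dlt i 1)).
Hypothesis g1t : g1 gt = rbase (@kt vec false).
Hypothesis g1l : forall l, g1 (gl l) = rletter (l, false).

Lemma dltD i y z : (dlt i y + dlt i z)%R = dlt i (y + z)%R.
Proof. by apply/ffunP => k; rewrite vaddE !ffunE; case: eqP; rewrite ?addr0. Qed.
Lemma dltN i z : (- dlt i z)%R = dlt i (- z)%R.
Proof. by apply/ffunP => k; rewrite !ffunE; case: eqP; rewrite ?oppr0. Qed.
Lemma dlt0 i : dlt i 0%R = 0%R.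
Proof. by apply/ffunP => k; rewrite !ffunE; case: eqP. Qed.
Lemma src0_dlt l i z : src0 l (dlt i z) = dlt i ((if l.2 then rn l.1 i else rm l.1 i)%:Z * z)%R.
Proof. by apply/ffunP => k; rewrite src0E !ffunE; case: eqP => [->|]; rewrite ?mulr0. Qed.

Lemma eval_stw l : eval g1 (stw l) = rletter l.
Proof. by case: l => l []; rewrite eval1 /eval_letter /= g1l // -hletterV. Qed.
Lemma eval_x i : eval g1 [:: pos (gx i)] = rbase (kvec (dlt i 1)).
Proof. by rewrite eval1 /eval_letter /= g1x. Qed.
Lemma eval_nseq i n : eval g1 (nseq n (pos (gx i))) = rbase (kvec (dlt i n)).
Proof.
elim: n => [|n IH]; first by rewrite eval0 dlt0 kvec0 hbase1.
by rewrite [nseq _ _]/= eval_cons -(eval1 g1) eval_x IH -hbaseM -kvecD dltD -intS.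
Qed.
Lemma vec_cross l v : (rbase (kvec (src0 l v)) * rletter l = rletter l * rbase (kvec (src0 (linv l) v)))%g.
Proof.
by apply: hletter_crosses; apply/rule_crosses; exists [::], v; rewrite /kval /= !mul1g.
Qed.
Lemma eval_binw i n : eval g1 (binw gx gl dbl i n) = rbase (kvec (dlt i n)).
Proof.
elim/ltn_ind: n => n IH; have [->|n0] := posnP n; first by rewrite binw0 eval0 dlt0 kvec0 hbase1.
rewrite binwE // eval_cons !eval_cat eval_cons eval_nseq IH; last by rewrite -divn2 ltn_Pdiv.
have -> : eval_letter g1 (gl (dbl i), true) = (rletter (dbl i, false))^-1%g by rewrite /eval_letter /= g1l.
have -> : eval_letter g1 (gl (dbl i), false) = rletter (dbl i, false) by rewrite /eval_letter /= g1l.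
have E : (rbase (kvec (dlt i n./2)) * rletter (dbl i, false) = rletter (dbl i, false) * rbase (kvec (dlt i (n./2).*2)))%g.
  have := vec_cross (dbl i, false) (dlt i n./2); rewrite !src0_dlt /= rm_dbl rn_dbl mul1r => ->.
  by rewrite -PoszM mul2n.
rewrite (mulgA (rbase _)) E -!mulgA mulKg -hbaseM -kvecD dltD -PoszD.
by rewrite addnC odd_double_half.
Qed.
Lemma eval_intw i z : eval g1 (intw gx gl dbl i z) = rbase (kvec (dlt i z)).
Proof. by case: z => n; rewrite /intw ?eval_inv eval_binw // -hbaseV -kvecN dltN. Qed.
Lemma eval_vecw v : eval g1 (vecw v) = rbase (kvec v).
Proof.
rewrite /WordArithmetic.vecw.
have -> : v = (\sum_(i <- enum C) dlt i (v i))%R.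
  apply/ffunP => k; rewrite sum_ffunE big_enum /= (bigD1 k) //= ffunE eqxx big1 ?addr0 // => i ne.
  by rewrite ffunE eq_sym (negPf ne).
move: (fun i => v i) => f.
have -> : [seq intw gx gl dbl i ((\sum_(i <- enum C) dlt i (v i))%R i) | i <- enum C] = [seq intw gx gl dbl i (v i) | i <- enum C].
  apply: eq_map => k; congr intw.
  rewrite sum_ffunE big_enum /= (bigD1 k) //= ffunE eqxx big1 ?addr0 // => i ne.
  by rewrite ffunE eq_sym (negPf ne).
elim: (enum C) => [|i r IH] /=; first by rewrite big_nil eval0 kvec0 hbase1.
by rewrite eval_cat eval_intw IH big_cons kvecD hbaseM.
Qed.
Lemma eval_conjw g e : eval g1 (conjw g e) = rbase (tconj (g, e)).
Proof.
rewrite /WordArithmetic.conjw eval_cat eval_inv eval_cons eval_vecw /tconj /= !hbaseM kvecN hbaseV -mulgA; congr (_ * (_ * _))%g.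
by rewrite /eval_letter /= g1t; case: e; rewrite // -hbaseV -ktV.
Qed.
Lemma eval_relL l i :
  eval g1 (nseq (rm l i) (pos (gx i)) ++ [:: pos (gl l)]) = eval g1 (pos (gl l) :: nseq (rn l i) (pos (gx i))).
Proof.
rewrite eval_cat (eval_cons g1 _ (nseq _ _)) !eval_nseq -(eval1 g1) -/(stw (l, false)) eval_stw.
by have := vec_cross (l, false) (dlt i 1); rewrite !src0_dlt /= !mulr1.
Qed.
Lemma eval_relT l :
  eval g1 (conjw (ra l) false ++ [:: pos (gl l)]) = eval g1 (pos (gl l) :: conjw (rc l) false).
Proof.
rewrite (eval_cat g1 (conjw _ _)) (eval_cons g1 _ (conjw _ _)) !eval_conjw -(eval1 g1) -/(stw (l, false)) eval_stw.
apply: hletter_crosses; apply/rule_crosses; exists [:: (0%R, false)], 0%R.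
rewrite !src00 /kval kvec0 !mulg1 /= /src /= /aff.
have s0 m : scale m (0%R : vec) = 0%R by apply/ffunP => k; rewrite !ffunE mulr0.
by rewrite !s0 !addr0 !mulg1.
Qed.
Lemma eval_relX i j : eval g1 [:: pos (gx i); pos (gx j)] = eval g1 [:: pos (gx j); pos (gx i)].
Proof.
have h a b : eval g1 [:: pos (gx a); pos (gx b)] = rbase (kvec (dlt a 1 + dlt b 1)%R).
  by rewrite (eval_cat g1 [:: _] [:: _]) !eval_x -hbaseM -kvecD.
by rewrite !h addrC.
Qed.

Hypothesis relX : forall i j, relator [:: pos (gx i); pos (gx j)] [:: pos (gx j); pos (gx i)] \in R.
Hypothesis relL : forall l i,
  relator (nseq (rm l i) (pos (gx i)) ++ [:: pos (gl l)]) (pos (gl l) :: nseq (rn l i) (pos (gx i))) \in R.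
Hypothesis relT : forall l,
  relator (conjw (ra l) false ++ [:: pos (gl l)]) (pos (gl l) :: conjw (rc l) false) \in R.
Variable l1 : pred A.
Hypothesis l1P : forall a, l1 a -> [\/ exists i, a = gx i, a = gt | exists l, a = gl l].
Hypotheses (l1x : forall i, l1 (gx i)) (l1t : l1 gt) (l1l : forall l, l1 (gl l)).
Notation on1 w := (all (fun x : letter A => l1 x.1) w).

Definition wof : pfun :=
  padd (padd (padd (pmul (pcst 3) pid) (pcst 20)) (pcst (8 * M))) (pmul (pcst #|C|) (pmul (pcst 3) pid)).
Definition uof : pfun := padd (pmul (pcst 2) wof) (pcst 2).
Lemma wof1 b : 3 * b + 20 + 8 * M <= wof b. Proof. by rewrite /wof /=; clear; lia. Qed.
Lemma wof2 b : #|C| * (3 * b) <= wof b. Proof. by rewrite /wof /=; clear; lia. Qed.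

Arguments wof : simpl never.
Lemma small_dlt (d : bool) i : small 1 (if d then (- dlt i 1)%R else dlt i 1).
Proof. by move=> k; case: d; rewrite ?dltN ffunE; case: eqP. Qed.
Lemma vecw_dlt i z : vecw (dlt i z) = intw gx gl dbl i z.
Proof.
rewrite /WordArithmetic.vecw.
have E r : uniq r -> flatten [seq intw gx gl dbl k (dlt i z k) | k <- r] = if i \in r then intw gx gl dbl i z else [::].
  elim: r => [//|k r IH] /= /andP[kr ur]; rewrite (IH ur) ffunE in_cons eq_sym.
  case: eqVneq => [->|ne]; first by rewrite (negPf kr) cats0.
  by rewrite (_ : intw gx gl dbl k 0 = [::]) //; apply: binw0.
by rewrite E ?enum_uniq // mem_enum.
Qed.

Lemma letter_kel b W (x : letter A) : 3 * b + 20 + 8 * M <= W -> #|C| * (3 * b) <= W -> 1 <= b -> l1 x.1 -> (exists l, x.1 = gl l) \/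
  exists k, [/\ ksmall 1 k, size k.1 <= 1, eval g1 [:: x] = rbase (kvl k) & der (1500 * W) [:: x] (kw k)].
Proof.
move=> w1 w2 b1 /l1P[[i E]|E|]; [right|right|by left]; case: x E => a d /= ->.
  exists ([::], if d then (- dlt i 1)%R else dlt i 1); split=> //.
  - split; [by []|exact: small_dlt].
  - by rewrite /kvl /kval /= mul1g -(@eval_vecw (if d then _ else _)); case: d; rewrite ?eval1 /eval_letter /= g1x eval_vecw // kvecN hbaseV.
  rewrite /Contraction.kw /=.
  have h1 : 0.+1 < 2 ^ b by apply: (@leq_trans (2 ^ 1)) => //; rewrite leq_exp2l.
  have d1 : der (W) [:: pos (gx i)] (vecw (dlt i 1)).
    rewrite vecw_dlt; have := binw_succ rm_dbl rn_dbl relL w1 w2 i h1.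
    by rewrite binw0.
  case: d; last by apply: der_mono d1; lia.
  have [s1 s2] := der_size d1.
  have d2 := der_inv d1 (leqnn _).
  have sd : small b (dlt i 1) by apply: small_le b1 _; exact: (small_dlt false i).
  have d3 := vecwN rm_dbl rn_dbl relX relL w1 w2 M1 sd.
  apply: (der_trans (b := inv_word (vecw (dlt i 1)))); last by apply: der_mono d3; lia.
  by apply: der_mono d2; move: s1 s2; rewrite /=; lia.
exists ([:: (0%R, d)], 0%R); split=> //.
- split; last exact: small0.
  by move=> y; rewrite inE => /eqP ->; apply: small0.
- rewrite /kvl /kval kvec0 mulg1 [tprod _]/= mulg1 /tconj /= oppr0 kvec0 mul1g mulg1 eval1 /eval_letter /= g1t.
  by case: d; rewrite // -hbaseV -ktV.
rewrite /Contraction.kw /Contraction.tw /= /WordArithmetic.conjw vecw0 !cats0 /=; apply: der_refl; rewrite /=; lia.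
Qed.

(** Prepending a letter [x_i] shifts indices by a unit vector only, so one binary digit per letter
    of [w] is enough. *)
Lemma word_kseq n b (w : word A) : on1 w -> size w <= n -> j0 + n.+1 <= b -> exists s k,
  [/\ ssmall (j0 + size w + 1) s k, size s <= size w, tsize s k <= size w,
      hv iso (@kvl C) s k = eval g1 w & der (3100 * wof b + (2 * n + 2) * (5 * uof b) + size w) w (sw s k)].
Proof.
move=> + + nb; elim: w => [_ _|x w IH]; last rewrite [all _ _]/= => /andP[hx hw] sn.
  exists [::], ([::], 0%R); split=> //.
  - by split=> //; split; [|apply: small0].
  - by rewrite eval0 /hv /= /kvl kval0 hbase1.
  by rewrite /Contraction.sw /Contraction.kw /= vecw0; apply: der_refl.
have {}sn : size w < n := sn.
rewrite (_ : size (x :: w) = (size w).+1) //.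
have [s [k [ss sz ts v d]]] := IH hw (ltnW sn); have e1 : size [:: x] = 1 by [].
have [_ sd] := der_size d.
have w1 := wof1 b; have w2 := wof2 b.
have ssw : size (sw s k) <= (2 * n + 1) * uof b.
  have := @sw_sz _ _ _ gx gt gl dbl _ _ _ w1 w2 M1 s k.
  have bb : j0 + size w + 1 <= b by slia.
  move=> /(_ (ssmall_le bb ss)) h; apply: leq_trans h _; rewrite -/(uof b) leq_mul2r; apply/orP; right; slia.
have [[l El]|[kx [skx szk ek dk]]] := letter_kel w1 w2 (ltac:(slia) : 1 <= b) hx.
  exists ((([::], 0%R), (l, x.2)) :: s), k; split; rewrite ?tsize_cons /= ?ltnS //; last first.
  - rewrite sw_cons /Contraction.kw /= vecw0 cat0s /WordArithmetic.stw /= -El -surjective_pairing.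
    by apply: (der_catr (X := [:: x]) d); rewrite e1 -addnA addn1.
  - rewrite hv_cons v eval_cons; congr (_ * _)%g; rewrite /kvl kval0 hbase1 mul1g -eval_stw eval1.
    by rewrite -El -surjective_pairing.
  - by rewrite ltnW.
  - apply/ssmall_cons; split; last by apply: ssmall_le ss; slia.
    by split; [|apply: small0].
have [|||dd h3 n3 z3] := @kw_lmul _ _ _ R gx gt gl dbl rm rn _ _ _ rm_dbl rn_dbl relX relL w1 w2 M1 (j0 + size w + 1) kx s k; rewrite ?ltnS //; try slia.
- by apply: ksmall_le skx; slia.
exists (lmul (@kmul C) kx s k).1, (lmul (@kmul C) kx s k).2; split.
- by apply: ssmall_le h3; slia.
- by rewrite n3; slia.
- by rewrite z3; slia.
- by rewrite hv_lmul ?v ?eval_cons -?ek ?eval1 //; apply: kvlM.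
apply: (der_trans (b := x :: sw s k)); first by apply: (der_catr (X := [:: x]) d); rewrite e1 -addnA addn1.
apply: (der_trans (b := kw kx ++ sw s k)).
  apply: (der_catl (Y := sw s k) dk); apply: leq_trans (leq_addr _ _); apply: leq_add; first by rewrite leq_mul2r orbT.
  by apply: leq_trans ssw _; apply: leq_mul; [rewrite leq_add2l|rewrite leq_pmull].
apply: der_mono dd; rewrite -/(uof b) -(addnA (3100 * _)); apply: leq_add; first by rewrite leq_mul2r orbT.
have q := leq_add (leq_add (leq_add szk (leq_trans ts (ltnW sn))) (leq_trans sz (ltnW sn))) (leqnn 1).
by apply: leq_trans (leq_addr _ _); rewrite leq_mul2r; apply/orP; right; apply: leq_trans q _; clear; lia.
Qed.

Theorem rule_group_space : exists f : pfun, forall w : word A, on1 w -> eval g1 w = 1%g -> red (f (size w)) w.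
Proof.
(* Digits to be provided: about [j0 + n] for the sequence that represents a word of length [n], and
   [M + 8] for each of at most [n] pinches. *)
pose b := padd (pcst (j0 + M + 20)) (pmul (pcst (M + 20)) pid).
pose W := pfcomp wof b; pose U := pfcomp uof b.
exists (padd (padd (padd (pmul (pcst 3100) W) (pmul (padd (pmul (pcst 2) pid) (pcst 2)) (pmul (pcst 5) U))) pid)
   (padd (pmul (padd (pmul (pcst 2) pid) (pcst 1)) (pmul (pcst 20) U)) (pmul (pcst 3000) W))) => w hw v.
have hb : j0 + (size w).+1 <= b (size w) by rewrite /=; nia.
have [s [k [ss sz ts vs d]]] := word_kseq hw (leqnn _) hb.
apply: (@red_der_trans _ _ _ _ (sw s k)); first by apply: der_mono d; exact: leq_addr.
have r : red (SP (wof (b (size w))) (tsize s k + size s + 1)) (sw s k).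
  have := @contract_seq _ _ _ R gx gt gl dbl ra rc rm rn _ _ _ j0 rmM rnM rmn raS rcS rm_dbl rn_dbl relX relL relT (wof1 _) (wof2 _) M1 (size w) (j0 + size w + 1) s k sz.
  by apply; [slia|rewrite /=; nia|exact: ss|rewrite vs].
apply: red_mono r; rewrite /SP; apply: leq_trans (leq_addl _ _); apply: leq_add; last by [].
by rewrite /U /= leq_mul2r; apply/orP; right; slia.
Qed.
End RuleGroupWords.
End RuleGroupWords.
Import RuleGroupWords.

(** * Computations as conjugations *)

Module ComputationPaths.
Import GRing.Theory.

Ltac wsz A := rewrite ?size_cat /=; repeat match goal with |- context [@size ?T ?s] =>
  tryif constr_eq T (Finite.sort (letter A)) then fail else change (@size T s) with (@size (Finite.sort (letter A)) s) end; lia.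

Section Contractibility.
Variables (A : finType) (R : seq (word A)).
Notation der := (der R).
Notation red := (red R).
Notation pos a := ((a, false) : letter A).
Notation neg a := ((a, true) : letter A).

(* a and b are contractible in the same spaces, from t on. *)
Definition ceq t (a b : word A) := forall s, t <= s -> red s a <-> red s b.
Lemma ceq_sym t a b : ceq t a b -> ceq t b a.
Proof. by move=> h s /h[h1 h2]; split. Qed.
Lemma ceq_trans t a b c : ceq t a b -> ceq t b c -> ceq t a c.
Proof. by move=> h h' s ts; split=> [/(h s ts)/(h' s ts)|/(h' s ts)/(h s ts)]. Qed.
Lemma ceq_der t a b : der t a b -> ceq t a b.
Proof.
move=> d s ts; split; apply: red_der_trans; apply: der_mono ts _ => //; exact: der_sym.
Qed.
Lemma ceq_in s t a b X Y : der s a b -> s + size X + size Y <= t ->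
  ceq t (X ++ a ++ Y) (X ++ b ++ Y).
Proof. by move=> d h; apply: ceq_der; apply: der_in d h. Qed.
Lemma ceq_shift t u v : size (u ++ v) <= t -> ceq t (u ++ v) (v ++ u).
Proof.
move=> h s ts; split; last exact: red_shift.
exact: red_shift.
Qed.

Lemma der_moveV s t a (x : letter A) b c : der s (a ++ [:: x]) ([:: x] ++ b ++ c) -> s + 4 <= t ->
  der t ([:: inv_letter x] ++ a ++ [:: x]) (b ++ c).
Proof.
move=> d h; apply: (der_trans (b := [:: inv_letter x] ++ [:: x] ++ b ++ c)).
  by apply: der_catr d _ => /=; lia.
have := der_catl (Y := b ++ c) (der_cancel R (inv_letter x)) (leqnn _); rewrite inv_letterK => d'.
have [_] := der_size d; rewrite /= => sz.
apply: der_mono d'; apply: leq_trans (leq_add (leqnn 2) (ltnW sz)) _; lia.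
Qed.

Variables (gs ge : A) (l : A) (c C c' C' v p x : word A) (n : nat).
Hypotheses (sc : size c <= n) (sC : size C <= n) (sc' : size c' <= n) (sC' : size C' <= n)
  (sv : size v <= n) (sp : size p <= 1) (sx : size x <= 1) (n1 : 100 <= n).
Hypotheses (d1 : der (700 * n) (c ++ [:: pos l]) ([:: pos l] ++ c'))
  (d2 : der (700 * n) (C ++ [:: pos l]) ([:: pos l] ++ C')).
Hypothesis ls : der 20 [:: pos l; pos gs] ([:: pos gs; pos l] ++ p).
Hypothesis lcomm : forall w, w = p ++ v ++ x ++ [:: neg ge] -> der (20 + size w + 1) ([:: pos l] ++ w) (w ++ [:: pos l]).
Hypothesis pv : der (20 + size p + size v) (p ++ v) (v ++ p).
Hypothesis Cp : der (20 + size C + size p) (C ++ inv_word p) (inv_word p ++ C).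
Hypothesis lp : der 100 ([:: pos l] ++ inv_word p ++ [:: neg l]) (inv_word p).
Hypothesis pe : der 20 (p ++ x ++ [:: neg ge]) ([:: neg ge] ++ p).

(** [c'] and [C'] are written as conjugates by [l]; the inner letters cancel and the outer ones are
    rotated away. Since cyclic shifts change the element but not its contractibility, the result is
    [ceq] and not [der]. Moving [l] across [s] leaves a factor [p], which absorbs the label [x] when
    it crosses [e^-1] and finally meets its inverse. *)
Lemma conj_step : ceq (1000 * n)
  ([:: neg gs] ++ c' ++ [:: pos gs] ++ (v ++ x) ++ [:: neg ge] ++ C')
  ([:: neg gs] ++ c ++ [:: pos gs] ++ v ++ [:: neg ge] ++ C).
Proof.
have e1 : der (700 * n + 4) ([:: neg l] ++ c ++ [:: pos l]) c'.
  by have := der_moveV (b := [::]) d1 (leqnn _).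
have e2 : der (700 * n + 4) ([:: neg l] ++ C ++ [:: pos l]) C'.
  by have := der_moveV (b := [::]) d2 (leqnn _).
have sp' := size_inv_word p.
have e3 : der 40 [:: neg gs; neg l] (inv_word p ++ [:: neg l; neg gs]).
  have := der_inv ls (leqnn _); rewrite inv_word_cat /inv_word /= => d.
  by apply: der_mono d; slia.
have T0 := ceq_in (X := [:: neg gs]) (Y := [:: pos gs] ++ (v ++ x) ++ [:: neg ge] ++ C') (der_sym e1) (t := 1000 * n).
have {}T0 := T0 ltac:(wsz A).
apply: (ceq_trans T0); rewrite -!catA.
have T1 := ceq_in (X := [::]) (Y := c ++ [:: pos l] ++ [:: pos gs] ++ v ++ x ++ [:: neg ge] ++ C') e3 (t := 1000 * n).
have {}T1 := T1 ltac:(wsz A).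
apply: (ceq_trans T1); rewrite -!catA.
have T2 := ceq_in (X := inv_word p ++ [:: neg l; neg gs] ++ c) (Y := v ++ x ++ [:: neg ge] ++ C') ls (t := 1000 * n).
have {}T2 := T2 ltac:(wsz A).
move: T2; rewrite -!catA => T2; apply: (ceq_trans T2).
have T3 := ceq_in (X := inv_word p ++ [:: neg l; neg gs] ++ c ++ [:: pos gs; pos l] ++ p ++ v ++ x ++ [:: neg ge]) (Y := [::]) (der_sym e2) (t := 1000 * n).
have {}T3 := T3 ltac:(wsz A).
move: T3; rewrite -!catA !cats0 => T3; apply: (ceq_trans T3).
have T4 := ceq_in (X := inv_word p ++ [:: neg l; neg gs] ++ c ++ [:: pos gs]) (Y := [:: neg l] ++ C ++ [:: pos l]) (lcomm erefl) (t := 1000 * n).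
have {}T4 := T4 ltac:(wsz A).
move: T4; rewrite -!catA => T4; apply: (ceq_trans T4).
have T5 := ceq_in (X := inv_word p ++ [:: neg l; neg gs] ++ c ++ [:: pos gs] ++ p ++ v ++ x ++ [:: neg ge]) (Y := C ++ [:: pos l]) (der_cancel R (pos l)) (t := 1000 * n).
have {}T5 := T5 ltac:(wsz A).
move: T5; rewrite -!catA => T5; apply: (ceq_trans T5); rewrite cat0s.
have T6 := ceq_shift (u := inv_word p ++ [:: neg l; neg gs] ++ c ++ [:: pos gs] ++ p ++ v ++ x ++ [:: neg ge] ++ C) (v := [:: pos l]) (t := 1000 * n).
have {}T6 := T6 ltac:(wsz A).
move: T6; rewrite -!catA => T6; apply: (ceq_trans T6).
have T7 := ceq_shift (u := [:: pos l] ++ inv_word p) (v := [:: neg l; neg gs] ++ c ++ [:: pos gs] ++ p ++ v ++ x ++ [:: neg ge] ++ C) (t := 1000 * n).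
have {}T7 := T7 ltac:(wsz A).
move: T7; rewrite -!catA => T7; apply: (ceq_trans T7).
have T8 := ceq_shift (u := [:: neg l]) (v := [:: neg gs] ++ c ++ [:: pos gs] ++ p ++ v ++ x ++ [:: neg ge] ++ C ++ [:: pos l] ++ inv_word p) (t := 1000 * n).
have {}T8 := T8 ltac:(wsz A).
apply: (ceq_trans T8); rewrite -!catA.
have T9 := ceq_in (X := [:: neg gs] ++ c ++ [:: pos gs]) (Y := x ++ [:: neg ge] ++ C ++ [:: pos l] ++ inv_word p ++ [:: neg l]) pv (t := 1000 * n).
have {}T9 := T9 ltac:(wsz A).
move: T9; rewrite -!catA => T9; apply: (ceq_trans T9).
have T10 := ceq_in (X := [:: neg gs] ++ c ++ [:: pos gs] ++ v) (Y := C ++ [:: pos l] ++ inv_word p ++ [:: neg l]) pe (t := 1000 * n).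
have {}T10 := T10 ltac:(wsz A).
move: T10; rewrite -!catA => T10; apply: (ceq_trans T10).
have T11 := ceq_in (X := [:: neg gs] ++ c ++ [:: pos gs] ++ v ++ [:: neg ge] ++ p ++ C) (Y := [::]) lp (t := 1000 * n).
have {}T11 := T11 ltac:(wsz A).
move: T11; rewrite -!catA !cats0 => T11; apply: (ceq_trans T11).
have T12 := ceq_in (X := [:: neg gs] ++ c ++ [:: pos gs] ++ v ++ [:: neg ge] ++ p) (Y := [::]) Cp (t := 1000 * n).
have {}T12 := T12 ltac:(wsz A).
move: T12; rewrite -!catA !cats0 => T12; apply: (ceq_trans T12).
have cw : der 2 (p ++ inv_word p) [::] by apply: der_cancelw; wsz A.
have T13 := ceq_in (X := [:: neg gs] ++ c ++ [:: pos gs] ++ v ++ [:: neg ge]) (Y := C) cw (t := 1000 * n).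
have {}T13 := T13 ltac:(wsz A).
by move: T13; rewrite -!catA.
Qed.
End Contractibility.

(* Configurations (g, v) linked by marked rules; v spells the labels of the path
   from 0 to g. *)
Inductive lpath (C L X : finType) (ra rc : L -> {ffun C -> int}) (rm rn : L -> C -> nat) (ml : pred L) (lab : L -> seq X)
    (j : nat) : {ffun C -> int} * seq X -> {ffun C -> int} * seq X -> Prop :=
| LRefl x : lpath ra rc rm rn ml lab j x x
| LSym x y : lpath ra rc rm rn ml lab j x y -> lpath ra rc rm rn ml lab j y x
| LTrans x y z : lpath ra rc rm rn ml lab j x y -> lpath ra rc rm rn ml lab j y z -> lpath ra rc rm rn ml lab j x z
| LStep l g g' v : ml l -> move ra rc rm rn (l, false) g g' -> small j g -> small j g' -> size v <= j ->
    lpath ra rc rm rn ml lab j (g, v) (g', v ++ lab l).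

Section MarkedPaths.
Variables (C L A X : finType) (R : seq (word A)).
Notation vec := {ffun C -> int}.
Notation der := (der R).
Notation red := (red R).
Variables (gx : C -> A) (gt : A) (gl : L -> A) (dbl : C -> L).
Variables (ra rc : L -> vec) (rm rn : L -> C -> nat).
Notation vecw := (vecw gx gl dbl).
Notation conjw := (conjw gx gt gl dbl).
Notation stw := (stw gl).
Notation pos a := ((a, false) : letter A).
Notation neg a := ((a, true) : letter A).
Notation src := (src ra rc rm rn).
Variable (M j0 : nat).
Hypotheses (rmM : forall l i, rm l i <= M) (rnM : forall l i, rn l i <= M).
Hypothesis rmn : forall l i, (rm l i == 0%N) = (rn l i == 0%N).
Hypotheses (raS : forall l, small j0 (ra l)) (rcS : forall l, small j0 (rc l)).
Hypotheses (rm_dbl : forall i, rm (dbl i) i = 1) (rn_dbl : forall i, rn (dbl i) i = 2).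
Hypothesis M1 : 1 <= M.
Hypothesis relX : forall i j, relator [:: pos (gx i); pos (gx j)] [:: pos (gx j); pos (gx i)] \in R.
Hypothesis relL : forall l i,
  relator (nseq (rm l i) (pos (gx i)) ++ [:: pos (gl l)]) (pos (gl l) :: nseq (rn l i) (pos (gx i))) \in R.
Hypothesis relT : forall l,
  relator (conjw (ra l) false ++ [:: pos (gl l)]) (pos (gl l) :: conjw (rc l) false) \in R.
Variable l1 : pred A.
Hypotheses (l1x : forall i, l1 (gx i)) (l1t : l1 gt) (l1l : forall l, l1 (gl l)).
Variables (gp gh : X -> A) (ge gs : A) (ml : pred L) (lab : L -> seq X) (ix : X -> X) (l2 : pred A).
Hypotheses (l2p : forall x, l2 (gp x)) (l2h : forall x, l2 (gh x)) (l2e : l2 ge).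
Hypothesis lab1 : forall l, size (lab l) <= 1.
Hypothesis comm : forall a b, l1 a -> l2 b -> relator [:: pos a; pos b] [:: pos b; pos a] \in R.
Hypothesis relP : forall x y, relator [:: pos (gp x); pos (gh y)] [:: pos (gh y); pos (gp x)] \in R.
Hypothesis relE : forall x, relator [:: pos (gp x); pos ge] [:: pos ge; pos (gp x); pos (gh x)] \in R.
Hypothesis relS : relator [:: pos gt; pos gs] [:: pos gs; pos gt; pos ge] \in R.
Definition pw (v : seq X) : word A := [seq pos (gp x) | x <- v].
Definition hw (v : seq X) : word A := [seq pos (gh x) | x <- v].
Hypothesis relSl : forall l, ml l -> relator [:: pos (gl l); pos gs] ([:: pos gs; pos (gl l)] ++ pw (lab l)) \in R.
Hypothesis relI : forall x, [:: pos (gh x); pos (gh (ix x))] \in R.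
Notation lpath := (lpath ra rc rm rn ml lab).
Notation on1 w := (all (fun x : letter A => l1 x.1) w).
Notation on2 w := (all (fun x : letter A => l2 x.1) w).

(* Contracting Cw (g, v) amounts to proving s^-1 t^g s = t^g e v^-1. *)
Definition Cw (x : vec * seq X) : word A :=
  [:: neg gs] ++ conjw x.1 false ++ [:: pos gs] ++ hw x.2 ++ [:: neg ge] ++ conjw x.1 true.

Lemma on1_conjw g e : on1 (conjw g e).
Proof.
have h i n : on1 (binw gx gl dbl i n).
  elim/ltn_ind: n => n IH; have [->|n0] := posnP n; first by rewrite binw0.
  rewrite binwE //= l1l all_cat IH /=; last by rewrite -divn2 ltn_Pdiv.
  by rewrite l1l all_nseq /= l1x orbT.
have hv : on1 (vecw g).
  rewrite /WordArithmetic.vecw; elim: (enum C) => //= i r IH; rewrite all_cat IH andbT.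
  by case: (g i) => n; rewrite /intw ?all_inv h.
by rewrite /WordArithmetic.conjw all_cat all_inv hv /= l1t hv.
Qed.
Lemma on2_hw v : on2 (hw v). Proof. by rewrite all_map; apply/allP => x _; apply: l2h. Qed.
Lemma on2_pw v : on2 (pw v). Proof. by rewrite all_map; apply/allP => x _; apply: l2p. Qed.

Lemma comm_ph p v : der (20 + size p + size v) (pw p ++ hw v) (hw v ++ pw p).
Proof.
have c a b : [exists x, a == gh x] -> [exists y, b == gp y] -> relator [:: pos a; pos b] [:: pos b; pos a] \in R \/ True by right.
pose q1 : pred A := fun a => [exists x, a == gp x]; pose q2 : pred A := fun a => [exists x, a == gh x].
have h a b : q1 a -> q2 b -> relator [:: pos a; pos b] [:: pos b; pos a] \in R.
  by move=> /existsP[x /eqP ->] /existsP[y /eqP ->].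
have h1 : all (fun x : letter A => q1 x.1) (pw p) by rewrite all_map; apply/allP => x _; apply/existsP; exists x.
have h2 : all (fun x : letter A => q2 x.1) (hw v) by rewrite all_map; apply/allP => x _; apply/existsP; exists x.
by have := der_sym (comm_word h h1 h2); rewrite !size_map.
Qed.

Lemma lab_cases l : lab l = [::] \/ exists x, lab l = [:: x].
Proof. by have := lab1 l; case: (lab l) => [|x [|//]]; [left|right; exists x]. Qed.

Lemma path_step j l g g' v : j0 <= j -> ml l -> move ra rc rm rn (l, false) g g' ->
  small j g -> small j g' -> size v <= j ->
  ceq R (1000 * (3 * wof C M (j + M + 2) + 200)) (Cw (g', v ++ lab l)) (Cw (g, v)).
Proof.
move=> jj mll [z [Eg Eg']] sg sg' sv.
set b := j + M + 2; have w1 := wof1 C M b; have w2 := wof2 C M b; set W := wof C M b in w1 w2 *.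
have bj i u : i <= b -> small i u -> small b u by move=> h; apply: small_le.
have jb : j <= b by rewrite /b; lia.
have sgz : small j (src (l, false) z) by rewrite -Eg.
have [s1 s2 s3] := src_small rmM rnM rmn raS rcS w1 w2 M1 jj sgz.
have cl e : der (1500 * W) (conjw g e ++ stw (l, false)) (stw (l, false) ++ conjw g' e).
  rewrite Eg Eg'; apply: (conjw_letter rmM rnM rm_dbl rn_dbl relX relL relT w1 w2 M1).
  - by apply: bj (raS _); rewrite /b; lia.
  - by apply: bj (rcS _); rewrite /b; lia.
  - by apply: bj s1; rewrite /b; lia.
  - by apply: bj s2; rewrite /b; lia.
  - by rewrite -Eg; apply: bj sg.
  - by rewrite -Eg'; apply: bj sg'.
have szc u e : small j u -> size (conjw u e) <= 3 * W + 200.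
  by move=> su; refine (leq_trans (size_conjw gx gt gl dbl w1 w2 M1 e (bj _ _ _ jb su)) _); clear; lia.
rewrite /Cw /= -/(hw (v ++ lab l)).
have -> : hw (v ++ lab l) = hw v ++ hw (lab l) by rewrite /hw map_cat.
apply: (@conj_step _ _ gs ge (gl l) _ _ _ _ _ (pw (lab l))); rewrite ?size_map ?szc //.
- by rewrite /b in w1; lia.
- by lia.
- by apply: der_mono (cl false); lia.
- by apply: der_mono (cl true); lia.
- by apply: der_mono (der_relE (relSl mll)); rewrite size_cat size_map /=; have := lab1 l; lia.
- move=> w ->; have o : on2 (pw (lab l) ++ hw v ++ hw (lab l) ++ [:: neg ge]).
    by rewrite !all_cat on2_pw !on2_hw /= l2e.
  have o1 : on1 [:: pos (gl l)] by rewrite /= l1l.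
  have := der_sym (comm_word comm o1 o).
  by apply: der_mono; rewrite /=; lia.
- exact: comm_ph.
- have o : on2 (inv_word (pw (lab l))) by rewrite all_inv on2_pw.
  have := der_sym (comm_word comm (on1_conjw g true) o); rewrite size_inv_word size_map.
  by apply: der_mono; lia.
- have o1 : on1 [:: pos (gl l)] by rewrite /= l1l.
  have o : on2 (inv_word (pw (lab l))) by rewrite all_inv on2_pw.
  have d := der_sym (comm_word comm o1 o).
  have [_ sz] := der_size d.
  apply: (der_trans (b := inv_word (pw (lab l)) ++ [:: pos (gl l); neg (gl l)])).
    have := der_catl (Y := [:: neg (gl l)]) d (leqnn _); rewrite -!catA => d'.
    by apply: der_mono d'; rewrite size_inv_word size_map /=; have := lab1 l; lia.
  have := der_catr (X := inv_word (pw (lab l))) (der_cancel R (pos (gl l))) (leqnn _); rewrite cats0 => d'.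
  by apply: der_mono d'; rewrite size_inv_word size_map /=; have := lab1 l; lia.
have [->|[x ->]] := lab_cases l; first by apply: der_refl.
have d1 : der 10 [:: pos (gp x); pos ge] [:: pos ge; pos (gp x); pos (gh x)] := der_relE (relE x).
apply: (der_trans (b := ([:: neg ge] ++ [:: pos (gp x); pos ge]) ++ [:: neg ge])).
  have d2 := der_catr (X := [:: neg ge]) (der_sym d1) (leqnn _).
  have d3 := der_catl (Y := [:: pos (gp x); pos (gh x)]) (der_cancel R (neg ge)) (leqnn _).
  have d4 : der 12 ([:: pos (gp x); pos (gh x)]) ([:: neg ge] ++ [:: pos (gp x); pos ge]).
    by apply: der_sym; exact: der_trans (der_mono (isT : 11 <= 12) (der_sym d2)) (der_mono (isT : 4 <= 12) d3).
  by apply: der_catl d4 _.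
by have := der_catr (X := [:: neg ge; pos (gp x)]) (der_cancel R (pos ge)) (leqnn _); apply: der_mono.
Qed.

Definition bj j := 1000 * (3 * wof C M (j + M + 2) + 200).
Arguments bj : simpl never.
Lemma path_ceq j x y : j0 <= j -> lpath j x y -> ceq R (bj j) (Cw x) (Cw y).
Proof.
move=> jj; elim=> {x y} [x|x y _|x y z _ h _ h'|l g g' v h1 h2 h3 h4 h5].
- by [].
- exact: ceq_sym.
- exact: ceq_trans h h'.
by apply: ceq_sym; apply: path_step.
Qed.
Lemma Cw0 w : Cw (0%R, w) = [:: neg gs; pos gt; pos gs] ++ hw w ++ [:: neg ge; neg gt].
Proof. by rewrite /Cw /WordArithmetic.conjw /= vecw0. Qed.
Lemma st_der : der 12 [:: neg gs; pos gt; pos gs] [:: pos gt; pos ge].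
Proof.
have d1 := der_relE relS; have d2 := der_catr (X := [:: neg gs]) d1 (leqnn _).
apply: (der_trans (der_mono _ d2)) => //.
have := der_catl (Y := [:: pos gt; pos ge]) (der_cancel R (neg gs)) (leqnn _).
exact: der_mono.
Qed.
Lemma Cw00 : red 20 (Cw (0%R, [::])).
Proof.
rewrite Cw0 /=; apply: der_red.
apply: (der_trans (b := [:: pos gt; pos ge] ++ [:: neg ge; neg gt])); first exact: (der_catl (Y := [:: neg ge; neg gt]) st_der).
apply: (der_trans (b := [:: pos gt] ++ [::] ++ [:: neg gt])).
  by have := der_in (X := [:: pos gt]) (Y := [:: neg gt]) (der_cancel R (pos ge)) (leqnn _); apply: der_mono.
by have := der_cancel R (pos gt); apply: der_mono.
Qed.
Lemma Cw_red j g v : j0 <= j -> lpath j (0%R, [::]) (g, v) -> red (bj j) (Cw (g, v)).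
Proof.
move=> jj h; apply/(path_ceq jj h) => //; apply: red_mono Cw00; rewrite /bj; lia.
Qed.
Lemma hw_red j w : j0 <= j -> lpath j (0%R, [::]) (0%R, w) -> red (bj j + size w + 20) (hw w).
Proof.
move=> jj /(Cw_red jj); rewrite Cw0; set t := bj j + size w + 20 => r.
have {}r : red t ([:: neg gs; pos gt; pos gs] ++ hw w ++ [:: neg ge; neg gt]) by apply: red_mono r; rewrite /t; lia.
have e1 : ceq R t ([:: neg gs; pos gt; pos gs] ++ hw w ++ [:: neg ge; neg gt]) ([:: pos gt; pos ge] ++ hw w ++ [:: neg ge; neg gt]).
  by apply: (ceq_in (X := [::]) st_der); rewrite size_cat size_map /= /t /bj; lia.
have e2 : ceq R t ([:: pos gt; pos ge] ++ hw w ++ [:: neg ge; neg gt]) (hw w ++ [:: neg ge; neg gt; pos gt; pos ge]).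
  have := @ceq_shift _ R t [:: pos gt; pos ge] (hw w ++ [:: neg ge; neg gt]); rewrite -!catA; apply.
  by rewrite !size_cat size_map /= /t /bj; lia.
have e3 : ceq R t (hw w ++ [:: neg ge; neg gt; pos gt; pos ge]) (hw w).
  have d : der 4 [:: neg ge; neg gt; pos gt; pos ge] [::].
    apply: (der_trans (b := [:: neg ge; pos ge])); last by apply: der_mono (der_cancel R (neg ge)).
    exact: (der_in (X := [:: neg ge]) (Y := [:: pos ge]) (der_cancel R (neg gt))).
  by have := ceq_in (X := hw w) (Y := [::]) (t := t) d; rewrite !cats0; apply; rewrite size_map /t /=; lia.
by apply/(e3 t) => //; apply/(e2 t) => //; apply/(e1 t).
Qed.

(** For the inverse of [t^g] the formula yields the factor [v e^-1] in front; it commutes with all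
    letters of the first group and is moved to the end. *)
Lemma conj_der j g v e (y := if e then hw v ++ [:: neg ge] else [:: pos ge] ++ inv_word (hw v)) :
  j0 <= j -> small j g -> size v <= j -> lpath j (0%R, [::]) (g, v) ->
  der (20 * bj j) ([:: neg gs] ++ conjw g e ++ [:: pos gs]) (conjw g e ++ y).
Proof.
move=> jj sg sv /(Cw_red jj) r.
have w1 := wof1 C M (j + M + 2); have w2 := wof2 C M (j + M + 2).
have szc d : 2 * size (conjw g d) <= bj j.
  have sg' : small (j + M + 2) g by apply: small_le sg; lia.
  by have := size_conjw gx gt gl dbl w1 w2 M1 d sg'; rewrite /bj; lia.
have sv' : size (hw v) <= bj j by rewrite size_map /bj; lia.
have b1 : 1000 <= bj j by rewrite /bj; lia.
have df : der (4 * bj j) ([:: neg gs] ++ conjw g false ++ [:: pos gs]) (conjw g false ++ [:: pos ge] ++ inv_word (hw v)).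
  apply: (@red_der _ _ (bj j)).
    rewrite (inv_word_cat (conjw g false)) (inv_word_cat [:: pos ge]) inv_wordK conjwN (_ : inv_word [:: pos ge] = [:: neg ge]) //.
    by move: r; rewrite /Cw -!catA.
  move: (conjw g false) (szc false) (hw v) sv' b1; clear => cf h1 hv h2 h3; rewrite !size_cat size_inv_word; wsz A.
rewrite /y; case: e {y}; last by apply: der_mono df; lia.
have di := der_inv df (leqnn _).
have o : on2 (hw v ++ [:: neg ge]) by rewrite all_cat on2_hw /= l2e.
apply: (der_trans (b := (hw v ++ [:: neg ge]) ++ conjw g true)).
  have {}di : der (20 * bj j) (inv_word ([:: neg gs] ++ conjw g false ++ [:: pos gs])) (inv_word (conjw g false ++ [:: pos ge] ++ inv_word (hw v))).
    by apply: der_mono di; move: (conjw g false) (szc false) (hw v) sv' b1; clear => cf h1 hv h2 h3; rewrite !size_cat size_inv_word; wsz A.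
  move: di; rewrite (inv_word_cat [:: neg gs]) !(inv_word_cat (conjw g false)) (inv_word_cat [:: pos ge]) inv_wordK !conjwN.
  by rewrite (_ : inv_word [:: neg gs] = [:: pos gs]) // (_ : inv_word [:: pos gs] = [:: neg gs]) // (_ : inv_word [:: pos ge] = [:: neg ge]) // -!catA.
have := comm_word comm (on1_conjw g true) o; apply: der_mono.
move: (conjw g true) (szc true) (hw v) sv' b1; clear => cf h1 hv h2 h3; wsz A.
Qed.
End MarkedPaths.
End ComputationPaths.
Import ComputationPaths.

(** * Presentations of generated subgroups and their growth *)

Module Presentations.
Import GRing.Theory.

Lemma pfun_growth f (F : pfun) : (forall n, f n <= F n) -> polynomial_growth f.
Proof.
move=> h; have [c hc] := pfP F.
exists (fun n => c * n.+1 ^ c), (c%:R *: ('X + 1) ^+ c)%R; split.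
- by move=> m n mn; rewrite leq_mul2l leq_exp_base ?orbT.
- by move=> n; rewrite hornerZ horner_exp hornerD hornerX hornerC natrM natrX -natr1.
exists 1 => // n; rewrite !mul1n; apply: leq_trans (leq_addr _ _).
exact: leq_trans (h n) (hc n).
Qed.

Section PresEq.
Variables (A : finType) (R : seq (word A)).
Notation pe := (pres_eq R).
Lemma pe_refl w : pe w w. Proof. exact: rst_refl. Qed.
Lemma pe_sym u v : pe u v -> pe v u. Proof. exact: rst_sym. Qed.
Lemma pe_trans u v w : pe u v -> pe v w -> pe u w. Proof. exact: rst_trans. Qed.
Lemma pe_ctx X Y u v : pe u v -> pe (X ++ u ++ Y) (X ++ v ++ Y).
Proof.
elim=> {u v} [u v h|u|u v _ h|u v w _ h _ h']; [|exact: pe_refl|exact: pe_sym|exact: pe_trans h h'].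
case: h => [{}u {}v x|{}u {}v r rR]; apply: rst_step.
  by have := PresCancel R (X ++ u) (v ++ Y) x; rewrite -!catA.
by have := PresRelator (X ++ u) (v ++ Y) rR; rewrite -!catA.
Qed.
Lemma pe_cancel w : pe (w ++ inv_word w) [::].
Proof.
elim: w => [|x w IH]; first exact: pe_refl.
rewrite inv_word_cons; have := pe_ctx [:: x] [:: inv_letter x] IH; rewrite /= -!catA => h.
apply: pe_trans h _; apply: rst_step; exact: (PresCancel R [::] [::] x).
Qed.
Lemma pe_cat1 u v : pe u [::] -> pe v [::] -> pe (u ++ v) [::].
Proof. by move=> h h'; apply: pe_trans h'; have := pe_ctx [::] v h. Qed.
Lemma pe_cancelV w : pe (inv_word w ++ w) [::].
Proof. by have := pe_cancel (inv_word w); rewrite inv_wordK. Qed.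
Lemma pe_shift u v : pe (u ++ v) [::] -> pe (v ++ u) [::].
Proof.
move=> h; apply: (@pe_trans _ (inv_word u ++ (u ++ v) ++ u)).
  by have := pe_ctx [::] (v ++ u) (pe_sym (pe_cancelV u)); rewrite /= -!catA.
by apply: pe_trans (pe_ctx _ _ h) _; apply: pe_cancelV.
Qed.
Lemma pe_inv w : pe w [::] -> pe (inv_word w) [::].
Proof. by move=> h; apply: pe_trans (pe_cancelV w); have := pe_ctx (inv_word w) [::] (pe_sym h); rewrite !cats0. Qed.
Lemma pe_rel r : (r \in R) || (r \in map (@inv_word A) R) -> pe r [::].
Proof.
have h s : s \in R -> pe s [::] by move=> sR; apply: rst_step; have := PresRelator [::] [::] sR; rewrite cats0.
by case/orP=> [/h//|/mapP[s /h hs ->]]; apply: pe_inv.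
Qed.
Lemma pe_entry w W : entry_step R w W -> (forall v, v \in W -> pe v [::]) -> pe w [::].
Proof.
case=> {w W} [u v x|u v x|u v r rR|u v r rR|u v|u v|] h; last exact: pe_refl.
- apply: pe_trans (h _ (mem_head _ _)); apply: pe_sym; apply: rst_step; exact: PresCancel.
- apply: pe_trans (h _ (mem_head _ _)); apply: rst_step; exact: PresCancel.
- by apply: pe_trans (h _ (mem_head _ _)); apply: pe_sym; apply: pe_ctx (pe_rel rR).
- by apply: pe_trans (h _ (mem_head _ _)); apply: pe_ctx (pe_rel rR).
- by apply: pe_shift; apply: h; apply: mem_head.
by apply: pe_cat1; apply: h; rewrite !inE eqxx ?orbT.
Qed.
Lemma rw_pe s U V : rw R s U V -> (forall v, v \in V -> pe v [::]) -> forall u, u \in U -> pe u [::].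
Proof.
elim=> {U V} [U _ h //|U V W _ [U1 V1 w W1 e] _ IH h]; have {}IH := IH h.
move=> u; rewrite mem_cat inE => /or3P[uU|/eqP ->|uV].
- by apply: IH; rewrite mem_cat uU.
- by apply: pe_entry e _ => v vW; apply: IH; rewrite !mem_cat vW orbT.
by apply: IH; rewrite !mem_cat uV !orbT.
Qed.
Lemma red_pe s w : red R s w -> pe w [::].
Proof. by move=> /rw_pe h; apply: h => //; apply: mem_head. Qed.

Lemma eval_pe (G : groupType) (gen : A -> G) : (forall r, r \in R -> eval gen r = 1%g) ->
  forall u v, pe u v -> eval gen u = eval gen v.
Proof.
move=> h u v; elim=> {u v} [u v []|u|u v _|u v w _ -> _ ->] //.
  by move=> {}u {}v x; rewrite !eval_cat (eval_cat gen [:: x] [:: _]) !eval1 eval_inv_letter mulgV mul1g.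
by move=> {}u {}v r /h E; rewrite !eval_cat E mul1g.
Qed.

Lemma space_growth (F : pfun) : (forall w, pe w [::] -> red R (F (size w)) w) ->
  polynomial_growth (space_function R).
Proof.
move=> h; apply: (@pfun_growth _ F) => n.
apply/bigmax_leqP => k _; apply/bigmax_leqP => w /asboolP wp.
apply: leq_trans (red_space (h _ wp)) _.
by apply: pf_homo; rewrite size_tuple -ltnS.
Qed.
End PresEq.

Section Generated.
Variables (A : finType) (GG : groupType) (gen : A -> GG).
Definition gen_pred : pred GG := fun g => `[< exists w, eval gen w = g >].
(** The subgroup generated by [gen]: an [hnn] is a full symmetric group, which need not be generated
    by the letters. *)
Record gsub := GSub { gval : GG; gvalP : gen_pred gval }.
HB.instance Definition _ := [isSub for gval].
HB.instance Definition _ := [Choice of gsub by <:].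
Lemma gen_pred1 : gen_pred 1%g. Proof. by apply/asboolP; exists [::]; rewrite eval0. Qed.
Lemma gen_predM (x y : gsub) : gen_pred (gval x * gval y)%g.
Proof.
case: x y => [x /= /asboolP[u <-]] [y /= /asboolP[v <-]].
by apply/asboolP; exists (u ++ v); rewrite eval_cat.
Qed.
Lemma gen_predV (x : gsub) : gen_pred (gval x)^-1%g.
Proof. by case: x => [x /= /asboolP[u <-]]; apply/asboolP; exists (inv_word u); rewrite eval_inv. Qed.
Definition gsub1 := GSub gen_pred1.
Definition gsubM x y := GSub (gen_predM x y).
Definition gsubV x := GSub (gen_predV x).
Lemma gsub_mulA : associative gsubM. Proof. by move=> x y z; apply: val_inj; apply: mulgA. Qed.
Lemma gsub_mul1 : left_id gsub1 gsubM. Proof. by move=> x; apply: val_inj; apply: mul1g. Qed.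
Lemma gsub_mulr1 : right_id gsub1 gsubM. Proof. by move=> x; apply: val_inj; apply: mulg1. Qed.
Lemma gsub_mulV : left_inverse gsub1 gsubV gsubM. Proof. by move=> x; apply: val_inj; apply: mulVg. Qed.
Lemma gsub_mulrV : right_inverse gsub1 gsubV gsubM. Proof. by move=> x; apply: val_inj; apply: mulgV. Qed.
HB.instance Definition _ := isGroup.Build gsub gsub_mulA gsub_mul1 gsub_mulr1 gsub_mulV gsub_mulrV.
Lemma gen_gen a : gen_pred (gen a).
Proof. by apply/asboolP; exists [:: (a, false)]; rewrite eval1. Qed.
Definition sgen a : gsub := GSub (gen_gen a).
Lemma gval_eval w : gval (eval sgen w) = eval gen w.
Proof.
elim: w => [|[a d] w IH]; first by rewrite !eval0.
by rewrite !eval_cons -IH; case: d.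
Qed.
Lemma sgen_generates : generates sgen.
Proof. by case=> x px; have /asboolP[w E] := px; exists w; apply: val_inj; rewrite /= gval_eval. Qed.

(** Contracting all words of value 1 gives the completeness of the relators along with the space
    bound, so no separate proof that they present the group is required. *)
Lemma sgen_presents (R : seq (word A)) (F : nat -> nat) : (forall r, r \in R -> eval gen r = 1%g) ->
  (forall w, eval gen w = 1%g -> red R (F (size w)) w) -> presents R sgen.
Proof.
move=> hR hF; split=> [|w]; first exact: sgen_generates.
split=> [E|h].
  by apply: red_pe (hF w _); rewrite -gval_eval E.
by apply: val_inj; rewrite /= gval_eval (eval_pe hR h) eval0.
Qed.
End Generated.

Ltac wsz A := rewrite ?size_cat /=; repeat match goal with |- context [@size ?T ?s] =>
  tryif constr_eq T (Finite.sort (letter A)) then fail else change (@size T s) with (@size (Finite.sort (letter A)) s) end; lia.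
Section Pieces.
Variables (A : finType) (R : seq (word A)).
Notation der := (der R).
Notation pos a := ((a, false) : letter A).
Variables l1 l2 : pred A.
Hypothesis comm : forall a b, l1 a -> l2 b -> relator [:: pos a; pos b] [:: pos b; pos a] \in R.
Notation on1 w := (all (fun x : letter A => l1 x.1) w).
Notation on2 w := (all (fun x : letter A => l2 x.1) w).
Variable e : A.
Notation cj w := ([:: (e, true)] ++ w ++ [:: pos e]).
(** Between neighbouring pieces the pair [e e^-1] is inserted; the factors [p.2] commute with the
    later [p.1] and are collected at the end. *)
Lemma conj_pieces T (ps : seq (word A * word A)) (u := flatten [seq p.1 | p <- ps]) (y := flatten [seq p.2 | p <- ps]) :
  (forall p, p \in ps -> [/\ on1 p.1, on2 p.2 & der T (cj p.1) (p.1 ++ p.2)]) ->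
  [/\ on1 u, on2 y & der (T + 2 * (size u + size y) + 30) (cj u) (u ++ y)].
Proof.
rewrite {}/u {}/y; elim: ps => [_|[w z] ps IH h].
  split=> //=; apply: der_mono (der_cancel R (e, true)); lia.
have [|o1 o2 d] := IH; first by move=> p hp; apply: h; rewrite inE hp orbT.
have [ow oz dw] := h _ (mem_head _ _); rewrite /= in ow oz dw; have {}dw : der T (cj w) (w ++ z) := dw.
rewrite -[flatten [seq p.1 | p <- _ :: _]]/(w ++ flatten [seq p.1 | p <- ps]) -[flatten [seq p.2 | p <- _ :: _]]/(z ++ flatten [seq p.2 | p <- ps]).
move: (flatten _) (flatten _) o1 o2 d => y u o1 o2 d; rewrite !all_cat ow oz; split=> //.
set B := T + _ + _.
have sB : B = T + 2 * (size w + size u + size z + size y) + 30 by rewrite /B !size_cat; lia.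
apply: (der_trans (b := ([:: (e, true)] ++ w) ++ [:: pos e; (e, true)] ++ (u ++ [:: pos e]))).
  have := der_sym (der_in (X := [:: (e, true)] ++ w) (Y := u ++ [:: pos e]) (der_cancel R (pos e)) (leqnn _)).
  by rewrite -!catA => dd; apply: der_mono dd; rewrite sB; wsz A.
apply: (der_trans (b := (w ++ z) ++ (cj u))).
  have := der_catl (Y := cj u) dw (leqnn _); rewrite -!catA => dd.
  by apply: der_mono dd; rewrite sB; wsz A.
apply: (der_trans (b := (w ++ z) ++ (u ++ y))).
  by apply: der_catr d _; rewrite sB; wsz A.
have := der_in (X := w) (Y := y) (comm_word comm o1 oz) (leqnn _); rewrite -!catA => dd.
by apply: der_mono dd; rewrite sB; lia.
Qed.
End Pieces.
End Presentations.
Import Presentations.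

(** * From polynomial space machines to finitely presented groups *)

Module Embedding.
Import GRing.Theory.
Notation tsize := Contraction.tsize.

Section PathExtra.
Variables (C L X : finType) (ra rc : L -> {ffun C -> int}) (rm rn : L -> C -> nat).
Lemma lpath_mono ml (lab : L -> seq X) j j' x y : j <= j' ->
  lpath ra rc rm rn ml lab j x y -> lpath ra rc rm rn ml lab j' x y.
Proof.
move=> jj; elim=> {x y} [x|x y _ h|x y z _ h _ h'|l g g' v h1 h2 h3 h4 h5].
- exact: LRefl.
- exact: LSym.
- exact: LTrans h h'.
by apply: LStep => //; [apply: small_le h3|apply: small_le h4|apply: leq_trans jj].
Qed.
Variables (H : groupType) (hX : X -> H) (lab : L -> seq X) (ml : pred L) (chi : {ffun C -> int} -> H).
Fixpoint evX (v : seq X) : H := if v is x :: v' then (hX x * evX v')%g else 1%g.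
Lemma evX_cat u v : evX (u ++ v) = (evX u * evX v)%g.
Proof. by elim: u => [|x u IH] /=; rewrite ?mul1g // IH mulgA. Qed.
Hypothesis chi0 : chi 0%R = 1%g.
Hypothesis chi_move : forall l g g', ml l -> reach ra rc rm rn ml g -> move ra rc rm rn (l, false) g g' ->
  chi g' = (chi g * evX (lab l))%g.
Lemma reach_move (l : L * bool) g g' : ml l.1 -> move ra rc rm rn l g g' ->
  reach ra rc rm rn ml g' -> reach ra rc rm rn ml g.
Proof. by move=> mll mv h; apply: (ReachS (l := linv l) _ h (move_sym mv)). Qed.
(** Along a path, the value of [v] times [chi(g)^-1] is constant; at the origin with the empty label
    it is 1. *)
Lemma lpath_chi j x y : lpath ra rc rm rn ml lab j x y ->
  (reach ra rc rm rn ml x.1 <-> reach ra rc rm rn ml y.1) /\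
  (reach ra rc rm rn ml x.1 -> (evX x.2 * (chi x.1)^-1 = evX y.2 * (chi y.1)^-1)%g).
Proof.
elim=> {x y} [x|x y _ [h h']|x y z _ [h1 h2] _ [h3 h4]|l g g' v mll mv _ _ _] /=.
- by [].
- by split=> [|/h/h' ->]; [tauto|].
- split; first tauto; by move=> hx; rewrite h2 // h4 //; apply/h1.
split; first by split=> h; [apply: (ReachS (l := (l, false)) _ h mv)|apply: (reach_move (l := (l, false)) _ mv)].
move=> h; rewrite evX_cat (chi_move mll h mv) invgM !mulgA; congr (_ * _)%g.
by rewrite mulgK.
Qed.
Lemma lpath_ev j g v : lpath ra rc rm rn ml lab j (0%R, [::]) (g, v) -> evX v = chi g.
Proof.
move=> /lpath_chi[_ /= h]; have {}h := h (Reach0 _ _ _ _ _).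
by move: h; rewrite chi0 invg1 mulg1 => /esym h; rewrite -(mulgVK (chi g) (evX v)) h mul1g.
Qed.
End PathExtra.

Lemma eval2 (A : finType) (G : groupType) (gen : A -> G) a b :
  eval gen [:: (a, false); (b, false)] = (gen a * gen b)%g.
Proof. by rewrite eval_cons eval1. Qed.
Lemma eval3 (A : finType) (G : groupType) (gen : A -> G) a b c :
  eval gen [:: (a, false); (b, false); (c, false)] = (gen a * (gen b * gen c))%g.
Proof. by rewrite eval_cons eval2. Qed.
Lemma arith1 W U m : 3100 * W + (2 * m + 2) * (5 * U) + m <= 4000 * W + (4 * m + 2) * (30 * U) + m.
Proof. lia. Qed.
Lemma arith2 t m W : t <= 2 * m + 1 ->
  t * (20 * (2 * W + 2)) + 3000 * W <= 4000 * W + (4 * m + 2) * (30 * (2 * W + 2)) + m.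
Proof. by move=> h; have := leq_mul h (leqnn (20 * (2 * W + 2))); lia. Qed.
Lemma arith3 z v W U j d m : z <= 2 * m * (d + 1) -> v <= (2 * m + 1) * U ->
  let B := 4000 * W + (4 * m + 2) * (30 * U) + 10 * m + (30 * j + (10 * ((2 * m + 1) * (d + 1)) + 100)) in
  [/\ z <= B, 4000 * W + (4 * m + 2) * (30 * U) + m + z + 2 <= B & 20 * j + 2 * (v + z) + 30 <= B].
Proof. by move=> h1 h2 B; rewrite /B; split; lia. Qed.

Section Final.
Variables (H : groupType) (X C J : finType) (hX : X -> H) (ix : X -> X).
Hypothesis hix : forall x, hX (ix x) = ((hX x)^-1)%g.
Notation evX := (evX hX).
Hypothesis Xgen : forall h, exists w, evX w = h.
Notation vec := {ffun C -> int}.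
Variables (ra rc : J -> vec) (rm rn : J -> C -> nat) (lab : J -> seq X).
Hypothesis rmn : forall l i, (rm l i == 0%N) = (rn l i == 0%N).
Hypothesis lab1 : forall j, size (lab j) <= 1.
Variable chi : vec -> H.
Hypothesis chi0 : chi 0%R = 1%g.
Hypothesis chi_move : forall j g g', reach ra rc rm rn predT g -> move ra rc rm rn (j, false) g g' ->
  chi g' = (chi g * evX (lab j))%g.
Variables fr fw : pfun.
(** However large the detours by which [g] was reached, there is a path to [g] within bounds that
    depend on its digits only. This limits the cost of crossing [s]. *)
Hypothesis direct : forall n g, reach ra rc rm rn predT g -> small n g ->
  exists v, lpath ra rc rm rn predT lab (fr n) (0%R, [::]) (g, v) /\ size v <= fr n.
(** This is what makes the trivial words of [H] contractible in the absence of relators of [H]. *)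
Hypothesis trivial_path : forall w, evX w = 1%g ->
  lpath ra rc rm rn predT lab (fw (size w)) (0%R, [::]) (0%R, w).

(** The instructions, which are marked, and one unmarked doubling letter for each coordinate, by
    which numbers are written in binary. *)
Let L : finType := (J + C)%type.
Let ra' (l : L) := if l is inl j then ra j else 0%R.
Let rc' (l : L) := if l is inl j then rc j else 0%R.
Let rm' (l : L) := if l is inl j then rm j else fun=> 1.
Let rn' (l : L) := match l with inl j => rn j | inr i => fun k => if k == i then 2 else 1 end.
Let lab' (l : L) := if l is inl j then lab j else [::].
Let ml : pred L := fun l => if l is inl _ then true else false.
Let dbl (i : C) : L := inr i.
Lemma rmn' l i : (rm' l i == 0%N) = (rn' l i == 0%N).
Proof. by case: l => [j|k] //=; case: ifP. Qed.
Let M := (\max_l \max_i (rm' l i + rn' l i)).+2.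
Let j0 := \max_l \max_i (`|ra' l i| + `|rc' l i|).
Lemma rmM' l i : rm' l i <= M.
Proof.
rewrite /M; apply: leq_trans (leq_trans (leqnSn _) (leqnSn _)).
by apply: leq_trans (leq_bigmax l); apply: leq_trans (leq_bigmax i); apply: leq_addr.
Qed.
Lemma rnM' l i : rn' l i <= M.
Proof.
rewrite /M; apply: leq_trans (leq_trans (leqnSn _) (leqnSn _)).
by apply: leq_trans (leq_bigmax l); apply: leq_trans (leq_bigmax i); apply: leq_addl.
Qed.
Lemma j0E l i : `|ra' l i| + `|rc' l i| <= j0.
Proof. by apply: leq_trans (leq_bigmax l); apply: leq_trans (leq_bigmax i). Qed.
Lemma raS' l : small j0 (ra' l).
Proof. by move=> i; apply: leq_ltn_trans (ltn_expl j0 (isT : 1 < 2)); apply: leq_trans (j0E l i); apply: leq_addr. Qed.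
Lemma rcS' l : small j0 (rc' l).
Proof. by move=> i; apply: leq_ltn_trans (ltn_expl j0 (isT : 1 < 2)); apply: leq_trans (j0E l i); apply: leq_addl. Qed.
Lemma rm_dbl' i : rm' (dbl i) i = 1. Proof. by []. Qed.
Lemma rn_dbl' i : rn' (dbl i) i = 2. Proof. by rewrite /= eqxx. Qed.
Lemma M1' : 1 <= M. Proof. by []. Qed.
Notation reach' := (reach ra' rc' rm' rn' ml).
Notation lpath' := (lpath ra' rc' rm' rn' ml lab').

Lemma reachE g : reach' g -> reach ra rc rm rn predT g.
Proof.
elim=> {g} [|l g g' mll _ h mv]; first exact: Reach0.
case: l mll mv => [[j|//] d] _ [z [E E']].
by apply: (ReachS (l := (j, d)) _ h) => //; exists z; rewrite E E'; case: d {E E'}.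
Qed.
Lemma lpathE j x y : lpath ra rc rm rn predT lab j x y -> lpath' j x y.
Proof.
elim=> {x y} [x|x y _ h|x y z _ h _ h'|l g g' v _ mv h3 h4 h5].
- exact: LRefl.
- exact: LSym.
- exact: LTrans h h'.
by apply: (@LStep _ _ _ _ _ _ _ _ _ _ (inl l : L)).
Qed.
Lemma chi_move' l g g' : ml l -> reach' g -> move ra' rc' rm' rn' (l, false) g g' ->
  chi g' = (chi g * evX (lab' l))%g.
Proof. by case: l => [j|//] _ /reachE h mv; apply: chi_move. Qed.
Lemma lab1' l : size (lab' l) <= 1. Proof. by case: l => [j|//]; apply: lab1. Qed.

Let A : finType := option (option (option ((C + L) + (X + X)))).
Notation pos a := ((a, false) : letter A).
Let gt : A := None.
Let ge : A := Some None.
Let gs : A := Some (Some None).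
Let gx i : A := Some (Some (Some (inl (inl i)))).
Let gl l : A := Some (Some (Some (inl (inr l)))).
Let gp x : A := Some (Some (Some (inr (inl x)))).
Let gh x : A := Some (Some (Some (inr (inr x)))).
Let l1 : pred A := fun a => match a with None => true | Some (Some (Some (inl _))) => true | _ => false end.
Let lp : pred A := fun a => if a is Some (Some (Some (inr (inl _)))) then true else false.
Let lh : pred A := fun a => if a is Some (Some (Some (inr (inr _)))) then true else false.
Let l2 : pred A := fun a => [|| lp a, lh a | a == ge].
Notation conjw := (conjw gx gt gl dbl).
Notation hw := (hw gh).
Notation pw := (pw gp).
(** [R1] to [R3] belong to the rule group, [R4] makes it commute with the second factor, [R5] and
    [R6] concern that factor, and [R7] and [R8] describe [s]. Of [H] only the inverse pairs [R9] are
    imposed, so that its words can be made positive. *)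
Let R1 := [seq relator [:: pos (gx p.1); pos (gx p.2)] [:: pos (gx p.2); pos (gx p.1)] | p <- enum {: C * C}].
Let R2 := [seq relator (nseq (rm' p.1 p.2) (pos (gx p.2)) ++ [:: pos (gl p.1)]) (pos (gl p.1) :: nseq (rn' p.1 p.2) (pos (gx p.2))) | p <- enum {: L * C}].
Let R3 := [seq relator (conjw (ra' l) false ++ [:: pos (gl l)]) (pos (gl l) :: conjw (rc' l) false) | l <- enum L].
Let R4 := [seq relator [:: pos p.1; pos p.2] [:: pos p.2; pos p.1] | p <- enum {: A * A} & l1 p.1 && l2 p.2].
Let R5 := [seq relator [:: pos p.1; pos p.2] [:: pos p.2; pos p.1] | p <- enum {: A * A} & lp p.1 && lh p.2].
Let R6 := [seq relator [:: pos (gp x); pos ge] [:: pos ge; pos (gp x); pos (gh x)] | x <- enum X].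
Let R7 := [:: relator [:: pos gt; pos gs] [:: pos gs; pos gt; pos ge]].
Let R8 := [seq relator [:: pos (gl (inl j)); pos gs] ([:: pos gs; pos (gl (inl j))] ++ pw (lab j)) | j <- enum J].
Let R9 := [seq [:: pos (gh x); pos (gh (ix x))] | x <- enum X].
Let R : seq (word A) := R1 ++ R2 ++ R3 ++ R4 ++ R5 ++ R6 ++ R7 ++ R8 ++ R9.
Notation der := (der R).
Notation red := (red R).
Lemma relX' i j : relator [:: pos (gx i); pos (gx j)] [:: pos (gx j); pos (gx i)] \in R.
Proof. by rewrite !mem_cat; apply/orP; left; apply/mapP; exists (i, j); rewrite ?mem_enum. Qed.
Lemma relL' l i : relator (nseq (rm' l i) (pos (gx i)) ++ [:: pos (gl l)]) (pos (gl l) :: nseq (rn' l i) (pos (gx i))) \in R.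
Proof. by rewrite !mem_cat; apply/orP; right; apply/orP; left; apply/mapP; exists (l, i); rewrite ?mem_enum. Qed.
Lemma relT' l : relator (conjw (ra' l) false ++ [:: pos (gl l)]) (pos (gl l) :: conjw (rc' l) false) \in R.
Proof. by rewrite !mem_cat; do 2 (apply/orP; right); apply/orP; left; apply/mapP; exists l; rewrite ?mem_enum. Qed.
Lemma comm' a b : l1 a -> l2 b -> relator [:: pos a; pos b] [:: pos b; pos a] \in R.
Proof.
move=> ha hb; rewrite !mem_cat; do 3 (apply/orP; right); apply/orP; left; apply/mapP; exists (a, b) => //.
by rewrite mem_filter /= ha hb mem_enum.
Qed.
Lemma commP' a b : lp a -> lh b -> relator [:: pos a; pos b] [:: pos b; pos a] \in R.
Proof.
move=> ha hb; rewrite !mem_cat; do 4 (apply/orP; right); apply/orP; left; apply/mapP; exists (a, b) => //.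
by rewrite mem_filter /= ha hb mem_enum.
Qed.
Lemma relE' x : relator [:: pos (gp x); pos ge] [:: pos ge; pos (gp x); pos (gh x)] \in R.
Proof. by rewrite !mem_cat; do 5 (apply/orP; right); apply/orP; left; apply/mapP; exists x; rewrite ?mem_enum. Qed.
Lemma relS' : relator [:: pos gt; pos gs] [:: pos gs; pos gt; pos ge] \in R.
Proof. by rewrite !mem_cat; do 6 (apply/orP; right); apply/orP; left; rewrite inE. Qed.
Lemma relSl' l : ml l -> relator [:: pos (gl l); pos gs] ([:: pos gs; pos (gl l)] ++ pw (lab' l)) \in R.
Proof. by case: l => [j|//] _; rewrite !mem_cat; do 7 (apply/orP; right); apply/orP; left; apply/mapP; exists j; rewrite ?mem_enum. Qed.
Lemma relI' x : [:: pos (gh x); pos (gh (ix x))] \in R.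
Proof. by rewrite !mem_cat; do 8 (apply/orP; right); apply/mapP; exists x; rewrite ?mem_enum. Qed.
Lemma relP' x y : relator [:: pos (gp x); pos (gh y)] [:: pos (gh y); pos (gp x)] \in R.
Proof. exact: commP'. Qed.
Lemma l1x' i : l1 (gx i). Proof. by []. Qed.
Lemma l1t' : l1 gt. Proof. by []. Qed.
Lemma l1l' l : l1 (gl l). Proof. by []. Qed.
Lemma l1P' a : l1 a -> [\/ exists i, a = gx i, a = gt | exists l, a = gl l].
Proof. by case: a => [[[[[i|l]|[]]|]|]|] //= _; [constructor 1; exists i|constructor 3; exists l|constructor 2]. Qed.
Lemma l2p' x : l2 (gp x). Proof. by []. Qed.
Lemma l2h' x : l2 (gh x). Proof. by []. Qed.
Lemma l2e' : l2 ge. Proof. by rewrite /l2 eqxx !orbT. Qed.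

Notation iso := (@rule_isoP C L ra' rc' rm' rn' rmn').
Notation G1 := (rgroup ra' rc' rm' rn').
Let g1 (a : A) : G1 := match a with
  | None => hbase iso (@kt vec false)
  | Some (Some (Some (inl (inl i)))) => hbase iso (kvec (dlt i 1))
  | Some (Some (Some (inl (inr l)))) => hletter iso (l, false)
  | _ => 1%g end.
Lemma g1x' i : g1 (gx i) = hbase iso (kvec (dlt i 1)). Proof. by []. Qed.
Lemma g1t' : g1 gt = hbase iso (@kt vec false). Proof. by []. Qed.
Lemma g1l' l : g1 (gl l) = hletter iso (l, false). Proof. by []. Qed.

Notation FI := (@trivial_isoP H X).
Let F : groupType := hnn (@trivial_iso H X).
(** The generator [p_x] is sent to the pair of the free letter [x] and its value in [H]. On the
    subgroup generated by these pairs, the evaluation of free words in [H] becomes the second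
    projection, which is [Psi_e]. *)
Let g11 (a : A) : F * H := if a is Some (Some (Some (inr (inl x)))) then (hletter FI (x, false), hX x) else 1%g.
Let g12 (a : A) : H := if a is Some (Some (Some (inr (inr x)))) then hX x else 1%g.
Let Psi_e (f : F * H) (q : H) : Prop := q = f.2.
Lemma Pe1 : Psi_e 1%g 1%g. Proof. by []. Qed.
Lemma PeM a b c d : Psi_e a b -> Psi_e c d -> Psi_e (a * c)%g (b * d)%g. Proof. by rewrite /Psi_e => -> ->. Qed.
Lemma PeV a b : Psi_e a b -> Psi_e (a^-1)%g (b^-1)%g. Proof. by rewrite /Psi_e => ->. Qed.
Lemma Pe_fun b : Psi_e 1%g b -> b = 1%g. Proof. by []. Qed.
Notation G2 := (ghnn Psi_e).
Notation iso2 := (graph_isoP Pe1 PeM PeV Pe_fun).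
Let g2 : A -> G2 := ggen Pe1 PeM PeV Pe_fun ge g11 g12.
Notation on1 w := (all (fun x : letter A => l1 x.1) w).
Notation on2 w := (all (fun x : letter A => l2 x.1) w).
Notation onp w := (all (fun x : letter A => lp x.1) w).
Notation onh w := (all (fun x : letter A => lh x.1) w).

Lemma eval_hw v : eval g12 (hw v) = evX v.
Proof. by elim: v => [|x v IH]; rewrite ?eval0 // /ComputationPaths.hw /= eval_cons -/(hw v) IH. Qed.
Lemma eval_pw v : (eval g11 (pw v)).2 = evX v.
Proof. by elim: v => [|x v IH]; rewrite ?eval0 // /ComputationPaths.pw /= eval_cons -/(pw v) -IH. Qed.

Let pwl (u : seq (X * bool)) : word A := [seq (gp x.1, x.2) | x <- u].
Let hwl (u : seq (X * bool)) : word A := [seq (gh x.1, x.2) | x <- u].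
Lemma onp_pwl w : onp w -> exists u, w = pwl u.
Proof.
elim: w => [_|[[[[[a|[x|x]]|]|]|] d] w IH] //=; first by exists [::].
by move=> /IH[u ->]; exists ((x, d) :: u).
Qed.
Lemma onh_hwl w : onh w -> exists u, w = hwl u.
Proof.
elim: w => [_|[[[[[a|[x|x]]|]|]|] d] w IH] //=; first by exists [::].
by move=> /IH[u ->]; exists ((x, d) :: u).
Qed.
Lemma eval_pwl u : (eval g11 (pwl u)).1 = hval FI [seq (1%g, x) | x <- u] 1%g.
Proof.
elim: u => [|[x d] u IH]; first by rewrite /pwl /= eval0 hbase1.
rewrite /pwl /= eval_cons -/(pwl u) -IH hbase1 mul1g; congr (_ * _)%g.
by case: d; rewrite /eval_letter.
Qed.
Lemma free_red (w : word A) : onp w -> eval g11 w = 1%g -> red (pid (size w)) w.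
Proof.
move=> /onp_pwl[u ->] E; have {E} : (eval g11 (pwl u)).1 = 1%g by rewrite E.
rewrite eval_pwl; have [n] := ubnP (size u); elim: n u => // n IH u sn E.
have [pf|/not_pinchfree[s1 [c [l [c' [s2 [Es _]]]]]]] := pselect (pinchfree (@trivial_iso H X) [seq (1%g, x) | x <- u]).
  by have [] := britton E pf; case: (u) => // _ _; apply: red0.
have Eu : u = [seq x.2 | x <- s1] ++ l :: linv l :: [seq x.2 | x <- s2].
  have := congr1 (map snd) Es; rewrite -map_comp map_id_in // map_cat /= => -> //.
pose u1 := [seq x.2 | x <- s1]; pose u2 := [seq x.2 | x <- s2]; rewrite -/u1 -/u2 in Eu.
apply: (@red_der_trans _ _ _ _ (pwl (u1 ++ u2))).
  have := der_in (X := pwl u1) (Y := pwl u2) (der_cancel R (gp l.1, l.2)) (leqnn _).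
  rewrite /pwl Eu !map_cat => d; apply: der_mono d.
  by rewrite -[pf pid _]/(size _) size_cat /= !size_map; lia.
apply: (red_mono (s := size (pwl (u1 ++ u2)))).
  by rewrite /pid /= Eu !size_map !size_cat /=; lia.
apply: IH; first by move: sn; rewrite Eu !size_cat /=; lia.
rewrite -{}E Eu !map_cat /=.
have hc (a b : seq (H * (X * bool))) p : hval FI (a ++ b) p = (hval FI a 1%g * hval FI b p)%g.
  elim: a => [|[y m] a IHa] /=; first by rewrite hbase1 mul1g.
  by rewrite IHa !mulgA.
by rewrite !hc /= hbase1 !mul1g hletterV mulVKg.
Qed.

Let bjp : pfun := pmul (pcst 1000) (padd (pmul (pcst 3) (pfcomp (wof C M) (padd pid (pcst (M + 2))))) (pcst 200)).
Lemma bjpE j : bjp j = bj C M j. Proof. by rewrite /bjp /bj /= !addnA. Qed.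

Lemma hwl_pos u : exists v, [/\ size v = size u, eval g12 (hwl u) = evX v & der (size u + 6) (hwl u) (hw v)].
Proof.
elim: u => [|[x d] u [v [sv ev dv]]]; first by exists [::]; rewrite eval0; split=> //; apply: der_refl.
exists ((if d then ix x else x) :: v); split; first by rewrite /= sv.
  rewrite /hwl /= eval_cons -/(hwl u) ev; congr (_ * _)%g.
  by case: d; rewrite /eval_letter /= ?hix.
apply: (der_trans (b := (gh x, d) :: hw v)).
  by have := der_catr (X := [:: (gh x, d)]) dv (leqnn _); apply: der_mono; rewrite /=; lia.
have d1 : der 4 [:: (gh x, d)] [:: pos (gh (if d then ix x else x))].
  case: d; last exact: der_refl.
  have a1 : der 3 ([:: (gh x, true)] ++ [:: pos (gh x); pos (gh (ix x))]) [:: (gh x, true)].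
    by have := der_catr (X := [:: (gh x, true)]) (der_rel (relI' x)) (leqnn _); rewrite cats0.
  have a2 := der_catl (Y := [:: pos (gh (ix x))]) (der_cancel R (gh x, true)) (leqnn _).
  exact: der_trans (der_mono (isT : 3 <= 4) (der_sym a1)) (der_mono (isT : 3 <= 4) a2).
by apply: der_catl d1 _; rewrite size_map sv /=; lia.
Qed.
Let f12 : pfun := padd (padd (pfcomp bjp (padd fw (pcst j0))) (pmul (pcst 2) pid)) (pcst 40).
(** The word is first made positive by means of [R9]; then [trivial_path] provides a loop at 0 with
    this label, and [hw_red] contracts the label. *)
Lemma h_red (w : word A) : onh w -> eval g12 w = 1%g -> red (f12 (size w)) w.
Proof.
move=> /onh_hwl[u ->]; have [v [sv -> d]] := hwl_pos u => E.
have lp' := lpath_mono (leq_addr j0 _) (lpathE (trivial_path E)).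
have := hw_red rmM' rnM' rmn' raS' rcS' rm_dbl' rn_dbl' M1' relX' relL' relT' l1x' l1t' l1l' l2p' l2h' l2e' lab1' comm' relP' relE' relS' relSl' (leq_addl _ _) lp'.
rewrite sv => r; have s1 : size (hwl u) = size u by rewrite size_map.
apply: (@red_der_trans _ _ _ _ (hw v)); first by apply: der_mono d; rewrite s1 /f12 /=; lia.
by apply: red_mono r; rewrite -bjpE s1 /f12; rewrite /padd /pfcomp /pcst /pmul /pid; move: (bjp) => q /=; lia.
Qed.

Lemma e_pieces u : exists ps : seq (word A * word A), [/\ flatten [seq p.1 | p <- ps] = pwl u,
  flatten [seq p.2 | p <- ps] = hwl u & forall p, p \in ps -> [/\ onp p.1, onh p.2 & der 60 ([:: (ge, true)] ++ p.1 ++ [:: pos ge]) (p.1 ++ p.2)]].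
Proof.
elim: u => [|[x d] u [ps [E1 E2 h]]]; first by exists [::].
exists (([:: (gp x, d)], [:: (gh x, d)]) :: ps); split; rewrite /= ?E1 ?E2 //.
move=> p; rewrite inE => /predU1P[->|/h//]; split=> //.
have d0 : der 12 ([:: (ge, true)] ++ [:: pos (gp x)] ++ [:: pos ge]) ([:: pos (gp x); pos (gh x)]).
  have a1 := der_catr (X := [:: (ge, true)]) (der_relE (relE' x)) (leqnn _).
  have a2 := der_catl (Y := [:: pos (gp x); pos (gh x)]) (der_cancel R (ge, true)) (leqnn _).
  exact: der_trans (der_mono (isT : 11 <= 12) a1) (der_mono (isT : 4 <= 12) a2).
case: d; last by apply: der_mono d0.
have d1 : der 60 ([:: (ge, true)] ++ [:: (gp x, true)] ++ [:: pos ge]) [:: (gh x, true); (gp x, true)].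
  by have d1 := der_inv d0 (leqnn _); refine (der_mono _ d1).
apply: (der_trans d1).
by have := comm_letter commP' (x := (gp x, true)) (y := (gh x, true)) isT isT; apply: der_mono.
Qed.
Lemma hy_e (w : word A) q : onp w -> Psi_e (eval g11 w) q -> exists y,
  [/\ onh y, size y <= (padd (pmul (pcst 4) pid) (pcst 100)) (size w), eval g12 y = q &
     der ((padd (pmul (pcst 4) pid) (pcst 100)) (size w)) ((ge, true) :: w ++ [:: pos ge]) (w ++ y)].
Proof.
move=> /onp_pwl[u ->] ->; have [ps [E1 E2 h]] := e_pieces u.
have [_ o d] := conj_pieces commP' h; rewrite E1 E2 in o d.
have s1 : size (pwl u) = size u by rewrite size_map.
have s2 : size (hwl u) = size u by rewrite size_map.
exists (hwl u); split=> //.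
- by rewrite s1 s2 /=; lia.
- elim: (u) => [|[x b] v IH]; first by rewrite !eval0.
  by rewrite /hwl /pwl /= !eval_cons -/(hwl v) -/(pwl v) IH; case: b.
by apply: der_mono d; rewrite s1 s2 /=; lia.
Qed.

Lemma lp_ge : ~~ lp ge. Proof. by []. Qed.
Lemma lh_ge : ~~ lh ge. Proof. by []. Qed.
Lemma g11_h a : lh a -> g11 a = 1%g. Proof. by case: a => [[[[a|[x|x]]|]|]|]. Qed.
Lemma g12_p a : lp a -> g12 a = 1%g. Proof. by case: a => [[[[a|[x|x]]|]|]|]. Qed.
Lemma h2_red : exists f2 : pfun, forall w : word A, on2 w -> eval g2 w = 1%g -> red (f2 (size w)) w.
Proof. exact: (graph_space Pe1 PeM PeV Pe_fun lp_ge lh_ge g11_h g12_p commP' free_red h_red hy_e). Qed.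

(** The image of [t^g] under psi is [e chi(g)^-1]. It depends on [g] alone because [chi] does. *)
Let psit (g : vec) : G2 := (hstable iso2 tt * (hbase iso2 (1, chi g))^-1)%g.
Let psil (l : L) : G2 := eval g2 (pw (lab' l)).
Lemma g2_base w : all (fun x : letter A => x.1 != ge) w -> eval g2 w = hbase iso2 (eval g11 w, eval g12 w).
Proof. exact: ggen_base. Qed.
Lemma eval2_hw v : eval g2 (hw v) = hbase iso2 (1%g, evX v).
Proof.
rewrite g2_base ?eval_hw; last by rewrite all_map; apply/allP.
by rewrite (eval_eq1 g11_h) // all_map; apply/allP.
Qed.
Lemma psil_base l : psil l = hbase iso2 (eval g11 (pw (lab' l)), 1%g).
Proof.
rewrite /psil g2_base; last by rewrite all_map; apply/allP.
by rewrite (eval_eq1 g12_p) // all_map; apply/allP.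
Qed.
Lemma psil_e l : (psil l * hstable iso2 tt = hstable iso2 tt * psil l * hbase iso2 (1%g, evX (lab' l)))%g.
Proof.
rewrite psil_base -mulgA -hbaseM.
apply: (hletter_crosses iso2 (l := (tt, false))); split=> //=; first by rewrite mulg1.
by rewrite /Psi_e /= mul1g eval_pw.
Qed.
(** The image of a marked letter with label of value [h] conjugates [e] into [e h^-1] and commutes
    with [H]; this matches the factor [h] by which [chi] changes. *)
Lemma psit_move (l : L * bool) g g' : ml l.1 -> reach' g -> move ra' rc' rm' rn' l g g' ->
  psit g' = ((psilet psil l)^-1 * psit g * psilet psil l)%g.
Proof.
have h (j : L) u u' : ml j -> reach' u -> move ra' rc' rm' rn' (j, false) u u' ->
    psit u' = ((psil j)^-1 * psit u * psil j)%g.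
  move=> mlj ru mv; rewrite /psit (chi_move' mlj ru mv).
  have c v : ((hbase iso2 (1%g, v))^-1 * psil j = psil j * (hbase iso2 (1%g, v))^-1)%g.
    rewrite psil_base -hbaseV -!hbaseM; congr (hbase _ (_, _)); first by rewrite /= invg1 mul1g mulg1.
    by rewrite /= mul1g mulg1.
  have -> : hbase iso2 (1%g, (chi u * evX (lab' j))%g) = (hbase iso2 (1%g, chi u) * hbase iso2 (1%g, evX (lab' j)))%g.
    by rewrite -hbaseM; congr (hbase _ (_, _)); rewrite mulg1.
  rewrite invgM -!mulgA c !mulgA; congr (_ * _)%g.
  have := psil_e j; move: (psil j) (hstable iso2 tt) (hbase _ _) => p e x E.
  have E' : (e * p = p * (e * x^-1))%g by rewrite mulgA E mulgK.
  by rewrite -mulgA E' mulKg.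
case: l => j [] /= mlj rg mv; rewrite /psilet /=; last exact: h.
have mv' := move_sym mv; have rg' : reach' g' by apply: (ReachS (l := (j, true)) _ rg mv).
rewrite invgK (h _ _ _ mlj rg' mv'); move: (psit g') (psil j) => a c; by rewrite !mulgA mulgV mul1g mulgK.
Qed.

Let fel : eqType := ((vec * bool) + (L * bool))%type.
Let fval (x : fel) : G1 := match x with inl y => hbase iso (tconj y) | inr l => hletter iso l end.
Let fpsi (x : fel) : G2 := match x with inl y => psix psit y | inr l => psilet psil l end.
Let fok (x : fel) := match x with inl y => reach' y.1 | inr l => ml l.1 end.
Let finv (x : fel) : fel := match x with inl y => inl (tinv y) | inr l => inr (linv l) end.
Let fprod (T : groupType) (f : fel -> T) (s : seq fel) := foldr (fun x y => f x * y)%g 1%g s.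
(** The graph of psi, as the set of pairs of values of one and the same product of generators. It is
    functional by [Ps_fun], that is, by [psi_wd]. *)
Let Psi_s (d : G1) (q : G2) := exists s, [/\ forall x, x \in s -> fok x, fprod fval s = d & fprod fpsi s = q].
Lemma fprod_cat (T : groupType) (f : fel -> T) s s' : fprod f (s ++ s') = (fprod f s * fprod f s')%g.
Proof. by elim: s => [|x s IH] /=; rewrite ?mul1g // IH mulgA. Qed.
Lemma fprod_inv (T : groupType) (f : fel -> T) s : (forall x, f (finv x) = (f x)^-1)%g ->
  fprod f (rev (map finv s)) = (fprod f s)^-1%g.
Proof.
move=> h; elim: s => [|x s IH]; first by rewrite /= invg1.
by rewrite /= rev_cons -cats1 fprod_cat IH /= mulg1 h invgM.
Qed.
Lemma Ps1 : Psi_s 1%g 1%g. Proof. by exists [::]. Qed.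
Lemma PsM a b c d : Psi_s a b -> Psi_s c d -> Psi_s (a * c)%g (b * d)%g.
Proof.
move=> [s [h1 <- <-]] [s' [h2 <- <-]]; exists (s ++ s'); split; rewrite ?fprod_cat //.
by move=> x; rewrite mem_cat => /orP[/h1|/h2].
Qed.
Lemma PsV a b : Psi_s a b -> Psi_s (a^-1)%g (b^-1)%g.
Proof.
move=> [s [h1 <- <-]]; exists (rev (map finv s)); split.
- by move=> x; rewrite mem_rev => /mapP[y /h1 hy ->]; case: y hy.
- by apply: fprod_inv => -[y|l]; rewrite /= ?tconjV ?hbaseV ?hletterV.
by apply: fprod_inv => -[y|l]; rewrite /= ?psix_tinv ?psilet_linv.
Qed.
Notation dv' := (@dv C L ra' rc' rm' rn' rmn').
Notation okd' := (okd ra' rc' rm' rn' ml).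
Lemma flat_dv s : (forall x, x \in s -> fok x) -> exists ds dt,
  [/\ okd' ds dt, dv' ds dt = fprod fval s & psiv psit psil ds dt = fprod fpsi s].
Proof.
elim: s => [_|x s IH h]; first by exists [::], [::]; split=> //=; rewrite /dv /hv /= hbase1.
have [|ds [dt [ok E1 E2]]] := IH; first by move=> y ys; apply: h; rewrite inE ys orbT.
have := h _ (mem_head _ _); case: x h => [y|l] h /= hy; last first.
  exists (([::], l) :: ds), dt; split; first by apply/okd_cons.
    by rewrite /dv hv_cons -/(dv' _ _) E1 /= hbase1 mul1g.
  by rewrite /= E2 mul1g.
have oky : okt ra' rc' rm' rn' ml [:: y] by move=> z; rewrite inE => /eqP ->.
exists (lmul cat [:: y] ds dt).1, (lmul cat [:: y] ds dt).2; split.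
- case: (ds) ok => [|[t3 l3] ds3] /=; first by move=> [h1 _]; split=> //; apply/(@okt_cat _ _ _ _ _ _ _ [:: y]).
  by move=> /okd_cons[h1 h2 h3]; apply/okd_cons; split=> //; apply/(@okt_cat _ _ _ _ _ _ _ [:: y]).
- by rewrite /dv hv_lmul -?/(dv' _ _) ?E1 /= ?mulg1 //; apply: tprod_cat.
rewrite -E2; case: (ds) => [|[t3 l3] ds3] //=; by rewrite !mulgA.
Qed.
Lemma dv_flat ds dt : okd' ds dt -> Psi_s (dv' ds dt) (psiv psit psil ds dt).
Proof.
have ht t : okt ra' rc' rm' rn' ml t -> Psi_s (hbase iso (tprod t)) (psiprod psit t).
  move=> ok; exists (map inl t); split.
  - by move=> x /mapP[y /ok hy ->].
  - elim: (t) => [|y u IH]; first by rewrite /= hbase1.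
    exact: etrans (congr1 (fun z => hbase iso (tconj y) * z)%g IH) (esym (hbaseM _ _ _)).
  - by elim: (t) => [|y u IH] //=; rewrite IH.
elim: ds => [[h _]|[t l] ds IH /okd_cons[mll okt1 /IH h]]; first exact: ht.
rewrite /dv hv_cons -/(dv' _ _) /=; apply: PsM h; apply: PsM; first exact: ht.
by exists [:: inr l]; split; rewrite /= ?mulg1 // => x; rewrite inE => /eqP ->.
Qed.
Lemma Ps_fun b : Psi_s 1%g b -> b = 1%g.
Proof.
case=> s [h E <-]; have [ds [dt [ok E1 <-]]] := flat_dv h.
have h1 := psi_wd psit_move ok.
exact: h1 (etrans E1 E).
Qed.

Notation iso3 := (graph_isoP Ps1 PsM PsV Ps_fun).
Let g3 : A -> ghnn Psi_s := ggen Ps1 PsM PsV Ps_fun gs g1 g2.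
Lemma g1_2' a : l2 a -> g1 a = 1%g. Proof. by case: a => [[[[[a|a]|[x|x]]|]|]|]. Qed.
Lemma g2_1' a : l1 a -> g2 a = 1%g.
Proof.
have h : g11 a = 1%g -> g12 a = 1%g -> a != ge -> g2 a = 1%g.
  by move=> E1 E2 /negPf E3; rewrite /g2 /ggen E3 E1 E2 hbase1.
by case: a h => [[[[a|[x|x]]|]|]|] // h _; apply: h.
Qed.
Let D (b : nat) := fr b + j0 + b.
(** A label for [g] within the bounds of [direct]. Where there is none, the default is the empty
    word. *)
Let vof (b : nat) (g : vec) : seq X :=
  some_such [::] (fun v => lpath' (D b) (0%R, [::]) (g, v) /\ size v <= D b).
Lemma vofP b g : reach' g -> small b g ->
  [/\ lpath' (D b) (0%R, [::]) (g, vof b g), size (vof b g) <= D b & evX (vof b g) = chi g].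
Proof.
move=> rg sg; have [v [h1 h2]] := direct (reachE rg) sg.
have h3 : lpath' (D b) (0%R, [::]) (g, v) /\ size v <= D b.
  by split; [apply: lpath_mono (lpathE h1)|apply: leq_trans h2 _]; rewrite /D; lia.
have [h4 h5] := some_suchP [::] (Q := fun v => lpath' (D b) (0%R, [::]) (g, v) /\ size v <= D b) h3; split=> //.
exact: (lpath_ev chi0 chi_move' h4).
Qed.
Let yt b (x : vec * bool) : word A :=
  if x.2 then hw (vof b x.1) ++ [:: (ge, true)] else [:: pos ge] ++ inv_word (hw (vof b x.1)).
Let yl (l : L * bool) : word A := if l.2 then inv_word (pw (lab' l.1)) else pw (lab' l.1).
Let pct b (t : seq (vec * bool)) : seq (word A * word A) := [seq (conjw x.1 x.2, yt b x) | x <- t].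
Let pcd b ds dt : seq (word A * word A) :=
  flatten [seq pct b x.1 ++ [:: (stw gl x.2, yl x.2)] | x <- ds] ++ pct b dt.
Lemma pct1 b t : flatten [seq p.1 | p <- pct b t] = tw gx gt gl dbl t.
Proof. by rewrite /pct -map_comp. Qed.
Lemma pcd_cons b t l ds dt : pcd b ((t, l) :: ds) dt = pct b t ++ [:: (stw gl l, yl l)] ++ pcd b ds dt.
Proof. by rewrite /pcd /= -!catA. Qed.
Lemma pcd1 b ds dt : flatten [seq p.1 | p <- pcd b ds dt] = sw gx gt gl dbl (dsk ds) (dt, 0%R).
Proof.
elim: ds => [|[t l] ds IH].
  by rewrite /pcd [flatten _]/= pct1 /sw /= /kw /= vecw0 cats0.
rewrite pcd_cons map_cat flatten_cat pct1 map_cat flatten_cat IH sw_cons.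
by rewrite /kw vecw0 cats0.
Qed.
Lemma eval_yt b x : reach' x.1 -> small b x.1 -> eval g2 (yt b x) = psix psit x.
Proof.
case: x => g e /= rg sg; have [_ _ ev] := vofP rg sg.
have ge2 : eval_letter g2 (pos ge) = hstable iso2 tt by rewrite /eval_letter /g2 /ggen eqxx.
have ge3 : eval_letter g2 (ge, true) = ((hstable iso2 tt)^-1)%g by rewrite -ge2.
rewrite /yt /psix /= /psit; case: e => /=.
  by rewrite eval_cat eval1 ge3 eval2_hw ev invgM invgK.
by rewrite eval_cons eval_inv ge2 eval2_hw ev.
Qed.
Lemma eval_yl l : eval g2 (yl l) = psilet psil l.
Proof. by case: l => l []; rewrite /yl /psilet /= ?eval_inv. Qed.
Lemma eval_pcd b ds dt : okd' ds dt -> ssmall b (dsk ds) (dt, 0%R) ->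
  eval g2 (flatten [seq p.2 | p <- pcd b ds dt]) = psiv psit psil ds dt.
Proof.
have ht t : okt ra' rc' rm' rn' ml t -> tsmall b t -> eval g2 (flatten [seq p.2 | p <- pct b t]) = psiprod psit t.
  elim: t => [|x t IH] ok st; first by rewrite eval0.
  rewrite /pct /= eval_cat -/(pct b t) IH ?eval_yt //.
  - by apply: ok; apply: mem_head.
  - by apply: st; apply: mem_head.
  - by move=> z zt; apply: ok; rewrite inE zt orbT.
  by move=> z zt; apply: st; rewrite inE zt orbT.
elim: ds => [[h _] [_ [h' _]]|[t l] ds IH /okd_cons[mll okt1 h]]; first exact: ht.
rewrite /dsk /= => /ssmall_cons[[/= st _] ss].
rewrite pcd_cons map_cat flatten_cat map_cat flatten_cat eval_cat ht // eval_cat IH //.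
by rewrite [flatten _]/= cats0 eval_yl /= mulgA.
Qed.
Lemma pcd_ok b ds dt : okd' ds dt -> ssmall b (dsk ds) (dt, 0%R) ->
  forall p, p \in pcd b ds dt -> [/\ on1 p.1, on2 p.2, size p.2 <= D b + 1 & der (20 * bj C M (D b)) ([:: (gs, true)] ++ p.1 ++ [:: pos gs]) (p.1 ++ p.2)].
Proof.
have ht t : okt ra' rc' rm' rn' ml t -> tsmall b t -> forall p, p \in pct b t ->
    [/\ on1 p.1, on2 p.2, size p.2 <= D b + 1 & der (20 * bj C M (D b)) ([:: (gs, true)] ++ p.1 ++ [:: pos gs]) (p.1 ++ p.2)].
  move=> ok st p /mapP[[g e] xt ->]; have rg := ok _ xt; have sg := st _ xt; rewrite /= in rg sg *.
  have [h1 h2 _] := vofP rg sg; split.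
  - exact: (on1_conjw dbl l1x' l1t' l1l').
  - by case: e {xt} => /=; rewrite ?all_cat ?all_inv (on2_hw l2h') ?l2e' //= ?l2e'.
  - by case: e {xt} => /=; rewrite ?size_cat ?size_inv_word size_map /=; move: h2; clear; lia.
  have sg' : small (D b) g by apply: small_le sg; rewrite /D; lia.
  have jj : j0 <= D b by rewrite /D; lia.
  exact: (conj_der rmM' rnM' rmn' raS' rcS' rm_dbl' rn_dbl' M1' relX' relL' relT' l1x' l1t' l1l' l2p' l2h' l2e' lab1' comm' relP' relE' relS' relSl' e jj sg' h2 h1).
have b1 : 1000 <= bj C M (D b) by rewrite /bj; lia.
elim: ds => [[h _] [_ [h' _]]|[t l] ds IH /okd_cons[mll okt1 h]]; first exact: ht.
rewrite /dsk /= => /ssmall_cons[[/= st _] ss] p.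
rewrite pcd_cons mem_cat => /orP[/(ht _ okt1 st)//|]; rewrite inE => /predU1P[->|]; last by apply: IH.
have o2 : on2 (pw (lab' l.1)) by rewrite all_map; apply/allP.
split=> /=.
- by case: (l).
- by rewrite /yl; case: ifP; rewrite ?all_inv.
- by rewrite /yl; case: ifP; rewrite ?size_inv_word size_map; have := lab1' l.1; lia.
have d0 : der 20 ([:: (gs, true)] ++ [:: pos (gl l.1)] ++ [:: pos gs]) ([:: pos (gl l.1)] ++ pw (lab' l.1)).
  have sl : size (pw (lab' l.1)) <= 1 by rewrite size_map; apply: lab1'.
  have a1 := der_catr (X := [:: (gs, true)]) (der_relE (relSl' mll)) (leqnn _).
  have a2 := der_catl (Y := [:: pos (gl l.1)] ++ pw (lab' l.1)) (der_cancel R (gs, true)) (leqnn _).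
  apply: der_trans (der_mono _ a1) (der_mono _ a2); by rewrite /= ?size_cat /=; move: sl; move: (size _); lia.
case: l {mll} d0 o2 => l [] /= d0 o2; rewrite /WordArithmetic.stw /yl /=; last by apply: der_mono d0; lia.
have sl : size (pw (lab' l)) <= 1 by rewrite size_map; apply: lab1'.
have d1 := der_inv d0 (leqnn _).
have o1 : on1 [:: (gl l, true)] by [].
have o3 : on2 (inv_word (pw (lab' l))) by rewrite all_inv.
apply: (der_trans (b := inv_word (pw (lab' l)) ++ [:: (gl l, true)])).
  move: d1; rewrite (inv_word_cat [:: pos (gl l)] (pw _)) => d1; apply: der_mono d1.
  by rewrite /=; move: sl b1; move: (size _) (bj _ _ _); clear; lia.
have := comm_word comm' o1 o3; apply: der_mono; rewrite size_inv_word /=.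
by move: sl b1; move: (size _) (bj _ _ _); clear; lia.
Qed.

Lemma on1_all (w : word A) : all (fun x : letter A => [|| l1 x.1, l2 x.1 | x.1 == gs]) w.
Proof. by apply/allP => -[[[[[[a|a]|[x|x]]|]|]|] d] _; rewrite /l2 /= ?eqxx ?orbT. Qed.
Let bb : pfun := padd (pcst (j0 + M + 20)) (pmul (pcst (M + 20)) pid).
Let Dp : pfun := padd (padd fr (pcst j0)) pid.
Let UU := pfcomp (uof C M) bb.
Let WW := pfcomp (wof C M) bb.
Let fys : pfun := padd (padd (padd (pmul (pcst 4000) WW) (pmul (padd (pmul (pcst 4) pid) (pcst 2)) (pmul (pcst 30) UU)))
   (pmul (pcst 10) pid))
  (padd (pmul (pcst 30) (pfcomp bjp (pfcomp Dp bb))) (padd (pmul (pcst 10) (pmul (padd (pmul (pcst 2) pid) (pcst 1)) (padd (pfcomp Dp bb) (pcst 1)))) (pcst 100))).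
(** By [dform], [w] becomes a product of generators [t^g] and marked letters with few digits. Then
    [s] is carried across these one by one, with a label chosen by [vof] for each [t^g], and
    [conj_pieces] collects the factors of the second group. *)
Lemma hy_s (w : word A) q : on1 w -> Psi_s (eval g1 w) q -> exists y,
  [/\ on2 y, size y <= fys (size w), eval g2 y = q &
     der (fys (size w)) ((gs, true) :: w ++ [:: pos gs]) (w ++ y)].
Proof.
move=> ow Pq; have [s0 [h0 E0 E0']] := Pq; have [ds [dt [ok E1 E2]]] := flat_dv h0.
set n := size w; set b := bb n; have w1 := wof1 C M b; have w2 := wof2 C M b.
have hb : j0 + n.+1 <= b by rewrite /b /bb /=; nia.
have [s [k [ss sz ts vs d]]] := word_kseq rm_dbl' rn_dbl' M1' g1x' g1t' g1l' relX' relL' l1P' l1t' ow (leqnn _) hb.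
have vd : hv iso (@kvl C) s k = dv' ds dt by rewrite vs E1 E0.
have hj : j0 + size w + 1 + (M + 8) * n.+1 <= b by rewrite /b /bb /= -/n; nia.
have [ds' [dt' [[ok' sd' ss' ts' vd'] d']]] := dform rmM' rnM' raS' rcS' rm_dbl' rn_dbl' relX' relL' relT' w1 w2 M1' sz (leq_trans (leq_addr _ _) (leq_addr _ _)) hj ss ok vd.
have Eq : psiv psit psil ds' dt' = q.
  by apply: (Psi_eq PsM PsV Ps_fun _ Pq); rewrite -E0 -E1 -vd'; apply: dv_flat.
have H21 a c m : a <= m -> c <= m -> a + c + 1 <= 2 * m + 1 by clear; lia.
have H20 a c m : a <= m -> c <= m -> a + c <= 2 * m by clear; lia.
have ps := pcd_ok ok' ss'.
have ps' p : p \in pcd b ds' dt' -> [/\ on1 p.1, on2 p.2 & der (20 * bj C M (D b)) ([:: (gs, true)] ++ p.1 ++ [:: pos gs]) (p.1 ++ p.2)].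
  by move=> /ps[].
have [_ oy dp] := conj_pieces comm' ps'; rewrite pcd1 in dp.
set y := flatten [seq p.2 | p <- _] in oy dp *; set V := sw _ _ _ _ _ _ in dp d'.
have cnt : size (pcd b ds' dt') = tsize (dsk ds') (dt', 0%R) + size ds'.
  elim: (ds') => [|[t l] r IH]; first by rewrite /pcd /pct size_map /tsize /= addn0.
  by rewrite pcd_cons (size_cat (pct b t)) (size_cat [:: _]) IH size_map /tsize /= !addnA addn1 !addnS !addSn -!addnA; congr (_ + _).+1.
have sy : size y <= 2 * n * (D b + 1).
  apply: (@leq_trans (size (pcd b ds' dt') * (D b + 1))).
    rewrite /y; elim: (pcd b ds' dt') ps => //= p r IH h; rewrite size_cat mulSn leq_add //.
      by have [] := h p (mem_head _ _).
    by apply: IH => z zr; apply: h; rewrite inE zr orbT.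
  rewrite leq_mul2r cnt; apply/orP; right.
  exact: H20 (leq_trans ts' ts) (leq_trans sd' sz).
have sV : size V <= (2 * n + 1) * uof C M b.
  apply: leq_trans (sw_sz gx gt gl dbl w1 w2 M1' ss') _; rewrite -/(uof C M b) leq_mul2r; apply/orP; right.
  by apply: H21; [exact: leq_trans ts' ts|rewrite /dsk size_map; exact: leq_trans sd' sz].
set Q0 := 4000 * wof C M b + (4 * n + 2) * (30 * uof C M b) + n.
have dV : der Q0 w V.
  apply: (der_trans (b := sw gx gt gl dbl s k)).
    exact: der_mono (arith1 _ _ _) d.
  exact: der_mono (arith2 _ (H21 _ _ _ ts sz)) d'.
exists y; have By : [/\ size y <= fys n, Q0 + size y + 2 <= fys n & 20 * bj C M (D b) + 2 * (size V + size y) + 30 <= fys n].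
  have -> : fys n = 4000 * wof C M b + (4 * n + 2) * (30 * uof C M b) + 10 * n + (30 * bj C M (D b) + (10 * ((2 * n + 1) * (D b + 1)) + 100)).
    rewrite -bjpE /D; by [].
  exact: arith3 sy sV.
have [By1 By2 By3] := By; split=> //; first by rewrite /y (eval_pcd ok' ss').
apply: (der_trans (b := [:: (gs, true)] ++ V ++ [:: pos gs])).
  by have := der_in (X := [:: (gs, true)]) (Y := [:: pos gs]) dV (leqnn _); apply: der_mono; rewrite -addnA; exact: leq_trans (leq_add (leq_addr (size y) Q0) (leqnn 2)) By2.
apply: (der_trans (b := V ++ y)); first by apply: der_mono dp.
by apply: der_catl (der_sym dV) _; move: By2; clear; lia.
Qed.

Lemma g3_base w : all (fun x : letter A => x.1 != gs) w -> eval g3 w = hbase iso3 (eval g1 w, eval g2 w).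
Proof. exact: ggen_base. Qed.
Lemma ne1 (u : word A) : on1 u -> all (fun x : letter A => x.1 != gs) u.
Proof. by apply: sub_all => x; apply: contraTneq => ->. Qed.
Lemma ne2 (u : word A) : on2 u -> all (fun x : letter A => x.1 != gs) u.
Proof. by apply: sub_all => x; apply: contraTneq => ->. Qed.
Lemma g3_l1 u v : on1 u -> on1 v -> eval g1 u = eval g1 v -> eval g3 u = eval g3 v.
Proof. by move=> ou ov E; rewrite !g3_base ?ne1 // E !(eval_eq1 g2_1'). Qed.
Lemma g3_l2 u v : on2 u -> on2 v -> eval g2 u = eval g2 v -> eval g3 u = eval g3 v.
Proof. by move=> ou ov E; rewrite !g3_base ?ne2 // E !(eval_eq1 g1_2'). Qed.
Lemma g3_s u (v w : word A) : on1 u -> on2 v -> Psi_s (eval g1 u) (eval g2 v) ->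
  eval g3 (u ++ [:: pos gs]) = eval g3 ([:: pos gs] ++ u ++ v).
Proof.
move=> ou ov h; rewrite !eval_cat.
have -> : eval g3 [:: pos gs] = hletter iso3 (tt, false) by rewrite eval1 /eval_letter /g3 /ggen eqxx.
rewrite (g3_base (ne1 ou)) (g3_base (ne2 ov)) (eval_eq1 g2_1' ou) (eval_eq1 g1_2' ov) -hbaseM.
apply: hletter_crosses; split=> //=; first by rewrite mulg1.
by rewrite mul1g.
Qed.
Lemma g3_rel r : r \in R -> eval g3 r = 1%g.
Proof.
rewrite !mem_cat => /orP[/mapP[[i j] _ ->]|/orP[/mapP[[l i] _ ->]|/orP[/mapP[l _ ->]|/orP[/mapP[[a b]]|]]]].
- by apply/eval_relator; apply: g3_l1 => //; apply: (eval_relX g1x').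
- apply/eval_relator; apply: g3_l1; last exact: (eval_relL g1x' g1l').
    by rewrite all_cat all_nseq /= orbT.
  by rewrite /= all_nseq orbT.
- apply/eval_relator; apply: g3_l1; last exact: (eval_relT rm_dbl' rn_dbl' g1x' g1t' g1l').
    by rewrite all_cat (on1_conjw dbl l1x' l1t' l1l').
  by rewrite /= (on1_conjw dbl l1x' l1t' l1l').
- rewrite mem_filter => /andP[hab _] ->; have la : l1 a by case/andP: hab.
  have lb : l2 b by case/andP: hab.
  apply/eval_relator; rewrite [(a, b).1]/= [(a, b).2]/=.
  have na : a != gs by apply: contraTneq la => ->.
  have nb : b != gs by apply: contraTneq lb => ->.
  have e1 : all (fun x : letter A => x.1 != gs) [:: pos a; pos b] by rewrite /= na nb.
  have e2 : all (fun x : letter A => x.1 != gs) [:: pos b; pos a] by rewrite /= na nb.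
  rewrite (g3_base e1) (g3_base e2) !eval2.
  have E1 := g1_2' lb; have E2 := g2_1' la.
  move: (g1 a) (g1 b) (g2 a) (g2 b) E1 E2 => x y z t -> ->.
  by rewrite !mulg1 !mul1g.
case/orP=> [/mapP[[a b]]|].
  rewrite mem_filter => /andP[hab _] ->; have la : lp a by case/andP: hab.
  have lb : lh b by case/andP: hab.
  apply/eval_relator; rewrite [(a, b).1]/= [(a, b).2]/=.
  have [[x ->] [y ->]] : (exists x, a = gp x) /\ exists x, b = gh x.
    by move: la lb {hab}; case: a => [[[[?|[x|?]]|]|]|] //; case: b => [[[[?|[?|y]]|]|]|] //; split; [exists x|exists y].
  apply: g3_l2 => //; rewrite !g2_base // !eval2 [g11 (gh _)]/= [g12 (gp _)]/=.
  by rewrite !mulg1 !mul1g.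
case/orP=> [/mapP[x _ ->]|].
  apply/eval_relator; apply: g3_l2; rewrite /= ?l2e' //.
  have ge2 : eval_letter g2 (pos ge) = hletter iso2 (tt, false) by rewrite /eval_letter /g2 /ggen eqxx.
  have ge3 : g2 ge = hletter iso2 (tt, false) := ge2.
  have -> : eval g2 [:: pos ge; pos (gp x); pos (gh x)] = (g2 ge * eval g2 [:: pos (gp x); pos (gh x)])%g by rewrite eval3 eval2.
  have -> : eval g2 [:: pos (gp x); pos ge] = (eval g2 [:: pos (gp x)] * g2 ge)%g by rewrite eval2 eval1.
  rewrite ge3 (g2_base (w := [:: pos (gp x); pos (gh x)])) // (g2_base (w := [:: pos (gp x)])) //.
  rewrite !eval2 !eval1; apply: hletter_crosses; split; rewrite /Psi_e /= ?mulg1 ?mul1g //.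
case/orP=> [|].
  rewrite inE => /eqP ->; apply/eval_relator.
  apply: (@g3_s [:: pos gt] [:: pos ge] [::]); rewrite /= ?l2e' //.
  exists [:: inl (0%R, false)]; split.
  - by move=> x; rewrite inE => /eqP ->; apply: Reach0.
  - by rewrite /= mulg1 eval1 /eval_letter /= /tconj /= oppr0 kvec0 mul1g mulg1.
  rewrite /= mulg1 /psix /= /psit chi0 eval1 /eval_letter /g2 /ggen eqxx.
  by rewrite (hbase1 iso2) invg1 mulg1.
case/orP=> [/mapP[j _ ->]|/mapP[x _ ->]].
  apply/eval_relator; apply: (@g3_s [:: pos (gl (inl j))] (pw (lab j)) [::]) => //.
    by rewrite all_map; apply/allP.
  exists [:: inr (inl j, false)]; split; rewrite /= ?mulg1 ?eval1 //.
  by move=> y; rewrite inE => /eqP ->.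
rewrite g3_base // (eval_eq1 g1_2') // g2_base // (eval_eq1 g11_h) //.
rewrite eval2 [g12 (gh x)]/= [g12 (gh (ix x))]/= hix mulgV.
by rewrite (hbase1 iso2) (hbase1 iso3).
Qed.

Theorem final_group : exists (G : groupType) (A : finType) (R : seq (word A)) (gen : A -> G),
    [/\ presents R gen, polynomial_growth (space_function R)
      & exists f : {multiplicative H -> G}, injective f].
Proof.
have l1s : ~~ l1 gs by [].
have l2s : ~~ l2 gs by [].
have [f1 h1] := rule_group_space rmM' rnM' raS' rcS' rm_dbl' rn_dbl' M1' g1x' g1t' g1l' relX' relL' relT' l1P' l1t'.
have [f2 h2] := h2_red.
have [FF hF] := graph_space Ps1 PsM PsV Ps_fun l1s l2s g1_2' g2_1' comm' h1 h2 hy_s.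
have hF' w : eval g3 w = 1%g -> red (FF (size w)) w by apply: hF; apply: on1_all.
have hR := g3_rel.
exists (gsub g3), A, R, (sgen g3); split; first exact: sgen_presents hR hF'.
  apply: space_growth => w hw; apply: hF'.
  by rewrite (eval_pe hR hw) eval0.
pose emb h := hbase iso3 (1%g, hbase iso2 (1%g, h)).
have embP h : gen_pred g3 (emb h).
  have [w <-] := Xgen h; apply/asboolP; exists (hw w).
  rewrite /g3 (@ggen_base _ _ _ _ Ps1 PsM PsV Ps_fun gs g1 g2); last by rewrite all_map; apply/allP.
  by rewrite -/g2 eval2_hw (eval_eq1 g1_2') // all_map; apply/allP.
pose f h := GSub (embP h).
have fM : {morph f : x y / (x * y)%g}.
  move=> x y; apply: val_inj; rewrite /= /emb -hbaseM; congr (hbase _ (_, _)); first by rewrite mulg1.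
  by rewrite -hbaseM; congr (hbase _ (_, _)); rewrite mulg1.
pose ff : {multiplicative H -> gsub g3} := HB.pack_for {multiplicative H -> gsub g3} f (isMultiplicative.Build _ _ f fM).
exists ff => x y E; have E1 : emb x = emb y := congr1 val E.
by have E2 := congr1 snd (hbase_inj E1); have := congr1 snd (hbase_inj E2).
Qed.
End Final.
End Embedding.
Import Embedding.

(** * Stacks coded by integers and affine stack rules *)

Module StackRules.
Import Order.TTheory GRing.Theory Num.Theory.

Lemma min_natP (P : nat -> Prop) n : P n -> P (min_nat P) /\ min_nat P <= n.
Proof.
move=> Pn; rewrite /min_nat; case: pselect => [e|[]]; last by exists n; apply/asboolP.
case: ex_minnP => m /asboolP Pm hm; split=> //; exact/hm/asboolP.
Qed.

Lemma poly_bound (p : {poly rat}) : exists c : nat, forall n : nat, (p.[n%:R] <= (c * n.+1 ^ c)%:R)%R.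
Proof.
elim/poly_ind: p => [|p a [c hc]]; first by exists 0 => n; rewrite horner0.
have [d hd] : exists d : nat, (a <= d%:R)%R.
  exists (Num.bound `|a|)%R; apply: le_trans (ler_norm a) _; apply: ltW.
  by apply: archi_boundP; apply: normr_ge0.
exists (c + d).+1 => n; rewrite hornerMXaddC.
apply: (@le_trans _ _ ((c * n.+1 ^ c)%:R * n%:R + d%:R)%R); first by rewrite lerD // ler_wpM2r.
rewrite -natrM -natrD ler_nat.
have h1 : n.+1 ^ c * n <= n.+1 ^ (c + d).+1.
  by rewrite expnSr; apply: leq_mul => //; rewrite leq_pexp2l // leq_addr.
have h2 : 0 < n.+1 ^ (c + d).+1 by rewrite expn_gt0.
have := leq_mul (leqnn c) h1; have := leq_mul (leqnn d) h2; rewrite muln1 mulnA.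
move: (n.+1 ^ (c + d).+1) (c * n.+1 ^ c * n) h2 => e f; rewrite mulSn mulnDl; lia.
Qed.
Lemma growth_pfun f : polynomial_growth f -> exists F : pfun, forall n, f n <= F n.
Proof.
move=> [g [p [_ gp [c _ h]]]]; have [d hd] := poly_bound p.
have [e he] : exists e, forall n, g n <= e * n.+1 ^ e.
  by exists d => n; rewrite -(ler_nat rat) gp; apply: hd.
pose E : pfun := pmul (pcst e) (PFun (pf := fun n => n.+1 ^ e) (ex_intro _ e.+1 (fun n => leq_trans (leq_pexp2l (ltn0Sn n) (leqnSn e)) (leq_pmull _ (ltn0Sn e)))) (fun m n h => leq_exp_base e (h : m.+1 <= n.+1))).
exists (padd (pmul (pcst c) (pfcomp E (pmul (pcst c) pid))) (pmul (pcst c) pid)) => n.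
by apply: leq_trans (h n) _; rewrite leq_add2r leq_mul2l; apply/orP; right; apply: he.
Qed.

Section Digits.
Variables (C D : finType).
Notation vec := {ffun C -> int}.
Notation m := #|D|.+1.
(** Digits start at 1, so that different stacks have different codes, even if one of them is a
    prefix of the other; the empty stack has code 0. *)
Definition code (d : D) : nat := (enum_rank d).+1.
Lemma code_lt d : code d < m. Proof. by rewrite /code ltnS ltn_ord. Qed.
Fixpoint enc (s : seq D) : nat := if s is d :: s' then code d + m * enc s' else 0.
Lemma enc_cat p z : enc (p ++ z) = enc p + m ^ size p * enc z.
Proof.
elim: p => [|d p IH]; first by rewrite mul1n.
by rewrite [LHS]/= IH /= expnS; lia.
Qed.
Lemma enc_lt s : enc s < m ^ size s.
Proof.
elim: s => [|d s IH] //=; rewrite expnS; apply: leq_trans (leq_mul (leqnn m) IH).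
by rewrite mulnS ltn_add2r code_lt.
Qed.
Lemma enc_small s : enc s < 2 ^ (m * size s).
Proof. by apply: leq_trans (enc_lt s) _; rewrite expnM; apply: leq_exp_base; apply: ltnW; apply: ltn_expl. Qed.
Lemma size_enc n s : enc s < 2 ^ n -> size s <= n.
Proof.
have h t : 2 ^ size t <= (enc t).+1.
  elim: t => [|d t IH] //=; rewrite expnS.
  have mD : 2 <= m by rewrite ltnS; apply/card_gt0P; exists d.
  have cd : 0 < code d by []. by have := leq_mul mD (leqnn (enc t)); move: IH cd; move: (enc t) (code d) (2 ^ size t) (m * enc t); clear; lia.
move=> hs; have : 2 ^ size s <= 2 ^ n by apply: leq_trans (h s) hs.
by rewrite leq_exp2l.
Qed.
(** In an affine rule [z] ranges over all integers. Comparing remainders modulo [m] and using that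
    digits lie strictly between 0 and [m], one finds that only codes of stacks can occur as [z]. *)
Lemma enc_prefix p s (z : int) : ((enc s)%:Z = ((enc p)%:Z + (m ^ size p)%:Z * z))%R ->
  exists s', s = p ++ s' /\ z = enc s'.
Proof.
elim: p s z => [|d p IH] s z; first by rewrite /= => h; exists s; split=> //; lia.
case: s => [|a s] /=; rewrite ?expnS => h.
  (* The empty stack is impossible here: the code of [d] would be a multiple of [m], although it
     lies strictly between 0 and [m]. *)
  exfalso; have := code_lt d; have : 0 < code d by []. move: h; move: (code d) (enc p) (#|D|.+1) (m ^ size p) => x y M w h1 h2 h3.
  have E : (x%:Z = - (M%:Z * (y%:Z + w%:Z * z)))%R by move: h1; rewrite !PoszD !PoszM; nia.
  have : (x%:Z < M%:Z)%R by lia.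
  have : (0 < x%:Z)%R by lia.
  rewrite E; move: (_ + _)%R => u; have [u0|u0] : (u <= -1 \/ 0 <= u)%R by lia.
    by have := ler_wpM2l (isT : (0 <= M%:Z)%R) u0; lia.
  by have := mulr_ge0 (isT : (0 <= M%:Z)%R) u0; lia.
have E : code a = code d /\ ((enc s)%:Z = (enc p)%:Z + (m ^ size p)%:Z * z)%R.
  have := code_lt d; have := code_lt a; move: h; move: (code d) (code a) (enc p) (enc s) (#|D|.+1) (m ^ size p) => x x' y s' M w h h1 h2.
  have h' : (x'%:Z - x%:Z = M%:Z * ((y%:Z + w%:Z * z) - s'%:Z))%R.
    by move: h; rewrite !PoszD !PoszM; nia.
  move: h'; set u := (_ - s'%:Z)%R => h'.
  have u0 : u = 0%R by nia.
  by rewrite u0 mulr0 in h'; split; [lia|move: u0; rewrite /u; lia].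
case: E => /succn_inj/val_inj/enum_rank_inj -> /IH[s' [-> ->]].
by exists s'.
Qed.
Lemma enc_inj : injective enc.
Proof.
move=> s p E; have [|s' [-> ]] := @enc_prefix p s 0%R; first by rewrite E mulr0 addr0.
case: s' => [|d s' /= h]; first by rewrite cats0.
by exfalso; have : 0 < code d by []; lia.
Qed.

Definition stacks := C -> seq D.
Definition encv (s : stacks) : vec := [ffun c => (enc (s c))%:Z%R].
Lemma encv_inj s s' : encv s = encv s' -> s = s'.
Proof. by move=> /ffunP E; apply/funext => c; have := E c; rewrite !ffunE => -[/enc_inj]. Qed.
(** The flag [true] demands that the given word be the whole stack, which makes it possible to test
    for emptiness; [false] replaces a prefix. An exact stack receives the multiplier 0. *)
Definition srule := C -> bool * (seq D * seq D).
Definition rstep (r : srule) (s s' : stacks) := forall c,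
  if (r c).1 then s c = (r c).2.1 /\ s' c = (r c).2.2
  else exists z, s c = (r c).2.1 ++ z /\ s' c = (r c).2.2 ++ z.
Variables (J : finType) (rl : J -> srule).
Definition sra (j : J) : vec := [ffun c => (enc (rl j c).2.1)%:Z%R].
Definition src_ (j : J) : vec := [ffun c => (enc (rl j c).2.2)%:Z%R].
Definition srm (j : J) c := if (rl j c).1 then 0 else m ^ size (rl j c).2.1.
Definition srn (j : J) c := if (rl j c).1 then 0 else m ^ size (rl j c).2.2.
Lemma srmn j c : (srm j c == 0) = (srn j c == 0).
Proof. by rewrite /srm /srn; case: ifP => // _; rewrite !expn_eq0. Qed.
Notation smove := (move sra src_ srm srn).
Lemma smoveE j g g' : smove (j, false) g g' <-> exists z : vec, forall c,
  g c = ((enc (rl j c).2.1)%:Z + (srm j c)%:Z * z c)%R /\ g' c = ((enc (rl j c).2.2)%:Z + (srn j c)%:Z * z c)%R.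
Proof.
split=> [[z [-> ->]]|[z h]]; first by exists z => c; rewrite !ffunE.
by exists z; split; apply/ffunP => c; have [h1 h2] := h c; rewrite ?h1 ?h2 !ffunE.
Qed.
Lemma step_move j s s' : rstep (rl j) s s' -> smove (j, false) (encv s) (encv s').
Proof.
move=> h; apply/smoveE.
exists [ffun c => if (rl j c).1 then 0%R else (enc (drop (size (rl j c).2.1) (s c)))%:Z%R] => c.
rewrite !ffunE /srm /srn; have := h c; case: (rl j c) => [[] [p p']] /=.
  by move=> [-> ->]; rewrite !mul0r !addr0.
move=> [z [-> ->]]; rewrite drop_size_cat // !enc_cat; split; by rewrite PoszD PoszM.
Qed.
(** By [enc_prefix] an affine move that starts at a code of stacks is a genuine stack rule and ends
    at a code. Together with the backward version, this excludes meaningless reachable vectors. *)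
Lemma move_step j s g' : smove (j, false) (encv s) g' -> exists s', g' = encv s' /\ rstep (rl j) s s'.
Proof.
case/smoveE=> z h.
have H1 c : exists q, (if (rl j c).1 then s c = (rl j c).2.1 /\ q = (rl j c).2.2
    else exists z, s c = (rl j c).2.1 ++ z /\ q = (rl j c).2.2 ++ z) /\ g' c = (enc q)%:Z%R.
  have [] := h c; rewrite /srm /srn ffunE; case: (rl j c) => [[] [p p']] /=.
    rewrite !mul0r !addr0 => -[/enc_inj ->] ->; by exists p'.
  by move=> /enc_prefix[y [-> ->]] ->; exists (p' ++ y); rewrite enc_cat PoszD PoszM; split=> //; exists y.
exists (fun c => projT1 (cid (H1 c))); split.
  by apply/ffunP => c; rewrite ffunE; case: (cid (H1 c)) => q [].
by move=> c; case: (cid (H1 c)) => q [].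
Qed.
Lemma move_step_back j g s' : smove (j, false) g (encv s') -> exists s, g = encv s /\ rstep (rl j) s s'.
Proof.
case/smoveE=> z h.
have H1 c : exists q, (if (rl j c).1 then q = (rl j c).2.1 /\ s' c = (rl j c).2.2
    else exists z, q = (rl j c).2.1 ++ z /\ s' c = (rl j c).2.2 ++ z) /\ g c = (enc q)%:Z%R.
  have [] := h c; rewrite /srm /srn ffunE; case: (rl j c) => [[] [p p']] /=.
    by rewrite !mul0r !addr0 => -> [/enc_inj ->]; exists p.
  by move=> -> /enc_prefix[y [-> ->]]; exists (p ++ y); rewrite enc_cat PoszD PoszM; split=> //; exists y.
exists (fun c => projT1 (cid (H1 c))); split.
  by apply/ffunP => c; rewrite ffunE; case: (cid (H1 c)) => q [].
by move=> c; case: (cid (H1 c)) => q [].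
Qed.
(** The property has to be invariant in both directions, because inverse letters apply rules
    backwards. *)
Lemma reach_ind_stacks (P : stacks -> Prop) : P (fun=> [::]) ->
  (forall j s s', rstep (rl j) s s' -> P s <-> P s') ->
  forall g, reach sra src_ srm srn predT g -> exists s, g = encv s /\ P s.
Proof.
move=> P0 PS g; elim=> {g} [|[j d] g g' _ _ [s [-> Ps]] mv].
  by exists (fun=> [::]); split=> //; apply/ffunP => c; rewrite !ffunE.
case: d mv => [/move_sym mv|/move_step[s' [-> st]]]; last by exists s'; split=> //; apply/(PS _ _ _ st).
by have [s' [-> st]] := move_step_back mv; exists s'; split=> //; apply/(PS _ _ _ st).
Qed.
End Digits.

Lemma step_det (I : finType) (M : turing_machine I) (c d d' : config M) :
  deterministic M -> step c d -> step c d' -> d = d'.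
Proof.
move=> det /andP[_ /existsP[m /andP[hm /eqP ->]]] /andP[_ /existsP[m' /andP[hm' /eqP ->]]].
by have := card_le1_eqP (det c.1 [ffun i => scan (c.2 i)]) m m' hm hm' => ->.
Qed.
End StackRules.
Import StackRules.

(** * Simulation of the machine by stack rules *)

Module MachineSimulation.
Import GRing.Theory.

Section Machine.
Variables (B : finType) (H : groupType) (gen : B -> H) (M : turing_machine (letter B)).
Hypothesis det : deterministic M.
Hypothesis dec : decides M (fun w => eval gen w = 1%g).
Variable SM : pfun.
Hypothesis space_M : forall n, tm_space_function M n <= SM n.

Notation X := (letter B).
Notation Sym := (tm_letter M).
Notation Q := (tm_state M).
Notation k := (tm_tapes M).+1.
Notation tape := (seq Sym * seq Sym)%type.
Let St : finType := option (option Q).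
Let D : finType := (St + Sym)%type.
Let C : finType := ((bool * bool) + ('I_k * bool))%type.
(* The stacks: state, input to be copied, copied input, free space of the
   machine, and the two halves of its tapes. *)
Let cS : C := inl (false, false).
Let cU : C := inl (false, true).
Let cV : C := inl (true, false).
Let cB : C := inl (true, true).
Let cT (i : 'I_k) (b : bool) : C := inr (i, b).
Let clean : D := inl None.
Let copy : D := inl (Some None).
Let run (q : Q) : D := inl (Some (Some q)).
Let d0 : D := clean.
Let sy (a : Sym) : D := inr a.
Let le (x : X) : D := inr (inl x).
Notation stacks := (stacks C D).
Notation srule := (srule C D).
Notation crule := (bool * (seq D * seq D))%type.
Let rule (s s' : seq D) (u v b : crule) (t : 'I_k -> bool -> crule) : srule := fun c =>
  match c with
  | inl (false, false) => (true, (s, s')) | inl (false, true) => u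
  | inl (true, false) => v | inl (true, true) => b | inr (i, e) => t i e
  end.
Let keep : crule := (false, ([::], [::])).
Let none : crule := (true, ([::], [::])).
Let push d : crule := (false, ([::], [:: d])).
Let pop d : crule := (false, ([:: d], [::])).
Let ktape : 'I_k -> bool -> crule := fun _ _ => keep.
Let ntape : 'I_k -> bool -> crule := fun _ _ => none.
Let trivr : srule := rule [::] [::] none none none ntape.

(* An instruction rewrites the symbols next to the heads only. *)
Let ot (T : Type) (o : option T) : seq T := if o is Some x then [:: x] else [::].
Let loc (a b : {ffun 'I_k -> option Sym}) (ins : {ffun 'I_k -> option Sym * option bool}) i : tape :=
  act (ins i) (ot (b i), ot (a i)).
(** The number of squares by which the instruction lengthens the tapes; the same number of free
    cells is consumed. *)
Let ext (a b : {ffun 'I_k -> option Sym}) ins :=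
  \sum_i (size (loc a b ins i).1 + size (loc a b ins i).2 - (size (ot (b i)) + size (ot (a i)))).
(** If there is no letter next to the head, this half of the tape must be empty, and the rule checks
    it by an exact stack: [act] behaves differently at the ends of a tape. *)
Let trule (a b : {ffun 'I_k -> option Sym}) ins i (e : bool) : crule :=
  if e then (~~ isSome (a i), (map sy (ot (a i)), map sy (loc a b ins i).2))
  else (~~ isSome (b i), (map sy (ot (b i)), map sy (loc a b ins i).1)).
(** By determinism [pick] finds the only instruction there is. Where none applies, in particular in
    the accepting state, the rule is the identity on the empty configuration. *)
Let tmrule (q : Q) (a b : {ffun 'I_k -> option Sym}) : srule :=
  if q == tm_accept M then trivr else
  if [pick m in tm_delta q a] is Some m then
    rule [:: run q] [:: run m.1] none keep (false, (nseq (ext a b m.2) d0, [::])) (trule a b m.2)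
  else trivr.
Let J : finType := ((X + X) + (option (bool * bool) + (D + C * D)) + (Q * {ffun 'I_k -> option Sym} * {ffun 'I_k -> option Sym}))%type.
Let jpush x : J := inl (inl (inl x)).
Let jcopy x : J := inl (inl (inr x)).
Let jstart : J := inl (inr (inl (Some (false, false)))).
Let jrun : J := inl (inr (inl (Some (false, true)))).
Let jacc : J := inl (inr (inl (Some (true, false)))).
Let jfin : J := inl (inr (inl None)).
Let jbud d : J := inl (inr (inr (inl d))).
Let jclean c d : J := inl (inr (inr (inr (c, d)))).
Let jtm q a b : J := inr (q, a, b).
(** [jcopy] writes a letter twice, on [cV] and on the first tape, and pays for the second copy with
    a free cell. Free cells are supplied by [jbud] during the loading phase; once the state is
    [clean], anything may be erased. *)
Definition rl (j : J) : srule :=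
  match j with
  | inl (inl (inl x)) => rule [::] [::] (push (le x)) keep keep ktape
  | inl (inl (inr x)) => rule [:: copy] [:: copy] (pop (le x)) (push (le x)) (pop d0)
      (fun i e => if (i == ord0) && e then push (le x) else keep)
  | inl (inr (inl (Some (false, false)))) => rule [::] [:: copy] keep none keep ntape
  | inl (inr (inl (Some (false, true)))) => rule [:: copy] [:: run (tm_start M)] none keep keep ktape
  | inl (inr (inl (Some (true, false)))) => rule [:: run (tm_accept M)] [:: clean] keep keep keep ktape
  | inl (inr (inl (Some (true, true)))) => trivr
  | inl (inr (inl None)) => rule [:: clean] [::] none none none ntape
  | inl (inr (inr (inl d))) => rule [::] [::] keep keep (push d) ktape
  | inl (inr (inr (inr (c, d)))) => if c == cS then trivr else
      fun c' => if c' == cS then (true, ([:: clean], [:: clean])) else if c' == c then pop d else keep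
  | inr (q, a, b) => tmrule q a b
  end.
Definition lab (j : J) : seq X := if j is inl (inl (inl x)) then [:: x] else [::].

Let hX := eval_letter gen.
Lemma evXE w : evX hX w = eval gen w.
Proof. by elim: w => [|x w IH]; rewrite ?eval0 // eval_cons /= IH. Qed.
Let dx (d : D) : option X := if d is inr (inl x) then Some x else None.
Let ds (d : D) : option Sym := if d is inr a then Some a else None.
Let U (s : stacks) := pmap dx (s cU).
Let V (s : stacks) := pmap dx (s cV).
Let tapes (s : stacks) : {ffun 'I_k -> tape} := [ffun i => (pmap ds (s (cT i false)), pmap ds (s (cT i true)))].
(* The tapes once the rest of the loaded word has been copied. *)
Let ctapes (s : stacks) : {ffun 'I_k -> tape} :=
  [ffun i => if i == ord0 then ((tapes s i).1, map inl (rev (U s)) ++ (tapes s i).2) else tapes s i].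
Let acc (c : config M) := exists2 p, path (@step _ M) c p & (last c p).1 = tm_accept M.
(** Backward moves from the accepting state lead to configurations whose tapes have nothing to do
    with [cV]. They are joined to 0 by unlabelled moves, hence the value 1 whenever the machine
    would accept. Otherwise the value is that of the loaded word; at the start of copying the two
    agree, since accepted words have value 1. *)
Definition schi (s : stacks) : H :=
  match s cS with
  | [::] => eval gen (rev (U s))
  | [:: inl (Some None)] => if `[< acc (tm_start M, ctapes s) >] then 1%g else eval gen (rev (U s) ++ V s)
  | [:: inl (Some (Some q))] => if `[< acc (q, tapes s) >] then 1%g else eval gen (V s)
  | _ => 1%g
  end.

(** Determinism serves the direction from [c] to [d]: an accepting path from [c] has to begin with
    the step to [d]. *)
Lemma acc_step (c d : config M) : step c d -> acc c <-> acc d.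
Proof.
move=> cd; split=> -[p]; last by move=> pp h; exists (d :: p); rewrite //= cd.
case: p => [_ /= h|e p /= /andP[ce pp] h]; first by move: cd; rewrite /step h eqxx.
by exists p; rewrite (step_det det cd ce).
Qed.
Lemma acc_accept t : acc (tm_accept M, t). Proof. by exists [::]. Qed.

Lemma act_loc (ins : option Sym * option bool) (l r l' r' : seq Sym) (b a : option Sym) :
  l = ot b ++ l' -> r = ot a ++ r' -> (b = None -> l' = [::]) -> (a = None -> r' = [::]) ->
  act ins (l, r) = ((act ins (ot b, ot a)).1 ++ l', (act ins (ot b, ot a)).2 ++ r').
Proof.
move=> -> -> hb ha; case: ins => [[y|] [[]|]]; case: b hb => [b|] hb; case: a ha => [a|] ha //=;
  rewrite /act /= ?(hb erefl) ?(ha erefl) //.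
Qed.
Lemma pmap_sy (s : seq Sym) : pmap ds (map sy s) = s.
Proof. by elim: s => //= a s ->. Qed.

Lemma tm_step q a b m s s' : q != tm_accept M -> m \in tm_delta q a ->
  rstep (rule [:: run q] [:: run m.1] none keep (false, (nseq (ext a b m.2) d0, [::])) (trule a b m.2)) s s' ->
  step (q, tapes s) (m.1, tapes s').
Proof.
move=> qa hm h; apply/andP; split=> //; apply/existsP; exists m.
have ht i e := h (cT i e).
have ha : [ffun i => scan (tapes s i)] = a.
  apply/ffunP => i; rewrite !ffunE /scan /=; have := ht i true; rewrite /= /trule.
  by case: (a i) => [x|] /=; [move=> [z [-> _]]|move=> [-> _]].
rewrite /= ha hm /=; apply/eqP; congr (_, _); apply/ffunP => i; rewrite !ffunE.
have := ht i true; have := ht i false; rewrite /= /trule /loc.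
set F := act (m.2 i) (ot (b i), ot (a i)).
move=> hl hr.
have [l' [e1 e2 e3]] : exists l', [/\ pmap ds (s (cT i false)) = ot (b i) ++ l', pmap ds (s' (cT i false)) = F.1 ++ l' & b i = None -> l' = [::]].
  case: (b i) hl => [x|] /=; last by move=> [-> ->]; exists [::]; rewrite pmap_sy cats0.
  by move=> [z [-> ->]]; exists (pmap ds z); rewrite pmap_cat pmap_sy.
have [r' [f1 f2 f3]] : exists r', [/\ pmap ds (s (cT i true)) = ot (a i) ++ r', pmap ds (s' (cT i true)) = F.2 ++ r' & a i = None -> r' = [::]].
  case: (a i) hr => [x|] /=; last by move=> [-> ->]; exists [::]; rewrite pmap_sy cats0.
  by move=> [z [-> ->]]; exists (pmap ds z); rewrite pmap_cat pmap_sy.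
by rewrite e2 f2 (act_loc _ e1 f1 e3 f3).
Qed.

Lemma trivr_step s s' : rstep trivr s s' -> s = (fun=> [::]) /\ s' = (fun=> [::]).
Proof.
move=> h; split; apply/funext => c; have := h c.
  by case: c => [[[] []]|[i e]] /= [].
by case: c => [[[] []]|[i e]] /= [].
Qed.

Lemma tapes_keep s s' : (forall i e, s (cT i e) = s' (cT i e)) -> tapes s = tapes s'.
Proof. by move=> h; apply/ffunP => i; rewrite !ffunE !h. Qed.
Lemma keep_ok (x : seq D) : exists z, x = [::] ++ z /\ x = [::] ++ z.
Proof. by exists x. Qed.
Lemma keepE (s s' : stacks) c : (exists z, s c = [::] ++ z /\ s' c = [::] ++ z) -> s' c = s c.
Proof. by case=> z [-> ->]. Qed.

Lemma accepts_acc w : accepts M w <-> acc (init M w).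
Proof.
split=> [[p /andP[pp /eqP h]]|[p pp h]]; first by exists p.
by exists p; rewrite /accepting pp h /=.
Qed.

Lemma schi_step j s s' : rstep (rl j) s s' -> schi s' = (schi s * evX hX (lab j))%g.
Proof.
have tk s1 s2 : (forall i e, exists z, s1 (cT i e) = [::] ++ z /\ s2 (cT i e) = [::] ++ z) -> tapes s2 = tapes s1.
  by move=> ht; apply: tapes_keep => i e; apply: keepE.
have tn (s1 : stacks) : (forall i e, s1 (cT i e) = [::]) -> tapes s1 = [ffun=> ([::], [::])].
  by move=> ht; apply/ffunP => i; rewrite !ffunE !ht.
case: j => [[[x|x]|[[[[] []]|]|[d|[c d]]]]|[[q a] b]] h.
- have [e1 e2] := h cS; have [z [u1 u2]] := h cU; rewrite /= in e1 e2 u1 u2.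
  by rewrite /schi e1 e2 /U u1 u2 /= mulg1 rev_cons -cats1 eval_cat eval1.
- have [e1 e2] := h cS; have [z [u1 u2]] := h cU; have [y [v1 v2]] := h cV; rewrite /= in e1 e2 u1 u2 v1 v2.
  rewrite /schi e1 e2 /= mulg1 /V v1 v2 /=.
  have EU : U s = x :: U s' by rewrite /U u1 u2.
  rewrite EU rev_cons -cats1 -catA /=.
  suff -> : ctapes s = ctapes s' by [].
  apply/ffunP => i; rewrite !ffunE; have := h (cT i true); have := h (cT i false).
  rewrite /= andbF andbT => -[l [-> ->]] /=; case: eqP => _ /= [r [-> ->]] //=.
  by rewrite EU rev_cons -cats1 map_cat -catA.
- by have [-> ->] := trivr_step h; rewrite /= mulg1.
- have [e1 e2] := h cS; rewrite /= in e1 e2; rewrite /schi e1 e2 /= mulg1.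
  by rewrite (asboolT (acc_accept _)).
- have [e1 e2] := h cS; have [u1 u2] := h cU; rewrite /= in e1 e2 u1 u2.
  rewrite /schi e1 e2 /= mulg1 /U u1 /=.
  have -> : V s' = V s by rewrite /V (keepE (h cV)).
  suff -> : ctapes s = tapes s' by [].
  rewrite (tk s s'); last by move=> i e; exact: (h (cT i e)).
  by apply/ffunP => i; rewrite !ffunE /U u1 /=; case: eqP.
- have [e1 e2] := h cS; have [v1 v2] := h cV; rewrite /= in e1 e2 v1 v2.
  rewrite /schi e1 e2 /= mulg1 /V v2 /= cats0.
  have -> : U s' = U s by rewrite /U (keepE (h cU)).
  (* Here the correctness of the machine enters: if the loaded word is accepted, its value is 1. *)
  case: asboolP => // ac; apply/esym; apply/(dec _).2; apply/accepts_acc; move: ac.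
  congr (acc (_, _)); apply/ffunP => i.
  have E : U s' = U s by rewrite /U (keepE (h cU)).
  have [_ t1] := h (cT i false); have [_ t2] := h (cT i true); rewrite /= in t1 t2.
  by rewrite !ffunE E t1 t2 /= cats0; case: eqP.
- have [e1 e2] := h cS; have [u1 u2] := h cU; rewrite /= in e1 e2 u1 u2.
  by rewrite /schi e1 e2 /U u2 /= eval0 mulg1.
- have [e1 e2] := h cS; rewrite /= in e1 e2.
  by rewrite /schi e1 e2 /= mulg1 /U (keepE (h cU)).
- move: h; rewrite /rl; case: eqP => [_ /trivr_step[-> ->]|ne h]; first by rewrite /= mulg1.
  have [e1 e2] := h cS; rewrite /= in e1 e2.
  by rewrite /schi e1 e2 /= mulg1.
move: h; rewrite /rl /tmrule; case: eqP => [_ /trivr_step[-> ->]|/eqP qa]; first by rewrite /= mulg1.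
case: pickP => [m hm h|_ /trivr_step[-> ->]]; last by rewrite /= mulg1.
have [e1 e2] := h cS; rewrite /= in e1 e2.
rewrite /schi e1 e2 /= mulg1.
have -> : V s' = V s by rewrite /V (keepE (h cV)).
have st := acc_step (tm_step qa hm h).
by have -> : `[< acc (q, tapes s) >] = `[< acc (m.1, tapes s') >] by apply: asbool_equiv_eq.
Qed.

Let sumC (F : C -> nat) := F cU + F cV + F cB + \sum_i (F (cT i false) + F (cT i true)).
Lemma sumCE F : sumC F = \sum_(c | c != cS) F c.
Proof.
rewrite big_mkcond big_sumType /sumC; congr (_ + _).
  transitivity (\sum_a \sum_b (if (inl (a, b) : C) != cS then F (inl (a, b)) else 0)).
    have e (a b : bool) : ((inl (a, b) : C) != cS) = a || b by case: a; case: b.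
    by rewrite !big_bool !e /= addn0 [RHS]addnC (addnC (F (inl (true, true)))) addnA.
  by rewrite pair_bigA; apply: eq_bigr => -[a b].
transitivity (\sum_i \sum_e F (inr (i, e))).
  by apply: eq_bigr => i _; rewrite big_bool addnC.
by rewrite pair_bigA; apply: eq_bigr => -[a b].
Qed.
Let N (s : stacks) := sumC (fun c => size (s c)).
Lemma N_step r s s' : rstep r s s' ->
  sumC (fun c => size (r c).2.1) + N s' = sumC (fun c => size (r c).2.2) + N s.
Proof.
move=> h; rewrite /N !sumCE -!big_split; apply: eq_bigr => c _ /=; have := h c.
by case: (r c) => [[] [p p']] /= => [[-> ->]|[z [-> ->]]]; rewrite ?size_cat; lia.
Qed.
Lemma act_size ins (t : tape) : size t.1 + size t.2 <= size (act ins t).1 + size (act ins t).2.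
Proof.
by case: t => l r; case: ins => [[y|] [[]|]]; case: l => [|x l]; case: r => [|z r]; rewrite /act /=; lia.
Qed.
Lemma ext_sum (a b : {ffun 'I_k -> option Sym}) ins :
  \sum_i (size (ot (b i)) + size (ot (a i))) + ext a b ins = \sum_i (size (loc a b ins i).1 + size (loc a b ins i).2).
Proof.
rewrite -big_split; apply: eq_bigr => i _ /=; rewrite subnKC //; exact: (act_size (ins i) (ot (b i), ot (a i))).
Qed.
Definition region (j : J) := if j is inl (inl (inl _)) then false else
  if j is inl (inr (inr _)) then false else if j is inl (inr (inl None)) then false else true.
(** During copying and running, free cells pay for every new square, so the total size is conserved,
    forwards and backwards. A path inside this region never needs more space than its end points. *)
Lemma region_N j s s' : region j -> rstep (rl j) s s' -> N s = N s'.
Proof.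
move=> rj h; have := N_step h; suff -> : sumC (fun c => size (rl j c).2.1) = sumC (fun c => size (rl j c).2.2) by lia.
have z0 : \sum_(i < k) (0 + 0) = 0 by rewrite big1.
case: j rj {h} => [[[x|x]|[[[[] []]|]|[d|[c d]]]]|[[q a] b]] //= _; rewrite /sumC /=.
  - rewrite [X in _ + X = _]big1; last by move=> i _; rewrite andbF; case: ifP.
    by rewrite (bigD1 ord0) //= big1 // => i /negPf ->.
rewrite /tmrule; case: eqP => // _; case: pickP => //= m _.
rewrite size_nseq !add0n.
transitivity (\sum_i (size (loc a b m.2 i).1 + size (loc a b m.2 i).2)); last by apply: eq_bigr => i _; rewrite !size_map.
by rewrite -ext_sum addnC; congr (_ + _); apply: eq_bigr => i _; rewrite !size_map.
Qed.

(** A crude bound for the bits of the codes of stacks of total size [n]: each symbol is allowed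
    [#|D|.+1] bits. It also exceeds the length of the labels. *)
Let K (n : nat) := (#|D|.+1 + 1) * (n + 2).
Lemma state_size j s s' : rstep (rl j) s s' -> size (s cS) <= 1 /\ size (s' cS) <= 1.
Proof.
have tr : rstep trivr s s' -> size (s cS) <= 1 /\ size (s' cS) <= 1 by move=> /trivr_step[-> ->].
case: j => [[[x|x]|[[[[] []]|]|[d|[c d]]]]|[[q a] b]] h; try by have [-> ->] := h cS.
- by move: h; rewrite /rl; case: eqP => _ // h; have [-> ->] := h cS.
move: h; rewrite /= /tmrule; case: eqP => // _; case: pickP => // m _ h.
by have [-> ->] := h cS.
Qed.
Lemma small_enc n s : size (s cS) <= 1 -> N s <= n -> small (K n) (encv s).
Proof.
move=> s1 sn c; rewrite ffunE absz_nat; apply: leq_trans (enc_small _) _; rewrite leq_exp2l //.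
rewrite /K mulnDl mul1n; apply: leq_trans (leq_addr _ _); rewrite leq_mul2l /=.
have [->|ne] := eqVneq c cS; first by apply: leq_trans s1 _; rewrite addn2.
apply: leq_trans (_ : N s <= _); last by lia.
by rewrite /N sumCE (bigD1 c) //= leq_addr.
Qed.
Notation lpth := (lpath (sra rl) (src_ rl) (srm rl) (srn rl) predT lab).
Let LP n (x y : stacks * seq X) := lpth (K n) (encv x.1, x.2) (encv y.1, y.2).
Lemma LP_step n j s s' v : rstep (rl j) s s' -> N s <= n -> N s' <= n -> size v <= n ->
  LP n (s, v) (s', v ++ lab j).
Proof.
move=> h hs hs' hv; have [z1 z2] := state_size h.
apply: LStep => //; [exact: step_move|exact: small_enc|exact: small_enc|].
by rewrite /K; apply: leq_trans hv _; nia.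
Qed.
Lemma LP_step0 n j s s' v : lab j = [::] -> rstep (rl j) s s' -> N s <= n -> N s' <= n -> size v <= n ->
  LP n (s, v) (s', v).
Proof. by move=> l h h1 h2 h3; have := LP_step h h1 h2 h3; rewrite l cats0. Qed.

Let zero : stacks := fun=> [::].
Let sg (s : seq D) (u v : seq X) (b : seq D) (t : 'I_k -> tape) : stacks := fun c =>
  match c with
  | inl (false, false) => s | inl (false, true) => map le u | inl (true, false) => map le v | inl (true, true) => b
  | inr (i, e) => map sy (if e then (t i).2 else (t i).1) end.
Let t0 : 'I_k -> tape := fun=> ([::], [::]).
Lemma N_sg s u v b t : N (sg s u v b t) = size u + size v + size b + \sum_i (size (t i).1 + size (t i).2).
Proof. by rewrite /N /sumC /= !size_map; under eq_bigr do rewrite !size_map. Qed.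
Lemma sum_t0 : \sum_i (size (t0 i).1 + size (t0 i).2) = 0. Proof. by rewrite big1. Qed.
Lemma load_path n u b : size u + size b <= n -> LP n (zero, [::]) (sg [::] u [::] b t0, rev u).
Proof.
elim: b => [|d b IH].
  elim: u => [|x u IH] hn.
    have -> : sg [::] [::] [::] [::] t0 = zero by apply/funext => -[[[] []]|[i []]].
    exact: LRefl.
  apply: LTrans (IH _) _; first by move: hn => /=; lia.
  rewrite rev_cons -cats1; apply: (LP_step (j := jpush x)).
  - by move=> [[[] []]|[i []]] //=; try (by exists [::]); exists (map le u).
  - by rewrite N_sg sum_t0 /=; move: hn => /=; lia.
  - by rewrite N_sg sum_t0 /=; move: hn => /=; lia.
  by rewrite size_rev; move: hn => /=; lia.
move=> hn; apply: LTrans (IH _) _; first by move: hn => /=; lia.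
apply: (LP_step0 (j := jbud d)) => //.
- by move=> [[[] []]|[i []]] //=; try (by exists [::]); [exists b|exists (map le u)].
- by rewrite N_sg sum_t0 /=; move: hn => /=; lia.
- by rewrite N_sg sum_t0 /=; move: hn => /=; lia.
by rewrite size_rev; move: hn => /=; lia.
Qed.
Lemma clean_path n s v : s cS = [:: clean] -> N s <= n -> size v <= n -> LP n (s, v) (zero, v).
Proof.
have [m] := ubnP (N s); elim: m s => // m IH s Nm sS Nn vn.
have [[c [d [z [ne E]]]]|h] := pselect (exists c d z, c != cS /\ s c = d :: z).
  pose s' : stacks := fun c' => if c' == c then z else s c'.
  have st : rstep (rl (jclean c d)) s s'.
    rewrite /= (negPf ne) => c'; case: eqP => [->|/eqP nc'].
      by rewrite /= /s' eq_sym (negPf ne).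
    by rewrite /s'; case: eqP => [->|_] /=; [exists z|exists (s c')].
  have Ns : N s = (N s').+1.
    rewrite /N !sumCE (bigD1 c) //= [in RHS](bigD1 c) //= E /s' eqxx /= addSn; congr (_ + _).+1.
    by apply: eq_bigr => c' /andP[_ /negPf ->].
  apply: LTrans (LP_step0 (j := jclean c d) (s' := s') _ st Nn _ vn) _ => //; first by lia.
  apply: IH => //; last by apply: leq_trans Nn; rewrite Ns.
    by rewrite Ns ltnS in Nm.
  by rewrite /s' eq_sym (negPf ne).
have hz c : c != cS -> s c = [::].
  by move=> ne; case E : (s c) => [|d z] //; case: h; exists c, d, z.
apply: (LP_step0 (j := jfin)) => //.
- by move=> [[[] []]|[i []]] /=; split=> //; exact: hz.
by rewrite /N /sumC /zero /= big1.
Qed.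

(** What [load_path] needs during loading, in a form that survives backward moves; for this [cU]
    must consist of input letters already during copying. The stacks are unrestricted when the
    machine runs or cleans up. *)
Let Inv (s : stacks) :=
  [/\ s cS = [::] -> [/\ s cV = [::], forall i e, s (cT i e) = [::] & exists u, s cU = map le u],
      s cS = [:: copy] -> exists u, s cU = map le u
    & [\/ s cS = [::], s cS = [:: copy], s cS = [:: clean] | exists q, s cS = [:: run q]]].
(** A path from 0 in space bounded by the size of its end, irrespective of how [s] was reached. *)
Let Good (s : stacks) := exists v, LP (N s) (zero, [::]) (s, v) /\ size v <= N s.
Lemma good_load s : Inv s -> s cS = [::] -> Good s.
Proof.
move=> [h _ _] e; have [hV hT [u hU]] := h e.
have -> : s = sg [::] u [::] (s cB) t0.
  by apply/funext => -[[[] []]|[i []]] //=; rewrite ?hT.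
exists (rev u); rewrite N_sg sum_t0 size_rev /= addn0 !addn0; split; first exact: load_path.
exact: leq_addr.
Qed.
Lemma good_clean s : s cS = [:: clean] -> Good s.
Proof. by move=> e; exists [::]; split=> //; apply: LSym; apply: clean_path. Qed.
Lemma good_region j s s' : region j -> rstep (rl j) s s' -> Good s <-> Good s'.
Proof.
move=> rj h; have E := region_N rj h.
have l0 : lab j = [::] by case: j rj {h} => [[[x|x]|[[[[] []]|]|[d|[c d]]]]|[[q a] b]].
split=> -[v [h1 h2]]; exists v; rewrite ?E in h1 h2 *; split=> //; apply: LTrans h1 _.
  by apply: (LP_step0 l0 h) => //; rewrite E.
by apply: LSym; apply: (LP_step0 l0 h) => //; rewrite E.
Qed.
Lemma le_cat x z u : le x :: z = map le u -> exists u', z = map le u'.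
Proof. by case: u => // y u [_ ->]; exists u. Qed.
Lemma inv_step j s s' : rstep (rl j) s s' -> Inv s <-> Inv s'.
Proof.
have zI : Inv zero by split=> //; [split=> //; exists [::]|constructor 1].
have tr : rstep trivr s s' -> Inv s <-> Inv s' by move=> /trivr_step[-> ->]; split=> _.
case: j => [[[x|x]|[[[[] []]|]|[d|[c d]]]]|[[q a] b]] h.
- have [e1 e2] := h cS; have [z [u1 u2]] := h cU; have v1 := keepE (h cV); have t1 i e := keepE (h (cT i e)).
  rewrite /= in e1 e2 u1 u2; rewrite /Inv e1 e2; split=> -[I _ _]; split=> //; try by constructor 1.
    have [hV hT [u hU]] := I erefl; split; rewrite ?v1 //; first by move=> i e; rewrite t1.
    by exists (x :: u); rewrite u2 /= -hU u1.
  have [hV hT [u hU]] := I erefl; split; rewrite -?v1 //; first by move=> i e; rewrite -t1.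
  by rewrite u2 in hU; have [u' E] := le_cat hU; exists u'; rewrite u1.
- have [e1 e2] := h cS; have [z [u1 u2]] := h cU; rewrite /= in e1 e2 u1 u2; rewrite /Inv e1 e2.
  split=> -[_ I _]; split=> //; try by constructor 2.
    by move=> _; have [u hU] := I erefl; rewrite u1 in hU; have [u' E] := le_cat hU; exists u'; rewrite u2.
  by move=> _; have [u hU] := I erefl; exists (x :: u); rewrite u1 /= -hU u2.
- exact: tr.
- have [e1 e2] := h cS; rewrite /= in e1 e2; rewrite /Inv e1 e2.
  by split=> _; split=> //; [constructor 3|constructor 4; exists (tm_accept M)].
- have [e1 e2] := h cS; have [u1 u2] := h cU; rewrite /= in e1 e2 u1 u2; rewrite /Inv e1 e2 u1.
  split=> _; split=> //; [by constructor 4; exists (tm_start M)|by exists [::]|by constructor 2].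
- have [e1 e2] := h cS; have u1 := keepE (h cU); have [v1 v2] := h cV; have t1 i e := (h (cT i e)).1; rewrite /= in e1 e2 v1 v2.
  rewrite /Inv e1 e2 u1; split=> -[I1 I2 _]; split=> //; try by [constructor 2|constructor 1].
    by move=> _; have [_ _] := I1 erefl.
  by move=> _; split=> //; try exact: I2; move=> i e; exact: t1.
- have [e1 e2] := h cS; have [u1 u2] := h cU; have [v1 v2] := h cV; have t2 i e := (h (cT i e)).2; rewrite /= in e1 e2 u1 u2 v1 v2.
  rewrite /Inv e1 e2; split=> _; split=> //; try by [constructor 3|constructor 1].
  by move=> _; split=> //; exists [::]; rewrite u2.
- have [e1 e2] := h cS; have u1 := keepE (h cU); have v1 := keepE (h cV); have t1 i e := keepE (h (cT i e)); rewrite /= in e1 e2.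
  rewrite /Inv e1 e2 u1 v1; split=> -[I _ _]; split=> //; try by constructor 1.
    by move=> _; have [hV hT hU] := I erefl; split=> // i e; rewrite t1.
  by move=> _; have [hV hT hU] := I erefl; split=> // i e; rewrite -t1.
- move: h; rewrite /rl; case: eqP => [_ /tr//|ne h].
  have [e1 e2] := h cS; rewrite /= in e1 e2; rewrite /Inv e1 e2.
  by split=> _; split=> //; constructor 3.
move: h; rewrite /= /tmrule; case: eqP => [_ /tr//|_]; case: pickP => [m _ h|_ /tr//].
have [e1 e2] := h cS; rewrite /= in e1 e2; rewrite /Inv e1 e2.
by split=> _; split=> //; constructor 4; [exists m.1|exists q].
Qed.
(** Within the region a path is prolonged at constant size. In the loading and cleaning phases the
    previous path is forgotten and replaced by the short one of [load_path] or [clean_path]. *)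
Lemma good_step j s s' : rstep (rl j) s s' -> (Inv s /\ Good s) <-> (Inv s' /\ Good s').
Proof.
move=> h; have I := inv_step h.
have key : (Inv s -> Good s <-> Good s') -> (Inv s /\ Good s) <-> (Inv s' /\ Good s').
  move=> hk; split=> -[i0 g]; split; [exact/I|exact/(hk i0)|exact/I|]; apply/(hk (I.2 i0)); exact: g.
apply: key => i; have i' := I.1 i.
have [rj|nr] := boolP (region j); first exact: good_region h.
have both : (s cS = [::] \/ s cS = [:: clean]) -> (s' cS = [::] \/ s' cS = [:: clean]) -> Good s <-> Good s'.
  by move=> h1 h2; split=> _; [case: h2 => /= e|case: h1 => /= e]; by [apply: good_load|apply: good_clean].
case: j nr h => [[[x|x]|[[[[] []]|]|[d|[c d]]]]|[[q a] b]] //= _ h.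
- by have [/= e1 e2] := h cS; apply: both; left.
- by have [/= e1 e2] := h cS; apply: both; [right|left].
- by have [/= e1 e2] := h cS; apply: both; left.
move: h; case: eqP => [_ /trivr_step[-> ->]|_ h]; first by split.
by have [/= e1 e2] := h cS; apply: both; right.
Qed.

Let csize (t : 'I_k -> tape) := \sum_i (size (t i).1 + size (t i).2).
Lemma N_sgc r u v b t : N (sg r u v b t) = size u + size v + size b + csize t.
Proof. by rewrite N_sg. Qed.
Lemma head_split (T : Type) (s : seq T) : s = ot (ohead s) ++ behead s.
Proof. by case: s. Qed.
Lemma head_none (T : Type) (s : seq T) : ohead s = None -> behead s = [::].
Proof. by case: s. Qed.
Lemma tm_rstep q (t : {ffun 'I_k -> tape}) c v Bt : step (q, t) c -> csize c.2 <= Bt ->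
  exists j, [/\ lab j = [::], region j &
   rstep (rl j) (sg [:: run q] [::] v (nseq (Bt - csize t) d0) t) (sg [:: run c.1] [::] v (nseq (Bt - csize c.2) d0) c.2)].
Proof.
move=> /andP[qa /existsP[m /andP[hm /eqP E]]] hcB; rewrite /= in qa hm E.
pose a : {ffun 'I_k -> option Sym} := [ffun i => scan (t i)]; pose b : {ffun 'I_k -> option Sym} := [ffun i => ohead (t i).1].
exists (jtm q a b); split=> //.
have ha i : (t i).2 = ot (a i) ++ behead (t i).2 by rewrite ffunE; apply: head_split.
have hb i : (t i).1 = ot (b i) ++ behead (t i).1 by rewrite ffunE; apply: head_split.
have na i : a i = None -> behead (t i).2 = [::] by rewrite ffunE; apply: head_none.
have nb i : b i = None -> behead (t i).1 = [::] by rewrite ffunE; apply: head_none.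
have ct i : c.2 i = ((loc a b m.2 i).1 ++ behead (t i).1, (loc a b m.2 i).2 ++ behead (t i).2).
  by rewrite E ffunE -(act_loc (m.2 i) (hb i) (ha i) (nb i) (na i)) -surjective_pairing.
have sz : csize c.2 = csize t + ext a b m.2.
  have E1 : csize c.2 = \sum_i (size (loc a b m.2 i).1 + size (loc a b m.2 i).2) + \sum_i (size (behead (t i).1) + size (behead (t i).2)).
    by rewrite -big_split; apply: eq_bigr => i _; rewrite ct !size_cat /=; lia.
  have E2 : csize t = \sum_i (size (ot (b i)) + size (ot (a i))) + \sum_i (size (behead (t i).1) + size (behead (t i).2)).
    by rewrite -big_split; apply: eq_bigr => i _; rewrite {1}ha {1}hb !size_cat /=; lia.
  by rewrite E1 E2 -ext_sum; lia.
rewrite /rl /jtm /tmrule (negPf qa).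
case: pickP => [m' hm'|/(_ m)]; last by rewrite [X in X = _]hm.
have Em : m' = m by apply: (card_le1_eqP (det q a)).
rewrite {}Em => -[[[] []]|[i e]] /=.
- exists (nseq (Bt - csize c.2) d0); split=> //=; rewrite -nseqD; congr nseq.
  by move: hcB; rewrite sz; move: (csize t) (ext _ _ _); clear; lia.
- by exists (map le v).
- by split.
- by rewrite E.
rewrite /trule; case: e => /=.
  case Ea : (a i) => [x|] /=.
    exists (map sy (behead (t i).2)); rewrite ct /= map_cat; split=> //.
    by rewrite [in LHS](ha i) Ea.
  rewrite ct /= (na i Ea) cats0; split=> //.
  by rewrite (ha i) Ea (na i Ea).
case Eb : (b i) => [x|] /=.
  exists (map sy (behead (t i).1)); rewrite ct /= map_cat; split=> //.
  by rewrite [in LHS](hb i) Eb.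
rewrite ct /= (nb i Eb) cats0; split=> //.
by rewrite (hb i) Eb (nb i Eb).
Qed.
Lemma run_path n Bt v p q (t : {ffun 'I_k -> tape}) : path (@step _ M) (q, t) p -> (last (q, t) p).1 = tm_accept M ->
  (forall c, c \in (q, t) :: p -> config_size c <= Bt) -> size v + Bt <= n ->
  LP n (sg [:: run q] [::] v (nseq (Bt - csize t) d0) t, v) (zero, v).
Proof.
move=> pp lp hp vn.
have sN (r : D) (s : {ffun 'I_k -> tape}) : csize s <= Bt -> N (sg [:: r] [::] v (nseq (Bt - csize s) d0) s) <= n.
  by rewrite N_sgc size_nseq => h; apply: leq_trans vn; move: h; move: (csize s) (size v); clear => a b h; rewrite /= add0n -addnA subnK.
have vn' : size v <= n by lia.
elim: p q t pp lp hp => [|c p IH] q t pp lp hp; have ht : csize t <= Bt by apply: (hp _ (mem_head _ _)).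
  move: lp => /= ->; apply: LTrans (clean_path (s := sg [:: clean] [::] v (nseq (Bt - csize t) d0) t) _ _ vn') => //; last exact: sN.
  apply: (LP_step0 (j := jacc)) => //; try exact: sN.
  by move=> [[[] []]|[i e]] /=; (try by split); exact: keep_ok.
move: pp => /= /andP[st pp].
have hc : csize c.2 <= Bt by apply: (hp c); rewrite !inE eqxx orbT.
have [j [lj rj h]] := tm_rstep v st hc.
apply: LTrans (LP_step0 lj h (sN _ _ ht) (sN _ _ hc) vn') _.
case: c st pp lp hp hc h => q' t' st pp lp hp hc h; apply: IH => // c hc'; apply: hp.
by rewrite inE hc' orbT.
Qed.
Lemma copy_path n w1 w2 b lb : size w1 + size w2 + size w2 + b + 2 * size w1 <= n -> size lb <= n ->
  LP n (sg [:: copy] (rev w1) w2 (nseq (b + size w1) d0) (init M w2).2, lb)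
       (sg [:: copy] [::] (w1 ++ w2) (nseq b d0) (init M (w1 ++ w2)).2, lb).
Proof.
have ci w : csize (init M w).2 = size w.
  rewrite /csize (bigD1 ord0) //= big1 ?addn0 => [|i /negPf ne]; first by rewrite ffunE eqxx size_map.
  by rewrite ffunE ne.
elim/last_ind: w1 w2 => [|w1 x IH] w2 hn hl; first by rewrite addn0; apply: LRefl.
rewrite size_rcons in hn; rewrite cat_rcons.
apply: LTrans (IH (x :: w2) _ hl); last by move: hn => /=; lia.
rewrite size_rcons addnS rev_rcons; apply: (LP_step0 (j := jcopy x)) => //.
- move=> [[[] []]|[i e]] /=.
  + by exists (nseq (b + size w1) d0).
  + by exists (map le w2).
  + by exists (map le (rev w1)).
  + by [].
  rewrite !ffunE /=; case: (i == ord0) => /=; case: e => /=; try by exists [::].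
  by exists (map sy (map inl w2)).
- rewrite N_sgc ci size_nseq /= size_rev; move: hn; move: (size w2) (size w1); clear; lia.
- rewrite N_sgc ci size_nseq /= size_rev; move: hn; move: (size w2) (size w1); clear; lia.
Qed.
Lemma encv0 : encv zero = 0%R. Proof. by apply/ffunP => c; rewrite !ffunE. Qed.
(** The space of the machine, with room for the word on its stacks and on the first tape. *)
Let nw m := 3 * m + SM m.
Lemma machine_trivial w : eval gen w = 1%g -> lpth (K (nw (size w))) (0%R, [::]) (0%R, w).
Proof.
move=> ew; have aw := (dec w).2.2 ew; set n := nw (size w).
have [S [hS [p [ap Sp]]]] : exists S, S <= SM (size w) /\ exists p, accepting w p /\ S = \max_(c <- init M w :: p) config_size c.
  exists (input_space M w); split.
    apply: leq_trans (space_M _); rewrite /tm_space_function.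
    apply: leq_trans (leq_bigmax (Ordinal (ltnSn (size w)))).
    by apply: (@leq_bigmax_cond _ _ (fun u : (size w).-tuple _ => input_space M u) (in_tuple w)); apply/asboolP.
  case: aw => q0 aq0; rewrite /input_space.
  have [|[p hp1 hp2] _] := @min_natP (fun s => exists2 p, accepting w p & s = \max_(c <- init M w :: p) config_size c) (\max_(c <- init M w :: q0) config_size c); first by exists q0.
  by exists p.
case/andP: ap => pp /eqP lp.
have ci : csize (init M w).2 = size w.
  rewrite /csize (bigD1 ord0) //= big1 ?addn0 => [|i /negPf ne]; first by rewrite ffunE eqxx size_map.
  by rewrite ffunE ne.
have hn : 3 * size w + S <= n by rewrite /n /nw leq_add2l.
clearbody n.
have wn : size w <= n by apply: leq_trans hn; move: (size w); clear; lia.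
have hB c : c \in init M w :: p -> config_size c <= S + size w.
  move=> hc; apply: leq_trans (leq_addr _ _); rewrite Sp.
  by elim: (_ :: p) hc => // y r IH; rewrite inE big_cons => /predU1P[->|/IH h]; [exact: leq_maxl|apply: leq_trans h (leq_maxr _ _)].
rewrite -encv0 -/(LP n (zero, [::]) (zero, w)).
(* Of these free cells, [size w] are consumed by copying the input, and [S] remain for the
   computation. *)
apply: LTrans (load_path (n := n) (u := rev w) (b := nseq (S + size w) d0) _) _.
  by rewrite size_rev size_nseq; apply: leq_trans hn; move: (size w); clear; lia.
rewrite revK.
have e0 : (init M [::]).2 = t0 :> ('I_k -> tape) by apply/funext => i; rewrite ffunE; case: ifP.
apply: LTrans (_ : LP n _ (sg [:: copy] (rev w) [::] (nseq (S + size w) d0) (init M [::]).2, w)) _.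
  rewrite e0; apply: (LP_step0 (j := jstart)) => //.
  - by move=> [[[] []]|[i e]] /=; [exists (nseq (S + size w) d0)| |exists (map le (rev w))| |case: e].
  - rewrite N_sg sum_t0 size_rev size_nseq /=; apply: leq_trans hn; move: (size w); clear; lia.
  rewrite N_sg sum_t0 size_rev size_nseq /=; apply: leq_trans hn; move: (size w); clear; lia.
have := @copy_path n w [::] S w; rewrite cats0 /= => h.
apply: LTrans (h _ wn) _; first by apply: leq_trans hn => /=; move: (size w); clear; lia.
apply: LTrans (_ : LP n _ (sg [:: run (tm_start M)] [::] w (nseq S d0) (init M w).2, w)) _.
  apply: (LP_step0 (j := jrun)) => //.
  - by move=> [[[] []]|[i e]] /=; (try by split); exact: keep_ok.
  - rewrite N_sgc ci size_nseq /=; apply: leq_trans hn; move: (size w); clear; lia.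
  rewrite N_sgc ci size_nseq /=; apply: leq_trans hn; move: (size w); clear; lia.
have := @run_path n (S + size w) w p (tm_start M) (init M w).2 pp lp hB.
by rewrite ci addnK; apply; apply: leq_trans hn; move: (size w); clear; lia.
Qed.
Let frp : pfun := pmul (pcst (#|D|.+1 + 1)) (padd (pmul (pcst #|C|) pid) (pcst 2)).
Let fwp : pfun := pmul (pcst (#|D|.+1 + 1)) (padd (padd (pmul (pcst 3) pid) SM) (pcst 2)).
Lemma machine_direct n g : reach (sra rl) (src_ rl) (srm rl) (srn rl) predT g -> small n g ->
  exists v, lpth (frp n) (0%R, [::]) (g, v) /\ size v <= frp n.
Proof.
move=> rg sg'.
have [||s [Eg [_ [v [h1 h2]]]]] := @reach_ind_stacks C D J rl (fun s => Inv s /\ Good s) _ _ g rg.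
- have zI : Inv zero by split=> //; [split=> //; exists [::]|constructor 1].
  by split=> //; apply: good_load.
- by move=> j s s'; apply: good_step.
have Nn : N s <= #|C| * n.
  rewrite /N sumCE; apply: (@leq_trans (\sum_(c : C) n)); last by rewrite sum_nat_const.
  rewrite big_mkcond; apply: leq_sum => c _; case: ifP => // _.
  by apply: (@size_enc D); have := sg' c; rewrite Eg ffunE absz_nat.
exists v; split; last by apply: leq_trans h2 _; rewrite /frp /=; move: Nn; move: (N s) (#|C| * n); clear; nia.
rewrite -encv0 Eg; apply: lpath_mono h1; rewrite /K /frp /= leq_mul2l; apply/orP; right.
by rewrite leq_add2r.
Qed.
Let chi (g : {ffun C -> int}) : H := some_such 1%g (fun h => exists s : stacks, g = encv s /\ h = schi s).
Lemma chiE s : chi (encv s) = schi s.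
Proof.
rewrite /chi; have [|s' [/encv_inj <- ->]] // := @some_suchP H 1%g (fun h => exists s' : stacks, encv s = encv s' /\ h = schi s') (schi s).
by exists s.
Qed.
Theorem machine_embeds : generates gen -> exists (G : groupType) (A : finType) (R : seq (word A)) (gen : A -> G),
    [/\ presents R gen, polynomial_growth (space_function R)
      & exists f : {multiplicative H -> G}, injective f].
Proof.
move=> gg; apply: (@final_group H X C J hX (@inv_letter B) _ _ (sra rl) (src_ rl) (srm rl) (srn rl) lab _ _ chi _ _ frp fwp).
- by move=> x; apply: eval_inv_letter.
- by move=> h; have [w E] := gg h; exists w; rewrite evXE.
- exact: srmn.
- by case=> [[[x|x]|y]|y].
- by rewrite -encv0 chiE /schi /zero /= eval0.
- move=> j g g' rg mv.
  have [||s [Eg _]] := @reach_ind_stacks C D J rl (fun=> True) _ _ g rg => //.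
  rewrite Eg in mv *; have [s' [-> h]] := move_step mv.
  by rewrite !chiE; apply: schi_step.
- exact: machine_direct.
move=> w; rewrite evXE => /machine_trivial h; apply: lpath_mono h.
exact: leqnn.
Qed.
End Machine.

Theorem pspace_embeds (H : groupType) : in_PSPACE H ->
  exists (G : groupType) (A : finType) (R : seq (word A)) (gen : A -> G),
    [/\ presents R gen, polynomial_growth (space_function R)
      & exists f : {multiplicative H -> G}, injective f].
Proof.
move=> [B [gen [gg [M [det dec /growth_pfun[F hF]]]]]].
have h := machine_embeds det dec hF gg. exact: h.
Qed.
End MachineSimulation.
Import MachineSimulation.

(** * Savitch search on a Turing machine *)

Module SavitchTM.
Section SavitchMachine.
Variables (X G : finType) (io : X -> G) (bar gap : G).
Variables (Qd : finType) (q0 : Qd) (dl : Qd -> G -> G -> Qd) (fin : Qd -> bool) (K : nat).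

(* Tape 0 holds the input.  Tape 1 holds End and S blocks, one for each level of
   the recursion: Hd b tells which half of the walk is being searched, and the
   S columns (x_i, y_i, z_i) spell its ends x, y and the current midpoint z.
   Tape 2 holds Mk and the cells (x_i, y_i) of the walk to be searched next,
   tape 3 holds Mk and S in unary. *)
Inductive wletter := End | Mk | Un | Hd of bool | Cell of G * G | Col of G * G * G.
Definition wenc (w : wletter) : (option bool + bool) + (G * G + G * G * G) :=
  match w with
  | End => inl (inl None) | Mk => inl (inl (Some false)) | Un => inl (inl (Some true))
  | Hd b => inl (inr b) | Cell p => inr (inl p) | Col p => inr (inr p)
  end.
Definition wdec (w : (option bool + bool) + (G * G + G * G * G)) : wletter :=
  match w with
  | inl (inl None) => End | inl (inl (Some false)) => Mk | inl (inl (Some true)) => Un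
  | inl (inr b) => Hd b | inr (inl p) => Cell p | inr (inr p) => Col p
  end.
Lemma wencK : cancel wenc wdec. Proof. by case. Qed.
HB.instance Definition _ := Finite.copy wletter (can_type wencK).

(* The states LA, ..., LD repeatedly replace S by S (S + 1), which is the size of
   tape 1; Call searches a walk and Ret returns the answer to the level above. *)
Inductive sstate := S0 | S1 | S2 | LA of 'I_K.+1 | LO of 'I_K.+1 | LN of 'I_K.+1 | LB of 'I_K.+1
  | LR of 'I_K.+1 | LT of 'I_K.+1 | LC of 'I_K.+1 | LD of 'I_K.+1
  | C0 | Call of Qd | Rew | Back of bool | Ret of bool | Up | Inc of bool | Acc | Rej.
Definition senc (s : sstate) : ('I_8 + 'I_8 * 'I_K.+1) + (Qd + 'I_3 * bool) :=
  match s with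
  | S0 => inl (inl (inord 0)) | S1 => inl (inl (inord 1)) | S2 => inl (inl (inord 2))
  | C0 => inl (inl (inord 3)) | Rew => inl (inl (inord 4)) | Up => inl (inl (inord 5))
  | Acc => inl (inl (inord 6)) | Rej => inl (inl (inord 7))
  | LA i => inl (inr (inord 0, i)) | LO i => inl (inr (inord 1, i)) | LN i => inl (inr (inord 2, i))
  | LB i => inl (inr (inord 3, i)) | LR i => inl (inr (inord 4, i)) | LT i => inl (inr (inord 5, i))
  | LC i => inl (inr (inord 6, i)) | LD i => inl (inr (inord 7, i))
  | Call q => inr (inl q)
  | Back b => inr (inr (inord 0, b)) | Ret b => inr (inr (inord 1, b)) | Inc b => inr (inr (inord 2, b))
  end.
Definition sdec (s : ('I_8 + 'I_8 * 'I_K.+1) + (Qd + 'I_3 * bool)) : sstate :=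
  match s with
  | inl (inl i) => nth Rej [:: S0; S1; S2; C0; Rew; Up; Acc; Rej] i
  | inl (inr (j, i)) => nth (fun=> Rej) [:: LA; LO; LN; LB; LR; LT; LC; LD] j i
  | inr (inl q) => Call q
  | inr (inr (j, b)) => nth (fun=> Rej) [:: Back; Ret; Inc] j b
  end.
Lemma sencK : cancel senc sdec. Proof. by case=> //= *; rewrite inordK. Qed.
HB.instance Definition _ := Finite.copy sstate (can_type sencK).

Definition sym : finType := (X + (wletter : finType))%type.
Definition action := (option sym * option bool)%type.
Let st : action := (None, None).
Let R : action := (None, Some true).
Let L : action := (None, Some false).
Let wr (w : wletter) : action := (Some (inr w), Some true).
Let ext (s : option sym) (w : wletter) : action := if s is Some _ then R else wr w.

Let first : G := nth gap (enum G) 0.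
(* One digit of the successor: incoming carry to outgoing carry. *)
Definition dinc (c : bool) (z : G) : bool * G :=
  if c then if (index z (enum G)).+1 < #|G| then (false, nth gap (enum G) (index z (enum G)).+1)
            else (true, first)
  else (false, z).

(** [Call] fills a block and at the same time lets the automaton test the pair as a single step; the
    test counts only at the last block. [Up] loads the second half [(z, y)] of the walk, and [Inc]
    the first half for the next midpoint. *)
Definition nx (q : sstate) (s0 s1 s2 s3 : option sym) : option (sstate * (action * action * action * action)) :=
  match q with
  | S0 => Some (S1, (st, wr End, wr Mk, wr Mk))
  | S1 => Some (S2, (st, st, wr (Cell (bar, bar)), wr Un))
  | S2 => match s0 with
          | Some (inl x) => Some (S2, (R, st, wr (Cell (io x, gap)), wr Un))
          | _ => Some (LA ord0, (st, st, wr (Cell (bar, gap)), wr Un)) end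
  | LA i => if s2 is Some (inr Mk) then Some (LO i, (st, st, st, R)) else Some (LA i, (st, st, L, L))
  | LO i => if s3 is Some _ then Some (LN i, (st, wr (Hd false), R, st)) else Some (LR i, (st, st, st, L))
  | LN i => if s2 is Some _ then Some (LN i, (st, wr (Col (gap, gap, gap)), R, st))
            else Some (LB i, (st, st, L, st))
  | LB i => if s2 is Some (inr Mk) then Some (LO i, (st, st, st, R)) else Some (LB i, (st, st, L, st))
  | LR i => if s3 is Some (inr Mk) then Some (LT i, (st, L, st, st)) else Some (LR i, (st, st, st, L))
  | LT i => if s1 is Some (inr End) then
              if i == ord_max then Some (C0, (st, R, st, st)) else Some (LC i, (st, R, R, R))
            else Some (LT i, (st, L, st, st))
  | LC i => if s1 is Some _ then Some (LC i, (st, R, ext s2 (Cell (gap, gap)), ext s3 Un))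
            else Some (LD i, (st, L, st, st))
  | LD i => if s1 is Some (inr End) then Some (LA (inord i.+1), (st, R, st, st))
            else Some (LD i, (st, L, st, st))
  | C0 => Some (Call q0, (st, wr (Hd false), R, st))
  | Call q => match s1, s2 with
              | Some (inr (Col _)), Some (inr (Cell (x, y))) =>
                  Some (Call (dl q x y), (st, wr (Col (x, y, first)), wr (Cell (x, first)), st))
              | None, _ => Some (Back (fin q), (st, L, L, st))
              | _, _ => Some (Rew, (st, st, L, st))
              end
  | Rew => if s2 is Some (inr Mk) then Some (C0, (st, st, st, st)) else Some (Rew, (st, st, L, st))
  | Back r => if s1 is Some (inr (Hd _)) then Some (Ret r, (st, L, st, st)) else Some (Back r, (st, L, L, st))
  | Ret r => match s1 with
             | Some (inr End) => Some (if r then Acc else Rej, (st, st, st, st))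
             | Some (inr (Hd b)) =>
                 if r then if b then Some (Ret true, (st, L, st, st)) else Some (Up, (st, wr (Hd true), R, st))
                 else Some (Inc true, (st, wr (Hd false), R, st))
             | _ => Some (Ret r, (st, L, st, st)) end
  | Up => match s1 with
          | Some (inr (Col (x, y, z))) => Some (Up, (st, R, wr (Cell (z, y)), st))
          | _ => Some (Rew, (st, st, L, st)) end
  | Inc c => match s1 with
             | Some (inr (Col (x, y, z))) =>
                 Some (Inc (dinc c z).1, (st, wr (Col (x, y, (dinc c z).2)), wr (Cell (x, (dinc c z).2)), st))
             | _ => if c then Some (Back false, (st, L, L, st)) else Some (Rew, (st, st, L, st)) end
  | Acc | Rej => None
  end.

Definition pick4 (T : Type) (p : T * T * T * T) (i : 'I_4) : T :=
  let '(a, b, c, d) := p in match val i with 0 => a | 1 => b | 2 => c | _ => d end.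
Definition savitch : turing_machine X :=
  @TuringMachine X 3 wletter sstate S0 Acc (fun q s =>
    if nx q (s (inord 0)) (s (inord 1)) (s (inord 2)) (s (inord 3)) is Some (q', a)
    then [set (q', [ffun i => pick4 a i])] else set0).

Lemma savitch_det : deterministic savitch.
Proof. by move=> q s /=; case: nx => [[q' a]|]; rewrite ?cards1 ?cards0. Qed.

Notation tape := (seq sym * seq sym)%type.
Definition sc (t : tape) : option sym := ohead t.2.
(** The same function as [act]; the separate clause for an idle tape allows a step to be computed
    when that tape is a variable. *)
Definition ac (a : action) (t : tape) : tape :=
  if a is (None, None) then t else
  let r := if a.1 is Some y then y :: behead t.2 else t.2 in
  match a.2, t.1, r with
  | Some false, x :: l, _ => (l, x :: r)
  | Some true, l, x :: r' => (x :: l, r')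
  | _, l, _ => (l, r)
  end.
Definition conf := (sstate * (tape * tape * tape * tape))%type.
Definition nstep (c : conf) : option conf :=
  let '(q, (t0, t1, t2, t3)) := c in
  if nx q (sc t0) (sc t1) (sc t2) (sc t3) is Some (q', (a0, a1, a2, a3))
  then Some (q', (ac a0 t0, ac a1 t1, ac a2 t2, ac a3 t3)) else None.
Definition emb (c : conf) : config savitch := (c.1, [ffun i => pick4 c.2 i]).

Lemma acE a t : act (M := savitch) a t = ac a t.
Proof. by case: a => [[y|] [b|]]; case: t. Qed.
Lemma pick4_ac (a : action * action * action * action) (t : tape * tape * tape * tape) :
  [ffun i => act (M := savitch) (pick4 a i) (pick4 t i)] =
  [ffun i => pick4 (ac a.1.1.1 t.1.1.1, ac a.1.1.2 t.1.1.2, ac a.1.2 t.1.2, ac a.2 t.2) i].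
Proof.
case: a => [[[a0 a1] a2] a3]; case: t => [[[t0 t1] t2] t3].
by apply/ffunP => -[[|[|[|i]]] hi]; rewrite !ffunE /pick4 /= acE.
Qed.
Lemma step_emb c d : step (emb c) d = (if nstep c is Some c' then d == emb c' else false).
Proof.
case: c => q [[[t0 t1] t2] t3]; rewrite /step /emb /=.
rewrite !ffunE /pick4 !inordK //= -/(sc t0) -/(sc t1) -/(sc t2) -/(sc t3).
case E : nx => [[q' [[[a0 a1] a2] a3]]|] /=; last first.
  by apply/negP => /andP[_ /existsP[m]]; rewrite inE.
have -> /= : q != Acc by apply/eqP => qA; rewrite qA in E.
have := pick4_ac (a0, a1, a2, a3) (t0, t1, t2, t3); rewrite /= => <-.
apply/existsP/eqP => [[m /andP[]]|->]; last first.
  exists (q', [ffun i => pick4 (a0, a1, a2, a3) i]); rewrite inE eqxx /=.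
  by apply/eqP; congr (_, _); apply/ffunP => i; rewrite !ffunE.
by rewrite inE => /eqP -> /eqP ->; congr (_, _); apply/ffunP => i; rewrite !ffunE.
Qed.

Inductive runs : conf -> conf -> Prop :=
| Runs0 c : runs c c
| RunsS c c' d : nstep c = Some c' -> runs c' d -> runs c d.
Lemma runs_trans c d e : runs c d -> runs d e -> runs c e.
Proof. by elim=> // {}c c' {}d h _ IH /IH; apply: RunsS. Qed.
Lemma runs1 c d e : nstep c = Some d -> runs d e -> runs c e. Proof. exact: RunsS. Qed.
Lemma runs2 c d e : runs d e -> nstep c = Some d -> runs c e. Proof. by move=> h1 h2; exact: RunsS h2 h1. Qed.
Let w_ (w : wletter) : sym := inr w.
Let cells (ps : seq (G * G)) : seq sym := map (fun p => w_ (Cell p)) ps.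
Let cols (ps : seq (G * G * G)) : seq sym := map (fun p => w_ (Col p)) ps.
Let lft (t : tape) : tape := ac L t.
Let fold q (xy : seq (G * G)) : Qd := foldl (fun q p => dl q p.1 p.2) q xy.

Lemma call_sweep cs xy q t0 t3 l1 l2 r1 : size cs = size xy ->
  runs (Call q, (t0, (l1, cols cs ++ r1), (l2, cells xy), t3))
    (Call (fold q xy), (t0, (catrev (cols [seq (p, first) | p <- xy]) l1, r1),
       (catrev (cells [seq (p.1, first) | p <- xy]) l2, [::]), t3)).
Proof.
elim: xy cs q l1 l2 => [|[x y] xy IH] [|c cs] //= q l1 l2; first by move=> _; apply: Runs0.
by case=> h; apply: runs2 (IH cs _ _ _ h) _.
Qed.
Lemma rew_sweep ps t0 t1 t3 r : runs (Rew, (t0, t1, lft (catrev (cells ps) [:: w_ Mk], r), t3))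
  (C0, (t0, t1, ([::], w_ Mk :: cells ps ++ r), t3)).
Proof.
rewrite catrevE -[ps in X in runs _ X]revK -map_rev; move: (rev ps) => {}ps.
elim: ps r => [|p ps IH] r /=; first by apply: runs2 (Runs0 _) _.
by apply: runs1 => //; rewrite rev_cons /cells map_rcons cat_rcons; exact: IH.
Qed.
Lemma back_sweep b e cs ps t0 t3 l r r2 : size cs = size ps ->
  runs (Back b, (t0, lft (catrev (cols cs) (w_ (Hd e) :: l), r), lft (catrev (cells ps) [:: w_ Mk], r2), t3))
    (Ret b, (t0, lft (l, w_ (Hd e) :: cols cs ++ r), ([::], w_ Mk :: cells ps ++ r2), t3)).
Proof.
rewrite !catrevE -[ps in X in runs _ X]revK -[cs in X in runs _ X]revK -!map_rev -(size_rev cs) -(size_rev ps).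
move: (rev ps) (rev cs) => {cs}ps cs.
elim: ps cs r r2 => [|p ps IH] [|c cs] //= r r2; first by move=> _; apply: runs2 (Runs0 _) _.
by case=> h; apply: runs1 => //; rewrite !rev_cons /cells /cols !map_rcons !cat_rcons; exact: IH.
Qed.
Lemma ret_sweep b e cs t0 t2 t3 l r :
  runs (Ret b, (t0, lft (catrev (cols cs) (w_ (Hd e) :: l), r), t2, t3))
    (Ret b, (t0, (l, w_ (Hd e) :: cols cs ++ r), t2, t3)).
Proof.
rewrite catrevE -[cs in X in runs _ X]revK -map_rev; move: (rev cs) => {}cs.
elim: cs r => [|p ps IH] r /=; first by apply: Runs0.
by apply: runs1 => //; rewrite rev_cons /cols map_rcons cat_rcons; exact: IH.
Qed.
Lemma up_sweep (x y z : seq G) ps t0 t3 l1 l2 r1 : size y = size x -> size z = size x -> size ps = size x ->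
  runs (Up, (t0, (l1, cols (zip (zip x y) z) ++ r1), (l2, cells ps), t3))
    (Up, (t0, (catrev (cols (zip (zip x y) z)) l1, r1), (catrev (cells (zip z y)) l2, [::]), t3)).
Proof.
elim: x y z ps l1 l2 => [|a x IH] [|b y] [|c z] [|p ps] //= l1 l2; first by move=> _ _ _; apply: Runs0.
by case=> h1 [h2] [h3]; apply: runs2 (IH y z ps _ _ h1 h2 h3) _.
Qed.

Fixpoint inc (c : bool) (z : seq G) : bool * seq G :=
  if z is a :: z' then ((inc (dinc c a).1 z').1, (dinc c a).2 :: (inc (dinc c a).1 z').2) else (c, [::]).
Lemma size_inc c z : size (inc c z).2 = size z.
Proof. by elim: z c => //= a z IH c; rewrite IH. Qed.
Lemma inc_sweep c (x y z : seq G) ps t0 t3 l1 l2 r1 : size y = size x -> size z = size x -> size ps = size x ->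
  runs (Inc c, (t0, (l1, cols (zip (zip x y) z) ++ r1), (l2, cells ps), t3))
    (Inc (inc c z).1, (t0, (catrev (cols (zip (zip x y) (inc c z).2)) l1, r1),
       (catrev (cells (zip x (inc c z).2)) l2, [::]), t3)).
Proof.
elim: x y z ps c l1 l2 => [|a x IH] [|b y] [|d z] [|p ps] //= c l1 l2; first by move=> _ _ _; apply: Runs0.
by case=> h1 [h2] [h3]; apply: runs2 (IH y z ps _ _ _ h1 h2 h3) _.
Qed.

(** Strings are numbers in base [#|G|] with the least significant symbol first, because the carry of
    [Inc] travels to the right. *)
Definition num (z : seq G) : nat := foldr (fun a n => index a (enum G) + #|G| * n) 0 z.
Lemma index_card (a : G) : index a (enum G) < #|G|.
Proof. by rewrite cardE index_mem mem_enum. Qed.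
Lemma index_first : index first (enum G) = 0.
Proof. by apply: index_uniq; rewrite ?enum_uniq // -cardE; apply/card_gt0P; exists gap. Qed.
Lemma num_lt z : num z < #|G| ^ size z.
Proof.
elim: z => //= a z IH; have := index_card a; rewrite expnS.
move=> h; apply: leq_trans (_ : #|G| * (num z).+1 <= _); first by rewrite mulnS ltn_add2r.
by rewrite leq_mul2l IH orbT.
Qed.
Lemma num_inj z z' : size z = size z' -> num z = num z' -> z = z'.
Proof.
elim: z z' => [|a z IH] [|b z'] //= [h] E.
have e0 : index a (enum G) = index b (enum G).
  by have := congr1 (modn^~ #|G|) E; rewrite /= !(addnC (index _ _)) !(mulnC #|G|) !modnMDl !modn_small ?index_card.
rewrite (IH z' h); last first.
  by move: E; rewrite e0 => /addnI/eqP; rewrite eqn_pmul2l => [/eqP//|]; apply: leq_ltn_trans (index_card a).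
by congr (_ :: _); rewrite -(nth_index gap (mem_enum G a)) e0 nth_index ?mem_enum.
Qed.
Lemma inc_false z : inc false z = (false, z).
Proof. by elim: z => //= a z ->. Qed.
Lemma inc_num z : if (inc true z).1 then (num z).+1 = #|G| ^ size z else num (inc true z).2 = (num z).+1.
Proof.
elim: z => //= a z IH; rewrite /dinc; have [h|h] := ltnP (index a (enum G)).+1 #|G| => /=.
  by rewrite inc_false /= index_uniq ?enum_uniq //; rewrite -cardE.
have e : (index a (enum G)).+1 = #|G| by have := index_card a; move: h; lia.
case: ifP IH => _ IH /=; first by rewrite expnS -IH mulnS -addSn e.
by rewrite index_first IH mulnS -addSn e.
Qed.
Lemma num_first n : num (nseq n first) = 0.
Proof. by elim: n => //= n ->; rewrite index_first muln0. Qed.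

Definition local_step (x y : seq G) := fin (fold q0 (zip x y)).
(** Walks of exactly [2 ^ k] steps, as halving demands. The rules used later admit idle steps, which
    pad shorter walks. *)
Fixpoint reach (k : nat) (x y : seq G) : bool :=
  if k is k'.+1 then `[< exists z, [/\ size z = size x, reach k' x z & reach k' z y] >] else local_step x y.

(** Blocks are reused for every midpoint, so of the deeper ones only the shape is known, not the
    contents. *)
Fixpoint blocks (S k : nat) (bl : seq sym) : Prop :=
  if k is k'.+1 then exists b (cs : seq (G * G * G)) bl', [/\ bl = w_ (Hd b) :: cols cs ++ bl', size cs = S & blocks S k' bl']
  else bl = [::].

(** Induction on the level. Inside, [main] runs through the midpoints from [z] onwards, by induction
    on the number of strings not yet tried. Earlier searches leave arbitrary columns behind, hence
    the existential quantifiers. *)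
Lemma call_run k : forall x y l bl t0 t3, size y = size x -> blocks (size x) k.+1 bl ->
  exists bl' ps, [/\ blocks (size x) k.+1 bl', size ps = size x &
   runs (C0, (t0, (l, bl), ([::], w_ Mk :: cells (zip x y)), t3))
        (Ret (reach k x y), (t0, lft (l, bl'), ([::], w_ Mk :: cells ps), t3))].
Proof.
elim: k => [|k IHk] x y l bl t0 t3 sy [b [cs [bl' [-> scs hbl]]]].
  rewrite {}hbl.
  have szxy : size (zip x y) = size x by rewrite size_zip sy minnn.
  exists (w_ (Hd false) :: cols [seq (p, first) | p <- zip x y] ++ [::]), [seq (p.1, first) | p <- zip x y].
  split; [by exists false, [seq (p, first) | p <- zip x y], [::]; rewrite size_map szxy|by rewrite size_map szxy|].
  apply: runs1 => //; apply: runs_trans (call_sweep _ _ _ _ _ _ _) _; first by rewrite szxy.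
  apply: runs1 => //.
  apply: runs_trans (back_sweep _ _ _ _ _ _ _ _) _; first by rewrite !size_map.
  by rewrite !cats0; apply: Runs0.
have szxy : size (zip x y) = size x by rewrite size_zip sy minnn.
pose blz z b bl := w_ (Hd b) :: cols (zip (zip x y) z) ++ bl.
pose good z := reach k x z && reach k z y.
have main n z bl1 : #|G| ^ size x - num z < n -> size z = size x -> blocks (size x) k.+1 bl1 ->
  exists bl2 ps, [/\ blocks (size x) k.+2 bl2, size ps = size x &
   runs (C0, (t0, (catrev (cols (zip (zip x y) z)) (w_ (Hd false) :: l), bl1), ([::], w_ Mk :: cells (zip x z)), t3))
        (Ret `[< exists z', [/\ size z' = size x, num z <= num z' & good z'] >], (t0, lft (l, bl2), ([::], w_ Mk :: cells ps), t3))].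
  elim: n z bl1 => // n IHn z bl1 hn sz hb1.
  have szc z' : size z' = size x -> size (zip (zip x y) z') = size x by move=> e; rewrite size_zip szxy e minnn.
  (* The continuation after a failure at the midpoint [z]. The flag [b] is arbitrary since either
     half of the walk may have failed. *)
  have next bl2 ps : ~~ good z -> blocks (size x) k.+1 bl2 -> size ps = size x ->
    exists bl3 ps', [/\ blocks (size x) k.+2 bl3, size ps' = size x &
     forall b, runs (Ret false, (t0, (l, w_ (Hd b) :: cols (zip (zip x y) z) ++ bl2), ([::], w_ Mk :: cells ps), t3))
        (Ret `[< exists z', [/\ size z' = size x, num z <= num z' & good z'] >], (t0, lft (l, bl3), ([::], w_ Mk :: cells ps'), t3))].
    move=> ng hb2 sps; have iz := inc_num z; have siz := size_inc true z; rewrite sz in siz.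
    have [hd [tl [Eb hT]]] : exists hd tl, bl2 = w_ (Hd hd) :: tl /\ blocks (size x) k.+1 bl2.
      by case: (hb2) => b2 [cs2 [bl3 [-> h1 h2]]]; exists b2, (cols cs2 ++ bl3); split=> //; exists b2, cs2, bl3.
    case: ifP iz => ov iz.
      have -> : `[< exists z', [/\ size z' = size x, num z <= num z' & good z'] >] = false.
        apply/asboolP => -[z' [sz' hz' gz']]; have := num_lt z'; rewrite sz' -sz -iz ltnS => hz2.
        by move: ng; rewrite (@num_inj z z') ?gz' ?sz' //; apply/eqP; rewrite eqn_leq hz' hz2.
      exists (w_ (Hd false) :: cols (zip (zip x y) (inc true z).2) ++ bl2), (zip x (inc true z).2).
      split; [by exists false, (zip (zip x y) (inc true z).2), bl2; rewrite szc|by rewrite size_zip siz minnn|move=> b0].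
      apply: runs1 => //; apply: runs_trans (inc_sweep _ _ _ _ _ _ _ _ _) _ => //.
      rewrite ov Eb; apply: runs1 => //; rewrite -Eb.
      apply: runs_trans (back_sweep _ _ _ _ _ _ _ _) _; first by rewrite szc // size_zip siz minnn.
      by rewrite !cats0; apply: Runs0.
    have [|bl3 [ps' [h1 h2 h3]]] := IHn (inc true z).2 bl2 _ siz hb2.
      by move: hn; rewrite iz; have := num_lt z; rewrite sz; move: (num z) (#|G| ^ _); clear; lia.
    exists bl3, ps'; split=> // b0.
    apply: runs1 => //; apply: runs_trans (inc_sweep _ _ _ _ _ _ _ _ _) _ => //.
    rewrite ov Eb; apply: runs1 => //; rewrite -Eb.
    apply: runs_trans (rew_sweep _ _ _ _ _) _; rewrite cats0; move: h3.
    suff -> : `[< exists z', [/\ size z' = size x, num z <= num z' & good z'] >] =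
       `[< exists z', [/\ size z' = size x, num (inc true z).2 <= num z' & good z'] >] by [].
    apply: asbool_equiv_eq; split=> -[z' [e1 e2 e3]]; exists z'; split=> //; rewrite iz in e2 *; last exact: ltnW.
    rewrite ltn_neqAle e2 andbT; apply/eqP => e; move: ng; rewrite (@num_inj z z') ?e3 ?e1 //.
  have [bl2 [ps [h1 h2 h3]]] := IHk x z (catrev (cols (zip (zip x y) z)) (w_ (Hd false) :: l)) bl1 t0 t3 sz hb1.
  case r1 : (reach k x z) h3 => h3; last first.
    have [|bl3 [ps' [g1 g2 g3]]] := next bl2 ps _ h1 h2; first by rewrite /good r1.
    exists bl3, ps'; split=> //; apply: runs_trans h3 _; apply: runs_trans (ret_sweep _ _ _ _ _ _ _ _) (g3 false).
  have := IHk z y (catrev (cols (zip (zip x y) z)) (w_ (Hd true) :: l)) bl2 t0 t3; rewrite sy sz => /(_ erefl h1).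
  move=> [bl3 [ps3 [k1 k2 k3]]].
  have go : runs (C0, (t0, (catrev (cols (zip (zip x y) z)) (w_ (Hd false) :: l), bl1), ([::], w_ Mk :: cells (zip x z)), t3))
    (Ret (reach k z y), (t0, (l, w_ (Hd true) :: cols (zip (zip x y) z) ++ bl3), ([::], w_ Mk :: cells ps3), t3)).
    apply: runs_trans h3 _; apply: runs_trans (ret_sweep _ _ _ _ _ _ _ _) _.
    apply: runs1 => //; apply: runs_trans (up_sweep _ _ _ _ _ _ _ _) _ => //.
    have [hd [tl Eb]] : exists hd tl, bl2 = w_ (Hd hd) :: tl.
      by case: (h1) => b2 [cs2 [bl4 [-> _ _]]]; exists b2, (cols cs2 ++ bl4).
    rewrite Eb; apply: runs1 => //; rewrite -Eb.
    apply: runs_trans (rew_sweep _ _ _ _ _) _; rewrite cats0; apply: runs_trans k3 _.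
    exact: ret_sweep.
  case r2 : (reach k z y) go => go; last first.
    have [|bl4 [ps' [g1 g2 g3]]] := next bl3 ps3 _ k1 k2; first by rewrite /good r1 r2.
    exists bl4, ps'; split=> //; exact: runs_trans go (g3 true).
  rewrite asboolT; last by exists z; split=> //; rewrite /good r1 r2.
  exists (w_ (Hd true) :: cols (zip (zip x y) z) ++ bl3), ps3; split=> //.
    by exists true, (zip (zip x y) z), bl3; rewrite szc.
  by apply: runs_trans go _; apply: runs2 (Runs0 _) _.
have [hd [tl Eb]] : exists hd tl, bl' = w_ (Hd hd) :: tl.
  by case: (hbl) => b2 [cs2 [bl4 [-> _ _]]]; exists b2, (cols cs2 ++ bl4).
have [||bl2 [ps [h1 h2 h3]]] := main (#|G| ^ size x).+1 (nseq (size x) first) bl' _ _ hbl.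
- by rewrite num_first subn0.
- by rewrite size_nseq.
exists bl2, ps; split=> //.
apply: runs1 => //; apply: runs_trans (call_sweep _ _ _ _ _ _ _) _; first by rewrite szxy.
rewrite Eb; apply: runs1 => //; rewrite -Eb.
apply: runs_trans (rew_sweep _ _ _ _ _) _; rewrite cats0.
have -> : [seq (p, first) | p <- zip x y] = zip (zip x y) (nseq (size x) first).
  by rewrite -szxy; elim: (zip x y) => //= p s ->.
have -> : [seq (p.1, first) | p <- zip x y] = zip x (nseq (size x) first).
  by elim: x y sy {IHk scs hbl szxy blz good main bl2 ps h1 h2 h3 Eb} => [|a x IH] [|c y] //= [h]; rewrite IH.
apply: runs_trans h3 _.
have -> : reach k.+1 x y = `[< exists z', [/\ size z' = size x, num (nseq (size x) first) <= num z' & good z'] >].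
  apply: asbool_equiv_eq; split=> -[z]; rewrite /good; first by move=> [e1 e2 e3]; exists z; split=> //; [rewrite num_first|apply/andP].
  by move=> [e1 _ /andP[e2 e3]]; exists z.
exact: Runs0.
Qed.

Lemma catrev_cat (T : Type) (s1 s2 l : seq T) : catrev (s1 ++ s2) l = catrev s2 (catrev s1 l).
Proof. by elim: s1 l => //= a s IH l; rewrite IH. Qed.
Notation un n := (nseq n (w_ Un)).
Definition g3 : G * G * G := (gap, gap, gap).
Definition isend (s : sym) := if s is inr End then true else false.

Lemma la_sweep i ps t0 t1 r2 r3 :
  runs (LA i, (t0, t1, lft (catrev (cells ps) [:: w_ Mk], r2), lft (catrev (un (size ps)) [:: w_ Mk], r3)))
    (LO i, (t0, t1, ([::], w_ Mk :: cells ps ++ r2), ([:: w_ Mk], un (size ps) ++ r3))).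
Proof.
have aux qs : forall s2 s3,
  runs (LA i, (t0, t1, lft (cells qs ++ [:: w_ Mk], s2), lft (un (size qs) ++ [:: w_ Mk], s3)))
    (LO i, (t0, t1, ([::], w_ Mk :: catrev (cells qs) s2), ([:: w_ Mk], catrev (un (size qs)) s3))).
  elim: qs => [|q qs IH] s2 s3; first by apply: runs2 (Runs0 _) _.
  by apply: runs1 => //; exact: IH.
by have := aux (rev ps) r2 r3; rewrite size_rev !catrevE rev_nseq /cells map_rev revK.
Qed.
Lemma ln_sweep i ps t0 t3 l1 r1 l2 :
  runs (LN i, (t0, (l1, r1), (l2, cells ps), t3))
    (LN i, (t0, (catrev (cols (nseq (size ps) g3)) l1, drop (size ps) r1), (catrev (cells ps) l2, [::]), t3)).
Proof.
elim: ps l1 r1 l2 => [|p ps IH] l1 r1 l2 /=; first by rewrite drop0; apply: Runs0.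
by apply: runs1 => //=; case: r1 => [|a r1] /=; apply: runs_trans (IH _ _ _) _; apply: Runs0.
Qed.
Lemma lb_sweep i ps t0 t1 r l3 u r3 :
  runs (LB i, (t0, t1, lft (catrev (cells ps) [:: w_ Mk], r), (l3, u :: r3)))
    (LO i, (t0, t1, ([::], w_ Mk :: cells ps ++ r), (u :: l3, r3))).
Proof.
rewrite !catrevE -[ps in X in runs _ X]revK -!map_rev; move: (rev ps) => {}ps.
elim: ps r => [|p ps IH] r /=; first by apply: runs2 (Runs0 _) _.
by apply: runs1 => //; rewrite rev_cons /cells map_rcons cat_rcons; exact: IH.
Qed.
Definition newblk S := w_ (Hd false) :: cols (nseq S g3).
Lemma lo_sweep i ps n t0 l1 r1 l3 :
  runs (LO i, (t0, (l1, r1), ([::], w_ Mk :: cells ps), (l3, un n)))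
    (LR i, (t0, (catrev (flatten (nseq n (newblk (size ps)))) l1, drop (n * (size ps).+1) r1),
       ([::], w_ Mk :: cells ps), lft (catrev (un n) l3, [::]))).
Proof.
elim: n l1 r1 l3 => [|n IH] l1 r1 l3; first by rewrite drop0; apply: runs2 (Runs0 _) _.
apply: runs1 => //; apply: runs_trans (ln_sweep _ _ _ _ _ _ _) _.
apply: runs1 => //; apply: runs_trans (lb_sweep _ _ _ _ _ _ _ _) _; rewrite cats0.
apply: runs_trans (IH _ _ _) _; rewrite /= catrev_cat !drop_drop.
have -> : drop (n * (size ps).+1 + size ps) (behead r1) = drop (n.+1 * (size ps).+1) r1.
  by rewrite mulSn -drop1 drop_drop; congr drop; lia.
exact: Runs0.
Qed.
Lemma lr_sweep i n t0 t1 t2 r :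
  runs (LR i, (t0, t1, t2, lft (catrev (un n) [:: w_ Mk], r)))
    (LT i, (t0, lft t1, t2, ([::], w_ Mk :: un n ++ r))).
Proof.
have aux : forall s, runs (LR i, (t0, t1, t2, lft (un n ++ [:: w_ Mk], s)))
    (LT i, (t0, lft t1, t2, ([::], w_ Mk :: catrev (un n) s))).
  by elim: n => [|n IH] s; [apply: runs2 (Runs0 _) _|apply: runs1 => //; exact: IH].
by have := aux r; rewrite !catrevE rev_nseq.
Qed.
Lemma lt_sweep i w t0 t2 t3 r : ~~ has isend w ->
  runs (LT i, (t0, lft (catrev w [:: w_ End], r), t2, t3)) (LT i, (t0, ([::], w_ End :: w ++ r), t2, t3)).
Proof.
rewrite catrevE -has_rev -[w in X in runs _ X]revK; move: (rev w) => {}w.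
elim: w r => [|a w IH] r /=; first by move=> _; apply: Runs0.
rewrite negb_or => /andP[ha hw]; apply: (@runs1 _ (LT i, (t0, lft (w ++ [:: w_ End], a :: r), t2, t3))).
  by case: a ha => [?|[]].
by rewrite rev_cons cat_rcons; exact: IH.
Qed.
Lemma ld_sweep i w t0 t2 t3 r : ~~ has isend w ->
  runs (LD i, (t0, lft (catrev w [:: w_ End], r), t2, t3)) (LD i, (t0, ([::], w_ End :: w ++ r), t2, t3)).
Proof.
rewrite catrevE -has_rev -[w in X in runs _ X]revK; move: (rev w) => {}w.
elim: w r => [|a w IH] r /=; first by move=> _; apply: Runs0.
rewrite negb_or => /andP[ha hw]; apply: (@runs1 _ (LD i, (t0, lft (w ++ [:: w_ End], a :: r), t2, t3))).
  by case: a ha => [?|[]].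
by rewrite rev_cons cat_rcons; exact: IH.
Qed.
Lemma lc_sweep i w ps t0 l1 l2 l3 : size ps <= size w ->
  runs (LC i, (t0, (l1, w), (l2, cells ps), (l3, un (size ps))))
    (LC i, (t0, (catrev w l1, [::]), (catrev (cells (ps ++ nseq (size w - size ps) (gap, gap))) l2, [::]),
      (catrev (un (size w)) l3, [::]))).
Proof.
elim: w ps l1 l2 l3 => [|a w IH] [|p ps] //= l1 l2 l3 h; try by apply: Runs0.
  by apply: runs1 => //; have := IH [::] (a :: l1) (w_ (Cell (gap, gap)) :: l2) (w_ Un :: l3) (leq0n _); rewrite /= subn0.
by apply: runs1 => //; apply: runs_trans (IH ps _ _ _ h) _; apply: Runs0.
Qed.

Definition square m := m * m.+1.
Lemma has_blocks n S : ~~ has isend (flatten (nseq n (newblk S))).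
Proof.
have h : ~~ has isend (newblk S) by rewrite /newblk /= /cols has_map; elim: S.
by elim: n => //= n IH; rewrite has_cat negb_or h.
Qed.
Lemma size_blocks n S : size (flatten (nseq n (newblk S))) = n * S.+1.
Proof. by elim: n => //= n IH; rewrite size_cat IH size_map size_nseq mulSn. Qed.
Lemma blocks_blocks n S : blocks S n (flatten (nseq n (newblk S))).
Proof. by elim: n => //= n IH; exists false, (nseq S g3), (flatten (nseq n (newblk S))); rewrite size_nseq. Qed.
Lemma square_le m : m <= square m. Proof. by rewrite /square mulnS leq_addr. Qed.
Lemma iter_square_le k m : m <= iter k square m.
Proof. by elim: k => //= k IH; apply: leq_trans (square_le _). Qed.

(** [m] blocks, each with a head and [m] columns, occupy [m (m + 1)] squares. If the loop goes on,
    this length is copied to tapes 2 and 3 as the new [m]; after the last turn the blocks are kept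
    for the search. *)
Lemma setup_loop k (i : 'I_K.+1) ps t0 r1 : i + k = K -> size r1 <= square (size ps) ->
  let S := iter k.+1 square (size ps) in
  let m := iter k square (size ps) in
  exists2 w, blocks m m w &
  runs (LA i, (t0, ([:: w_ End], r1), (catrev (cells ps) [:: w_ Mk], [::]), (catrev (un (size ps)) [:: w_ Mk], [::])))
    (C0, (t0, ([:: w_ End], w), ([::], w_ Mk :: cells (ps ++ nseq (m - size ps) (gap, gap))), ([::], w_ Mk :: un m))).
Proof.
elim: k i ps r1 => [|k IH] i ps r1 hi hr1 S m.
  exists (flatten (nseq (size ps) (newblk (size ps)))); first exact: blocks_blocks.
  apply: runs1 => //; apply: runs_trans (la_sweep _ _ _ _ _ _) _; rewrite !cats0.
  apply: runs_trans (lo_sweep _ _ _ _ _ _ _) _; rewrite drop_oversize //.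
  apply: runs_trans (lr_sweep _ _ _ _ _ _) _.
  apply: runs_trans (lt_sweep _ _ _ _ _ (has_blocks _ _)) _; rewrite /m /= subnn !cats0.
  apply: (@runs1 _ (C0, (t0, ([:: w_ End], flatten (nseq (size ps) (newblk (size ps)))), ([::], w_ Mk :: cells ps), ([::], w_ Mk :: un (size ps))))); last exact: Runs0.
  have -> // : i = ord_max by apply: val_inj; move: hi; rewrite addn0.
  by rewrite /= eqxx.
have iK : i < K by apply: (@leq_trans (i + k.+1)); [rewrite addnS ltnS leq_addr|rewrite hi].
have sw := size_blocks (size ps) (size ps); set w := flatten _ in sw.
have spw : size ps <= size w by rewrite sw; exact: square_le.
have [||w' hw' hr] := IH (inord i.+1) (ps ++ nseq (size w - size ps) (gap, gap)) w.
- by rewrite inordK; lia.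
- by rewrite size_cat size_nseq subnKC //; apply: square_le.
move: hw' hr; rewrite size_cat size_nseq subnKC // sw -/(square _) -iterSr => hw' hr.
exists w' => //.
apply: runs1 => //; apply: runs_trans (la_sweep _ _ _ _ _ _) _; rewrite !cats0.
apply: runs_trans (lo_sweep _ _ _ _ _ _ _) _; rewrite drop_oversize // -/w.
apply: runs_trans (lr_sweep _ _ _ _ _ _) _.
apply: runs_trans (lt_sweep _ _ _ _ _ (has_blocks _ _)) _; rewrite -/w !cats0.
apply: (@runs1 _ (LC i, (t0, ([:: w_ End], w), ([:: w_ Mk], cells ps), ([:: w_ Mk], un (size ps))))).
  have ne : (i == ord_max) = false by apply/eqP => e; move: iK; rewrite e /= ltnn.
  by rewrite /= ne.
apply: runs_trans (lc_sweep _ _ _ _ _ spw) _.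
apply: runs1 => //; apply: runs_trans (ld_sweep _ _ _ _ _ (has_blocks _ _)) _; rewrite -/w !cats0.
apply: runs1 => //.
move: hr; rewrite -catA -nseqD.
have -> : square (size ps) - size ps + (iter k.+1 square (size ps) - square (size ps)) = m - size ps.
  rewrite /m iterSr; have := iter_square_le k (square (size ps)); have := square_le (size ps).
  by clear; lia.
by rewrite sw -/(square _).
Qed.

Lemma load_sweep u t0 t1 l2 l3 :
  runs (S2, ((t0, map inl u), t1, (l2, [::]), (l3, [::])))
    (LA ord0, ((catrev (map inl u) t0, [::]), t1,
       (catrev (cells (rcons [seq (io x, gap) | x <- u] (bar, gap))) l2, [::]), (catrev (un (size u).+1) l3, [::]))).
Proof.
elim: u t0 l2 l3 => [|x u IH] t0 l2 l3; first by apply: runs2 (Runs0 _) _.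
by apply: runs1 => //; apply: runs_trans (IH _ _ _) _; apply: Runs0.
Qed.

Definition source (u : seq X) (d : nat) : seq G := bar :: map io u ++ bar :: nseq d gap.
Definition target (n : nat) : seq G := bar :: nseq n.-1 gap.
Definition side (u : seq X) : nat := iter K square (size u).+2.
(** Each of the levels [k], ..., 0 takes a block, so [side u] blocks permit a search of depth
    [side u - 1]. *)
Definition yes (u : seq X) : bool := reach (side u).-1 (source u (side u - (size u).+2)) (target (side u)).
Definition weight (c : conf) : nat :=
  let '(t0, t1, t2, t3) := c.2 in
  size t0.1 + size t0.2 + (size t1.1 + size t1.2) + (size t2.1 + size t2.2) + (size t3.1 + size t3.2).
Definition start (u : seq X) : conf := (S0, (([::], map inl u), ([::], [::]), ([::], [::]), ([::], [::]))).
Lemma size_of_blocks S k bl : blocks S k bl -> size bl = k * S.+1.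
Proof.
elim: k bl => [|k IH] bl /=; first by move=> ->.
by move=> [b [cs [bl' [-> h /IH h']]]]; rewrite /= size_cat size_map h h' mulSn.
Qed.
Lemma savitch_run u : exists c, [/\ runs (start u) c, c.1 = if yes u then Acc else Rej
  & weight c = size u + (square (side u)).+1 + (side u).+1 + (side u).+1].
Proof.
pose ps : seq (G * G) := (bar, bar) :: rcons [seq (io x, gap) | x <- u] (bar, gap).
have sps : size ps = (size u).+2 by rewrite /= size_rcons size_map.
have [|//|w hw hr] := @setup_loop K ord0 ps (catrev (map inl u) [::], [::]) [::].
  by [].
rewrite sps -/(side u) in hw hr.
have dS : (size u).+2 <= side u := iter_square_le _ _.
have S1 : side u = (side u).-1.+1 by move: dS; case: (side u).
pose d := side u - (size u).+2.
have Ez : ps ++ nseq d (gap, gap) = zip (source u d) (target (side u)).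
  rewrite /source /target /= -cats1 -catA /=.
  have -> : (side u).-1 = size u + d.+1 by rewrite /d; move: dS; clear; lia.
  congr (_ :: _); elim: u {ps sps hw hr dS S1} d => [|x u IH] d /=; last by rewrite IH.
  by congr (_ :: _); elim: d => //= d ->.
have sx : size (source u d) = side u.
  by rewrite /= size_cat size_map /= size_nseq /d; move: dS; clear; lia.
have sy : size (target (side u)) = side u by rewrite /= size_nseq -S1.
have := @call_run (side u).-1 (source u d) (target (side u)) [:: w_ End] w (catrev (map inl u) [::], [::]) ([::], w_ Mk :: un (side u)).
rewrite sx sy -S1 -Ez => /(_ erefl hw)[bl' [qs [hb sq hr2]]].
pose fc : conf := (if yes u then Acc else Rej, ((catrev (map inl u) [::], [::]), ([::], w_ End :: bl'), ([::], w_ Mk :: cells qs), ([::], w_ Mk :: un (side u)))).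
exists fc; split=> //; last first.
  rewrite /weight /fc /= catrevE size_cat size_rev !size_map size_nseq sq (size_of_blocks hb) /square.
  by rewrite !addn0 !add0n.
apply: runs1 => //; apply: runs1 => //.
apply: runs_trans (load_sweep u [::] _ _ _) _.
apply: runs_trans (_ : runs _ (LA ord0, ((catrev (map inl u) [::], [::]), ([:: w_ End], [::]), (catrev (cells ps) [:: w_ Mk], [::]), (catrev (un (size ps)) [:: w_ Mk], [::])))) _.
  by rewrite sps; apply: Runs0.
rewrite sps; apply: runs_trans hr _; apply: runs_trans hr2 _.
by apply: runs2 (Runs0 _) _.
Qed.

Lemma act_grow a (t : tape) : size t.1 + size t.2 <= size (ac a t).1 + size (ac a t).2.
Proof.
by case: t => l r; case: a => [[y|] [[]|]]; case: l => [|x l]; case: r => [|z r]; rewrite /ac //=; lia.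
Qed.
(** Letters are never erased, so the space of a run is the size of its last configuration. *)
Lemma weight_step c d : nstep c = Some d -> weight c <= weight d.
Proof.
case: c => q [[[t0 t1] t2] t3] /=; case: nx => [[q' [[[a0 a1] a2] a3]]|] // [<-] /=.
by rewrite /weight /=; do 3 (apply: leq_add; last exact: act_grow); exact: act_grow.
Qed.
Lemma config_size_emb c : config_size (emb c) = weight c.
Proof.
by case: c => q [[[t0 t1] t2] t3]; rewrite /config_size /weight !big_ord_recr big_ord0 /= !ffunE.
Qed.
Lemma runs_path_weight c d : runs c d ->
  exists2 p, path (@step X savitch) (emb c) p /\ last (emb c) p = emb d & \max_(e <- emb c :: p) config_size e <= weight d.
Proof.
elim=> [{}c|{}c c' {}d h r [p [hp lp] hw]].
  by exists [::]; rewrite // big_seq1 config_size_emb.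
exists (emb c' :: p); first by rewrite /= step_emb h eqxx.
rewrite big_cons geq_max hw andbT config_size_emb; apply: leq_trans (weight_step h) _.
by apply: leq_trans hw; rewrite big_cons config_size_emb leq_maxl.
Qed.
Lemma emb_start u : emb (start u) = init savitch u.
Proof. by congr (_, _); apply/ffunP => -[[|[|[|[|i]]]] hi]; rewrite !ffunE. Qed.
Lemma halt_unique (c : config savitch) p p' : path (@step X savitch) c p -> path (@step X savitch) c p' ->
  (forall d, ~~ step (last c p) d) -> (forall d, ~~ step (last c p') d) -> last c p = last c p'.
Proof.
elim: p p' c => [|a p IH] [|b p'] c //=.
- by move=> _ /andP[h _] /(_ b); rewrite h.
- by move=> /andP[h _] _ _ /(_ a); rewrite h.
by move=> /andP[h1 hp] /andP[h2 hp']; move: hp'; rewrite (step_det savitch_det h2 h1); apply: IH.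
Qed.
Lemma halted_acc (c : config savitch) : c.1 = Acc -> forall d, ~~ step c d.
Proof. by move=> h d; rewrite /step h eqxx. Qed.
Lemma halted_emb c : c.1 = Acc \/ c.1 = Rej -> forall d, ~~ step (emb c) d.
Proof. by case: c => q [[[t0 t1] t2] t3] /= [] -> d; rewrite step_emb. Qed.

Lemma savitch_accepts u : accepts savitch u <-> yes u.
Proof.
have [c [r hc _]] := savitch_run u; have [p [hp lp] _] := runs_path_weight r.
rewrite emb_start in hp lp; split=> [[p' /andP[hp' /eqP h']]|y].
  case: ifP hc => // _ hc; move: (halt_unique hp hp').
  by rewrite lp => /(_ (halted_emb (or_intror hc)) (halted_acc h')) e; move: h'; rewrite -e /= hc.
by exists p; rewrite /accepting hp lp /= hc y.
Qed.
Theorem savitch_decides : decides savitch yes.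
Proof.
move=> u; split; last exact: savitch_accepts.
have [c [r hc _]] := savitch_run u; have [p [hp lp] _] := runs_path_weight r.
by rewrite emb_start in hp lp; exists p; rewrite // lp; apply: halted_emb; rewrite hc; case: ifP; [left|right].
Qed.
Theorem savitch_space n : tm_space_function savitch n <=
  n + (square (iter K square n.+2)).+1 + (iter K square n.+2).+1 + (iter K square n.+2).+1.
Proof.
have sq a b : a <= b -> square a <= square b by move=> h; rewrite /square leq_mul.
have it a b k : a <= b -> iter k square a <= iter k square b by move=> h; elim: k => //= k; apply: sq.
apply/bigmax_leqP => k _; apply/bigmax_leqP => u /asboolP /savitch_accepts y.
have su : size u <= n by rewrite size_tuple -ltnS.
have [c [r hc hw]] := savitch_run u; have [p [hp lp] hm] := runs_path_weight r.
rewrite emb_start in hp lp hm.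
have [|_ h] := @min_natP (fun s => exists2 p, accepting (M := savitch) u p & s = \max_(c <- init savitch u :: p) config_size c) (\max_(c <- init savitch u :: p) config_size c).
  by exists p; rewrite // /accepting hp lp /= hc y.
apply: leq_trans h _; apply: leq_trans hm _; rewrite hw !leq_add ?ltnS //; rewrite /side; [apply: sq|..]; exact: it.
Qed.
End SavitchMachine.
End SavitchTM.
Import SavitchTM.

(** * Space-bounded rewriting as string rewriting *)

Module WindowRewriting.
Section StringRewriting.
Variables (L : finType) (ok : L -> L -> L -> L -> bool).

Definition win (x y : seq L) := exists (p : seq L) a b c d (q : seq L), [/\ x = p ++ [:: a, b & q], y = p ++ [:: c, d & q] & ok a b c d].
(* The state records whether the columns agree so far, the last column in that
   case, and whether exactly one window has been rewritten. *)
Definition wstate : finType := (bool * option (L * L) * bool)%type.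
Definition wq0 : wstate := (true, None, false).
Definition wdl (s : wstate) (x y : L) : wstate :=
  let '(b, o, d) := s in
  (b && (x == y), if b then Some (x, y) else None, (d && (x == y)) || (if o is Some (a, c) then ok a x c y else false)).
Definition wfin (s : wstate) := s.2.

(** The three cases of the invariant: the window lies behind the automaton, it is completed by the
    next column, or it is still to come. *)
Lemma win_fold (b : bool) (o : option (L * L)) (d : bool) (xs ys : seq L) : size xs = size ys ->
  wfin (foldl (fun q p => wdl q p.1 p.2) ((b, o, d) : wstate) (zip xs ys)) <->
  [\/ d /\ xs = ys, exists a c x1 y1 q, [/\ o = Some (a, c), xs = x1 :: q, ys = y1 :: q & ok a x1 c y1] | b /\ win xs ys].
Proof.
elim: xs ys b o d => [|x xs IH] [|y ys] //= b o d h.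
  split=> [dd|[[]//|[? [? [? [? [? []]]]]]//|[_ [p [? [? [? [? [? [e]]]]]]]]]]; first by constructor 1.
  by case: p e.
case: h => h; split=> [/(IH _ _ _ _ h)[[/orP[/andP[dd /eqP xy]|hw] e]|[a [c [x1 [y1 [q [ho ex ey hk]]]]]]|[/andP[hb /eqP xy] [p [a [c [e [f [q [ex ey hk]]]]]]]]]|hh].
- by constructor 1; rewrite dd xy e.
- by case: o hw => // -[a c] hk; constructor 2; exists a, c, x, y, xs; rewrite e.
- case: b ho => // -[ea ec]; constructor 3; split=> //; exists [::], a, x1, c, y1, q.
  by rewrite ex ey ea ec.
- by constructor 3; split=> //; exists (x :: p), a, c, e, f, q; rewrite ex ey xy.
apply/(IH _ _ _ _ h); case: hh => [[dd [exy e]]|[a [c [x1 [y1 [q [ho [ex e] [ey e'] hk]]]]]]|[hb [p [a [c [e [f [q [ex ey hk]]]]]]]]].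
- by constructor 1; rewrite dd exy eqxx.
- by constructor 1; rewrite ho ex ey hk orbT e e'.
rewrite hb; case: p ex ey => [|z p] /= [-> ->] [-> ->].
  by constructor 2; exists a, e, c, f, q.
by constructor 3; rewrite eqxx; split=> //; exists p, a, c, e, f, q.
Qed.
Lemma local_stepE (x y : seq L) : size x = size y -> local_step wq0 wdl wfin x y <-> win x y.
Proof.
move=> h; split=> [/(win_fold _ _ _ h)[[]//|[? [? [? [? [? []]]]]]//|[]//]|w].
by apply/(win_fold _ _ _ h); constructor 3.
Qed.
Notation reach := (reach wq0 wdl wfin).

Lemma reach_sound (P : seq L -> Prop) k (x y : seq L) : (forall u v, win u v -> P v -> P u) -> size y = size x -> reach k x y -> P y -> P x.
Proof.
move=> hP; elim: k x y => [|k IH] x y h; first by move=> /(local_stepE (esym h)); apply: hP.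
move=> /asboolP[z [hz h1 h2]] Py; apply: (IH x z) => //; apply: (IH z y) => //; by rewrite hz.
Qed.
Hypothesis ok_refl : forall a b, ok a b a b.
Lemma win_refl (x : seq L) : 1 < size x -> win x x.
Proof. by case: x => [|a [|b x]] // _; exists [::], a, b, a, b, x. Qed.
Lemma reach_path k (x : seq L) (p : seq (seq L)) : 1 < size x -> path (fun u v => (size u == size v) && local_step wq0 wdl wfin u v) x p ->
  size p <= 2 ^ k -> reach k x (last x p).
Proof.
elim: k x p => [|k IH] x p sx.
  case: p => [_ _|y [|z p]] //=; last by rewrite andbT => /andP[].
  by apply/local_stepE => //; exact: win_refl.
move=> hp hs; apply/asboolP; have := hp; rewrite -{1}(cat_take_drop (2 ^ k) p) cat_path => /andP[h1 h2].
exists (last x (take (2 ^ k) p)).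
have szp q z : path (fun u v => (size u == size v) && local_step wq0 wdl wfin u v) z q -> size (last z q) = size z.
  by elim: q z => //= a q IHq z /andP[/andP[/eqP e _] /IHq ->].
have st := szp _ _ h1; split=> //; first by apply: IH => //; rewrite size_take; case: ltnP.
rewrite -{2}(cat_take_drop (2 ^ k) p) last_cat; apply: IH => //; first by rewrite st.
by rewrite size_drop; move: hs; rewrite expnS; lia.
Qed.

Inductive sw : seq L -> seq L -> Prop :=
| Sw0 x : sw x x
| SwS x y z : win x y -> sw y z -> sw x z.
Lemma sw_trans x y z : sw x y -> sw y z -> sw x z.
Proof. by elim=> // {}x y' {}y h _ IH /IH; apply: SwS. Qed.
Lemma sw_ctx (p q x y : seq L) : sw x y -> sw (p ++ x ++ q) (p ++ y ++ q).
Proof.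
elim=> [{}x|{}x z {}y [p' [a [b [c [d [q' [-> -> h]]]]]]] _ IH]; first exact: Sw0.
by apply: SwS IH; exists (p ++ p'), a, b, c, d, (q' ++ q); rewrite -!catA.
Qed.
Lemma win_size x y : win x y -> size x = size y.
Proof. by move=> [p [a [b [c [d [q [-> -> _]]]]]]]; rewrite !size_cat. Qed.
Lemma sw1 a b c d : ok a b c d -> sw [:: a; b] [:: c; d].
Proof. by move=> h; apply: SwS (Sw0 _); exists [::], a, b, c, d, [::]. Qed.

Lemma sw_reach k n (x y z : seq L) : sw x y -> size x = n -> 1 < n -> #|L| ^ n <= 2 ^ k -> reach k (x ++ z) (y ++ z).
Proof.
move=> hxy sx n1 hk.
pose e : rel (n.-tuple L) := fun u v => local_step wq0 wdl wfin (u ++ z) (v ++ z).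
have C : forall v (u : n.-tuple L), sw u v -> exists2 v' : n.-tuple L, connect e u v' & v = v'.
  move=> v u; move Eu: (tval u) => u0 h; elim: h u Eu => [{}u0 u <-|{}u0 y0 z0 w _ IH u Eu].
    by exists u.
  have sy : size y0 == n by rewrite -(win_size w) -Eu size_tuple.
  have [v' h1 ->] := IH (Tuple sy) erefl; exists v' => //; apply: connect_trans h1; apply: connect1.
  rewrite /e /= Eu; apply/local_stepE; first by rewrite !size_cat (win_size w).
  case: w => p [a [b [c [d [q [-> -> h]]]]]]; exists p, a, b, c, d, (q ++ z); by rewrite -!catA.
have sx' : size x == n by apply/eqP.
have [v' /connectP[p0 hp ev] ->] := C y (Tuple sx') hxy.
case/shortenP: hp ev => p hp' up _ ev.
have sp : size p < #|L| ^ n.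
  by have := max_card (mem (Tuple sx' :: p)); rewrite card_tuple (card_uniqP up).
have -> : tval v' ++ z = last (x ++ z) (map (fun u : n.-tuple L => u ++ z) p).
  by rewrite ev (last_map (fun u : n.-tuple L => u ++ z) p (Tuple sx')).
apply: reach_path; first by rewrite size_cat sx; lia.
  suff H (q : seq (n.-tuple L)) u : path e u q ->
      path (fun u v => (size u == size v) && local_step wq0 wdl wfin u v) (tval u ++ z) [seq tval w ++ z | w <- q].
    exact: H hp'.
  elim: q u => //= v q IH u /andP[uv /IH ->]; rewrite andbT; apply/andP; split=> //.
  by rewrite !size_cat !size_tuple.
by rewrite size_map; apply: leq_trans hk; apply: ltnW.
Qed.
End StringRewriting.
End WindowRewriting.
Import WindowRewriting.

(** * Sequences of words as strings of symbols *)

Module WordsAsStrings.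
Section WordStrings.
Variables (X A : finType) (R : seq (word A)) (Gp : groupType) (gen : A -> Gp) (phi : X -> word A) (m : nat).
Hypothesis relR : forall r, r \in R -> eval gen r = 1%g.
Hypothesis m2 : 1 < m.
Hypothesis sizeR : forall r, r \in R -> size r <= m.
Hypothesis size_phi : forall x, size (phi x) <= m.

(* A symbol is a bar, or a short word or input letter that may carry a mark.
   Marked symbols have left the front of their segment and travel to its end. *)
Let V : finType := (m.-bseq (letter A) + X)%type.
Let L : finType := option (V * bool).
Definition wval (v : V) : Gp := match v with inl s => eval gen s | inr x => eval gen (phi x) end.
(** [g] is the value of the current segment so far, and a bar demands that it be 1. A marked symbol
    counts as if it still stood at the front, hence the multiplication from the left. *)
Fixpoint trivial (g : Gp) (s : seq L) : Prop :=
  match s with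
  | [::] => g = 1%g
  | None :: s' => g = 1%g /\ trivial 1%g s'
  | Some (v, false) :: s' => trivial (g * wval v)%g s'
  | Some (v, true) :: s' => trivial (wval v * g)%g s'
  end.
(* Every sound replacement of two adjacent symbols is a rule. *)
Definition wok (a b c d : L) : bool := `[< forall g s, trivial g [:: c, d & s] -> trivial g [:: a, b & s] >].
Lemma wok_refl a b : wok a b a b. Proof. exact/asboolP. Qed.
Notation win := (win wok).
Notation sw := (sw wok).

Lemma win_sound s t : win s t -> forall g, trivial g t -> trivial g s.
Proof.
move=> [p [a [b [c [d [q [-> -> /asboolP h]]]]]]]; elim: p => [|[[v []]|] p IH] g //=; try exact: h; try exact: IH.
by move=> [-> /IH].
Qed.

Definition bar : L := None.
Definition wl (s : word A) : L := Some (inl (insub_bseq m s), false).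
Definition marked (s : word A) : L := Some (inl (insub_bseq m s), true).
Definition gap : L := wl [::].
Definition inp (x : X) : L := Some (inr x, false).
Definition lw (w : word A) : seq L := map (fun a => wl [:: a]) w.
Notation gaps n := (nseq n gap).

Lemma wval_insub s : size s <= m -> wval (inl (insub_bseq m s)) = eval gen s.
Proof. by move=> h; rewrite /= /insub_bseq insubdK. Qed.
Lemma eval_gap : eval gen (insub_bseq m [::]) = 1%g. Proof. by rewrite -[LHS]/(wval (inl _)) wval_insub // eval0. Qed.
Let se s t := sw s t /\ sw t s.
Lemma se_refl s : se s s. Proof. by split; apply: Sw0. Qed.
Lemma se_sym s t : se s t -> se t s. Proof. by case. Qed.
Lemma se_trans s t u : se s t -> se t u -> se s u.
Proof. by move=> [h1 h2] [h3 h4]; split; [apply: sw_trans h1 h3|apply: sw_trans h4 h2]. Qed.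
Lemma se_ctx p q s t : se s t -> se (p ++ s ++ q) (p ++ t ++ q).
Proof. by move=> [h1 h2]; split; apply: sw_ctx. Qed.
Lemma se_val u v u' v' : (wval u * wval v = wval u' * wval v')%g ->
  se [:: Some (u, false); Some (v, false)] [:: Some (u', false); Some (v', false)].
Proof. by move=> h; split; apply: sw1; apply/asboolP => g s /=; rewrite -!mulgA h. Qed.
Lemma se_gap c : se [:: gap; c] [:: c; gap].
Proof.
split; apply: sw1; apply/asboolP => g s; case: c => [[v []]|] /=; rewrite eval_gap ?mulg1; by [].
Qed.
Lemma se_gaps n s : se (gaps n ++ s) (s ++ gaps n).
Proof.
have one t : se (gap :: t) (t ++ [:: gap]).
  elim: t => [|c t IH]; first exact: se_refl.
  by apply: se_trans (se_ctx [::] t (se_gap c)) _; have := se_ctx [:: c] [::] IH; rewrite /= !cats0.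
elim: n s => [|n IH] s; first by rewrite cats0; apply: se_refl.
apply: (@se_trans _ (gap :: s ++ gaps n)); first by have := se_ctx [:: gap] [::] (IH s); rewrite !cats0.
by have := se_ctx [::] (gaps n) (one s); rewrite /= -catA.
Qed.
Lemma se_spread s : size s <= m -> se (wl s :: gaps (size s)) (lw s ++ [:: gap]).
Proof.
elim: s => [|a s IH] h; first exact: se_refl.
apply: (@se_trans _ ([:: wl [:: a]; wl s] ++ gaps (size s))).
  have E : se [:: wl (a :: s); gap] [:: wl [:: a]; wl s].
    apply: se_val; rewrite !wval_insub ?(ltnW m2) ?(ltnW h) //.
    by rewrite eval0 eval_cons eval1 mulg1.
  exact: (se_ctx [::] (gaps (size s)) E).
by have := se_ctx [:: wl [:: a]] [::] (IH (ltnW h)); rewrite !cats0.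
Qed.
(** A word of length at most [m] and value 1 can appear as one symbol in place of a gap; it is then
    spread over the adjacent gaps. *)
Lemma se_relator s : size s <= m -> eval gen s = 1%g -> se (gaps (size s).+1) (lw s ++ [:: gap]).
Proof.
case: s => [|a s] h e; first exact: se_refl.
apply: se_trans (se_spread h).
have E : se [:: gap; gap] [:: wl (a :: s); gap] by apply: se_val; rewrite !wval_insub // e eval0.
exact: (se_ctx [::] (gaps (size s)) E).
Qed.
(** This performs a splitting: if both parts are trivial, so is the whole. The opposite replacement
    would not be sound in general. *)
Lemma sw_bar z : sw [:: gap; z] [:: bar; z].
Proof. by apply: sw1; apply/asboolP => g s [-> h]; rewrite /= eval_gap mulg1. Qed.
Lemma sw_barbar : sw [:: bar; bar] [:: bar; gap].
Proof. by apply: sw1; apply/asboolP => g s [-> h]; move: h; rewrite /= eval_gap mulg1. Qed.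

Definition seg (w : word A) := lw w ++ [:: bar].
Lemma lw_cat u v : lw (u ++ v) = lw u ++ lw v. Proof. exact: map_cat. Qed.
Lemma size_lw u : size (lw u) = size u. Proof. exact: size_map. Qed.
Lemma se_insert u v s k : size s <= m -> eval gen s = 1%g ->
  se (seg (u ++ v) ++ gaps (k.+1 + size s)) (seg (u ++ s ++ v) ++ gaps k.+1).
Proof.
move=> h e; rewrite /seg !lw_cat -!catA.
apply: (@se_trans _ (lw u ++ gaps (size s).+1 ++ lw v ++ [:: bar] ++ gaps k)).
  rewrite addSnnS addnC nseqD.
  have := se_ctx (lw u) (gaps k) (se_sym (se_gaps (size s).+1 (lw v ++ [:: bar]))).
  by rewrite -!catA.
apply: se_trans (se_ctx (lw u) _ (se_relator h e)) _; rewrite -!catA.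
by have := se_ctx (lw u ++ lw s) (gaps k) (se_gaps 1 (lw v ++ [:: bar])); rewrite -!catA.
Qed.
(** The mark may be dropped in front of the bar: there the whole segment must have value 1, so the
    factor may pass from the left to the right of the product. *)
Lemma sw_shift u v : sw (bar :: seg (u ++ v)) (bar :: seg (v ++ u)).
Proof.
suff rot1 a w : sw (bar :: seg (a :: w)) (bar :: seg (w ++ [:: a])).
  elim: u v => [|a u IH] v; first by rewrite cats0; apply: Sw0.
  apply: sw_trans (rot1 a (u ++ v)) _; rewrite -catA.
  by have := IH (v ++ [:: a]); rewrite -catA.
rewrite /seg lw_cat /= -catA.
apply: (sw_trans (y := [:: bar; marked [:: a]] ++ lw w ++ [:: bar])).
  have E : sw [:: bar; wl [:: a]] [:: bar; marked [:: a]].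
    by apply: sw1; apply/asboolP => g s /=; rewrite mulg1 mul1g.
  exact: (sw_ctx [::] (lw w ++ [:: bar]) E).
apply: (sw_trans (y := [:: bar] ++ lw w ++ [:: marked [:: a]; bar])).
  suff E : sw (marked [:: a] :: lw w ++ [:: bar]) (lw w ++ [:: marked [:: a]; bar]).
    by have := sw_ctx [:: bar] [::] E; rewrite !cats0.
  elim: w => [|b w IH] /=; first exact: Sw0.
  apply: (sw_trans (y := [:: wl [:: b]; marked [:: a]] ++ lw w ++ [:: bar])).
    have E : sw [:: marked [:: a]; wl [:: b]] [:: wl [:: b]; marked [:: a]].
      by apply: sw1; apply/asboolP => g s /=; rewrite mulgA.
    exact: (sw_ctx [::] (lw w ++ [:: bar]) E).
  by have := sw_ctx [:: wl [:: b]] [::] IH; rewrite !cats0.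
have E : sw [:: marked [:: a]; bar] [:: wl [:: a]; bar].
  apply: sw1; apply/asboolP => g s /= [h t]; split=> //.
  have -> : eval gen (insub_bseq m [:: a]) = (g^-1)%g by rewrite -[LHS]mul1g -(mulVg g) -mulgA h mulg1.
  exact: mulVg.
by have := sw_ctx (bar :: lw w) [::] E; rewrite !cats0 -?catA.
Qed.
Lemma sw_split u v : sw (seg (u ++ v) ++ [:: gap]) (seg u ++ seg v).
Proof.
rewrite /seg lw_cat -!catA.
apply: (sw_trans (y := lw u ++ [:: gap] ++ lw v ++ [:: bar])).
  by have := (se_ctx (lw u) [::] (se_gaps 1 (lw v ++ [:: bar]))).2; rewrite !cats0 -!catA.
case E : (lw v ++ [:: bar]) => [|z s]; first by case: (lw v) E.
exact: (sw_ctx (lw u) s (sw_bar z)).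
Qed.

(** Empty words get no segment: a sequence may contain any number of them at no cost in total
    length, so their bars could not be accommodated. *)
Definition wseg (w : word A) := if w is [::] then [::] else seg w.
Definition segs (W : seq (word A)) := flatten (map wseg W).
(** For the duration of a step an empty word is lent a bar, at the expense of a gap. *)
Lemma open_seg w k : sw (bar :: wseg w ++ gaps (k.+1 + nilp w)) (bar :: seg w ++ gaps k.+1).
Proof.
case: w => [|a w] /=; last by rewrite addn0; apply: Sw0.
by rewrite addn1; apply: (sw_ctx [:: bar] (gaps k) (sw_bar gap)).
Qed.
Lemma close_seg w k : sw (bar :: seg w ++ gaps k) (bar :: wseg w ++ gaps (k + nilp w)).
Proof.
case: w => [|a w] /=; last by rewrite addn0; apply: Sw0.
by rewrite addn1; apply: (sw_ctx [::] (gaps k) sw_barbar).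
Qed.
Lemma size_wseg w : (size (wseg w) + nilp w = (size w).+1).
Proof. by case: w => [|a w] //=; rewrite size_cat size_lw addn0 addn1. Qed.

(** Up to [m] gaps are needed for a relator and a few more for bars, which explains [m.+3]. The
    leading bar is needed for marking the first letter in a cyclic shift and for absorbing the bar
    of an empty word. *)
Lemma entry_sw w W k k' : entry_step R w W -> size (wseg w) + k = size (segs W) + k' ->
  m.+3 <= k -> m.+3 <= k' -> sw (bar :: wseg w ++ gaps k) (bar :: segs W ++ gaps k').
Proof.
have relS r : (r \in R) || (r \in map (@inv_word A) R) -> size r <= m /\ eval gen r = 1%g.
  case/orP=> [h|/mapP[r' h ->]]; first by split; [apply: sizeR|apply: relR].
  by rewrite size_inv_word eval_inv relR // invg1; split=> //; apply: sizeR.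
have canS (x : letter A) : size [:: x; inv_letter x] <= m /\ eval gen [:: x; inv_letter x] = 1%g.
  by rewrite eval_cons eval1 eval_inv_letter mulgV.
have ins u v s j j' : size s <= m -> eval gen s = 1%g -> size (wseg (u ++ v)) + j = size (wseg (u ++ s ++ v)) + j' ->
    m.+3 <= j -> m.+3 <= j' -> sw (bar :: wseg (u ++ v) ++ gaps j) (bar :: wseg (u ++ s ++ v) ++ gaps j') /\
    sw (bar :: wseg (u ++ s ++ v) ++ gaps j') (bar :: wseg (u ++ v) ++ gaps j).
  move=> hs es hz hj hj'; have z1 := size_wseg (u ++ v); have z2 := size_wseg (u ++ s ++ v).
  have n1 : nilp (u ++ v) <= 1 by case: nilp.
  have n2 : nilp (u ++ s ++ v) <= 1 by case: nilp.
  have [i ei] : exists i, j = i.+1 + size s + nilp (u ++ v).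
    by exists (j - (1 + size s + nilp (u ++ v))); lia.
  have ej : j' = i.+1 + nilp (u ++ s ++ v) by move: z1 z2; rewrite !size_cat; lia.
  have o1 := @open_seg (u ++ v) (i + size s); have c2 := @close_seg (u ++ s ++ v) i.+1.
  have o2 := @open_seg (u ++ s ++ v) i; have c1 := @close_seg (u ++ v) (i.+1 + size s).
  rewrite -addSn in o1; have [d1 d2] := se_ctx [:: bar] [::] (@se_insert u v s i hs es).
  rewrite !cats0 in d1 d2; rewrite ei ej; split.
    by apply: sw_trans o1 _; apply: sw_trans d1 _; exact: c2.
  by apply: sw_trans o2 _; apply: sw_trans d2 _; exact: c1.
case=> {w W} [u v x|u v x|u v r /relS[rs re]|u v r /relS[rs re]|u v|u v|]; rewrite /segs /= ?cats0 => hz hk hk'.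
- by have [xs xe] := canS x; exact: (ins u v _ k k' xs xe hz hk hk').1.
- by have [xs xe] := canS x; exact: (ins u v _ k' k xs xe (esym hz) hk' hk).2.
- exact: (ins u v _ k k' rs re hz hk hk').1.
- exact: (ins u v _ k' k rs re (esym hz) hk' hk).2.
- have z1 := size_wseg (u ++ v); have z2 := size_wseg (v ++ u).
  have en : nilp (u ++ v) = nilp (v ++ u) by rewrite /nilp !size_cat addnC.
  have n1 : nilp (u ++ v) <= 1 by case: nilp.
  have [i ei] : exists i, k = i.+1 + nilp (u ++ v) by exists (k - (1 + nilp (u ++ v))); lia.
  have ez : size (wseg (u ++ v)) = size (wseg (v ++ u)).
    by apply/eqP; rewrite -(eqn_add2r (nilp (u ++ v))) z1 en z2 !size_cat addnC.
  have ei' : k' = i.+1 + nilp (v ++ u) by rewrite -en -ei; apply/esym; move: hz; rewrite ez => /addnI.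
  rewrite ei ei'; apply: sw_trans (open_seg _ _) _; apply: sw_trans (close_seg _ _).
  exact: (sw_ctx [::] _ (sw_shift u v)).
- have z1 := size_wseg (u ++ v); have z2 := size_wseg u; have z3 := size_wseg v; rewrite size_cat in hz.
  have n1 : nilp (u ++ v) <= 1 by case: nilp.
  have n2 : nilp u <= 1 by case: nilp.
  have n3 : nilp v <= 1 by case: nilp.
  have [i ei] : exists i, k = i.+2 + nilp (u ++ v) by exists (k - (2 + nilp (u ++ v))); lia.
  have ei' : k' = i.+1 + nilp u + nilp v.
    by move: hz z1 z2 z3; rewrite (size_cat u v) ei; move: (nat_of_bool (nilp (u ++ v))) (nat_of_bool (nilp u)) (nat_of_bool (nilp v)) (size (wseg (u ++ v))) (size (wseg u)) (size (wseg v)) (size u) (size v); clear; lia.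
  rewrite ei ei'; apply: sw_trans (open_seg _ _) _.
  apply: (sw_trans (y := bar :: seg u ++ seg v ++ gaps i.+1)).
    by have := sw_ctx [:: bar] (gaps i.+1) (sw_split u v); rewrite -!catA.
  apply: (sw_trans (y := bar :: seg u ++ wseg v ++ gaps (i.+1 + nilp v))).
    have := sw_ctx (bar :: lw u) [::] (@close_seg v i.+1); rewrite !cats0 /seg -!catA; exact.
  apply: (sw_trans (y := bar :: seg u ++ gaps (i.+1 + nilp v) ++ wseg v)).
    by have := (se_ctx (bar :: seg u) [::] (se_gaps (i.+1 + nilp v) (wseg v))).2; rewrite !cats0.
  apply: (sw_trans (y := bar :: wseg u ++ gaps (i.+1 + nilp v + nilp u) ++ wseg v)).
    by have := sw_ctx [::] (wseg v) (@close_seg u (i.+1 + nilp v)); rewrite /= -!catA.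
  have -> : i.+1 + nilp u + nilp v = i.+1 + nilp v + nilp u by lia.
  by have := (se_ctx (bar :: wseg u) [::] (se_gaps (i.+1 + nilp v + nilp u) (wseg v))).1; rewrite !cats0 -!catA.
by have -> : k = k' by []; apply: Sw0.
Qed.

Lemma segs1 w : segs [:: w] = wseg w. Proof. by rewrite /segs /= cats0. Qed.
Lemma segs_cat U W : segs (U ++ W) = segs U ++ segs W.
Proof. by rewrite /segs map_cat flatten_cat. Qed.
Lemma size_segs U : size (segs U) <= 2 * total_length U.
Proof.
elim: U => [|w U IH] //; rewrite tl_cons mulnDr -cat1s segs_cat size_cat leq_add //.
by rewrite /segs /= cats0; case: w => [|a w] //=; rewrite size_cat size_lw /=; lia.
Qed.
Definition board N U := bar :: segs U ++ gaps (N.-1 - size (segs U)).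
(** A nonempty word with its bar takes at most twice its length, whence [2 * s]; the first bar and
    the free gaps required by [entry_sw] account for [m + 4]. *)
Lemma rw_sw s N U W : rw R s U W -> 2 * s + m + 4 <= N -> sw (board N U) (board N W).
Proof.
move=> h hN; elim: h => [{}U _|{}U Z {}W Us UZ h IH]; first exact: Sw0.
have Zs := rw_le h; apply: sw_trans IH; have zU := size_segs U; have zZ := size_segs Z.
case: UZ Us Zs zU zZ => U1 U2 w Y wY Us Zs zU zZ; rewrite /board.
set k := N.-1 - size _; set k' := N.-1 - size _.
have hk : m.+3 <= k by rewrite /k; lia.
have hk' : m.+3 <= k' by rewrite /k'; lia.
have hkk : size (wseg w) + k = size (segs Y) + k'.
  have e1 : size (segs (U1 ++ w :: U2)) + k = N.-1 by rewrite subnKC //; lia.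
  have e2 : size (segs (U1 ++ Y ++ U2)) + k' = N.-1 by rewrite subnKC //; lia.
  by move: e1 e2; rewrite -(cat1s w) !segs_cat segs1 !size_cat; lia.
(* Whatever precedes the segment of [w] ends with a bar, as [entry_sw] requires. *)
have [P eP] : exists P, bar :: segs U1 = P ++ [:: bar].
  elim/last_ind: U1 {Us Zs zU zZ k k' hk hk' hkk} => [|U1 u [P IH']]; first by exists [::].
  rewrite -cats1 segs_cat -cat_cons IH' /segs /= cats0; case: u => [|a u]; first by exists P; rewrite cats0.
  by exists (P ++ [:: bar] ++ lw (a :: u)); rewrite -!catA.
have E T : bar :: segs (U1 ++ T) = P ++ bar :: segs T by rewrite segs_cat -cat_cons eP -catA.
rewrite -!cat_cons !E -(cat1s w) !segs_cat segs1 /= -!catA /= -!catA.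
apply: (sw_trans (y := P ++ (bar :: wseg w ++ gaps k) ++ segs U2)).
  by have := (se_ctx (P ++ bar :: wseg w) [::] (se_gaps k (segs U2))).2; rewrite !cats0; do !rewrite -catA /=.
apply: (sw_trans (y := P ++ (bar :: segs Y ++ gaps k') ++ segs U2)).
  by apply: sw_ctx; apply: entry_sw.
by have := (se_ctx (P ++ bar :: segs Y) [::] (se_gaps k' (segs U2))).1; rewrite !cats0; do !rewrite -catA /=.
Qed.

Definition phis (u : seq X) : word A := flatten (map phi u).
Lemma size_phis u : size (phis u) <= m * size u.
Proof. by elim: u => //= x u IH; rewrite /phis /= size_cat mulnS leq_add. Qed.
Lemma load_sw u k : sw (map inp u ++ bar :: gaps (k.+1 + size (phis u))) (seg (phis u) ++ gaps (k.+1 + size u)).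
Proof.
elim: u k => [|x u IH] k; first by rewrite !addn0; apply: Sw0.
rewrite /phis /= size_cat -/(phis u).
apply: (sw_trans (y := inp x :: seg (phis u) ++ gaps (k.+1 + size (phi x) + size u))).
  have := sw_ctx [:: inp x] [::] (IH (k + size (phi x))); by rewrite !cats0 /= addnA.
apply: (sw_trans (y := inp x :: gaps (size (phi x)).+1 ++ seg (phis u) ++ gaps (k + size u))).
  have -> : k.+1 + size (phi x) + size u = (size (phi x)).+1 + (k + size u) by lia.
  rewrite nseqD; have := (se_ctx [:: inp x] (gaps (k + size u)) (se_gaps (size (phi x)).+1 (seg (phis u)))).2.
  by rewrite /= -!catA.
apply: (sw_trans (y := (lw (phi x) ++ [:: gap; gap]) ++ seg (phis u) ++ gaps (k + size u))).
  apply: (sw_ctx [::] _ (x := inp x :: gaps (size (phi x)).+1)).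
  apply: (sw_trans (y := [:: wl (phi x); gap] ++ gaps (size (phi x)))).
    have [E _] : se [:: inp x; gap] [:: wl (phi x); gap] by apply: se_val; rewrite !wval_insub.
    exact: (sw_ctx [::] (gaps (size (phi x))) E).
  apply: (sw_trans (y := (wl (phi x) :: gaps (size (phi x))) ++ [:: gap])).
    by have := (se_ctx [:: wl (phi x)] [::] (se_gaps 1 (gaps (size (phi x))))).1; rewrite !cats0.
  by have := (se_ctx [::] [:: gap] (se_spread (size_phi x))).1; rewrite -catA.
rewrite -catA /seg lw_cat -!catA.
rewrite addnS -[gap :: gaps _]/(gaps 2 ++ gaps (k + size u)).
have := (se_ctx (lw (phi x)) (gaps (k + size u)) (se_gaps 2 (lw (phis u) ++ [:: bar]))).1.
by rewrite -!catA.
Qed.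

Lemma load_board u N : (size u).+2 + size (phis u) < N ->
  sw (bar :: map inp u ++ bar :: gaps (N - (size u).+2)) (board N [:: phis u]).
Proof.
move=> hN; have zs := size_wseg (phis u).
have [k ek] : exists k, N - (size u).+2 = k.+1 + size (phis u).
  by exists (N - (size u).+2 - (size (phis u)).+1); slia.
rewrite ek; apply: sw_trans (_ : sw _ (bar :: seg (phis u) ++ gaps (k.+1 + size u))) _.
  by have := sw_ctx [:: bar] [::] (load_sw u k); rewrite !cats0.
apply: sw_trans (close_seg _ _) _; rewrite /board segs1.
have -> : N.-1 - size (wseg (phis u)) = k.+1 + size u + nilp (phis u) by lia.
exact: Sw0.
Qed.

Lemma trivial_gaps k g : trivial g (gaps k) <-> g = 1%g.
Proof. by elim: k g => //= k IH g; rewrite eval_gap mulg1. Qed.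
Lemma trivial_inp u k g : trivial g (map inp u ++ bar :: gaps k) <-> (g * eval gen (phis u) = 1)%g.
Proof.
elim: u g => [|x u IH] g; last by rewrite /phis /= eval_cat mulgA; exact: IH.
rewrite /= eval0 mulg1; split=> [[]//|->]; split=> //; exact/trivial_gaps.
Qed.
Hypothesis presR : forall w, eval gen w = 1%g <-> pres_eq R w [::].
Variable F : pfun.
Hypothesis space_R : forall n, space_function R n <= F n.
(** [2 F + m + 4] symbols serve the rewriting, by [rw_sw], and the rest the expansion of the input,
    by [load_board]. *)
Let N (n : nat) := 2 * F (m * n) + m + 4 + (n.+2 + m * n).+1.

(** A contraction takes place in the first [N] columns and can be shortened to at most
    [#|L| ^ N <= 2 ^ (#|L| N)] steps, which depth [S - 1] covers. Conversely every walk on [S]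
    columns is sound, because each window rule is. *)
Lemma yes_eval K u : #|L| * N (size u) < side K u ->
  yes inp bar gap (wq0 L) (wdl wok) (@wfin L) K u <-> eval gen (phis u) = 1%g.
Proof.
move=> hK; rewrite /yes; set S := side K u in hK *; set n := size u.
have L0 : 0 < #|L| by apply/card_gt0P; exists bar.
have NS : N n < S by apply: leq_ltn_trans hK; rewrite leq_pmull.
have nN : n.+2 + size (phis u) < N n.
  by rewrite /N; apply: (@leq_trans (n.+2 + m * n).+1); [rewrite ltnS leq_add2l size_phis|exact: leq_addl].
have szS : size (source inp bar gap u (S - n.+2)) = S.
  by rewrite /= size_cat size_map /= size_nseq -/n; lia.
have szT : size (target bar gap S) = S by rewrite /= size_nseq; lia.
split=> [h|e].
  have P1 : forall s t, win s t -> trivial 1%g t -> trivial 1%g s by move=> s t w; apply: win_sound w 1%g.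
  have := reach_sound P1 _ h; rewrite szS szT => /(_ erefl)[|_ /trivial_inp]; last by rewrite mul1g.
  by split=> //; apply/trivial_gaps.
have pe := (presR (phis u)).1 e.
have rd := space_red pe.
have sp : word_space R (phis u) <= F (m * n).
  apply: leq_trans (space_R _).
  have hw : size (phis u) < (m * n).+1 by rewrite ltnS size_phis.
  apply: leq_trans (leq_bigmax (Ordinal hw)).
  by apply: (@leq_bigmax_cond _ _ (fun w : (size (phis u)).-tuple _ => word_space R w) (in_tuple (phis u))); apply/asboolP.
have chain : sw (source inp bar gap u (N n - n.+2)) (target bar gap (N n)).
  apply: sw_trans (load_board _) _; first exact: nN.
  have := rw_sw (N := N n) rd; rewrite /board /segs /= subn0; apply.
  by rewrite /N; apply: leq_trans (leq_addr _ _); rewrite !leq_add2r leq_mul2l.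
have := @sw_reach L wok wok_refl S.-1 (N n) _ _ (gaps (S - N n)) chain.
have -> : source inp bar gap u (N n - n.+2) ++ gaps (S - N n) = source inp bar gap u (S - n.+2).
  rewrite /source /= -catA /= -nseqD; congr (_ :: _ ++ _ :: nseq _ _); lia.
have -> : target bar gap (N n) ++ gaps (S - N n) = target bar gap S.
  rewrite /target /= -nseqD; congr (_ :: nseq _ _); lia.
apply.
- by rewrite /= size_cat size_map /= size_nseq -/n; lia.
- by lia.
apply: (@leq_trans (2 ^ (#|L| * N n))).
  by rewrite expnM leq_exp_base // ltnW // ltn_expl.
by rewrite leq_exp2l // -ltnS prednK //; exact: leq_ltn_trans (leq0n _) hK.
Qed.
Definition bound : pfun := padd (pmul (pcst #|L|) (padd (padd (pmul (pcst 2) (pfcomp F (pmul (pcst m) pid))) (pcst (m + 4)))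
  (padd (padd pid (pcst 3)) (pmul (pcst m) pid)))) (pcst 1).
Lemma boundE n : #|L| * N n < bound n.
Proof.
rewrite /bound /= addn1 ltnS leq_mul2l /N; apply/orP; right.
rewrite -(addnA (2 * F (m * n)) m 4) addn3; exact: leqnn.
Qed.
End WordStrings.

(** [K] applications of [square] raise [n + 2] at least to the power [2 ^ K], and
    [c (n + 1) ^ c <= (n + 2) ^ (2 c)]. *)
Lemma square_bound (F : pfun) : exists K, forall n, F n <= iter K square n.+2.
Proof.
have sq k n : n.+2 ^ (2 ^ k) <= iter k square n.+2.
  elim: k => [|k IH] //; rewrite expnS mulnC expnM expnS expn1 /= /square leq_mul //.
  exact: leqW.
have [c hc] := pfP F; exists (2 * c) => n; apply: leq_trans (hc n) _; apply: leq_trans (sq _ _).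
apply: (@leq_trans (n.+2 ^ c * n.+2 ^ c)).
  apply: leq_mul; last exact: leq_exp_base.
  by apply: (@leq_trans (2 ^ c)); [apply: ltnW; apply: ltn_expl|apply: leq_exp_base].
by rewrite -expnD leq_exp2l // addnn -mul2n; apply: ltnW; apply: ltn_expl.
Qed.
Lemma iter_square_pfun K : exists F : pfun, forall n, iter K square n.+2 = F n.
Proof.
elim: K => [|K [F hF]]; first by exists (padd pid (pcst 2)) => n; rewrite /= addn2.
by exists (pmul F (padd F (pcst 1))) => n; rewrite /= hF /square addn1.
Qed.

Theorem embeds_pspace (H : groupType) : finitely_generated H ->
  (exists (G : groupType) (A : finType) (R : seq (word A)) (gen : A -> G),
    [/\ presents R gen, polynomial_growth (space_function R)
      & exists f : {multiplicative H -> G}, injective f]) -> in_PSPACE H.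
Proof.
move=> [B [genB gB]] [G [A [R [gen [[gG pR] /growth_pfun[F hF] [f fi]]]]]].
have /choice[phi hphi] : forall x : letter B, exists w, eval gen w = f (eval_letter genB x).
  by move=> x; apply: gG.
(* [m] bounds all relators and all words [phi x], and it is at least 2 to accommodate the cancelling
   pairs. *)
pose m := 2 + \sum_(r <- R) size r + \sum_x size (phi x).
have m2 : 1 < m by rewrite /m -addnA.
have sizeR r : r \in R -> size r <= m.
  by move=> rR; rewrite /m (big_rem r rR) /=; lia.
have sizephi x : size (phi x) <= m by rewrite /m (bigD1 x) //=; lia.
have relR r : r \in R -> eval gen r = 1%g.
  by move=> rR; apply/pR; apply: red_pe; apply: der_red (der_rel rR).
have [K hK] := square_bound (bound (letter B) A m F).
have f1 : f 1%g = 1%g by apply: (@mulgI _ (f 1%g)); rewrite -gmulfM !mulg1.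
have ev w : eval gen (phis phi w) = f (eval genB w).
  elim: w => [|x w IH]; first by rewrite !eval0 f1.
  by rewrite /phis /= eval_cat IH hphi eval_cons gmulfM.
exists B, genB; split=> //.
exists (savitch (inp A m) (bar _ A m) (gap _ A m) (wq0 _) (wdl (wok gen phi (m := m))) (@wfin _) K); split.
- exact: savitch_det.
- move=> w; have [h1 h2] := savitch_decides (inp A m) (bar _ A m) (gap _ A m) (wq0 _) (wdl (wok gen phi (m := m))) (@wfin _) K w.
  split=> //; apply: (iff_trans h2); apply: (iff_trans (yes_eval relR m2 sizeR sizephi pR hF _)).
    by apply: leq_trans (boundE _ _ _ _ _) (hK _).
  by rewrite ev; split=> [e|->]; [apply: fi; rewrite e f1|rewrite f1].
have [S hS] := iter_square_pfun K.
apply: (@pfun_growth _ (padd (padd (padd pid (padd (pmul S (padd S (pcst 1))) (pcst 1))) (padd S (pcst 1))) (padd S (pcst 1)))) => n.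
by apply: leq_trans (savitch_space _ _ _ _ _ _ _ _) _; rewrite hS /square /= !addn1.
Qed.
End WordsAsStrings.
Import WordsAsStrings.

Theorem corollary1p3 (H : groupType) (fgH : finitely_generated H) :
  in_PSPACE H <->
  exists (G : groupType) (A : finType) (R : seq (word A)) (gen : A -> G),
    [/\ presents R gen, polynomial_growth (space_function R)
      & exists f : {multiplicative H -> G}, injective f].
Proof. by split; [exact: pspace_embeds|exact: embeds_pspace]. Qed.
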